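(* Let $\mathbb{S}=\mathbb{R}_+=[0,\infty)$ or $\mathbb{S}=\mathbb{N}_0$. Let $F^\odot=(F_t)_{t\in\mathbb{S}}$ be a product system of correspondences over a $C^*$-algebra (respectively, of $W^*$-correspondences over a $W^*$-algebra) $M$. Let $\sigma^\odot=(\sigma_t)_{t\in\mathbb{S}}$ be a covariant representation (respectively, in the $W^*$-case, a normal covariant representation) of $F^\odot$ on a Hilbert space $G$. Then there exists an isometric dilation (respectively, a normal isometric dilation) $\tau^\odot=(\tau_t)_{t\in\mathbb{S}}$ of $\sigma^\odot$.
   Context: Correspondences over $M$ are Hilbert $M$-modules (right modules, $M$-valued inner product $\langle\cdot,\cdot\rangle$) with a nondegenerate left action of $M$ by adjointable operators; $\odot$ denotes the internal tensor product of correspondences over $M$. In the $W^*$-case correspondences are $W^*$-correspondences (self-dual modules with normal left action) and $\odot$ is the tensor product of $W^*$-correspondences. A product system over $M$ is a family $F^\odot=(F_t)_{t\in\mathbb{S}}$ of correspondences over $M$ with $F_0=M$, together with a family of bilinear (i.e. $M$--$M$-linear) unitaries $u_{t,s}\colon F_t\odot F_s\to F_{t+s}$ that compose associatively and such that $u_{0,t}\colon F_0\odot F_t\to F_t$ and $u_{t,0}\colon F_t\odot F_0\to F_t$ are the canonical identifications. One writes $x_t\odot y_s\in F_{t+s}$ for $u_{t,s}(x_t\odot y_s)$. There are no continuity or measurability conditions on $t\mapsto F_t$. A covariant representation of $F^\odot$ on a Hilbert space $G$ is a family $\sigma^\odot=(\sigma_t)_{t\in\mathbb{S}}$ of linear completely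 contractive maps $\sigma_t\colon F_t\to\mathscr{B}(G)$ (with respect to the usual operator space structure of a Hilbert module as a corner of its linking algebra) such that $\sigma_0$ is a $*$-representation of $M$ (not necessarily nondegenerate), $\sigma_t(m_1x_tm_2)=\sigma_0(m_1)\sigma_t(x_t)\sigma_0(m_2)$, and $\sigma_{t+s}(x_t\odot y_s)=\sigma_t(x_t)\sigma_s(y_s)$ for all $s,t\in\mathbb{S}$, $x_t\in F_t$, $y_s\in F_s$, $m_1,m_2\in M$. In the $W^*$-case it is called normal if every $\sigma_t$ is $\sigma$-weakly continuous with respect to the natural $\sigma$-weak topologies. It is isometric if $\sigma_t(x_t)^*\sigma_t(y_t)=\sigma_0(\langle x_t,y_t\rangle)$ for all $t$ and all $x_t,y_t\in F_t$. A (normal) isometric dilation of a (normal) covariant representation $\sigma^\odot$ on $G$ is a (normal) isometric covariant representation $\tau^\odot$ of $F^\odot$ on a Hilbert space $H\supset G$ such that $p_G\tau_t(\cdot)p_G=\sigma_t$ for all $t\in\mathbb{S}$, where $p_G\in\mathscr{B}(H)$ is the orthogonal projection onto $G$ and $\mathscr{B}(G)$ is identified with $p_G\mathscr{B}(H)p_G$. *)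

(* Defs.v *)
From HB Require Import structures.
From mathcomp Require Import all_boot all_order all_algebra.
From mathcomp Require Import complex.
From mathcomp Require Import all_classical all_reals all_analysis.

Set Implicit Arguments.
Unset Strict Implicit.
Unset Printing Implicit Defensive.

Import Order.TTheory GRing.Theory Num.Theory.
Import numFieldNormedType.Exports.

Local Open Scope classical_set_scope.
Local Open Scope ring_scope.

Definition C (R : realType) : numClosedFieldType := R[i].

Section Time.
Variable R : realType.

Record nnreal := NNReal { nnval :> R ; nnval_ge0 : 0 <= nnval }.

HB.instance Definition _ := [isSub for nnval].
HB.instance Definition _ := [Choice of nnreal by <:].

Definition nnreal0 : nnreal := NNReal (lexx 0).
Definition nnreal_add (s t : nnreal) : nnreal :=
  NNReal (addr_ge0 (nnval_ge0 s) (nnval_ge0 t)).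

Fact nnreal_addA : associative nnreal_add.
Proof. by move=> r s t; apply: val_inj; exact: addrA. Qed.

Fact nnreal_addC : commutative nnreal_add.
Proof. by move=> s t; apply: val_inj; exact: addrC. Qed.

Fact nnreal_add0 : left_id nnreal0 nnreal_add.
Proof. by move=> t; apply: val_inj; exact: add0r. Qed.

HB.instance Definition _ :=
  GRing.isNmodule.Build nnreal nnreal_addA nnreal_addC nnreal_add0.

Inductive time_kind := discrete_time | continuous_time.

Definition time (k : time_kind) : nmodType :=
  match k with discrete_time => nat | continuous_time => nnreal end.

End Time.

Section Linear.
Variable R : realType.

Definition is_linear (V W : lmodType (C R)) (f : V -> W) : Prop :=
  forall (a : C R) x y, f (a *: x + y) = a *: f x + f y.

Definition lin_span (V : lmodType (C R)) (A : set V) : set V :=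
  [set v | exists n (a : 'I_n -> C R) (w : 'I_n -> V),
     (forall i, A (w i)) /\ v = \sum_i a i *: w i].

(* The coarsest topology making all functionals [p i] continuous. *)
Definition functional_topology (I : Type) (V : choiceType)
    (p : I -> V -> C R) : topologicalType :=
  initial_topology (fun v : V => (fun i => p i v) : {ptws I -> C R}).

End Linear.

Section Cstar.
Variable R : realType.

(* Not necessarily unital. *)
Record cstar_algebra := CstarAlgebra {
  cs_space :> completeNormedModType (C R) ;
  cs_mul : cs_space -> cs_space -> cs_space ;
  cs_star : cs_space -> cs_space ;
  cs_mulA : forall x y z, cs_mul x (cs_mul y z) = cs_mul (cs_mul x y) z ;
  cs_mul_linl : forall y, is_linear (fun x => cs_mul x y) ;
  cs_mul_linr : forall x, is_linear (cs_mul x) ;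
  cs_norm_mul : forall x y, `|cs_mul x y| <= `|x| * `|y| ;
  cs_star_antilin : forall (a : C R) x y,
    cs_star (a *: x + y) = Num.conj a *: cs_star x + cs_star y ;
  cs_starK : forall x, cs_star (cs_star x) = x ;
  cs_starM : forall x y, cs_star (cs_mul x y) = cs_mul (cs_star y) (cs_star x) ;
  cs_cstar : forall x, `|cs_mul (cs_star x) x| = `|x| ^+ 2 }.

Definition cs_ge0 (M : cstar_algebra) (m : M) : Prop :=
  exists n : M, m = cs_mul (cs_star n) n.

Record hilbert_module (M : cstar_algebra) := HilbertModule {
  hm_space :> completeNormedModType (C R) ;
  hm_ract : hm_space -> M -> hm_space ;
  hm_inner : hm_space -> hm_space -> M ;
  hm_ract_linl : forall m, is_linear (fun x => hm_ract x m) ;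
  hm_ract_linr : forall x, is_linear (hm_ract x) ;
  hm_ractM : forall x m n, hm_ract x (cs_mul m n) = hm_ract (hm_ract x m) n ;
  hm_inner_linr : forall x, is_linear (hm_inner x) ;
  hm_inner_ract : forall x y m,
    hm_inner x (hm_ract y m) = cs_mul (hm_inner x y) m ;
  hm_inner_star : forall x y, cs_star (hm_inner x y) = hm_inner y x ;
  hm_inner_ge0 : forall x, cs_ge0 (hm_inner x x) ;
  hm_norm : forall x, `|x| ^+ 2 = `|hm_inner x x| }.

Record correspondence (M : cstar_algebra) := Correspondence {
  co_module :> hilbert_module M ;
  co_lact : M -> co_module -> co_module ;
  co_lact_linl : forall x, is_linear (fun m => co_lact m x) ;
  co_lact_linr : forall m, is_linear (co_lact m) ;
  co_lactM : forall m n x, co_lact (cs_mul m n) x = co_lact m (co_lact n x) ;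
  co_lact_ract : forall m x n,
    co_lact m (hm_ract x n) = hm_ract (co_lact m x) n ;
  co_lact_adj : forall m x y,
    hm_inner (co_lact m x) y = hm_inner x (co_lact (cs_star m) y) ;
  co_nondegenerate :
    closure (lin_span [set co_lact mx.1 mx.2 | mx in [set: M * co_module]])
      = setT }.

(* Hilbert spaces, with inner product linear in the second argument. *)
Record hilbert := Hilbert {
  hs_space :> completeNormedModType (C R) ;
  dot : hs_space -> hs_space -> C R ;
  dot_linr : forall x (a : C R) y z, dot x (a *: y + z) = a * dot x y + dot x z ;
  dot_conj : forall x y, Num.conj (dot x y) = dot y x ;
  dot_norm : forall x, `|x| ^+ 2 = dot x x }.

Record bounded_op (G : hilbert) := BoundedOp {
  bop_fun :> {linear G -> G} ;
  bop_continuous : continuous bop_fun }.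

HB.instance Definition _ G := gen_eqMixin (bounded_op G).
HB.instance Definition _ G := gen_choiceMixin (bounded_op G).

End Cstar.

Section Wstar.
Variable R : realType.

(* Sakai: a C*-algebra that is, isometrically, the dual of a Banach space. *)
Record wstar_algebra := WstarAlgebra {
  ws_algebra :> cstar_algebra R ;
  ws_predual : completeNormedModType (C R) ;
  ws_pair : ws_algebra -> ws_predual -> C R ;
  ws_pair_linl : forall p (a : C R) x y,
    ws_pair (a *: x + y) p = a * ws_pair x p + ws_pair y p ;
  ws_pair_linr : forall x (a : C R) p q,
    ws_pair x (a *: p + q) = a * ws_pair x p + ws_pair x q ;
  ws_pair_le : forall x p, `|ws_pair x p| <= `|x| * `|p| ;
  ws_pair_norm : forall x (K : C R), 0 <= K ->
    (forall p, `|ws_pair x p| <= K * `|p|) -> `|x| <= K ;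
  ws_pair_surj : forall f : ws_predual -> C R,
    (forall (a : C R) p q, f (a *: p + q) = a * f p + f q) ->
    (exists K : C R, forall p, `|f p| <= K * `|p|) ->
    exists x, forall p, ws_pair x p = f p }.

Definition ws_sigma_weak (M : wstar_algebra) : topologicalType :=
  functional_topology (fun (p : ws_predual M) (m : M) => ws_pair m p).

(* The sigma-weak topology that E inherits as a corner of its linking algebra:
   by polar decomposition, the normal functionals on the corner are the maps
   x |-> phi(<y, x>) with phi a normal functional on M and y in E. *)
Definition hm_sigma_weak (M : wstar_algebra) (E : hilbert_module M) :
    topologicalType :=
  functional_topology
    (fun (py : ws_predual M * E) (x : E) => ws_pair (hm_inner py.2 x) py.1).

Definition square_summable (G : hilbert R) (g : nat -> G) : Prop :=
  cvgn (series (fun n => `|g n| ^+ 2 : C R)).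

Definition bop_sigma_weak (G : hilbert R) : topologicalType :=
  functional_topology
    (fun (gh : {gh : (nat -> G) * (nat -> G) |
                 square_summable gh.1 /\ square_summable gh.2})
         (a : bounded_op G) =>
       limn (series (fun n => dot ((sval gh).1 n) (a ((sval gh).2 n))))).

Definition self_dual (M : cstar_algebra R) (E : hilbert_module M) : Prop :=
  forall f : E -> M,
    is_linear f -> (forall x m, f (hm_ract x m) = cs_mul (f x) m) ->
    (exists K : C R, forall x, `|f x| <= K * `|x|) ->
    exists y, forall x, f x = hm_inner y x.

(* Normality of the left action M -> B^a(E) amounts to sigma-weak continuity of
   m |-> <y, m z> for all y, z, that is, of m |-> m z for all z. *)
Definition wstar_correspondence (M : wstar_algebra) (E : correspondence M) :
    Prop :=
  self_dual E /\
  forall z : E,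
    continuous ((fun m : M => co_lact m z) : ws_sigma_weak M -> hm_sigma_weak E).

End Wstar.

Section ProductSystem.
Variable R : realType.

Definition norm_generated (M : cstar_algebra R) (T : correspondence M)
    (A : set T) : Prop :=
  closure (lin_span A) = setT.

Definition wstar_generated (M : wstar_algebra R) (T : correspondence M)
    (A : set T) : Prop :=
  wstar_correspondence T /\
  closure (lin_span A : set (hm_sigma_weak T)) = setT.

(* The internal tensor product of E and F: the correspondence, unique up to
   unique bilinear unitary, that is generated by elementary tensors with
   <x (.) y, x' (.) y'> = <y, <x, x'> y'>.  The parameter [gen] says in which
   sense (norm or sigma-weak closure) it is generated. *)
Record tensor_product (M : cstar_algebra R)
    (gen : forall T : correspondence M, set T -> Prop)
    (E F : correspondence M) := TensorProduct {
  tp_corr :> correspondence M ;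
  tens : E -> F -> tp_corr ;
  tens_linl : forall y, is_linear (fun x => tens x y) ;
  tens_linr : forall x, is_linear (tens x) ;
  tens_balanced : forall x m y, tens (hm_ract x m) y = tens x (co_lact m y) ;
  tens_lact : forall m x y, co_lact m (tens x y) = tens (co_lact m x) y ;
  tens_ract : forall x y m, hm_ract (tens x y) m = tens x (hm_ract y m) ;
  tens_inner : forall x y x' y',
    hm_inner (tens x y) (tens x' y') = hm_inner y (co_lact (hm_inner x x') y') ;
  tens_gen : gen tp_corr [set tens xy.1 xy.2 | xy in [set: E * F]] }.

Definition bilinear_unitary (M : cstar_algebra R) (E F : correspondence M)
    (u : E -> F) : Prop :=
  [/\ is_linear u,
      forall m x, u (co_lact m x) = co_lact m (u x),
      forall x m, u (hm_ract x m) = hm_ract (u x) m,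
      forall x y, hm_inner (u x) (u y) = hm_inner x y &
      forall y, exists x, u x = y].

(* The equality F_0 = M is encoded as an identification [ps_unit] of the
   correspondence M over itself with F_0.  Since F_(r + s + t) and
   F_(r + (s + t)) are different types, elements of fibers are compared
   together with their index, by means of [existT]. *)
Record product_system (S : nmodType) (M : cstar_algebra R)
    (gen : forall T : correspondence M, set T -> Prop) := ProductSystem {
  ps_fiber :> S -> correspondence M ;
  ps_tensor : forall s t, tensor_product gen (ps_fiber s) (ps_fiber t) ;
  ps_u : forall s t, ps_tensor s t -> ps_fiber (s + t) ;
  ps_u_unitary : forall s t, bilinear_unitary (@ps_u s t) ;
  ps_mul := fun s t (x : ps_fiber s) (y : ps_fiber t) =>
    ps_u (tens (ps_tensor s t) x y) ;
  ps_mulA : forall r s t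
      (x : ps_fiber r) (y : ps_fiber s) (z : ps_fiber t),
    existT (fun t => ps_fiber t : Type) (r + s + t) (ps_mul (ps_mul x y) z) =
    existT (fun t => ps_fiber t : Type) (r + (s + t)) (ps_mul x (ps_mul y z)) ;
  ps_unit : M -> ps_fiber 0 ;
  ps_unit_linear : is_linear ps_unit ;
  ps_unit_lact : forall m n, ps_unit (cs_mul m n) = co_lact m (ps_unit n) ;
  ps_unit_ract : forall m n, ps_unit (cs_mul m n) = hm_ract (ps_unit m) n ;
  ps_unit_inner : forall m n,
    hm_inner (ps_unit m) (ps_unit n) = cs_mul (cs_star m) n ;
  ps_unit_surj : forall x, exists m, ps_unit m = x ;
  ps_mul_unitl : forall t m (x : ps_fiber t),
    existT (fun t => ps_fiber t : Type) (0 + t) (ps_mul (ps_unit m) x) =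
    existT (fun t => ps_fiber t : Type) t (co_lact m x) ;
  ps_mul_unitr : forall t (x : ps_fiber t) m,
    existT (fun t => ps_fiber t : Type) (t + 0) (ps_mul x (ps_unit m)) =
    existT (fun t => ps_fiber t : Type) t (hm_ract x m) }.

Definition cstar_product_system (S : nmodType) (M : cstar_algebra R) :=
  product_system S (@norm_generated M).

Record wstar_product_system (S : nmodType) (M : wstar_algebra R) :=
  WstarProductSystem {
    wps_system :> product_system S (@wstar_generated M) ;
    wps_fiber : forall t, wstar_correspondence (wps_system t) }.

End ProductSystem.

Section Representation.
Variables (R : realType) (S : nmodType).

(* ||X|| <= K, where X in M_n(E) acts as an operator M^n -> E^n.  This is the
   norm of X in M_n of the linking algebra of E, in which x in E is the operator
   (m, y) |-> (0, x m) on the Hilbert module M (+) E. *)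
Definition hm_mxnorm_le (M : cstar_algebra R) (E : hilbert_module M) n
    (X : 'M[E]_n) (K : C R) : Prop :=
  forall m : 'I_n -> M,
    let Xm i := \sum_j hm_ract (X i j) (m j) in
    `|\sum_i hm_inner (Xm i) (Xm i)|
      <= K ^+ 2 * `|\sum_j cs_mul (cs_star (m j)) (m j)|.

(* ||A|| <= K, where A in M_n(B(G)) acts as an operator G^n -> G^n. *)
Definition bop_mxnorm_le (G : hilbert R) n (A : 'M[bounded_op G]_n) (K : C R) :
    Prop :=
  forall g : 'I_n -> G,
    \sum_i `|\sum_j A i j (g j)| ^+ 2 <= K ^+ 2 * \sum_j `|g j| ^+ 2.

Definition completely_contractive (M : cstar_algebra R) (E : hilbert_module M)
    (G : hilbert R) (f : E -> bounded_op G) : Prop :=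
  forall n (X : 'M[E]_n) (K : C R), 0 <= K ->
    hm_mxnorm_le X K -> bop_mxnorm_le (map_mx f X) K.

Definition is_star_rep (M : cstar_algebra R) (G : hilbert R)
    (f : M -> bounded_op G) : Prop :=
  [/\ forall (a : C R) m n g, f (a *: m + n) g = a *: f m g + f n g,
      forall m n g, f (cs_mul m n) g = f m (f n g) &
      forall m g h, dot (f (cs_star m) g) h = dot g (f m h)].

Section Cov.
Variables (M : cstar_algebra R).
Variables (gen : forall T : correspondence M, set T -> Prop).
Variable F : product_system S gen.

Definition rep_family (G : hilbert R) := forall t : S, F t -> bounded_op G.

Definition rep0 (G : hilbert R) (sigma : rep_family G) (m : M) :
    bounded_op G :=
  sigma 0 (ps_unit F m).

Record covariant_rep (G : hilbert R) (sigma : rep_family G) : Prop :=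
  CovariantRep {
    cov_linear : forall t (a : C R) (x y : F t) g,
      sigma t (a *: x + y) g = a *: sigma t x g + sigma t y g ;
    cov_cc : forall t, completely_contractive (@sigma t) ;
    cov_star_rep : is_star_rep (rep0 sigma) ;
    cov_bimodule : forall t m1 (x : F t) m2 g,
      sigma t (hm_ract (co_lact m1 x) m2) g =
      rep0 sigma m1 (sigma t x (rep0 sigma m2 g)) ;
    cov_mul : forall s t (x : F s) (y : F t) g,
      sigma (s + t) (ps_mul x y) g = sigma s x (sigma t y g) }.

Definition isometric_rep (G : hilbert R) (sigma : rep_family G) : Prop :=
  forall t (x y : F t) g h,
    dot (sigma t x g) (sigma t y h) = dot g (rep0 sigma (hm_inner x y) h).

(* H contains G, by means of the linear isometry V. *)
Definition isometric_inclusion (G H : hilbert R) (V : G -> H) : Prop :=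
  is_linear V /\ forall g h, dot (V g) (V h) = dot g h.

Definition is_orthogonal_projection (G H : hilbert R) (V : G -> H)
    (p : bounded_op H) : Prop :=
  forall h, range V (p h) /\ forall g, dot (V g) (h - p h) = 0.

Definition isometric_dilation (G : hilbert R) (sigma : rep_family G)
    (H : hilbert R) (V : G -> H) (tau : rep_family H) : Prop :=
  [/\ covariant_rep tau, isometric_rep tau, isometric_inclusion V &
      exists2 p : bounded_op H, is_orthogonal_projection V p &
        forall t (x : F t) g, p (tau t x (p (V g))) = V (sigma t x g)].

End Cov.

Definition normal_rep (M : wstar_algebra R)
    (gen : forall T : correspondence M, set T -> Prop)
    (F : product_system S gen) (G : hilbert R) (sigma : rep_family F G) : Prop :=
  forall t, continuous (@sigma t : hm_sigma_weak (F t) -> bop_sigma_weak G).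

End Representation.

(* Main.v *)
(** The dilation space is the completion of the span of vectors [e (None, g)]
    and [e (Some x, g)] that play the roles of [V g] and [tau_s(x) V g] for [x]
    in [F_s].  Their inner products are forced: for [x] in [F_s] and [z] in
    [F_(s + r)], the vectors given by [(x, g)] and [(z, h)] have inner product
    [<g, sigma_r(L_x^* z) h>], where [L_x y = x (.) y].  So everything rests on
    this kernel being positive definite.

    Positivity is shown by induction on the number of times involved.  If [r] is
    the smallest one, every vector can be approximated by combinations of
    products [x (.) u] with [x] in [F_r], and the Gram matrix of such products is
    the amplification of the kernel at the remaining times by the positive
    matrix of the [<x_i, x_j>].  After the component in [G] is split off, what
    has to be seen is that [x (.) g |-> sigma_r(x) g] is a contraction from
    [F_r (.) G] to [G], which is complete contractivity of [sigma_r].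

    In the W*-case adjoints [L_x^*] exist by self-duality, and the approximation
    by products takes place in the seminorms of [y |-> <h, sigma_0(<y, y>) h>],
    because a normal functional that vanishes on products vanishes.  Normality
    of [tau] is checked on atoms and passes to limits, because a norm limit [f]
    of normal functionals on a self-dual module attains its norm at some [u] in
    the unit ball and satisfies [f x = f (u <u, x>)], which reduces the claim to
    the predual of [M]. *)

Require Import Defs.
From HB Require Import structures.
From mathcomp Require Import all_boot all_order all_algebra.
From mathcomp Require Import complex ring lra.
From mathcomp Require Import all_classical all_reals all_analysis.

Set Implicit Arguments.
Unset Strict Implicit.
Unset Printing Implicit Defensive.

Import Order.TTheory GRing.Theory Num.Theory.
Import numFieldNormedType.Exports.

Local Open Scope classical_set_scope.
Local Open Scope ring_scope.

(** * Real-valued norms and linear identities *)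

(** Two steps ask for the C*-algebra M_n(M): Gram matrices must act positively in representations,
    and the row contraction needs an inverse square root of one. Neither M_n(M) nor a functional
    calculus is constructed. Square roots in M come from an explicit iteration, and a norm bound for
    a selfadjoint matrix over M acting on M^n passes to every *-representation on a semi-inner
    product space, because powers of the matrix grow at the same rate there.

    Complete contractivity bounds sigma_r on rows of norm at most 1 only, whereas the kernel needs
    |sum sigma_r(x_j) g_j|^2 <= sum <g_i, sigma_0(<x_i, x_j>) g_j>. With A the Gram matrix, the row
    is multiplied by (A + e)^(-1/2) up to a scalar. This root is approximated by polynomials in A,
    which act alike on rows in F_r, on M^n and on G^n.

    Approximation by products has to be controlled before positivity is known at all times. A
    Cauchy-Schwarz bound for the kernel is therefore extracted from the case of two times, where one
    factor F_s splits off and positivity is already at hand. *)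

Section ComplexReal.
Variable R : realType.
Local Notation C := (C R).

Definition rc (a : R) : C := (a%:C)%C.
Definition cre (a : C) : R := complex.Re a.

Lemma rc_is_additive : zmod_morphism rc.
Proof. exact: (raddfB (real_complex R)). Qed.
Lemma rc_is_multiplicative : monoid_morphism rc.
Proof. split; [by []|exact: (rmorphM (real_complex R))]. Qed.
HB.instance Definition _ := GRing.isZmodMorphism.Build R C rc rc_is_additive.
HB.instance Definition _ := GRing.isMonoidMorphism.Build R C rc rc_is_multiplicative.

Lemma cre_is_additive : zmod_morphism cre.
Proof. by move=> [a b] [c d]. Qed.
HB.instance Definition _ := GRing.isZmodMorphism.Build C R cre cre_is_additive.

Lemma rcK : cancel rc cre. Proof. by []. Qed.
Lemma ler_rc a b : (rc a <= rc b) = (a <= b). Proof. exact: lecR. Qed.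
Lemma ltr_rc a b : (rc a < rc b) = (a < b). Proof. exact: ltcR. Qed.
Lemma ge0_rc (a : C) : 0 <= a -> a = rc (cre a).
Proof. by case: a => x y; rewrite lecE /= => /andP[/eqP -> _]. Qed.
Lemma cre_ge0 (a : C) : 0 <= a -> 0 <= cre a.
Proof. by rewrite lecE /= => /andP[]. Qed.
Lemma conj_rc a : Num.conj (rc a) = rc a.
Proof. by rewrite conj_Creal // complex_real. Qed.
Lemma conjcE (a : C) : Num.conj a = conjc a.
Proof. by []. Qed.
Lemma conj_i : Num.conj ('i%C : C) = - 'i%C.
Proof. by rewrite conjcE /=; congr (Complex _ _); rewrite oppr0. Qed.
Lemma conj_Ni : Num.conj (- 'i%C : C) = 'i%C.
Proof. by rewrite -conj_i conjCK. Qed.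
Lemma cre_conj (a : C) : cre (Num.conj a) = cre a.
Proof. by rewrite conjcE; case: a. Qed.
Lemma cre_rcM a (b : C) : cre (rc a * b) = a * cre b.
Proof. by case: b => x y; rewrite /cre /rc /=; simpc. Qed.
Lemma creMi (a : C) : cre ('i%C * a) = - complex.Im a.
Proof. by case: a => x y; rewrite /cre /=; simpc. Qed.

Section Norm.
Variable V : normedZmodType C.
Implicit Types x y : V.
(** Norms over [C] are complex numbers; estimates are carried out on this real value, where order is
    total and [lra] applies. *)
Definition nr x : R := cre `|x|.
Lemma normE x : `|x| = rc (nr x). Proof. exact: ge0_rc. Qed.
Lemma nr_ge0 x : 0 <= nr x. Proof. exact: cre_ge0. Qed.
Lemma nr0 : nr 0 = 0. Proof. by rewrite /nr normr0. Qed.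
Lemma nr_eq0 x : nr x = 0 -> x = 0.
Proof. by move=> h; apply/normr0_eq0; rewrite normE h rmorph0. Qed.
Lemma nrD x y : nr (x + y) <= nr x + nr y.
Proof. by rewrite -ler_rc rmorphD /= -!normE ler_normD. Qed.
Lemma nrN x : nr (- x) = nr x. Proof. by rewrite /nr normrN. Qed.
Lemma nrB x y : nr (x - y) <= nr x + nr y.
Proof. by rewrite -(nrN y); exact: nrD. Qed.
Lemma nrBC x y : nr (x - y) = nr (y - x). Proof. by rewrite -nrN opprB. Qed.
Lemma nr_sum I (r : seq I) (P : pred I) (F : I -> V) :
  nr (\sum_(i <- r | P i) F i) <= \sum_(i <- r | P i) nr (F i).
Proof.
elim/big_ind2: _ => //; first by rewrite nr0.
by move=> x a y b xa yb; apply: le_trans (nrD _ _) _; exact: lerD.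
Qed.
Lemma nr_le x a : `|x| <= rc a -> nr x <= a.
Proof. by rewrite normE ler_rc. Qed.
End Norm.

Lemma nrM (a b : C) : nr (a * b) = nr a * nr b.
Proof. by rewrite /nr normrM !normE -rmorphM. Qed.
Lemma nr_rc a : nr (rc a) = `|a|.
Proof. by rewrite /nr normc_def /= expr0n addr0 sqrtr_sqr. Qed.
Lemma nr_conj (a : C) : nr (Num.conj a) = nr a.
Proof. by rewrite /nr norm_conjC. Qed.
Lemma cre_le_nr (a : C) : cre a <= nr a.
Proof.
rewrite /nr normc_def /cre /=; case: a => x y /=.
apply: le_trans (ler_norm _) _; rewrite -sqrtr_sqr.
by rewrite ler_sqrt ?lerDl ?addr_ge0 ?sqr_ge0.
Qed.
Lemma nr_sqr (a : C) : rc (nr a ^+ 2) = Num.conj a * a.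
Proof. by rewrite rmorphXn /= -[rc (nr a)]normE normCK mulrC. Qed.
Lemma nr_sqrE (a : C) : nr a ^+ 2 = cre a ^+ 2 + (complex.Im a) ^+ 2.
Proof.
rewrite /nr normc_def /= sqr_sqrtr //; by rewrite addr_ge0 ?sqr_ge0.
Qed.

Lemma nrZ (V : normedModType C) (a : C) (x : V) : nr (a *: x) = nr a * nr x.
Proof. by rewrite /nr normrZ !normE -rmorphM. Qed.

Lemma exists_phase (a : C) : exists2 b : C, nr b = 1 & b * a = rc (nr a).
Proof.
have [->|a0] := eqVneq a 0.
  by exists 1; [rewrite -(rmorph1 rc) nr_rc normr1|rewrite mulr0 nr0 rmorph0].
have n0 : nr a != 0 by apply: contra_neq a0 => /nr_eq0.
exists (Num.conj a * rc (nr a)^-1).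
  by rewrite nrM nr_conj nr_rc ger0_norm ?invr_ge0 ?nr_ge0 // divff.
by rewrite mulrAC -nr_sqr -rmorphM expr2 mulfK.
Qed.

Lemma cvg_nrP (V : normedModType C) (T : Type) (F : set_system T) (FF : Filter F) (f : T -> V) (l : V) :
  f @ F --> l <-> (nr (f t - l) @[t --> F] --> (0 : R)).
Proof.
split=> [/cvgrPdist_lt h|/cvgrPdist_lt h]; apply/cvgrPdist_lt => e e0.
- have := h (rc e); rewrite -(rmorph0 rc) ltr_rc => /(_ e0).
  apply: filterS => t; rewrite normE ltr_rc sub0r normrN nrBC.
  by rewrite ger0_norm ?nr_ge0.
- have he : e = rc (cre e) by apply: ge0_rc; exact: ltW.
  have := h (cre e); rewrite -ltr_rc -he rmorph0 => /(_ e0).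
  apply: filterS => t; rewrite sub0r normrN ger0_norm ?nr_ge0 // => ht.
  by rewrite he normE ltr_rc nrBC.
Qed.

End ComplexReal.

(** * Reflection for linear identities in modules *)

Section LmodReflection.
Variables (K : nzRingType) (V : lmodType K).

Inductive lexp :=
  LVar of nat | LZero | LAdd of lexp & lexp | LOpp of lexp | LScale of K & lexp.

Fixpoint leval (env : seq V) (e : lexp) : V :=
  match e with
  | LVar i => nth 0 env i
  | LZero => 0
  | LAdd a b => leval env a + leval env b
  | LOpp a => - leval env a
  | LScale k a => k *: leval env a
  end.

Fixpoint lcoef (i : nat) (e : lexp) : K :=
  match e with
  | LVar j => if Nat.eqb i j then 1 else 0
  | LZero => 0
  | LAdd a b => lcoef i a + lcoef i b
  | LOpp a => - lcoef i a
  | LScale k a => k * lcoef i a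
  end.

Fixpoint lvars (n : nat) (e : lexp) : bool :=
  match e with
  | LVar j => (j < n)%N
  | LZero => true
  | LAdd a b => lvars n a && lvars n b
  | LOpp a => lvars n a
  | LScale k a => lvars n a
  end.

Lemma leval_coef env e : lvars (size env) e ->
  leval env e = \sum_(i < size env) lcoef i e *: env`_i.
Proof.
elim: e => [j jn||a iha b ihb /andP[ha hb]|a ih ha|k a ih ha] /=.
- rewrite (bigD1 (Ordinal jn)) //= PeanoNat.Nat.eqb_refl scale1r big1 ?addr0 //.
  move=> i /eqP ij; case: (PeanoNat.Nat.eqb_spec i j) => [e|]; last by rewrite scale0r.
  by case: ij; exact: val_inj.
- by rewrite big1 // => i _; rewrite scale0r.
- by rewrite iha // ihb // -big_split; apply: eq_bigr => i _; rewrite scalerDl.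
- by rewrite ih // -sumrN; apply: eq_bigr => i _; rewrite scaleNr.
- by rewrite ih // scaler_sumr; apply: eq_bigr => i _; rewrite scalerA.
Qed.

(** A recursive conjunction instead of a quantifier over ordinals, so that it computes to one ring
    goal per atom. *)
Fixpoint lall (n : nat) (a b : lexp) : Prop :=
  if n is n'.+1 then lcoef n' a = lcoef n' b /\ lall n' a b else True.

Lemma leval_eq env a b : lvars (size env) a && lvars (size env) b ->
  lall (size env) a b -> leval env a = leval env b.
Proof.
move=> /andP[ha hb] h; rewrite !leval_coef //; apply: eq_bigr => -[i /= hi] _.
congr (_ *: _); move: hi h; elim: (size env) => // n ih; rewrite ltnS => hi [h1 h2].
by move: hi; rewrite leq_eqVlt => /orP[/eqP ->//|/ih]; exact.
Qed.

End LmodReflection.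

Ltac lmod_mem x l :=
  lazymatch l with
  | nil => fail
  | @cons _ ?y ?l' => first [constr_eq x y | lmod_mem x l']
  end.
Ltac lmod_atoms t l :=
  lazymatch t with
  | (?a + ?b)%R => let l1 := lmod_atoms a l in lmod_atoms b l1
  | (- ?a)%R => lmod_atoms a l
  | (?k *: ?a)%R => lmod_atoms a l
  | 0%R => l
  | _ => match constr:(Set) with
         | _ => let _ := match constr:(Set) with _ => lmod_mem t l end in l
         | _ => constr:(t :: l)
         end
  end.
Ltac lmod_find x l :=
  lazymatch l with
  | @cons _ ?y ?l' =>
    match constr:(Set) with
    | _ => let _ := match constr:(Set) with _ => constr_eq x y end in constr:(O)
    | _ => let n := lmod_find x l' in constr:(S n)
    end
  end.
Ltac lmod_reify K t l :=
  lazymatch t with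
  | (?a + ?b)%R => let a' := lmod_reify K a l in let b' := lmod_reify K b l in
                   constr:(@LAdd K a' b')
  | (- ?a)%R => let a' := lmod_reify K a l in constr:(@LOpp K a')
  | (?k *: ?a)%R => let a' := lmod_reify K a l in constr:(@LScale K k a')
  | 0%R => constr:(@LZero K)
  | _ => let n := lmod_find t l in constr:(@LVar K n)
  end.
(* Linear identities in a module over [K] are reduced to ring identities
   between the coefficients of each atom. *)
Ltac lmod_coefs K :=
  lazymatch goal with
  | |- @eq ?V ?a ?b =>
    let l0 := constr:(@nil V) in
    let l1 := lmod_atoms a l0 in
    let l := lmod_atoms b l1 in
    let a' := lmod_reify K a l in
    let b' := lmod_reify K b l in
    refine (@leval_eq K _ l a' b' _ _);
    [ by [] | lazy beta iota zeta delta [lall lcoef Nat.eqb size]; repeat split ]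
  end.
Ltac rc_push :=
  rewrite ?(rmorphD, rmorphB, rmorphN, rmorphM, rmorphXn, fmorphV, rmorph_nat, rmorph1, rmorph0) /=.
Ltac lmod R := lmod_coefs (C R); rc_push; try ring; try (by field).

Section LinearMaps.
Variables (R : realType) (V W : lmodType (C R)) (f : V -> W).
Hypothesis fl : is_linear f.

Lemma lin0 : f 0 = 0.
Proof. by have := fl (-1) 0 0; rewrite scaler0 addr0 scaleN1r addNr. Qed.
Lemma linZ a x : f (a *: x) = a *: f x.
Proof. by have := fl a x 0; rewrite lin0 !addr0. Qed.
Lemma linD x y : f (x + y) = f x + f y.
Proof. by have := fl 1 x y; rewrite !scale1r. Qed.
Lemma linN x : f (- x) = - f x.
Proof. by rewrite -scaleN1r linZ scaleN1r. Qed.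
Lemma linB x y : f (x - y) = f x - f y.
Proof. by rewrite linD linN. Qed.
Lemma lin_sum I (r : seq I) (P : pred I) (F : I -> V) :
  f (\sum_(i <- r | P i) F i) = \sum_(i <- r | P i) f (F i).
Proof. by elim/big_rec2: _ => [|i x y _ <-]; [exact: lin0|exact: linD]. Qed.
End LinearMaps.

(** * Completeness and limits through real norms *)

Section Completeness.
Variable R : realType.
Local Notation C := (C R).

Lemma seq_complete (V : completeNormedModType C) (v : nat -> V) :
  (forall e : R, 0 < e -> exists N, forall m n,
     (N <= m)%N -> (N <= n)%N -> nr (v m - v n) < e) ->
  cvg (v n @[n --> \oo]).
Proof.
move=> h; apply: cauchy_cvg; apply: cauchy_exP => e e0.
have he : e = rc (cre e) by apply: ge0_rc; exact: ltW.
have [|N hN] := h (cre e); first by rewrite -ltr_rc -he rmorph0.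
exists (v N); exists N => // n /= Nn.
by rewrite -ball_normE /ball_ /= normE he ltr_rc; exact: hN.
Qed.

Lemma telescope_le (V : normedModType C) (v : nat -> V) (b : nat -> R) :
  (forall n, nr (v n.+1 - v n) <= b n.+1 - b n) ->
  forall n k, nr (v (n + k)%N - v n) <= b (n + k)%N - b n.
Proof.
move=> h n; elim=> [|k ih]; first by rewrite addn0 !subrr nr0.
rewrite addnS.
have -> : v (n + k).+1 - v n = (v (n + k).+1 - v (n + k)%N) + (v (n + k)%N - v n).
  by rewrite addrA subrK.
have := nrD (v (n + k).+1 - v (n + k)%N) (v (n + k)%N - v n).
have := h (n + k)%N; lra.
Qed.

(** The hypothesis forces [b] to be nondecreasing; being bounded it converges, and its oscillation
    dominates that of [v]. *)
Lemma telescope_cauchy (V : normedModType C) (v : nat -> V) (b : nat -> R) (B : R) :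
  (forall n, nr (v n.+1 - v n) <= b n.+1 - b n) -> (forall n, b n <= B) ->
  forall e : R, 0 < e -> exists N, forall m n,
    (N <= m)%N -> (N <= n)%N -> nr (v m - v n) < e.
Proof.
move=> h hB e e0.
have bnd : nondecreasing_seq b.
  by apply/nondecreasing_seqP => n; rewrite -subr_ge0; apply: le_trans (h n); exact: nr_ge0.
have cb : cvg (b n @[n --> \oo]).
  by apply: nondecreasing_is_cvgn => //; exists B => _ [n _ <-].
have /cvgrPdist_lt/(_ (e / 4)) [|N _ hN] := cb; first lra.
exists N.
suff H m n : (N <= n)%N -> (n <= m)%N -> nr (v m - v n) < e.
  move=> m n Nm Nn; case: (leqP n m) => [|/ltnW] nm; first exact: H.
  by rewrite nrBC; exact: H.
move=> Nn nm; rewrite -(subnKC nm); apply: le_lt_trans (telescope_le h _ _) _.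
have := hN n Nn; have := hN (n + (m - n))%N (leq_trans Nn (leq_addr _ _)).
by rewrite /= !ltr_norml => /andP[? ?] /andP[? ?]; lra.
Qed.

Lemma telescope_complete (V : completeNormedModType C) (v : nat -> V)
    (b : nat -> R) (B : R) :
  (forall n, nr (v n.+1 - v n) <= b n.+1 - b n) -> (forall n, b n <= B) ->
  cvg (v n @[n --> \oo]).
Proof. by move=> h hB; apply: seq_complete; exact: telescope_cauchy h hB. Qed.

Lemma cvg_le (u : nat -> R) (l a : R) :
  u n @[n --> \oo] --> l -> (forall n, u n <= a) -> l <= a.
Proof. by move=> ul h; apply: (closed_cvg [set x | x <= a]) ul => //; exact: nearW. Qed.

Lemma cvg_nr_le (V : normedModType C) (v : nat -> V) (l : V) (a : R) :
  v n @[n --> \oo] --> l -> (forall n, nr (v n) <= a) -> nr l <= a.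
Proof.
move=> /cvg_nrP vl h; apply/ler_addgt0Pr => e e0.
have /cvgrPdist_lt/(_ e e0) [N _ /(_ N (leqnn _))] := vl.
rewrite /= sub0r normrN ger0_norm ?nr_ge0 // => hN.
have := nrD (v N) (l - v N); rewrite addrC subrK => h1.
have := h N; rewrite nrBC in hN; lra.
Qed.

Lemma cvg_unique_nr (V : normedModType C) (v : nat -> V) (l l' : V) :
  v n @[n --> \oo] --> l -> v n @[n --> \oo] --> l' -> l = l'.
Proof. by move=> h h'; apply: (cvg_unique _ h h'). Qed.

Lemma cvg_lip (V W : normedModType C) (f : V -> W) (K : R)
    (T : Type) (F : set_system T) (FF : Filter F) (v : T -> V) (l : V) :
  (forall x y, nr (f x - f y) <= K * nr (x - y)) ->
  v t @[t --> F] --> l -> f (v t) @[t --> F] --> f l.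
Proof.
move=> h /cvg_nrP vl; apply/cvg_nrP.
apply: (@squeeze_cvgr _ _ _ _ (fun=> 0) (fun t => K * nr (v t - l))).
- by apply: nearW => t; rewrite nr_ge0 h.
- exact: cvg_cst.
- by rewrite -[X in _ --> X](mulr0 K); apply: cvgM => //; exact: cvg_cst.
Qed.

End Completeness.

Notation "x ** y" := (cs_mul x y) (at level 40, left associativity).

(** * Elementary identities in a C*-algebra *)

Section CstarBasics.
Variables (R : realType) (M : cstar_algebra R).
Local Notation C := (C R).
Implicit Types x y z u v h k : M.

Lemma cmDl x y z : (x + y) ** z = x ** z + y ** z.
Proof. exact: (linD (cs_mul_linl z)). Qed.
Lemma cmDr x y z : x ** (y + z) = x ** y + x ** z.
Proof. exact: (linD (cs_mul_linr x)). Qed.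
Lemma cmNl x z : (- x) ** z = - (x ** z).
Proof. exact: (linN (cs_mul_linl z)). Qed.
Lemma cmNr x y : x ** (- y) = - (x ** y).
Proof. exact: (linN (cs_mul_linr x)). Qed.
Lemma cmBl x y z : (x - y) ** z = x ** z - y ** z.
Proof. exact: (linB (cs_mul_linl z)). Qed.
Lemma cmBr x y z : x ** (y - z) = x ** y - x ** z.
Proof. exact: (linB (cs_mul_linr x)). Qed.
Lemma cmZl a x y : (a *: x) ** y = a *: (x ** y).
Proof. exact: (linZ (cs_mul_linl y)). Qed.
Lemma cmZr a x y : x ** (a *: y) = a *: (x ** y).
Proof. exact: (linZ (cs_mul_linr x)). Qed.
Lemma cm0l x : 0 ** x = 0.
Proof. exact: (lin0 (cs_mul_linl x)). Qed.
Lemma cm0r x : x ** 0 = 0.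
Proof. exact: (lin0 (cs_mul_linr x)). Qed.
Lemma cm_suml I (r : seq I) (P : pred I) (F : I -> M) x :
  (\sum_(i <- r | P i) F i) ** x = \sum_(i <- r | P i) F i ** x.
Proof. exact: (lin_sum (cs_mul_linl x)). Qed.
Lemma cm_sumr I (r : seq I) (P : pred I) (F : I -> M) x :
  x ** (\sum_(i <- r | P i) F i) = \sum_(i <- r | P i) x ** F i.
Proof. exact: (lin_sum (cs_mul_linr x)). Qed.

Lemma cs_starD x y : cs_star (x + y) = cs_star x + cs_star y.
Proof. by have := cs_star_antilin 1 x y; rewrite rmorph1 !scale1r. Qed.
Lemma cs_star0 : cs_star 0 = 0 :> M.
Proof. by apply: (addrI (cs_star 0)); rewrite -cs_starD !addr0. Qed.
Lemma cs_starZ (a : C) x : cs_star (a *: x) = Num.conj a *: cs_star x.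
Proof. by have := cs_star_antilin a x 0; rewrite cs_star0 !addr0. Qed.
Lemma cs_starN x : cs_star (- x) = - cs_star x.
Proof. by rewrite -scaleN1r cs_starZ rmorphN1 scaleN1r. Qed.
Lemma cs_starB x y : cs_star (x - y) = cs_star x - cs_star y.
Proof. by rewrite cs_starD cs_starN. Qed.
Lemma cs_starZr (a : R) x : cs_star (rc a *: x) = rc a *: cs_star x.
Proof. by rewrite cs_starZ conj_rc. Qed.
Lemma cs_star_sum I (r : seq I) (P : pred I) (F : I -> M) :
  cs_star (\sum_(i <- r | P i) F i) = \sum_(i <- r | P i) cs_star (F i).
Proof. by elim/big_rec2: _ => [|i x y _ <-]; [exact: cs_star0|exact: cs_starD]. Qed.

Lemma nr_cm x y : nr (x ** y) <= nr x * nr y.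
Proof. by apply: nr_le; rewrite rmorphM /= -!normE; exact: cs_norm_mul. Qed.
Lemma nr_cstar x : nr (cs_star x ** x) = nr x ^+ 2.
Proof.
by apply: (@complexI R); rewrite -[LHS]normE cs_cstar normE -rmorphXn.
Qed.
Lemma nr_star x : nr (cs_star x) = nr x.
Proof.
suff H y : nr y <= nr (cs_star y).
  by apply/eqP; rewrite eq_le H andbT -{2}(cs_starK x).
have [->|n0] := eqVneq (nr y) 0; first exact: nr_ge0.
have n0' : 0 < nr y by rewrite lt_def n0 nr_ge0.
by rewrite -(ler_pM2r n0') -expr2 -nr_cstar nr_cm.
Qed.
Lemma nr_cstar' x : nr (x ** cs_star x) = nr x ^+ 2.
Proof. by rewrite -{1}(cs_starK x) nr_cstar nr_star. Qed.

Lemma cvg_cm (f g : nat -> M) a b :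
  f n @[n --> \oo] --> a -> g n @[n --> \oo] --> b ->
  f n ** g n @[n --> \oo] --> a ** b.
Proof.
move=> /cvg_nrP fa /cvg_nrP gb; apply/cvg_nrP.
apply: (@squeeze_cvgr _ _ _ _ (fun=> 0)
  (fun n => nr (f n - a) * nr (g n - b) + nr (f n - a) * nr b
            + nr a * nr (g n - b))).
- apply: nearW => n; rewrite nr_ge0 /=.
  have -> : f n ** g n - a ** b =
      (f n - a) ** (g n - b) + (f n - a) ** b + a ** (g n - b).
    by rewrite cmBr subrK cmBl cmBr addrA subrK.
  apply: le_trans (nrD _ _) _; apply: lerD; last exact: nr_cm.
  by apply: le_trans (nrD _ _) _; apply: lerD; exact: nr_cm.
- exact: cvg_cst.
- have -> : 0 = 0 * 0 + 0 * nr b + nr a * 0 :> R by ring.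
  apply: cvgD; last by apply: cvgM => //; exact: cvg_cst.
  apply: cvgD; first exact: cvgM.
  by apply: cvgM => //; exact: cvg_cst.
Qed.

Lemma cvg_star (f : nat -> M) a :
  f n @[n --> \oo] --> a -> cs_star (f n) @[n --> \oo] --> cs_star a.
Proof. by apply: (@cvg_lip _ _ _ _ 1) => x y; rewrite -cs_starB nr_star mul1r. Qed.

End CstarBasics.

(** * Square roots and positivity in C*-algebras *)

Section Visser.
Variables (R : realType) (M : cstar_algebra R) (al : bool) (v : M).
Local Notation C := (C R).
Implicit Types x y z : M.
Hypothesis v_star : cs_star v = v.
Hypothesis v_le : forall x, nr (rc (al%:R : R) *: x + v ** x) <= nr x.

(** The iterates y_n live in the unitization and are kept as a scalar part [vc n] and a part [vm n]
    in M; [vop n] is left multiplication by y_n. The sequence [vq] is the same iteration started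
    from the scalar 1 in place of u. It majorizes the norms of the operators [vop n] and of their
    increments. *)
Fixpoint vc n : R := if n is k.+1 then (al%:R + vc k ^+ 2) / 2 else 0.
Fixpoint vq n : R := if n is k.+1 then (1 + vq k ^+ 2) / 2 else 0.
Fixpoint vm n : M :=
  if n is k.+1 then rc 2^-1 *: (v + rc (2 * vc k) *: vm k + vm k ** vm k) else 0.
Definition vop n x : M := rc (vc n) *: x + vm n ** x.

Lemma vq_bound n : 0 <= vq n <= 1.
Proof. by elim: n => [|n /andP[h0 h1]] /=; [lra|nra]. Qed.
Lemma vq_nondec n : vq n <= vq n.+1.
Proof. by rewrite /=; have := sqr_ge0 (1 - vq n); nra. Qed.
Lemma vcE n : vc n = al%:R * vq n.
Proof.
elim: n => [|n ih] /=; first by rewrite mulr0.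
by rewrite ih; case: al; rewrite ?mul1r ?mul0r // expr0n addr0 mul0r.
Qed.

Lemma vm_star n : cs_star (vm n) = vm n.
Proof.
elim: n => [|n ih] /=; first exact: cs_star0.
by rewrite cs_starZr !cs_starD cs_starZr cs_starM v_star ih.
Qed.

Lemma vm_comm n z : z ** v = v ** z -> z ** vm n = vm n ** z.
Proof.
move=> zv; elim: n => [|n ih] /=; first by rewrite cm0l cm0r.
by rewrite cmZr cmZl !cmDr !cmDl cmZr cmZl zv ih cs_mulA ih -cs_mulA ih cs_mulA.
Qed.

Lemma vm_commm m n : vm m ** vm n = vm n ** vm m.
Proof. by apply: vm_comm; apply/esym; exact: vm_comm. Qed.

Lemma vop_linear n : is_linear (vop n).
Proof.
move=> a x y; rewrite /vop cmDr cmZr !scalerDr !scalerA (mulrC a) -!addrA.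
by congr (_ + _); rewrite addrCA.
Qed.

Lemma vop_comm m n x : vop m (vop n x) = vop n (vop m x).
Proof.
rewrite /vop !scalerDr !cmDr !cmZr !scalerA (mulrC (rc _)) -!addrA; congr (_ + _).
by rewrite addrCA; congr (_ + (_ + _)); rewrite !cs_mulA vm_commm.
Qed.

Lemma vopS n x :
  vop n.+1 x = rc 2^-1 *: (rc al%:R *: x + v ** x + vop n (vop n x)).
Proof.
rewrite /vop /= cmZl !cmDl cmZl !cmDr !cmZr !cs_mulA.
by lmod R.
Qed.

Lemma vop_le n x : nr (vop n x) <= vq n * nr x.
Proof.
elim: n x => [|n ih] x; first by rewrite /vop /= rmorph0 scale0r cm0l addr0 nr0 mul0r.
rewrite vopS nrZ nr_rc ger0_norm ?invr_ge0 //=.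
have := nrD (rc al%:R *: x + v ** x) (vop n (vop n x)).
have := v_le x; have := ih x; have := ih (vop n x).
have /andP[q0 q1] := vq_bound n; have := nr_ge0 x.
move=> h1 h2 h3 h4 h5.
have : vq n * nr (vop n x) <= vq n * (vq n * nr x) by rewrite ler_wpM2l.
by rewrite expr2; nra.
Qed.

(** The iterates commute, so y_(n+2) - y_(n+1) = (y_(n+1) - y_n)(y_(n+1) + y_n)/2. The increments of
    [vq] factor in the same way, which makes the induction close. *)
Lemma vop_diff n x :
  nr (vop n.+1 x - vop n x) <= (vq n.+1 - vq n) * nr x.
Proof.
elim: n x => [|n ih] x.
  have -> : vop 0 x = 0 by rewrite /vop /= rmorph0 scale0r cm0l addr0.
  have := vop_le 1 x; rewrite subr0 /= subr0; lra.
have /andP[q0 q1] := vq_bound n; have /andP[q0' q1'] := vq_bound n.+1.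
have -> : vop n.+2 x - vop n.+1 x =
    rc 2^-1 *: (vop n.+1 (vop n.+1 x) - vop n (vop n x)).
  have e1 := vopS n.+1 x; have e2 := vopS n x.
  by rewrite e1 [X in _ - X = _]e2; lmod R.
set s := vop n.+1 x + vop n x.
have -> : vop n.+1 (vop n.+1 x) - vop n (vop n x) = vop n.+1 s - vop n s.
  have e1 : vop n s = vop n (vop n.+1 x) + vop n (vop n x) by exact: linD (vop_linear n) _ _.
  have e2 : vop n.+1 s = vop n.+1 (vop n.+1 x) + vop n.+1 (vop n x) by exact: linD (vop_linear n.+1) _ _.
  by rewrite e1 e2 (vop_comm n.+1 n); lmod R.
rewrite nrZ nr_rc ger0_norm ?invr_ge0 //.
have hs : nr s <= (vq n.+1 + vq n) * nr x.
  apply: le_trans (nrD _ _) _; rewrite mulrDl; apply: lerD; exact: vop_le.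
have := ih s; have := vq_nondec n.
have := nr_ge0 x; have := nr_ge0 s.
move=> h1 h2 h3 h4.
have h5 : (vq n.+1 - vq n) * nr s <= (vq n.+1 - vq n) * ((vq n.+1 + vq n) * nr x).
  by rewrite ler_wpM2l // subr_ge0.
have -> : vq n.+2 - vq n.+1 = (vq n.+1 ^+ 2 - vq n ^+ 2) / 2.
  have qS k : vq k.+1 = (1 + vq k ^+ 2) / 2 by [].
  by rewrite (qS n.+1) [X in _ - X = _]qS; field.
have -> : vq n.+1 ^+ 2 - vq n ^+ 2 = (vq n.+1 - vq n) * (vq n.+1 + vq n) by ring.
lra.
Qed.

(** The bound on the operators y_(n+1) - y_n becomes a bound in M when they are applied to the
    selfadjoint d = [vm n.+1 - vm n] itself, as |d d| = |d|^2. The scalar part costs a second copy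
    of the increment of [vq], hence the factor 2. *)
Lemma vm_diff n : nr (vm n.+1 - vm n) <= 2 * vq n.+1 - 2 * vq n.
Proof.
set d := vm n.+1 - vm n.
have ds : cs_star d = d by rewrite /d cs_starB !vm_star.
have := vop_diff n d.
have -> : vop n.+1 d - vop n d = rc (vc n.+1 - vc n) *: d + d ** d.
  by rewrite /vop opprD addrACA -scalerBl -cmBl rmorphB.
have q := vq_nondec n.
set e := _ *: _; set g := _ ** _ => h.
have : nr e <= (vq n.+1 - vq n) * nr d.
  rewrite /e nrZ nr_rc ler_wpM2r ?nr_ge0 // !vcE -mulrBr normrM.
  rewrite (ger0_norm (_ : 0 <= vq n.+1 - vq n)) ?subr_ge0 //.
  by case: (al) => /=; rewrite ?normr1 ?normr0 ?mul1r ?mul0r // subr_ge0.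
have : nr g = nr d ^+ 2 by rewrite /g -{1}ds nr_cstar.
have := nrB (e + g) e; rewrite addrAC subrr add0r => h1 h2 h3.
have h4 : nr d * nr d <= (2 * vq n.+1 - 2 * vq n) * nr d by rewrite -expr2; lra.
have [->|n0] := eqVneq (nr d) 0; first by lra.
have n0' : 0 < nr d by rewrite lt_def n0 nr_ge0.
by rewrite -(ler_pM2r n0').
Qed.

Lemma vq_cvg : vq n @[n --> \oo] --> (1 : R).
Proof.
have cb : cvg (vq n @[n --> \oo]).
  apply: nondecreasing_is_cvgn; first by apply/nondecreasing_seqP; exact: vq_nondec.
  by exists 1 => _ [n _ <-]; case/andP: (vq_bound n).
have /cvg_ex[l hl] := cb.
have : (1 + vq n * vq n) / 2 @[n --> \oo] --> (1 + l * l) / 2.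
  by apply: cvgM; [apply: cvgD; [exact: cvg_cst|exact: cvgM]|exact: cvg_cst].
have : vq n.+1 @[n --> \oo] --> l by rewrite (cvg_shiftS vq).
move=> h1 h2; have /= : l = (1 + l * l) / 2.
  by apply: (cvg_unique _ h1) => //; exact: h2.
move=> h; suff -> : 1 = l by [].
have : (1 - l) ^+ 2 = 0 by move: h; lra.
by move/eqP; rewrite sqrf_eq0 subr_eq0 => /eqP.
Qed.

Lemma vc_cvg : vc n @[n --> \oo] --> (al%:R : R).
Proof.
have -> : (fun n => vc n) = (fun n => al%:R * vq n) by apply/funext => n; rewrite vcE.
rewrite -[X in _ --> X]mulr1; apply: cvgM; [exact: cvg_cst|exact: vq_cvg].
Qed.

Lemma rc_cvg (f : nat -> R) l :
  f n @[n --> \oo] --> l -> rc (f n) @[n --> \oo] --> (rc l : C).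
Proof.
move=> h; apply/cvg_nrP.
have : `|f n - l| @[n --> \oo] --> `|l - l|.
  by apply: cvg_norm; apply: cvgB => //; exact: cvg_cst.
rewrite subrr normr0.
by under eq_fun do rewrite -nr_rc rmorphB.
Qed.

(* Visser's iteration [y <- (u + y^2)/2] for [y = 1 - sqrt (1 - u)], run in the
   unitization with [u = al 1 + v]. *)
Lemma visser : exists m : M,
  [/\ cs_star m = m,
      rc 2 *: m = v + rc (2 * al%:R) *: m + m ** m,
      forall x, nr (rc al%:R *: x + m ** x) <= nr x &
      forall z, z ** v = v ** z -> z ** m = m ** z].
Proof.
have cm : cvg (vm n @[n --> \oo]).
  apply: (telescope_complete (b := fun n => 2 * vq n) (B := 2)).
    exact: vm_diff.
  by move=> n; have := vq_bound n; lra.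
have /cvg_ex[m hm] := cm.
have hmS : vm n.+1 @[n --> \oo] --> m by rewrite (cvg_shiftS vm).
exists m; split.
- have h1 := cvg_star hm.
  by apply: (cvg_unique_nr h1); under eq_fun do rewrite vm_star.
- have h1 : rc 2 *: vm n.+1 @[n --> \oo] --> rc 2 *: m.
    by apply: cvgZ => //; exact: cvg_cst.
  apply: (cvg_unique_nr h1).
  have -> : (fun n => rc 2 *: vm n.+1) =
            (fun n => v + rc (2 * vc n) *: vm n + vm n ** vm n).
    apply/funext => n /=; rewrite scalerA -rmorphM mulfV //=.
    by rewrite rmorph1 scale1r.
  apply: cvgD; last exact: cvg_cm.
  apply: cvgD; first exact: cvg_cst.
  apply: cvgZ => //; apply: rc_cvg; apply: cvgM; [exact: cvg_cst|exact: vc_cvg].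
- move=> x; have h : vop n x @[n --> \oo] --> rc al%:R *: x + m ** x.
    apply: cvgD; last by apply: cvg_cm => //; exact: cvg_cst.
    by apply: cvgZ; [apply: rc_cvg; exact: vc_cvg|exact: cvg_cst].
  apply: (cvg_nr_le h) => n; apply: le_trans (vop_le n x) _.
  by have := vq_bound n; have := nr_ge0 x; nra.
- move=> z zv.
  have h1 : z ** vm n @[n --> \oo] --> z ** m by apply: cvg_cm => //; exact: cvg_cst.
  apply: (cvg_unique_nr h1).
  have -> : (fun n => z ** vm n) = (fun n => vm n ** z).
    by apply/funext => n; exact: vm_comm.
  by apply: cvg_cm => //; exact: cvg_cst.
Qed.

End Visser.

(** * Positive elements *)

Section Positivity.
Variables (R : realType) (M : cstar_algebra R).
Local Notation C := (C R).
Implicit Types a b h k l m x y z : M.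

Lemma nr_avg x y (B : R) : nr x <= B -> nr y <= B ->
  nr (rc 2^-1 *: (x + y)) <= B.
Proof.
move=> hx hy; rewrite nrZ nr_rc ger0_norm //.
have := nrD x y; lra.
Qed.

(** With m = 1 - (1 - h^2)^(1/2) from the iteration, the elements 1 - m + i h and 1 - m - i h of the
    unitization act isometrically. Their average 1 - m is therefore contractive, and so is its
    square 1 - h^2. *)
Lemma selfadj_sq_le1 h : cs_star h = h -> nr h <= 1 ->
  forall x, nr (x - h ** h ** x) <= nr x.
Proof.
move=> hs h1.
have [||m [ms em _ /(_ h)]] := @visser R M false (h ** h).
- by rewrite cs_starM hs.
- move=> x; rewrite rmorph0 scale0r add0r.
  apply: le_trans (nr_cm _ _) _; rewrite -{1}hs nr_cstar.
  by rewrite ler_piMl ?nr_ge0 // expr_le1 ?nr_ge0.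
rewrite cs_mulA => /(_ erefl) hm.
rewrite mulr0 rmorph0 scale0r addr0 in em.
have emm : m ** m = rc 2 *: m - h ** h by rewrite em; lmod R.
have key (s : C) x : Num.conj s = - s -> s * s = -1 ->
    nr (x - m ** x + s *: (h ** x)) = nr x.
  move=> cs ss; apply: (@pexpIrn _ 2) => //; rewrite ?nnegrE ?nr_ge0 //.
  rewrite -!nr_cstar; congr nr.
  rewrite cs_starD cs_starB cs_starZ !cs_starM ms hs cs.
  rewrite !(cmBl, cmDl, cmBr, cmDr, cmZl, cmZr) !cs_mulA.
  rewrite -!(cs_mulA (cs_star x)) hm emm !(cmBl, cmBr, cmDr, cmNr, cmZr, cmZl).
  by lmod_coefs (Defs.C R); rc_push; ring: ss.
have i1 x : nr (x - m ** x + 'i%C *: (h ** x)) = nr x.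
  by apply: key; rewrite ?conj_i // -expr2 sqr_i.
have i2 x : nr (x - m ** x + (- 'i%C) *: (h ** x)) = nr x.
  apply: key; last by rewrite mulrNN -expr2 sqr_i.
  by rewrite conj_Ni opprK.
have g1 x : nr (x - m ** x) <= nr x.
  have -> : x - m ** x = rc 2^-1 *: ((x - m ** x + 'i%C *: (h ** x)) +
                         (x - m ** x + (- 'i%C) *: (h ** x))) by lmod R.
  by apply: nr_avg; rewrite ?i1 ?i2.
move=> x.
have -> : x - h ** h ** x = (x - m ** x) - m ** (x - m ** x).
  by rewrite cmBr cs_mulA emm cmBl cmZl; lmod R.
exact: le_trans (g1 _) (g1 _).
Qed.

Lemma selfadj_sq_le h (t : R) : cs_star h = h -> nr h ^+ 2 <= t ->
  forall x, nr (rc t *: x - h ** h ** x) <= t * nr x.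
Proof.
move=> hs ht x.
have t0 : 0 <= t by apply: le_trans ht; exact: sqr_ge0.
have [t00|tn0] := eqVneq t 0.
  have : nr h ^+ 2 = 0 by apply/eqP; rewrite eq_le sqr_ge0 -{1}t00 ht.
  move/eqP; rewrite sqrf_eq0 => /eqP/nr_eq0 ->.
  by rewrite !cm0l subr0 t00 rmorph0 scale0r nr0 mul0r.
have tp : 0 < t by rewrite lt_def tn0.
set s := Num.sqrt t.
have s0 : 0 < s by rewrite sqrtr_gt0.
have st : s ^+ 2 = t by rewrite sqr_sqrtr.
have := @selfadj_sq_le1 (rc s^-1 *: h).
rewrite cs_starZr hs nrZ nr_rc ger0_norm ?invr_ge0 ?(ltW s0) //.
move=> /(_ erefl) H.
have {H}: nr (x - rc s^-1 *: h ** (rc s^-1 *: h) ** x) <= nr x.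
  apply: H; rewrite ler_pdivrMl // mulr1.
  by rewrite -(@ler_pXn2r _ 2) ?nnegrE ?nr_ge0 ?(ltW s0) // st.
have -> : rc t *: x - h ** h ** x =
          rc t *: (x - rc s^-1 *: h ** (rc s^-1 *: h) ** x).
  rewrite !(cmZl, cmZr) scalerBr !scalerA -!rmorphM /= -st.
  have -> : s ^+ 2 * (s^-1 / s) = 1 by field; exact: lt0r_neq0.
  by rewrite rmorph1 scale1r.
by rewrite nrZ nr_rc ger0_norm // ler_pM2l.
Qed.

(** Positivity expressed by |t - h| <= t for left multiplications. In this form it is visibly stable
    under sums and is the input that the square root iteration requires. *)
Definition ppos h := cs_star h = h /\
  exists2 t : R, 0 < t & forall x, nr (rc t *: x - h ** x) <= t * nr x.

Lemma ppos_sqrt h : ppos h -> exists w,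
  [/\ cs_star w = w, w ** w = h, ppos w & forall z, z ** h = h ** z -> z ** w = w ** z].
Proof.
move=> [hs [t t0 ht]].
(* Here u = 1 - h/t, so the limit 1 + m equals 1 - (h/t)^(1/2) and m is the negative of the root of
   h/t. *)
have [||m [ms em mle mcomm]] := @visser R M true (rc (- t^-1) *: h).
- by rewrite cs_starZr hs.
- move=> x; have -> : rc true%:R *: x + rc (- t^-1) *: h ** x =
      rc t^-1 *: (rc t *: x - h ** x).
    rewrite cmZl scalerBr !scalerA -rmorphM mulVf ?lt0r_neq0 //.
    by rewrite rmorphN scaleNr.
  by rewrite nrZ nr_rc ger0_norm ?invr_ge0 ?(ltW t0) // ler_pdivrMl.
have emm : m ** m = rc t^-1 *: h.
  move: em; rewrite mulr1 addrAC -[LHS]add0r => /addIr/esym/eqP.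
  by rewrite addrC addr_eq0 rmorphN scaleNr opprK => /eqP.
set s := Num.sqrt t.
have s0 : 0 < s by rewrite sqrtr_gt0.
have st : s ^+ 2 = t by rewrite sqr_sqrtr // ltW.
exists (rc (- s) *: m); split.
- by rewrite cs_starZr ms.
- rewrite cmZl cmZr emm !scalerA -!rmorphM /= -st.
  have -> : - s * - s * (s ^+ 2)^-1 = 1 by field; exact: lt0r_neq0.
  by rewrite rmorph1 scale1r.
- split; first by rewrite cs_starZr ms.
  exists s => // x; have -> : rc s *: x - rc (- s) *: m ** x = rc s *: (rc true%:R *: x + m ** x).
    by rewrite cmZl rmorph1 scale1r; lmod R.
  by rewrite nrZ nr_rc ger0_norm ?(ltW s0) // ler_pM2l.
- by move=> z zh; rewrite cmZr cmZl mcomm // cmZr cmZl zh.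
Qed.

Lemma ppos_sq h : cs_star h = h -> ppos (h ** h).
Proof.
move=> hs; split; first by rewrite cs_starM hs.
exists (nr h ^+ 2 + 1) => [|x]; first by have := sqr_ge0 (nr h); lra.
by apply: selfadj_sq_le => //; lra.
Qed.

Lemma pposD h k : ppos h -> ppos k -> ppos (h + k).
Proof.
move=> [hs [t t0 ht]] [ks [s s0 hk]]; split; first by rewrite cs_starD hs ks.
exists (t + s) => [|x]; first by lra.
have -> : rc (t + s) *: x - (h + k) ** x = (rc t *: x - h ** x) + (rc s *: x - k ** x).
  by rewrite cmDl; lmod R.
by apply: le_trans (nrD _ _) _; rewrite mulrDl; apply: lerD.
Qed.

Lemma ppos_ge0 h : ppos h -> exists2 k, cs_star k = k & h = k ** k.
Proof. by move=> /ppos_sqrt[w [ws ww _ _]]; exists w. Qed.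

Lemma sqr_addP h k : cs_star h = h -> cs_star k = k ->
  exists2 l, cs_star l = l & h ** h + k ** k = l ** l.
Proof. by move=> hs ks; apply: ppos_ge0; apply: pposD; exact: ppos_sq. Qed.

(** Let r = |l|^2. As l^2 and -l^2 = k^2 are both squares, r - l^2 and r + l^2 have norm at most r
    as multipliers. Applying (r + l^2)^2 - (r - l^2)^2 = 4 r l^2 to l^2 gives 4 r^3 <= 2 r^3. *)
Lemma sqr_add_eq0 k l : cs_star k = k -> cs_star l = l ->
  k ** k + l ** l = 0 -> l = 0.
Proof.
move=> ks ls /eqP; rewrite addr_eq0 => /eqP kl.
have nk : nr (k ** k) = nr k ^+ 2 by rewrite -{1}ks nr_cstar.
have nl : nr (l ** l) = nr l ^+ 2 by rewrite -{1}ls nr_cstar.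
set r := nr l ^+ 2.
have rE : nr k ^+ 2 = r by rewrite -nk kl nrN nl.
have h1 x : nr (rc r *: x - l ** l ** x) <= r * nr x by exact: selfadj_sq_le.
have h2 x : nr (rc r *: x + l ** l ** x) <= r * nr x.
  by have := selfadj_sq_le ks (_ : nr k ^+ 2 <= r) x; rewrite kl cmNl opprK; apply; rewrite rE.
have : nr (rc (4 * r) *: (l ** l ** (l ** l))) <= 2 * (r * (r * r)).
  have -> : rc (4 * r) *: (l ** l ** (l ** l)) =
    (rc r *: (rc r *: (l ** l) + l ** l ** (l ** l)) +
       l ** l ** (rc r *: (l ** l) + l ** l ** (l ** l)))
    - (rc r *: (rc r *: (l ** l) - l ** l ** (l ** l)) -
       l ** l ** (rc r *: (l ** l) - l ** l ** (l ** l))).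
    by rewrite !(cmDr, cmNr, cmZr); lmod R.
  apply: le_trans (nrB _ _) _.
  have r0 : 0 <= r by exact: sqr_ge0.
  have h3 : r * nr (rc r *: (l ** l) + l ** l ** (l ** l)) <= r * (r * r).
    by rewrite ler_wpM2l //; have := h2 (l ** l); rewrite nl.
  have h4 : r * nr (rc r *: (l ** l) - l ** l ** (l ** l)) <= r * (r * r).
    by rewrite ler_wpM2l //; have := h1 (l ** l); rewrite nl.
  have := h2 (rc r *: (l ** l) + l ** l ** (l ** l)).
  have := h1 (rc r *: (l ** l) - l ** l ** (l ** l)).
  lra.
have nll : nr (l ** l ** (l ** l)) = r * r.
  have {1}<- : cs_star (l ** l) = l ** l by rewrite cs_starM ls.
  by rewrite nr_cstar nl -/r expr2.
rewrite nrZ nr_rc nll ger0_norm; last by rewrite mulr_ge0 ?sqr_ge0.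
have r0 : 0 <= r by exact: sqr_ge0.
move=> h; have : r ^+ 3 <= 0 by rewrite 2!exprS expr1; lra.
have := exprn_ge0 3 r0 => h5 h6.
have /eqP : r ^+ 3 = 0 by lra.
by rewrite expf_eq0 /= /r sqrf_eq0 => /eqP/nr_eq0.
Qed.

Lemma selfadj_sq_eq0 x : cs_star x = x -> x ** x = 0 -> x = 0.
Proof.
move=> xs xx; apply: nr_eq0; apply/eqP; rewrite -sqrf_eq0.
by rewrite -nr_cstar xs xx nr0.
Qed.

(* Kaplansky's argument, applied to [b d] rather than [b] to avoid spectra. *)
Lemma star_mul_npos b d : cs_star d = d -> cs_star b ** b = - (d ** d) -> d = 0.
Proof.
move=> ds bb.
have [f fs fE] : exists2 f, cs_star f = f & f = d ** d.
  by exists (d ** d); rewrite // cs_starM ds.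
have [e es eE] : exists2 e, cs_star e = e & e = b ** cs_star b.
  by exists (b ** cs_star b); rewrite // cs_starM cs_starK.
have [b' b1 b2] : exists2 b', b' ** cs_star b' = - (e ** e) & cs_star b' ** b' = - (f ** f).
  exists (b ** d); rewrite cs_starM ds.
  - have -> : b ** d ** (d ** cs_star b) = b ** (d ** d) ** cs_star b by rewrite !cs_mulA.
    have -> : d ** d = - (cs_star b ** b) by rewrite bb opprK.
    by rewrite cmNr cmNl eE !cs_mulA.
  - have -> : d ** cs_star b ** (b ** d) = d ** (cs_star b ** b) ** d by rewrite !cs_mulA.
    by rewrite bb cmNr cmNl fE !cs_mulA.
(* Twice the real and, up to sign, the imaginary part of b': p^2 + q^2 is twice the sum of b' b'^*
   and b'^* b', both of which are negatives of squares. *)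
set p := b' + cs_star b'; set q := 'i%C *: (b' - cs_star b').
have ps : cs_star p = p by rewrite /p cs_starD cs_starK addrC.
have qs : cs_star q = q.
  rewrite /q cs_starZ cs_starB cs_starK.
  by rewrite conj_i; lmod R.
have sum0 : p ** p + q ** q + rc 2 *: (e ** e) + rc 2 *: (f ** f) = 0.
  have -> : q ** q = - ((b' - cs_star b') ** (b' - cs_star b')).
    by rewrite /q cmZl cmZr scalerA -expr2 sqr_i scaleN1r.
  have -> : e ** e = - (b' ** cs_star b') by rewrite b1 opprK.
  have -> : f ** f = - (cs_star b' ** b') by rewrite b2 opprK.
  by rewrite /p !(cmDl, cmDr, cmNl, cmNr); lmod R.
have s2 x : rc 2 *: (x ** x) = (rc (Num.sqrt 2) *: x) ** (rc (Num.sqrt 2) *: x).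
  by rewrite cmZl cmZr scalerA -rmorphM -expr2 sqr_sqrtr.
have s2s x : cs_star x = x -> cs_star (rc (Num.sqrt 2) *: x) = rc (Num.sqrt 2) *: x.
  by move=> xs; rewrite cs_starZr xs.
have [s ss es1] := sqr_addP ps qs.
have [r rs er1] := sqr_addP ss (s2s _ es).
rewrite es1 !s2 er1 in sum0.
have /eqP := sqr_add_eq0 rs (s2s _ fs) sum0.
rewrite scaler_eq0 => /orP[/eqP sq2|/eqP f0].
  have : rc (Num.sqrt (2 : R)) = rc 0 by rewrite sq2 rmorph0.
  move/(congr1 (@cre R)); by rewrite !rcK => /eqP; rewrite sqrtr_eq0 leNgt ltr0n.
have sa0 := selfadj_sq_eq0.
by apply: sa0 => //; rewrite -fE.
Qed.

(* [n] is twice the negative part of [m* m]. *)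
Lemma star_mul_sqr m : exists2 k, cs_star k = k & cs_star m ** m = k ** k.
Proof.
set h := cs_star m ** m.
have hs : cs_star h = h by rewrite /h cs_starM cs_starK.
have [c [cs cc pc hcomm]] := ppos_sqrt (ppos_sq hs).
have hc : h ** c = c ** h by apply: hcomm; rewrite cs_mulA.
have [l [ls ll _ lcomm]] := ppos_sqrt pc.
have hl : h ** l = l ** h by exact: lcomm.
set n := c - h.
have ns : cs_star n = n by rewrite /n cs_starB cs hs.
have nl : n ** l = l ** n by apply: lcomm; rewrite /n cmBl cmBr hc.
have hn : h ** n = - (c ** n) by rewrite /n !cmBr hc cc; lmod R.
have nn : n ** n = rc 2 *: (c ** n).
  by rewrite {1}/n cmBl hn; lmod R.
(* Since h n = - c n and l^2 = c commutes with n, b^* b = n h n = - (n l)^2, which is the situation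
   excluded by [star_mul_npos]. *)
set d := n ** l; set b := m ** n.
have ds : cs_star d = d by rewrite /d cs_starM ns ls nl.
have bb : cs_star b ** b = - (d ** d).
  rewrite /b cs_starM ns.
  have -> : n ** cs_star m ** (m ** n) = n ** (h ** n) by rewrite /h !cs_mulA.
  by rewrite hn cmNr -ll {2}/d nl /d !cs_mulA.
have d0 : d = 0 by exact: star_mul_npos bb.
have n0 : n = 0.
  apply: selfadj_sq_eq0 => //; rewrite nn -ll -cs_mulA -nl -/d d0 cm0r scaler0; exact: erefl.
exists l => //; rewrite ll; apply/esym/eqP; rewrite -subr_eq0; exact/eqP.
Qed.

Lemma cs_ge0P a : cs_ge0 a <-> exists2 k, cs_star k = k & a = k ** k.
Proof.
split=> [[n ->]|[k ks ->]]; first exact: star_mul_sqr.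
by exists k; rewrite ks.
Qed.

Lemma cs_ge0D a b : cs_ge0 a -> cs_ge0 b -> cs_ge0 (a + b).
Proof.
by move=> /cs_ge0P[k ks ->] /cs_ge0P[l ls ->]; apply/cs_ge0P; exact: sqr_addP.
Qed.

Lemma cs_ge00 : cs_ge0 (0 : M).
Proof. by exists 0; rewrite cm0r. Qed.

Lemma cs_ge0_sum I (r : seq I) (P : pred I) (F : I -> M) :
  (forall i, P i -> cs_ge0 (F i)) -> cs_ge0 (\sum_(i <- r | P i) F i).
Proof. by move=> h; apply: big_rec => [|i x Pi]; [exact: cs_ge00|apply: cs_ge0D; exact: h]. Qed.

Lemma cs_ge0Z (t : R) a : 0 <= t -> cs_ge0 a -> cs_ge0 (rc t *: a).
Proof.
move=> t0 [n ->]; exists (rc (Num.sqrt t) *: n).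
by rewrite cs_starZr cmZl cmZr scalerA -rmorphM -expr2 sqr_sqrtr.
Qed.

Lemma cs_ge0_conj a x : cs_ge0 a -> cs_ge0 (cs_star x ** a ** x).
Proof. by move=> [n ->]; exists (n ** x); rewrite cs_starM !cs_mulA. Qed.

(** In the unitization this says c^2 - z^* z = (c - y)^2. It turns z^* z <= c^2 into an identity
    whose terms can act on modules over M without adjoining a unit. *)
Lemma norm_defect z (c : R) : nr z <= c -> exists2 y, cs_star y = y &
  cs_star z ** z = rc (2 * c) *: y - y ** y.
Proof.
move=> zc; have c0 : 0 <= c by apply: le_trans zc; exact: nr_ge0.
have [c00|cn0] := eqVneq c 0.
  have -> : z = 0 by apply: nr_eq0; apply/eqP; rewrite eq_le nr_ge0 -{1}c00 zc.
  by exists 0; rewrite ?cs_star0 // !cm0r scaler0 subr0.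
have cp : 0 < c by rewrite lt_def cn0.
have [||m [ms em _ _]] := @visser R M false (rc (c ^+ 2)^-1 *: (cs_star z ** z)).
- by rewrite cs_starZr cs_starM cs_starK.
- move=> x; rewrite rmorph0 scale0r add0r cmZl nrZ nr_rc ger0_norm ?invr_ge0 ?sqr_ge0 //.
  rewrite ler_pdivrMl ?exprn_gt0 //; apply: le_trans (nr_cm _ _) _.
  rewrite nr_cstar ler_wpM2r ?nr_ge0 //.
  by rewrite ler_pXn2r ?nnegrE ?nr_ge0.
exists (rc c *: m); first by rewrite cs_starZr ms.
have : rc (c ^+ 2) *: (rc 2 *: m) = rc (c ^+ 2) *: (rc 2 *: m) by [].
rewrite {1}em mulr0 rmorph0 scale0r addr0 scalerDr scalerA -rmorphM divff ?expf_neq0 // rmorph1 scale1r.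
move=> /(canRL (addrK _)) ->.
by rewrite cmZl cmZr; lmod R.
Qed.

Lemma cs_norm_conj z x (c : R) : nr z <= c ->
  cs_ge0 (rc (c ^+ 2) *: (cs_star x ** x) - cs_star x ** (cs_star z ** z) ** x).
Proof.
move=> /norm_defect[y ys ->]; exists (rc c *: x - y ** x).
rewrite cs_starB cs_starZr cs_starM ys !(cmBl, cmBr, cmZl, cmZr) !cs_mulA.
by lmod R.
Qed.

(** From (1 - y)^2 = 1 - a - b one gets a - a^2 = k b k + k (1 - y)^2 k >= 0, where a = k^2. With r
    the root of a - a^2, the element u = a + i r satisfies u^* u = a and has real part a. Hence |a|
    <= |u| = |a|^(1/2). *)
Lemma nr_le1_ge0 a b : cs_ge0 a -> cs_ge0 b -> nr (a + b) <= 1 -> nr a <= 1.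
Proof.
move=> /cs_ge0P[k ks ak] [p pb] ab1.
have as_ : cs_star a = a by rewrite ak cs_starM ks.
have [||y [ys ey _ _]] := @visser R M false (a + b).
- by rewrite cs_starD as_ pb cs_starM cs_starK.
- move=> x; rewrite rmorph0 scale0r add0r; apply: le_trans (nr_cm _ _) _.
  by have := nr_ge0 x; nra.
rewrite mulr0 rmorph0 scale0r addr0 in ey.
have /cs_ge0P[r0 r0s e0] : cs_ge0 (a - a ** a).
  have -> : a - a ** a = cs_star (p ** k) ** (p ** k) + cs_star (k - y ** k) ** (k - y ** k).
    have yy : y ** y = rc 2 *: y - a - b by rewrite ey; lmod R.
    rewrite cs_starB !cs_starM ks ys !(cmBl, cmBr) !cs_mulA.
    have -> : k ** cs_star p ** p ** k = k ** b ** k by rewrite pb !cs_mulA.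
    have -> : k ** y ** y ** k = k ** (y ** y) ** k by rewrite !cs_mulA.
    rewrite yy !(cmBr, cmBl, cmZr, cmZl) {4}ak.
    have -> : a ** a = k ** a ** k by rewrite ak !cs_mulA.
    by rewrite {1}ak ak; lmod R.
  by apply: cs_ge0D; eexists.
have [r [rs er _ rcomm]] : exists w, [/\ cs_star w = w, w ** w = a - a ** a, ppos w &
     forall z, z ** (a - a ** a) = (a - a ** a) ** z -> z ** w = w ** z].
  by apply: ppos_sqrt; rewrite e0; exact: ppos_sq.
have ar : a ** r = r ** a by apply: rcomm; rewrite cmBr cmBl cs_mulA.
set u := a + 'i%C *: r.
have ci := @conj_i R.
have us : cs_star u = a - 'i%C *: r by rewrite /u cs_starD cs_starZ as_ rs ci scaleNr.
have uu : cs_star u ** u = a.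
  rewrite us /u !(cmBl, cmDr, cmZl, cmZr) scalerA -expr2 sqr_i er ar.
  by lmod R.
have nu : nr u ^+ 2 = nr a by rewrite -nr_cstar uu.
have : nr a <= nr u.
  have {1}-> : a = rc 2^-1 *: (u + cs_star u) by rewrite us /u; lmod R.
  by apply: nr_avg => //; rewrite nr_star.
move=> h; have h2 : nr a ^+ 2 <= nr a.
  by rewrite -{2}nu ler_pXn2r ?nnegrE ?nr_ge0.
by rewrite leNgt; apply/negP => h3; move: h2; rewrite expr2; nra.
Qed.

Lemma nr_ge0_mono a b : cs_ge0 a -> cs_ge0 b -> nr a <= nr (a + b).
Proof.
move=> a0 b0; apply/ler_addgt0Pr => e e0.
set s := nr (a + b) + e.
have s0 : 0 < s by have := nr_ge0 (a + b); rewrite /s; lra.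
have := @nr_le1_ge0 (rc s^-1 *: a) (rc s^-1 *: b).
rewrite -scalerDr !nrZ nr_rc ger0_norm ?invr_ge0 ?(ltW s0) //.
rewrite !ler_pdivrMl // mulr1; apply; last by rewrite /s; lra.
- by apply: cs_ge0Z => //; rewrite invr_ge0 ltW.
- by apply: cs_ge0Z => //; rewrite invr_ge0 ltW.
Qed.

Definition cs_le a b := cs_ge0 (b - a).

Lemma cs_le_nr a b : cs_ge0 a -> cs_le a b -> nr a <= nr b.
Proof.
by move=> a0 ab; have := nr_ge0_mono a0 ab; rewrite addrC subrK.
Qed.
Lemma cs_le_trans b a c : cs_le a b -> cs_le b c -> cs_le a c.
Proof.
move=> ab bc; rewrite /cs_le; have -> : c - a = (c - b) + (b - a) by rewrite addrA subrK.
exact: cs_ge0D.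
Qed.
Lemma cs_le_refl a : cs_le a a.
Proof. by rewrite /cs_le subrr; exact: cs_ge00. Qed.
Lemma cs_le_sum I (r : seq I) (P : pred I) (F G : I -> M) :
  (forall i, P i -> cs_le (F i) (G i)) ->
  cs_le (\sum_(i <- r | P i) F i) (\sum_(i <- r | P i) G i).
Proof. by move=> h; rewrite /cs_le -sumrB; exact: cs_ge0_sum. Qed.
End Positivity.

(** * Sesquilinear forms with values in the algebra *)

Section Forms.
Variable R : realType.
Local Notation C := (C R).

Record psd_form (V : lmodType C) (f : V -> V -> C) : Prop := PsdForm {
  psf_linr : forall u (a : C) v w, f u (a *: v + w) = a * f u v + f u w ;
  psf_conj : forall u v, Num.conj (f u v) = f v u ;
  psf_ge0 : forall u, 0 <= f u u }.

Lemma quadratic_ge0 (a b c : R) :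
  (forall t, 0 <= a + 2 * t * c + t ^+ 2 * b) -> c ^+ 2 <= a * b.
Proof.
move=> h; have [b0|bn0] := eqVneq b 0.
  rewrite b0 mulr0; suff -> : c = 0 by rewrite expr0n.
  apply/eqP/negPn/negP => cn0.
  have := h (- (a + 1) / (2 * c)); rewrite b0 mulr0 addr0.
  have -> : a + 2 * (- (a + 1) / (2 * c)) * c = -1 by field.
  lra.
have bp : 0 < b.
  rewrite lt_def bn0 /=; rewrite leNgt; apply/negP => bl0.
  have h0 := h 0; have h1 := h ((a + 1 + `|2 * c|) / - b + 1).
  set t := _ + 1 in h1.
  have n0 : 0 <= (a + 1 + `|2 * c|) / - b.
    by rewrite divr_ge0 ?oppr_ge0 ?(ltW bl0) //; have := normr_ge0 (2 * c); nra.
  have t1 : 1 <= t by rewrite /t; lra.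
  have e : (t - 1) * (- b) = a + 1 + `|2 * c| by rewrite /t addrK divfK // oppr_eq0.
  have := ler_norm (2 * c); have h2 := normr_ge0 (2 * c) => h3.
  have h4 : 2 * t * c <= t * `|2 * c| by rewrite mulrAC mulrC ler_wpM2l //; lra.
  have h5 : t ^+ 2 * b <= - t * (a + 1 + `|2 * c|) by rewrite -e; nra.
  nra.
have := h (- c / b).
have -> : a + 2 * (- c / b) * c + (- c / b) ^+ 2 * b = a - c ^+ 2 / b by field.
by rewrite subr_ge0 ler_pdivrMr.
Qed.

Section OneForm.
Variables (V : lmodType C) (f : V -> V -> C).
Hypothesis ff : psd_form f.
Implicit Types u v w : V.

Lemma psfDr u v w : f u (v + w) = f u v + f u w.
Proof. by have := psf_linr ff u 1 v w; rewrite scale1r mul1r. Qed.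
Lemma psf0r u : f u 0 = 0.
Proof. by apply: (addrI (f u 0)); rewrite -psfDr !addr0. Qed.
Lemma psfZr u a v : f u (a *: v) = a * f u v.
Proof. by have := psf_linr ff u a v 0; rewrite psf0r !addr0. Qed.
Lemma psfNr u v : f u (- v) = - f u v.
Proof. by rewrite -scaleN1r psfZr mulN1r. Qed.
Lemma psfDl u v w : f (u + v) w = f u w + f v w.
Proof. by rewrite -!(psf_conj ff w) psfDr rmorphD. Qed.
Lemma psf0l u : f 0 u = 0.
Proof. by rewrite -(psf_conj ff) psf0r rmorph0. Qed.
Lemma psfZl a u v : f (a *: u) v = Num.conj a * f u v.
Proof. by rewrite -!(psf_conj ff v) psfZr rmorphM. Qed.
Lemma psfNl u v : f (- u) v = - f u v.
Proof. by rewrite -!(psf_conj ff v) psfNr rmorphN. Qed.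
Lemma psf_sumr u I (r : seq I) (P : pred I) (F : I -> V) :
  f u (\sum_(i <- r | P i) F i) = \sum_(i <- r | P i) f u (F i).
Proof. by elim/big_rec2: _ => [|i x y _ <-]; [exact: psf0r|exact: psfDr]. Qed.
Lemma psf_suml u I (r : seq I) (P : pred I) (F : I -> V) :
  f (\sum_(i <- r | P i) F i) u = \sum_(i <- r | P i) f (F i) u.
Proof. by elim/big_rec2: _ => [|i x y _ <-]; [exact: psf0l|exact: psfDl]. Qed.

Definition sqn u : R := cre (f u u).
Lemma sqnE u : f u u = rc (sqn u).
Proof. by apply: ge0_rc; exact: (psf_ge0 ff). Qed.
Lemma sqn_ge0 u : 0 <= sqn u.
Proof. by apply: cre_ge0; exact: (psf_ge0 ff). Qed.
Lemma sqnZ a u : sqn (a *: u) = nr a ^+ 2 * sqn u.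
Proof.
by rewrite /sqn psfZl psfZr mulrA -nr_sqr cre_rcM.
Qed.
Lemma sqnN u : sqn (- u) = sqn u.
Proof. by rewrite /sqn psfNl psfNr opprK. Qed.

Lemma psf_CS u v : nr (f u v) ^+ 2 <= sqn u * sqn v.
Proof.
have [b b1 hb] := exists_phase (f u v).
have sv : sqn (b *: v) = sqn v by rewrite sqnZ b1 expr1n mul1r.
rewrite -sv; apply: quadratic_ge0 => t.
have := sqn_ge0 (u + rc t *: (b *: v)).
rewrite /sqn psfDl !psfDr !raddfD /= !(psfZl, psfZr) !conj_rc.
have hb' : Num.conj b * f v u = rc (nr (f u v)).
  by rewrite -(psf_conj ff u) -rmorphM hb; exact: conj_rc.
rewrite hb hb' !(mulrCA (Num.conj b) (rc t)) !cre_rcM !rcK.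
lra.
Qed.

Lemma psf_CS_eq0 u v : sqn v = 0 -> f u v = 0.
Proof.
move=> v0; apply: nr_eq0; apply/eqP; rewrite -sqrf_eq0 eq_le sqr_ge0 andbT.
by have := psf_CS u v; rewrite v0 mulr0.
Qed.

Lemma sqr_bounded_le1 (r : nat -> R) (B : R) :
  (forall k, 0 <= r k) -> (forall k, r k ^+ 2 <= r k.+1) -> (forall k, r k <= B) ->
  r 0%N <= 1.
Proof.
move=> r0 rS rB; rewrite leNgt; apply/negP => h.
set d := r 0%N - 1; have d0 : 0 < d by rewrite /d; lra.
have H k : 1 + k.+1%:R * d <= r k.
  elim: k => [|k ih]; first by rewrite /d; lra.
  apply: le_trans (rS k); have := r0 k.
  have -> : k.+2%:R = k.+1%:R + 1 :> R by rewrite -natr1.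
  have : 1 <= k.+1%:R :> R by rewrite ler1n.
  set y := k.+1%:R in ih * => h1 h2.
  have h3 : 0 <= y * d by rewrite mulr_ge0 //; lra.
  have h4 : (1 + y * d) ^+ 2 <= r k ^+ 2 by rewrite ler_pXn2r ?nnegrE //; lra.
  apply: le_trans h4; nra.
have [N hN] : exists N : nat, (B / d) < N%:R.
  by exists (Num.truncn (B / d)).+1; exact: truncnS_gt.
have := H N; have := rB N; rewrite ltr_pdivrMr // in hN.
rewrite -natr1; nra.
Qed.

(* Iterating [|f v (S v)|^2 <= f v v * f v (S^2 v)] along powers of 2 turns a
   growth rate of [f v (S^N v)] into a bound on [S]. *)
Lemma power_trick (S : V -> V) (la : R) v (K : R) :
  (forall u w, f (S u) w = f u (S w)) -> 0 <= la ->
  (forall N, nr (f v (iter N S v)) <= K * la ^+ N) ->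
  nr (f v (S v)) <= la * sqn v.
Proof.
move=> Ss la0 hK.
have Sit N u w : f (iter N S u) w = f u (iter N S w).
  by elim: N u w => //= N ih u w; rewrite Ss ih -iterSr.
pose a k := nr (f v (iter (2 ^ k) S v)).
have a_sq k : a k ^+ 2 <= sqn v * a k.+1.
  apply: le_trans (psf_CS _ _) _; rewrite ler_wpM2l ?sqn_ge0 //.
  rewrite /sqn Sit -iterD addnn -mul2n -expnS; exact: cre_le_nr.
have a_ge k : 0 <= a k by exact: nr_ge0.
have a0E : nr (f v (S v)) = a 0%N by [].
rewrite a0E.
have [s0|sn0] := eqVneq (sqn v) 0.
  have := a_sq 0%N; rewrite s0 mul0r mulr0 => h.
  by have := a_ge 0%N; nra.
have sp : 0 < sqn v by rewrite lt_def sn0 sqn_ge0.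
have [l0|ln0] := eqVneq la 0.
  have := a_sq 0%N; have := hK (2 ^ 1)%N.
  rewrite -/(a 1%N) l0 expr0n mulr0 mul0r => h1 h2.
  have := a_ge 0%N; have := a_ge 1%N; nra.
have lp : 0 < la by rewrite lt_def ln0.
pose r k := a k / (sqn v * la ^+ (2 ^ k)).
have dp k : 0 < sqn v * la ^+ (2 ^ k) by rewrite mulr_gt0 // exprn_gt0.
have := @sqr_bounded_le1 r (K / sqn v).
have -> : r 0%N = a 0%N / (la * sqn v) by rewrite /r expn0 expr1 (mulrC la).
rewrite ler_pdivrMr ?mulr_gt0 // mul1r; apply.
- by move=> k; rewrite divr_ge0 ?a_ge ?(ltW (dp _)).
- move=> k; rewrite /r exprMn exprVn ler_pdivrMr ?exprn_gt0 //.
  have -> : a k.+1 / (sqn v * la ^+ (2 ^ k.+1)) * (sqn v * la ^+ (2 ^ k)) ^+ 2 = sqn v * a k.+1.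
    rewrite expnS mulnC exprM; field.
    by rewrite sn0 expf_neq0.
  exact: a_sq.
- move=> k; rewrite ler_pdivrMr //.
  have -> : K / sqn v * (sqn v * la ^+ (2 ^ k)) = K * la ^+ (2 ^ k) by field.
  exact: hK.
Qed.

End OneForm.

Lemma dot_psd (G : hilbert R) : psd_form (@dot R G).
Proof.
split; [exact: dot_linr|exact: dot_conj|] => x.
by rewrite -dot_norm exprn_ge0.
Qed.

Lemma dot_sqn (G : hilbert R) (x : G) : sqn (@dot R G) x = nr x ^+ 2.
Proof. by rewrite /sqn -dot_norm normE -rmorphXn rcK. Qed.

Lemma dot_CS (G : hilbert R) (x y : G) : nr (dot x y) <= nr x * nr y.
Proof.
rewrite -(@ler_pXn2r _ 2) ?nnegrE ?mulr_ge0 ?nr_ge0 // exprMn -!dot_sqn.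
exact: psf_CS (dot_psd G) _ _.
Qed.

Definition fform (V : lmodType C) (f : V -> V -> C) n (u v : {ffun 'I_n -> V}) : C :=
  \sum_i f (u i) (v i).

Lemma fform_psd (V : lmodType C) (f : V -> V -> C) n :
  psd_form f -> psd_form (@fform V f n).
Proof.
move=> ff; split=> [u a v w|u v|u].
- rewrite mulr_sumr -big_split; apply: eq_bigr => i _.
  by rewrite !ffunE (psfDr ff) (psfZr ff).
- by rewrite rmorph_sum; apply: eq_bigr => i _; exact: psf_conj.
- by apply: sumr_ge0 => i _; exact: psf_ge0.
Qed.

End Forms.

(** * Module-valued inner products *)

Section ModuleForms.
Variables (R : realType) (M : cstar_algebra R).
Local Notation C := (C R).

Record mform (V : lmodType C) (ra : V -> M -> V) (ip : V -> V -> M) : Prop := MForm {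
  mf_linr : forall x, is_linear (ip x) ;
  mf_star : forall x y, cs_star (ip x y) = ip y x ;
  mf_ract : forall x y m, ip x (ra y m) = ip x y ** m ;
  mf_ge0 : forall x, cs_ge0 (ip x x) }.

Section OneMForm.
Variables (V : lmodType C) (ra : V -> M -> V) (ip : V -> V -> M).
Hypothesis mf : mform ra ip.
Implicit Types x y z : V.

Lemma mfDr x y z : ip x (y + z) = ip x y + ip x z.
Proof. exact: (linD (mf_linr mf x)). Qed.
Lemma mfZr x a y : ip x (a *: y) = a *: ip x y.
Proof. exact: (linZ (mf_linr mf x)). Qed.
Lemma mfNr x y : ip x (- y) = - ip x y.
Proof. exact: (linN (mf_linr mf x)). Qed.
Lemma mf0r x : ip x 0 = 0.
Proof. exact: (lin0 (mf_linr mf x)). Qed.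
Lemma mf_sumr x I (r : seq I) (P : pred I) (F : I -> V) :
  ip x (\sum_(i <- r | P i) F i) = \sum_(i <- r | P i) ip x (F i).
Proof. exact: (lin_sum (mf_linr mf x)). Qed.
Lemma mfDl x y z : ip (x + y) z = ip x z + ip y z.
Proof. by rewrite -!(mf_star mf z) mfDr cs_starD. Qed.
Lemma mfZl a x y : ip (a *: x) y = Num.conj a *: ip x y.
Proof. by rewrite -!(mf_star mf y) mfZr cs_starZ. Qed.
Lemma mfNl x y : ip (- x) y = - ip x y.
Proof. by rewrite -!(mf_star mf y) mfNr cs_starN. Qed.
Lemma mf_suml x I (r : seq I) (P : pred I) (F : I -> V) :
  ip (\sum_(i <- r | P i) F i) x = \sum_(i <- r | P i) ip (F i) x.
Proof.
rewrite -(mf_star mf) mf_sumr cs_star_sum; apply: eq_bigr => i _; exact: (mf_star mf).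
Qed.
Lemma mf_ractl x m y : ip (ra x m) y = cs_star m ** ip x y.
Proof. by rewrite -(mf_star mf) (mf_ract mf) cs_starM (mf_star mf). Qed.

Lemma ge0_le_nr_conj (a x : M) (c : R) : cs_ge0 a -> nr a <= c ->
  cs_le (cs_star x ** a ** x) (rc c *: (cs_star x ** x)).
Proof.
move=> [z ->]; rewrite nr_cstar => zc.
have c0 : 0 <= c by apply: le_trans zc; exact: sqr_ge0.
have := @cs_norm_conj R M z x (Num.sqrt c).
rewrite sqr_sqrtr // => h; rewrite /cs_le; apply: h.
by rewrite -(@ler_pXn2r _ 2) ?nnegrE ?nr_ge0 ?sqrtr_ge0 // sqr_sqrtr.
Qed.

(** With a = <x, y>, positivity of <x a - d y, x a - d y> and a^* <x, x> a <= d a^* a add up to d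
    a^* a <= d^2 <y, y>, which is divided by d > 0. The case c = 0 is the limit d -> 0. *)
Lemma mf_CS x y (c : R) : nr (ip x x) <= c ->
  cs_le (cs_star (ip x y) ** ip x y) (rc c *: ip y y).
Proof.
suff pos (d : R) : 0 < d -> nr (ip x x) <= d ->
    cs_le (cs_star (ip x y) ** ip x y) (rc d *: ip y y).
  move=> xc; have c0 : 0 <= c by apply: le_trans xc; exact: nr_ge0.
  have [c00|cn0] := eqVneq c 0; last by apply: pos => //; rewrite lt_def cn0.
  suff -> : ip x y = 0 by rewrite cm0r c00 rmorph0 scale0r; exact: cs_le_refl.
  apply: nr_eq0; apply/eqP; rewrite -sqrf_eq0 eq_le sqr_ge0 andbT.
  apply/ler_addgt0Pr => e e0; rewrite add0r -nr_cstar.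
  set d := e / (nr (ip y y) + 1).
  have n1 : 0 < nr (ip y y) + 1 by have := nr_ge0 (ip y y); lra.
  have d0 : 0 < d by rewrite divr_gt0.
  have h := pos d d0 (le_trans xc (_ : c <= d)).
  have := cs_le_nr (_ : cs_ge0 _) (h _); rewrite c00 => /(_ _ (ltW d0)) h2.
  apply: le_trans (h2 _) _; first by eexists.
  rewrite nrZ nr_rc gtr0_norm // /d mulrAC ler_pdivrMr // ler_pM2l //; lra.
move=> d0 xd; set a := ip x y.
have := mf_ge0 mf (ra x a - rc d *: y).
rewrite mfDl !mfDr !mfNl !mfNr !mfZl !mfZr conj_rc !mf_ractl !(mf_ract mf) -(mf_star mf x y) -/a => h.
have h1 := ge0_le_nr_conj a (mf_ge0 mf x) xd.
have d1 : 0 <= d^-1 by rewrite invr_ge0 ltW.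
have := cs_ge0Z d1 (cs_ge0D h h1); rewrite /cs_le; congr cs_ge0.
rewrite cs_mulA; have dn0 : d != 0 by exact: lt0r_neq0.
have dc : rc d != 0 by rewrite fmorph_eq0.
by lmod_coefs (Defs.C R); rc_push; field => //.
Qed.

Lemma mf_CS_nr x y : nr (ip x y) ^+ 2 <= nr (ip x x) * nr (ip y y).
Proof.
have := cs_le_nr _ (mf_CS y (lexx (nr (ip x x)))).
rewrite nr_cstar nrZ nr_rc ger0_norm ?nr_ge0 //; apply; by eexists.
Qed.

End OneMForm.

Definition fip (V : lmodType C) (ip : V -> V -> M) n (u v : {ffun 'I_n -> V}) : M :=
  \sum_i ip (u i) (v i).
Definition fra (V : lmodType C) (ra : V -> M -> V) n (u : {ffun 'I_n -> V}) (m : M) :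
  {ffun 'I_n -> V} := [ffun i => ra (u i) m].

Lemma fip_mform (V : lmodType C) (ra : V -> M -> V) ip n :
  mform ra ip -> mform (@fra V ra n) (@fip V ip n).
Proof.
move=> mf; split=> [u a v w|u v|u v m|u].
- rewrite scaler_sumr -big_split; apply: eq_bigr => i _.
  by rewrite !ffunE (mfDr mf) (mfZr mf).
- by rewrite cs_star_sum; apply: eq_bigr => i _; exact: (mf_star mf).
- by rewrite cm_suml; apply: eq_bigr => i _; rewrite ffunE (mf_ract mf).
- by apply: cs_ge0_sum => i _; exact: (mf_ge0 mf).
Qed.

Definition cip (x y : M) := cs_star x ** y.
Lemma cip_mform : mform (@cs_mul R M) cip.
Proof.
split=> [x|x y|x y m|x]; rewrite /cip.
- exact: cs_mul_linr.
- by rewrite cs_starM cs_starK.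
- by rewrite cs_mulA.
- by eexists.
Qed.

Lemma hm_mform (E : hilbert_module M) : mform (@hm_ract R M E) (@hm_inner R M E).
Proof.
split; [exact: hm_inner_linr|exact: hm_inner_star|exact: hm_inner_ract|exact: hm_inner_ge0].
Qed.

Lemma nr_hm (E : hilbert_module M) (x : E) : nr (hm_inner x x) = nr x ^+ 2.
Proof.
by apply: (@complexI R); rewrite -[LHS]normE -hm_norm normE -rmorphXn.
Qed.

Lemma hm_CS (E : hilbert_module M) (x y : E) : nr (hm_inner x y) <= nr x * nr y.
Proof.
rewrite -(@ler_pXn2r _ 2) ?nnegrE ?mulr_ge0 ?nr_ge0 // exprMn -!nr_hm.
exact: mf_CS_nr (hm_mform E) _ _.
Qed.

Lemma hm_inner_eq0 (E : hilbert_module M) (x : E) : (forall y, hm_inner x y = 0) -> x = 0.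
Proof.
move=> /(_ x) h; apply: nr_eq0; apply/eqP; rewrite -sqrf_eq0.
by rewrite -nr_hm h nr0.
Qed.

Lemma nr_ract (E : hilbert_module M) (x : E) m : nr (hm_ract x m) <= nr x * nr m.
Proof.
rewrite -(@ler_pXn2r _ 2) ?nnegrE ?mulr_ge0 ?nr_ge0 // exprMn -nr_hm.
rewrite (mf_ractl (hm_mform E)) hm_inner_ract.
apply: le_trans (nr_cm _ _) _; rewrite nr_star mulrC expr2 (expr2 (nr m)) mulrA.
rewrite ler_wpM2r ?nr_ge0 //; apply: le_trans (nr_cm _ _) _.
by rewrite nr_hm expr2.
Qed.

(** The difference of the two sides is <c x - y x, c x - y x> for the y of [norm_defect]. *)
Lemma lact_le (E : correspondence M) (m : M) (x : E) (c : R) : nr m <= c ->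
  cs_le (hm_inner (co_lact m x) (co_lact m x)) (rc (c ^+ 2) *: hm_inner x x).
Proof.
move=> /norm_defect[y ys e].
have mf := hm_mform E.
have := hm_inner_ge0 (rc c *: x - co_lact y x).
rewrite (mfDl mf) !(mfDr mf) !(mfNl mf, mfNr mf) !(mfZl mf, mfZr mf) conj_rc.
rewrite !co_lact_adj ys -!co_lactM e.
rewrite /cs_le; congr cs_ge0.
rewrite (linB (co_lact_linl x)) (linZ (co_lact_linl x)) (mfDr mf) (mfNr mf) (mfZr mf).
by lmod R.
Qed.

Lemma nr_lact (E : correspondence M) (m : M) (x : E) : nr (co_lact m x) <= nr m * nr x.
Proof.
rewrite -(@ler_pXn2r _ 2) ?nnegrE ?mulr_ge0 ?nr_ge0 // exprMn -!nr_hm.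
have := cs_le_nr (hm_inner_ge0 _) (lact_le x (lexx (nr m))).
by rewrite nrZ nr_rc ger0_norm ?sqr_ge0.
Qed.

End ModuleForms.

Arguments cip {R M} x y.

(** * Transfer of norm bounds from M^n to representations *)

Section PowerTransfer.
Variables (R : realType) (M : cstar_algebra R).
Local Notation C := (C R).

(** A *-representation on a possibly degenerate and incomplete space. Only the individual matrix
    coefficients are assumed bounded in [fr_bnd]; uniform bounds are a consequence of
    [power_transfer]. *)
Record form_rep (V : lmodType C) (f : V -> V -> C) (rho : M -> V -> V) : Prop := FormRep {
  fr_linr : forall m, is_linear (rho m) ;
  fr_linl : forall v, is_linear (rho^~ v) ;
  fr_mul : forall m n v, rho (m ** n) v = rho m (rho n v) ;
  fr_adj : forall m u v, f (rho (cs_star m) u) v = f u (rho m v) ;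
  fr_bnd : forall u v, exists K : R, forall m, nr (f u (rho m v)) <= K * nr m }.

Definition mxactM n (A : 'I_n -> 'I_n -> M) (m : {ffun 'I_n -> M}) : {ffun 'I_n -> M} :=
  [ffun i => \sum_j A i j ** m j].

Section Fixed.
Variables (V : lmodType C) (f : V -> V -> C) (rho : M -> V -> V).
Hypotheses (ff : psd_form f) (fr : form_rep f rho).

Definition mxactV n (A : 'I_n -> 'I_n -> M) (v : {ffun 'I_n -> V}) : {ffun 'I_n -> V} :=
  [ffun i => \sum_j rho (A i j) (v j)].

Variables (n : nat) (A : 'I_n -> 'I_n -> M) (c la : R).

Local Notation T := (fun m : {ffun 'I_n -> M} => rc c *: m + mxactM A m).
Local Notation S := (fun v : {ffun 'I_n -> V} => rc c *: v + mxactV A v).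

(** The matrix part of (c + A)^N, whose scalar part is c^N. Keeping the two apart replaces the
    identity matrix, as M need not have a unit. *)
Fixpoint affine_pow N : 'I_n -> 'I_n -> M :=
  if N is N'.+1 then fun i j =>
    rc c *: affine_pow N' i j + rc (c ^+ N') *: A i j + \sum_k A i k ** affine_pow N' k j
  else fun _ _ => 0.

Lemma iter_affineM N m :
  iter N T m = rc (c ^+ N) *: m + mxactM (affine_pow N) m.
Proof.
elim: N => [|N ih] /=; apply/ffunP => i.
  rewrite !ffunE expr0 rmorph1 scale1r big1 ?addr0 // => j _; exact: cm0l.
rewrite ih !ffunE.
have e j : (rc (c ^+ N) *: m + mxactM (affine_pow N) m) j =
  rc (c ^+ N) *: m j + \sum_k affine_pow N j k ** m k by rewrite !ffunE.
under [X in _ + X = _]eq_bigr => j _ do rewrite e cmDr cmZr.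
under [in RHS]eq_bigr => j _ do rewrite !cmDl !cmZl cm_suml.
rewrite !big_split /= -!scaler_sumr.
under [X in _ + (_ + X) = _]eq_bigr => j _ do
  (rewrite cm_sumr; under eq_bigr => k _ do rewrite cs_mulA).
rewrite exchange_big /= exprS scalerDr scalerA -rmorphM -!addrA.
by congr (_ + (_ + (_ + _))).
Qed.

Lemma iter_affineV N v :
  iter N S v = rc (c ^+ N) *: v + mxactV (affine_pow N) v.
Proof.
elim: N => [|N ih] /=; apply/ffunP => i.
  rewrite !ffunE expr0 rmorph1 scale1r big1 ?addr0 // => j _.
  exact: (lin0 (fr_linl fr _)).
rewrite ih !ffunE.
have e j : (rc (c ^+ N) *: v + mxactV (affine_pow N) v) j =
  rc (c ^+ N) *: v j + \sum_k rho (affine_pow N j k) (v k) by rewrite !ffunE.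
under [X in _ + X = _]eq_bigr => j _ do rewrite e (linD (fr_linr fr _)) (linZ (fr_linr fr _)) (lin_sum (fr_linr fr _)).
under [in RHS]eq_bigr => j _ do rewrite !(linD (fr_linl fr _)) !(linZ (fr_linl fr _)) (lin_sum (fr_linl fr _)).
rewrite !big_split /= -!scaler_sumr.
under [X in _ + (_ + X) = _]eq_bigr => j _ do
  under eq_bigr => k _ do rewrite -(fr_mul fr).
rewrite exchange_big /= exprS scalerDr scalerA -rmorphM -!addrA.
by congr (_ + (_ + (_ + _))).
Qed.

Hypotheses (As : forall i j, cs_star (A i j) = A j i).

Lemma affineV_sym u w : fform f (S u) w = fform f u (S w).
Proof.
have ffn := fform_psd n ff.
rewrite (psfDl ffn) (psfDr ffn) (psfZl ffn) (psfZr ffn) conj_rc; congr (_ + _).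
rewrite /fform.
under eq_bigr => i _ do rewrite ffunE (psf_suml ff).
under [RHS]eq_bigr => i _ do rewrite ffunE (psf_sumr ff).
rewrite exchange_big /=; apply: eq_bigr => i _; apply: eq_bigr => j _.
by rewrite -(fr_adj fr) As.
Qed.

Hypotheses (cla : `|c| <= la).
Hypothesis hT : forall m : {ffun 'I_n -> M},
  nr (fip cip (T m) (T m)) <= la ^+ 2 * nr (fip cip m m).

Lemma nr_entry (m : {ffun 'I_n -> M}) i : nr (m i) ^+ 2 <= nr (fip cip m m).
Proof.
rewrite -nr_cstar /fip (bigD1 i) //=; apply: nr_ge0_mono; first by eexists.
by apply: cs_ge0_sum => j _; eexists.
Qed.

(** With P the matrix part of (c + A)^N, the power is tested on the vector whose only entry is
    P_ij^* at j, so that P_ij P_ij^* appears at i. Its norm is |P_ij|^2, and [la ^+ N] is paid once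
    for the power and once for the scalar part. *)
Lemma affine_pow_le N i j : nr (affine_pow N i j) <= 2 * la ^+ N.
Proof.
have la0 : 0 <= la := le_trans (normr_ge0 c) cla.
have hTN m : nr (fip cip (iter N T m) (iter N T m)) <= (la ^+ N) ^+ 2 * nr (fip cip m m).
  elim: N m => [|N ih] m; first by rewrite expr0 expr1n mul1r.
  rewrite iterS; apply: le_trans (hT _) _.
  have -> : (la ^+ N.+1) ^+ 2 = la ^+ 2 * (la ^+ N) ^+ 2 by rewrite [la ^+ N.+1]exprS exprMn.
  by rewrite -mulrA ler_wpM2l ?sqr_ge0.
set b := cs_star (affine_pow N i j).
set m : {ffun 'I_n -> M} := [ffun k => if k == j then b else 0].
have mm : fip cip m m = cs_star b ** b.
  rewrite /fip (bigD1 j) //= big1 ?addr0 ?ffunE ?eqxx // => k /negPf kj.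
  by rewrite ffunE kj /cip cm0r.
have e : iter N T m i = rc (c ^+ N) *: m i + affine_pow N i j ** b.
  rewrite iter_affineM !ffunE (bigD1 j) //= big1 ?addr0 ?ffunE ?eqxx // => k /negPf kj.
  by rewrite ffunE kj cm0r.
have h1 : nr (iter N T m i) <= la ^+ N * nr b.
  rewrite -(@ler_pXn2r _ 2) ?nnegrE ?mulr_ge0 ?exprn_ge0 ?nr_ge0 //.
  apply: le_trans (nr_entry _ _) _; apply: le_trans (hTN _) _.
  by rewrite mm nr_cstar exprMn.
have h2 : nr (rc (c ^+ N) *: m i) <= la ^+ N * nr b.
  rewrite nrZ nr_rc normrX; apply: ler_pM; rewrite ?exprn_ge0 ?nr_ge0 //.
    by rewrite lerXn2r ?nnegrE.
  by rewrite /m ffunE; case: ifP => // _; rewrite nr0 nr_ge0.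
have := nrB (iter N T m i) (rc (c ^+ N) *: m i).
rewrite {1}e addrAC subrr add0r.
rewrite /b nr_cstar' nr_star in h1 h2 *.
move=> h3; have [->|n0] := eqVneq (nr (affine_pow N i j)) 0.
  by rewrite mulr_ge0 ?exprn_ge0.
have n0' : 0 < nr (affine_pow N i j) by rewrite lt_def n0 nr_ge0.
by rewrite -(ler_pM2r n0') -expr2; lra.
Qed.

(** The entries of (c + A)^(2N) are bounded by a multiple of [la ^+ (2 * N)], so the coefficient <v,
    S^(2N) v> grows at most at that rate, with a constant depending on v. [power_trick] for the
    square of [S] removes the constant. *)
Lemma power_transfer_sqn v :
  sqn (fform f (n := n)) (S v) <= la ^+ 2 * sqn (fform f (n := n)) v.
Proof.
have la0 : 0 <= la := le_trans (normr_ge0 c) cla.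
have ffn := fform_psd n ff.
pose K i j : R := sval (cid (fr_bnd fr (v i) (v j))).
have hK i j m : nr (f (v i) (rho m (v j))) <= `|K i j| * nr m.
  rewrite /K; case: cid => k hk /=; apply: le_trans (hk m) _.
  by rewrite ler_wpM2r ?nr_ge0 ?ler_norm.
have iterSS N w : iter N (S \o S) w = iter (2 * N) S w.
  by elim: N => // N ih; rewrite iterS ih mulnS.
apply: le_trans (_ : nr (fform f v (S (S v))) <= _).
  by rewrite /sqn affineV_sym; exact: cre_le_nr.
apply: (power_trick ffn (S := S \o S)
  (K := sqn (fform f (n := n)) v + \sum_i \sum_j `|K i j| * 2)).
- by move=> u w /=; rewrite !affineV_sym.
- exact: sqr_ge0.
move=> N; rewrite iterSS -exprM iter_affineV (psfDr ffn) (psfZr ffn).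
apply: le_trans (nrD _ _) _; rewrite mulrDl; apply: lerD.
  rewrite nrM nr_rc normrX (sqnE ffn) nr_rc (ger0_norm (sqn_ge0 ffn v)) mulrC.
  by rewrite ler_wpM2l ?(sqn_ge0 ffn) // lerXn2r ?nnegrE.
apply: le_trans (nr_sum _ _ _) _; rewrite mulr_suml; apply: ler_sum => i _.
rewrite ffunE (psf_sumr ff); apply: le_trans (nr_sum _ _ _) _.
rewrite mulr_suml; apply: ler_sum => j _; apply: le_trans (hK _ _ _) _.
by rewrite -mulrA ler_wpM2l // affine_pow_le.
Qed.

Lemma power_transfer v :
  nr (fform f v (S v)) <= la * sqn (fform f (n := n)) v.
Proof.
have la0 : 0 <= la := le_trans (normr_ge0 c) cla.
have ffn := fform_psd n ff.
rewrite -(@ler_pXn2r _ 2) ?nnegrE ?mulr_ge0 ?nr_ge0 ?(sqn_ge0 ffn) //.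
apply: le_trans (psf_CS ffn _ _) _.
have := power_transfer_sqn v; have := sqn_ge0 ffn v => h1 h2.
by rewrite exprMn [X in _ <= _ * X]expr2 mulrCA ler_wpM2l.
Qed.

End Fixed.

Section RowContraction.
Variables (E : hilbert_module M) (n : nat) (x : 'I_n -> E).
Hypothesis x_le1 : \sum_i nr (x i) ^+ 2 <= 1.
Implicit Types m : {ffun 'I_n -> M}.
Let mfE := hm_mform E.
Let mfM := fip_mform n (cip_mform M).

Definition rowact (y : 'I_n -> E) m : E := \sum_j hm_ract (y j) (m j).
Definition gram i j : M := hm_inner (x i) (x j).

Lemma fip_gram m m' : fip cip m (mxactM gram m') = hm_inner (rowact x m) (rowact x m').
Proof.
rewrite [in RHS]/rowact (mf_suml mfE); apply: eq_bigr => i _.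
rewrite ffunE /cip (mf_ractl mfE) (mf_sumr mfE); congr (_ ** _).
by apply: eq_bigr => j _; rewrite hm_inner_ract.
Qed.

Lemma gram_sym m m' : fip cip (mxactM gram m) m' = fip cip m (mxactM gram m').
Proof. by rewrite -(mf_star mfM) !fip_gram hm_inner_star. Qed.

(** A^2 <= A for the Gram matrix A: the i-th entry of A m is <x_i, Z> with Z = sum x_j m_j, so
    Cauchy-Schwarz bounds <A m, A m> by (sum |x_i|^2) <Z, Z>, while <m, A m> = <Z, Z>. *)
Lemma mxact_gram_le m :
  cs_le (fip cip (mxactM gram m) (mxactM gram m)) (fip cip m (mxactM gram m)).
Proof.
rewrite [X in cs_le _ X]fip_gram; set Z := rowact x m.
apply: (@cs_le_trans _ _ (\sum_i rc (nr (x i) ^+ 2) *: hm_inner Z Z)).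
  apply: cs_le_sum => i _; rewrite ffunE.
  have -> : \sum_j gram i j ** m j = hm_inner (x i) Z.
    by rewrite (mf_sumr mfE); apply: eq_bigr => j _; rewrite hm_inner_ract.
  by apply: (mf_CS mfE); rewrite nr_hm.
rewrite -scaler_suml -rmorph_sum /cs_le; move: x_le1; set t := \sum_i _ => t1.
have -> : hm_inner Z Z - rc t *: hm_inner Z Z = rc (1 - t) *: hm_inner Z Z by lmod R.
by apply: cs_ge0Z; [rewrite subr_ge0|exact: hm_inner_ge0].
Qed.

(** 1 - (1 - A)^2 = (A - A^2) + A, and both summands are positive. *)
Lemma gram_defect_le m :
  cs_le (fip cip (m - mxactM gram m) (m - mxactM gram m)) (fip cip m m).
Proof.
have h1 := mxact_gram_le m.
have := cs_ge0D h1 (_ : cs_ge0 (fip cip m (mxactM gram m))).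
rewrite fip_gram => /(_ (hm_inner_ge0 _)); rewrite /cs_le; congr cs_ge0.
rewrite (mfDl mfM) !(mfDr mfM) (mfNl mfM) (mfNr mfM) (mfNl mfM) (mfNr mfM).
by rewrite (gram_sym m m) !fip_gram; lmod R.
Qed.

(** 1 - A = (1 - A)^2 + (A - A^2). *)
Lemma gram_le m : cs_le (fip cip m (mxactM gram m)) (fip cip m m).
Proof.
have h1 := mxact_gram_le m.
have := cs_ge0D (mf_ge0 mfM (m - mxactM gram m)) h1.
rewrite /cs_le; congr cs_ge0.
rewrite (mfDl mfM) !(mfDr mfM) (mfNl mfM) (mfNr mfM) (mfNl mfM) (mfNr mfM).
by rewrite (gram_sym m m); lmod R.
Qed.

Variables (V : lmodType C) (f : V -> V -> C) (rho : M -> V -> V).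
Hypotheses (ff : psd_form f) (fr : form_rep f rho).

Lemma gram_rep_defect v :
  sqn (fform f (n := n)) (v - mxactV rho gram v) <= sqn (fform f (n := n)) v.
Proof.
pose A i j := - gram i j.
have As i j : cs_star (A i j) = A j i by rewrite /A cs_starN hm_inner_star.
have AM m : rc 1 *: m + mxactM A m = m - mxactM gram m.
  rewrite rmorph1 scale1r; congr (_ + _); apply/ffunP => i; rewrite !ffunE -sumrN.
  by apply: eq_bigr => j _; rewrite /A cmNl.
have AV w : rc 1 *: w + mxactV rho A w = w - mxactV rho gram w.
  rewrite rmorph1 scale1r; congr (_ + _); apply/ffunP => i; rewrite !ffunE -sumrN.
  by apply: eq_bigr => j _; rewrite /A (linN (fr_linl fr _)).
have := @power_transfer_sqn V f rho ff fr n A 1 1 As _ _ v.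
rewrite normr1 AV expr1n mul1r; apply => // m.
rewrite AM mul1r; apply: cs_le_nr; first exact: mf_ge0 mfM _.
exact: gram_defect_le.
Qed.

End RowContraction.

Lemma row_scale (E : hilbert_module M) n (x : 'I_n -> E) :
  exists2 r : R, 0 < r & \sum_i nr (rc r *: x i) ^+ 2 <= 1.
Proof.
have h : 0 <= \sum_i nr (x i) ^+ 2 by apply: sumr_ge0 => i _; exact: sqr_ge0.
set s := \sum_i _ in h *; have s1 : 0 < s + 1 by lra.
exists (Num.sqrt (s + 1))^-1; first by rewrite invr_gt0 sqrtr_gt0.
under eq_bigr => i _ do rewrite nrZ nr_rc exprMn ger0_norm ?invr_ge0 ?sqrtr_ge0 // exprVn sqr_sqrtr ?(ltW s1) //.
by rewrite -mulr_sumr ler_pdivrMl // mulr1 -/s; lra.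
Qed.

(** Positivity of the represented Gram matrix is read off from a norm bound: after scaling, 1 - A is
    a contraction on V^n, so <v, (1 - A) v> <= <v, v>. *)
Lemma gram_rep_ge0 (V : lmodType C) (f : V -> V -> C) (rho : M -> V -> V)
    (E : hilbert_module M) n (x : 'I_n -> E) (v : 'I_n -> V) :
  psd_form f -> form_rep f rho ->
  0 <= cre (\sum_i \sum_j f (v i) (rho (hm_inner (x i) (x j)) (v j))).
Proof.
move=> ff fr; have [r r0 hr] := row_scale x.
have ffn := fform_psd n ff.
set w : {ffun 'I_n -> V} := [ffun i => v i].
pose y i := rc r *: x i.
have h : sqn (fform f (n := n)) (w - mxactV rho (gram y) w) <= sqn (fform f (n := n)) w.
  exact: gram_rep_defect.
have h2 := psf_CS ffn w (w - mxactV rho (gram y) w).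
have h3 : nr (fform f w (w - mxactV rho (gram y) w)) <= sqn (fform f (n := n)) w.
  rewrite -(@ler_pXn2r _ 2) ?nnegrE ?nr_ge0 ?(sqn_ge0 ffn) //.
  by apply: le_trans h2 _; rewrite expr2 ler_wpM2l ?(sqn_ge0 ffn).
have := le_trans (cre_le_nr _) h3.
rewrite (psfDr ffn) (psfNr ffn) raddfB /= {1}/sqn gerBl.
have -> : fform f w (mxactV rho (gram y) w) =
    rc (r ^+ 2) * \sum_i \sum_j f (v i) (rho (hm_inner (x i) (x j)) (v j)).
  rewrite mulr_sumr; apply: eq_bigr => i _; rewrite !ffunE (psf_sumr ff) mulr_sumr.
  apply: eq_bigr => j _; rewrite ffunE /gram /y.
  rewrite (mfZl (hm_mform E)) (mfZr (hm_mform E)) scalerA conj_rc -rmorphM.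
  by rewrite (linZ (fr_linl fr _)) (psfZr ff).
by rewrite cre_rcM pmulr_rge0 // exprn_gt0.
Qed.

(** The matrix A = X^* X has norm at most K^2 on M^n: with a = A m, <a, a> = <X a, X m>, and
    Cauchy-Schwarz allows one factor of |a| to be cancelled. This bound on M^n is then transferred.
    It yields complete contractivity of the dilation. *)
Lemma mx_rep_le (V : lmodType C) (f : V -> V -> C) (rho : M -> V -> V)
    (E : hilbert_module M) p n (X : 'I_p -> 'I_n -> E) (v : 'I_n -> V) (K : R) :
  psd_form f -> form_rep f rho -> 0 <= K ->
  (forall m : 'I_n -> M, let Xm i := \sum_j hm_ract (X i j) (m j) in
     nr (\sum_i hm_inner (Xm i) (Xm i)) <= K ^+ 2 * nr (\sum_j cs_star (m j) ** m j)) ->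
  cre (\sum_j \sum_k f (v j) (rho (\sum_i hm_inner (X i j) (X i k)) (v k)))
    <= K ^+ 2 * \sum_j sqn f (v j).
Proof.
move=> ff fr K0 hX.
pose A j k : M := \sum_i hm_inner (X i j) (X i k).
have As i j : cs_star (A i j) = A j i.
  by rewrite /A cs_star_sum; apply: eq_bigr => k _; exact: hm_inner_star.
have mfE := hm_mform E.
have mfEp := fip_mform p mfE.
pose Xm (m : {ffun 'I_n -> M}) : {ffun 'I_p -> E} := [ffun i => \sum_j hm_ract (X i j) (m j)].
have hXm m : nr (fip (@hm_inner R M E) (Xm m) (Xm m)) <= K ^+ 2 * nr (fip cip m m).
  have := hX m; rewrite /fip /=.
  by under [in X in _ -> X]eq_bigr => i _ do rewrite !ffunE.
have XA m m' : fip (@hm_inner R M E) (Xm m) (Xm m') = fip cip m (mxactM A m').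
  rewrite /fip; under eq_bigr => i _ do rewrite !ffunE (mf_suml mfE).
  rewrite exchange_big /=; apply: eq_bigr => j _.
  rewrite ffunE /cip cm_sumr.
  under eq_bigr => i _ do rewrite (mf_ractl mfE) (mf_sumr mfE) cm_sumr.
  rewrite exchange_big /=; apply: eq_bigr => k _.
  rewrite /A cm_suml cm_sumr; apply: eq_bigr => i _.
  by rewrite hm_inner_ract.
have := @power_transfer V f rho ff fr n A 0 (K ^+ 2) As _ _ [ffun i => v i].
rewrite normr0 => /(_ (sqr_ge0 _)) H.
have {H} : nr (fform f [ffun i => v i] (rc 0 *: [ffun i => v i] + mxactV rho A [ffun i => v i]))
  <= K ^+ 2 * sqn (fform f (n := n)) [ffun i => v i].
  apply: H => m; rewrite rmorph0 scale0r add0r.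
  set a := mxactM A m.
  have := mf_CS_nr mfEp (Xm a) (Xm m); rewrite XA -/a => h.
  have h1 := hXm a; have h2 := hXm m.
  set y := nr (fip cip a a) in h h1 *.
  have y0 : 0 <= y by exact: nr_ge0.
  have h3 : y ^+ 2 <= (K ^+ 2 * y) * (K ^+ 2 * nr (fip cip m m)).
    by apply: le_trans h _; apply: ler_pM => //; exact: nr_ge0.
  have [->|yn0] := eqVneq y 0; first by rewrite mulr_ge0 ?sqr_ge0 ?nr_ge0.
  have yp : 0 < y by rewrite lt_def yn0.
  rewrite -(ler_pM2r yp) -expr2; apply: le_trans h3 _.
  by rewrite le_eqVlt; apply/orP; left; apply/eqP; ring.
rewrite rmorph0 scale0r add0r => h.
have -> : \sum_j sqn f (v j) = sqn (fform f (n := n)) [ffun i => v i].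
  by rewrite /sqn /fform raddf_sum; apply: eq_bigr => i _; rewrite ffunE.
apply: le_trans h; apply: le_trans (cre_le_nr _).
rewrite le_eqVlt; apply/orP; left; apply/eqP; congr cre.
rewrite /fform; apply: eq_bigr => i _; rewrite !ffunE (psf_sumr ff).
by apply: eq_bigr => j _; rewrite ffunE.
Qed.

End PowerTransfer.

(** * The row contraction given by complete contractivity *)

Section Newton.
Variables (R : realType) (e : R).
Local Notation C := (C R).
Section Iteration.
Variables (V : lmodType C) (f : V -> V).

(** For 0 <= f <= 1 this is s = (f + e)/(1 + e), which lies between e/(1 + e) and 1. The maps [nq n]
    are the Newton approximations of s^(-1/2), written as polynomials in f, and [nd n] is the error
    1 - s q_n^2. *)
Definition nsc v : V := rc (1 + e)^-1 *: (f v + rc e *: v).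
Fixpoint nq n v : V :=
  if n is k.+1 then nq k (v + rc 2^-1 *: (v - nsc (nq k (nq k v)))) else v.
Definition nd n v : V := v - nsc (nq n (nq n v)).

Hypothesis fl : is_linear f.

Lemma nsc_linear : is_linear nsc.
Proof. by move=> a x y; rewrite /nsc (linD fl) (linZ fl); lmod R. Qed.

Lemma nq_linear n : is_linear (nq n).
Proof.
elim: n => //= k ih a x y.
by rewrite !(linD ih, linZ ih, linN ih, linD nsc_linear, linZ nsc_linear); lmod R.
Qed.

Lemma nd_linear n : is_linear (nd n).
Proof.
have ih := nq_linear n; move=> a x y.
by rewrite /nd !(linD ih, linZ ih, linD nsc_linear, linZ nsc_linear); lmod R.
Qed.

Lemma nq_comm (T : V -> V) n : is_linear T -> (forall v, T (f v) = f (T v)) ->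
  forall v, T (nq n v) = nq n (T v).
Proof.
move=> Tl Tf; have Ts v : T (nsc v) = nsc (T v).
  by rewrite /nsc (linZ Tl) (linD Tl) (linZ Tl) Tf.
elim: n => //= k ih v.
by rewrite ih (linD Tl) (linZ Tl) (linB Tl) Ts !ih.
Qed.

Lemma nsc_nq n v : nsc (nq n v) = nq n (nsc v).
Proof.
apply: nq_comm => [|w]; first exact: nsc_linear.
by rewrite /nsc (linZ fl) (linD fl) (linZ fl).
Qed.

Lemma nd_nq n v : nd n (nq n v) = nq n (nd n v).
Proof. by rewrite /nd (linB (nq_linear n)) nsc_nq. Qed.

(* With [s q^2 = 1 - d], the Newton step [q' = q (1 + d/2)] for [s^(-1/2)]
   gives [s q'^2 = 1 - (3 d^2 + d^3)/4]. *)
Lemma ndS n v :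
  nd n.+1 v = rc (3 / 4) *: nd n (nd n v) + rc 4^-1 *: nd n (nd n (nd n v)).
Proof.
have ql := nq_linear n; have dl := nd_linear n.
have e1 w : nq n.+1 w = nq n (w + rc 2^-1 *: nd n w) by [].
set w1 := v + rc 2^-1 *: nd n v.
set w := w1 + rc 2^-1 *: nd n w1.
have e2 : nsc (nq n (nq n w)) = w - nd n w by rewrite /nd subKr.
have -> : nd n.+1 v = v - nsc (nq n (nq n w)).
  rewrite /nd !e1 -/w1; congr (v - nsc _).
  by congr (nq n _); rewrite /w (linD ql) (linZ ql) nd_nq.
have f1 : nd n w1 = nd n v + rc 2^-1 *: nd n (nd n v).
  by rewrite /w1 (linD dl v) (linZ dl).
have f2 : nd n w = nd n w1 + rc 2^-1 *: nd n (nd n w1).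
  by rewrite /w (linD dl w1) (linZ dl).
have f3 : nd n (nd n w1) = nd n (nd n v) + rc 2^-1 *: nd n (nd n (nd n v)).
  by rewrite f1 (linD dl (nd n v)) (linZ dl).
by rewrite e2 f2 f3 /w f1 /w1; lmod R.
Qed.

End Iteration.

(** Polynomials with real coefficients in adjoint maps are adjoint. Only real scalars have to pass
    through [B], so the same lemma serves the sesquilinear forms and the bilinear pairings of rows
    with columns. *)
Lemma nq_adj (V W Z : lmodType C) (f : V -> V) (g : W -> W) (B : V -> W -> Z) n :
  is_linear f -> is_linear g ->
  (forall w, {morph B^~ w : x y / x + y}) -> (forall v, {morph B v : x y / x + y}) ->
  (forall a v w, B (rc a *: v) w = rc a *: B v w) ->
  (forall a v w, B v (rc a *: w) = rc a *: B v w) ->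
  (forall v w, B (f v) w = B v (g w)) ->
  forall v w, B (nq f n v) w = B v (nq g n w).
Proof.
move=> fl gl Dl Dr Zl Zr h.
have Nl v w : B (- v) w = - B v w.
  have e1 : - v = rc (-1) *: v by rewrite rmorphN1 scaleN1r.
  by rewrite e1 Zl rmorphN1 scaleN1r.
have Nr v w : B v (- w) = - B v w.
  have e1 : - w = rc (-1) *: w by rewrite rmorphN1 scaleN1r.
  by rewrite e1 Zr rmorphN1 scaleN1r.
have hs v w : B (nsc f v) w = B v (nsc g w).
  by rewrite /nsc Zl Zr Dl Dr Zl Zr h.
elim: n => //= k ih v w.
rewrite ih Dl Zl Dl Nl hs !ih.
have gql := nq_linear gl k.
have -> : nq g k (w + rc 2^-1 *: (w - nsc g (nq g k (nq g k w)))) =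
    nq g k w + rc 2^-1 *: (nq g k w - nq g k (nsc g (nq g k (nq g k w)))).
  by rewrite (linD gql) (linZ gql) (linB gql).
by rewrite Dr Zr Dr Nr !(nsc_nq gl).
Qed.

End Newton.

Section GramContraction.
Variables (R : realType) (M : cstar_algebra R) (E : hilbert_module M) (G : hilbert R).
Local Notation C := (C R).

Lemma bop_linear (a : bounded_op G) : is_linear a.
Proof. by move=> k x y; rewrite linearP. Qed.

Lemma mxactM_linear n (A : 'I_n -> 'I_n -> M) : is_linear (mxactM A).
Proof.
move=> a x y; apply/ffunP => i; rewrite !ffunE scaler_sumr -big_split.
by apply: eq_bigr => j _; rewrite !ffunE cmDr cmZr.
Qed.

Lemma geo_lim (t a b c : R) : 0 <= t < 1 ->
  (forall n, a <= b + c * t ^+ n) -> a <= b.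
Proof.
move=> /andP[t0 t1] h.
have h1 : b + c * t ^+ n @[n --> \oo] --> b + c * 0.
  apply: cvgD; first exact: cvg_cst.
  by apply: cvgM; [exact: cvg_cst|apply: cvg_expr; rewrite ger0_norm].
rewrite mulr0 addr0 in h1.
by apply: (closed_cvg [set x | a <= x]) h1 => //; exact: nearW.
Qed.

Lemma newton_arith (p q : R) : p <= q -> p * p <= p -> 3 / 4 * p + 4^-1 * (p * p) <= q.
Proof. lra. Qed.

Lemma sqn_add_le (V : lmodType C) (f : V -> V -> C) (ff : psd_form f) u v (a b : R) :
  0 <= a -> 0 <= b -> sqn f u <= a ^+ 2 -> sqn f v <= b ^+ 2 ->
  sqn f (u + v) <= (a + b) ^+ 2.
Proof.
move=> a0 b0 ua vb.
have h : nr (f u v) <= a * b.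
  rewrite -(@ler_pXn2r _ 2) ?nnegrE ?mulr_ge0 ?nr_ge0 //.
  apply: le_trans (psf_CS ff _ _) _; rewrite exprMn.
  by apply: ler_pM => //; exact: sqn_ge0.
have := cre_le_nr (f u v).
rewrite {1}/sqn (psfDl ff) !(psfDr ff) !raddfD /= -/(sqn f u) -/(sqn f v).
rewrite -[f v u](psf_conj ff) cre_conj; nra.
Qed.

Variables (s0 : M -> bounded_op G) (s : E -> bounded_op G).
Hypothesis s0_rep : form_rep (@dot R G) (fun m g => s0 m g).
Hypothesis s_lin : forall g, is_linear (fun x => s x g).
Hypothesis s_ract : forall x m g, s (hm_ract x m) g = s x (s0 m g).
Hypothesis s_cc : completely_contractive s.

Let dd := dot_psd G.

(** [completely_contractive] speaks of square matrices, so the row is padded with zero rows. *)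
Lemma cc_row n (y : 'I_n -> E) (K : R) : 0 <= K ->
  (forall m : {ffun 'I_n -> M}, nr (hm_inner (rowact y m) (rowact y m))
     <= K ^+ 2 * nr (fip cip m m)) ->
  forall g : 'I_n -> G, nr (\sum_j s (y j) (g j)) ^+ 2 <= K ^+ 2 * \sum_j nr (g j) ^+ 2.
Proof.
case: n y => [|n] y K0 hy g.
  by rewrite !big_ord0 nr0 mulr0 expr0n.
pose X : 'M[E]_n.+1 := \matrix_(i, j) (if i == ord0 then y j else 0).
have hX : hm_mxnorm_le X (rc K).
  move=> m /=.
  have e2 (i : 'I_n.+1) : i != ord0 -> \sum_j hm_ract (X i j) (m j) = 0.
    move=> /negPf i0; rewrite big1 // => j _; rewrite mxE i0.
    exact: (lin0 (hm_ract_linl _)).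
  rewrite (bigD1 ord0) //= [X in _ + X]big1 ?addr0 => [|i i0]; last first.
    by rewrite e2 // (mf0r (hm_mform E)).
  rewrite !normE -rmorphXn -rmorphM ler_rc.
  have := hy [ffun i => m i]; rewrite /rowact /fip.
  have -> : \sum_j hm_ract (y j) ([ffun i => m i] j) = \sum_j hm_ract (X ord0 j) (m j).
    by apply: eq_bigr => j _; rewrite ffunE mxE eqxx.
  by under [X in _ <= _ * nr X -> _]eq_bigr => j _ do rewrite ffunE.
have K0' : 0 <= rc K by rewrite -(rmorph0 (@rc R)) ler_rc.
have := s_cc K0' hX g; rewrite (bigD1 ord0) //=.
have e1 : \sum_(i < n.+1 | i != ord0) `|\sum_(j < n.+1) map_mx s X i j (g j)| ^+ 2 = 0.
  rewrite big1 // => i /negPf i0; rewrite big1 ?normr0 ?expr0n // => j _.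
  by rewrite !mxE i0 (lin0 (s_lin _)).
rewrite e1 addr0.
have -> : \sum_j map_mx s X ord0 j (g j) = \sum_j s (y j) (g j).
  by apply: eq_bigr => j _; rewrite !mxE eqxx.
have -> : \sum_j `|g j| ^+ 2 = rc (\sum_j nr (g j) ^+ 2).
  by rewrite rmorph_sum; apply: eq_bigr => j _; rewrite normE -rmorphXn.
by rewrite normE -!rmorphXn -rmorphM ler_rc.
Qed.

Lemma cc_contractive x g : nr (s x g) <= nr x * nr g.
Proof.
have := @cc_row 1 (fun=> x) (nr x) (nr_ge0 _) _ (fun=> g).
rewrite !big_ord1 -exprMn => H; rewrite -(@ler_pXn2r _ 2) ?nnegrE ?mulr_ge0 ?nr_ge0 //.
apply: H => m; rewrite /rowact big_ord1 /fip big_ord1.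
by rewrite nr_hm nr_cstar -exprMn ler_pXn2r ?nnegrE ?mulr_ge0 ?nr_ge0 // nr_ract.
Qed.

Lemma mxactV_linear n (A : 'I_n -> 'I_n -> M) :
  is_linear (mxactV (fun m (g : G) => s0 m g) A : {ffun 'I_n -> G} -> _).
Proof.
move=> a x y; apply/ffunP => i; rewrite !ffunE scaler_sumr -big_split.
by apply: eq_bigr => j _; rewrite !ffunE linearP.
Qed.

Section Scaled.
Variables (n : nat) (y : 'I_n -> E) (e : R).
Hypotheses (y_le1 : \sum_i nr (y i) ^+ 2 <= 1) (e0 : 0 < e).

Let aM := mxactM (gram y).
Let aG : {ffun 'I_n -> G} -> {ffun 'I_n -> G} := mxactV (fun m (g : G) => s0 m g) (gram y).
(** The Gram matrix acting on rows from the right. Through the pairings [RE] and [RG] it is adjoint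
    to [aM] on columns over M and to [aG] on columns over G, which lets polynomials in it be moved
    between the three spaces. *)
Let aE (z : {ffun 'I_n -> E}) : {ffun 'I_n -> E} :=
  [ffun j => \sum_i hm_ract (z i) (gram y i j)].
Let dG : {ffun 'I_n -> G} -> {ffun 'I_n -> G} -> C := fform (@dot R G) (n := n).
Let dGp : psd_form dG := fform_psd n dd.
Let mfM := fip_mform n (cip_mform M).
Let mfE := hm_mform E.

Let aMl : is_linear aM := mxactM_linear _.
Let aGl : is_linear aG := mxactV_linear _.
Let aEl : is_linear aE.
Proof.
move=> a x z; apply/ffunP => i; rewrite !ffunE scaler_sumr -big_split.
by apply: eq_bigr => j _; rewrite !ffunE (linD (hm_ract_linl _)) (linZ (hm_ract_linl _)).
Qed.

Let RE (z : {ffun 'I_n -> E}) (m : {ffun 'I_n -> M}) : E := rowact z m.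
Let RG (z : {ffun 'I_n -> E}) (g : {ffun 'I_n -> G}) : G := \sum_j s (z j) (g j).

Let RE_adj z m : RE (aE z) m = RE z (aM m).
Proof.
rewrite /RE /rowact.
under eq_bigr => j _ do rewrite ffunE (lin_sum (hm_ract_linl _)).
rewrite exchange_big /=; apply: eq_bigr => i _.
rewrite ffunE (lin_sum (hm_ract_linr _)); apply: eq_bigr => j _.
by rewrite hm_ractM.
Qed.

Let RG_adj z g : RG (aE z) g = RG z (aG g).
Proof.
rewrite /RG.
under eq_bigr => j _ do rewrite ffunE (lin_sum (s_lin _)).
rewrite exchange_big /=; apply: eq_bigr => i _.
rewrite ffunE linear_sum; apply: eq_bigr => j _.
by rewrite s_ract.
Qed.

Let nqE k z m : RE (nq e aE k z) m = RE z (nq e aM k m).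
Proof.
apply: (nq_adj (B := RE) e k aEl aMl) => [w u v|v u w|a v w|a v w|v w]; last exact: RE_adj.
- by rewrite /RE /rowact -big_split; apply: eq_bigr => i _; rewrite ffunE (linD (hm_ract_linl _)).
- by rewrite /RE /rowact -big_split; apply: eq_bigr => i _; rewrite ffunE (linD (hm_ract_linr _)).
- by rewrite /RE /rowact scaler_sumr; apply: eq_bigr => i _; rewrite ffunE (linZ (hm_ract_linl _)).
- by rewrite /RE /rowact scaler_sumr; apply: eq_bigr => i _; rewrite ffunE (linZ (hm_ract_linr _)).
Qed.

Let nqG k z g : RG (nq e aE k z) g = RG z (nq e aG k g).
Proof.
apply: (nq_adj (B := RG) e k aEl aGl) => [w u v|v u w|a v w|a v w|v w]; last exact: RG_adj.
- by rewrite /RG -big_split; apply: eq_bigr => i _; rewrite ffunE (linD (s_lin _)).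
- by rewrite /RG -big_split; apply: eq_bigr => i _; rewrite ffunE linearD.
- by rewrite /RG scaler_sumr; apply: eq_bigr => i _; rewrite ffunE (linZ (s_lin _)).
- by rewrite /RG scaler_sumr; apply: eq_bigr => i _; rewrite ffunE linearZ.
Qed.

Let nq_symM k m m' : fip cip (nq e aM k m) m' = fip cip m (nq e aM k m').
Proof.
apply: (nq_adj (B := fip cip (n := n)) e k aMl aMl) => [w u v|v u w|a v w|a v w|v w].
- exact: (mfDl mfM).
- exact: (mfDr mfM).
- by rewrite (mfZl mfM) conj_rc.
- exact: (mfZr mfM).
- exact: gram_sym.
Qed.

Let nq_symG k g g' : dG (nq e aG k g) g' = dG g (nq e aG k g').
Proof.
apply: (nq_adj (Z := C^o) (B := dG) e k aGl aGl) => [w u v|v u w|a v w|a v w|v w].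
- exact: (psfDl dGp).
- exact: (psfDr dGp).
- by rewrite (psfZl dGp) conj_rc.
- exact: (psfZr dGp).
- rewrite /dG /fform.
  under eq_bigr => i _ do rewrite ffunE (psf_suml dd).
  under [RHS]eq_bigr => i _ do rewrite ffunE (psf_sumr dd).
  rewrite exchange_big /=; apply: eq_bigr => i _; apply: eq_bigr => j _.
  by rewrite -(fr_adj s0_rep) /gram hm_inner_star.
Qed.

Let ns_symM m m' : fip cip (nsc e aM m) m' = fip cip m (nsc e aM m').
Proof.
rewrite /nsc (mfZl mfM) (mfZr mfM) (mfDl mfM) (mfDr mfM) (mfZl mfM) (mfZr mfM) !conj_rc.
by rewrite gram_sym.
Qed.

Let nd_symM k m m' : fip cip (nd e aM k m) m' = fip cip m (nd e aM k m').
Proof.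
rewrite /nd (mfDl mfM) (mfDr mfM) (mfNl mfM) (mfNr mfM) ns_symM !nq_symM.
by rewrite -!(nsc_nq e aMl).
Qed.

(** The Newton step preserves positivity of the error d, since (3 d^2 + d^3)/4 has the form 3/4 <d
    m, d m> + 1/4 <d m, d (d m)>. At the start d = (1 - A)/(1 + e). *)
Let nd_geM k m : cs_ge0 (fip cip m (nd e aM k m)).
Proof.
elim: k m => [|k ih] m.
  have h1 := cs_ge0Z (_ : 0 <= (1 + e)^-1) (gram_le y_le1 m).
  have -> : fip cip m (nd e aM 0 m) = rc (1 + e)^-1 *: (fip cip m m - fip cip m (aM m)).
    rewrite /nd /= /nsc (mfDr mfM) (mfNr mfM) (mfZr mfM) (mfDr mfM) (mfZr mfM).
    have n0 : rc (1 + e) != 0 by rewrite fmorph_eq0 lt0r_neq0 // addr_gt0.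
    rewrite rmorphD rmorph1 in n0.
    by lmod_coefs (Defs.C R); rc_push; field.
  by apply: h1; rewrite invr_ge0 addr_ge0 // ltW.
have -> : fip cip m (nd e aM k.+1 m) =
    rc (3 / 4) *: fip cip (nd e aM k m) (nd e aM k m) +
    rc 4^-1 *: fip cip (nd e aM k m) (nd e aM k (nd e aM k m)).
  have e1 := ndS e aMl k m.
  have sym := @nd_symM k; rewrite e1; move: (nd e aM k) sym => D sym.
  by rewrite (mfDr mfM) (mfZr mfM) (mfZr mfM) !sym.
apply: cs_ge0D.
  by apply: cs_ge0Z; [rewrite divr_ge0|exact: mf_ge0 mfM _].
by apply: cs_ge0Z; [rewrite invr_ge0|exact: ih].
Qed.

(** Positivity of 1 - s q^2 gives q A q <= 1 + e, so the row y q has norm at most (1 + e)^(1/2) and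
    complete contractivity can be applied to it. *)
Let nqE_le k m : nr (hm_inner (RE (nq e aE k [ffun i => y i]) m) (RE (nq e aE k [ffun i => y i]) m))
  <= (1 + e) * nr (fip cip m m).
Proof.
set q := nq e aM k m.
have e1 : RE (nq e aE k [ffun i => y i]) m = rowact y q.
  by rewrite nqE /RE /rowact; apply: eq_bigr => i _; rewrite ffunE.
rewrite e1 -fip_gram.
have h0 : 0 <= 1 + e by rewrite addr_ge0 // ltW.
have n0 : rc (1 + e) != 0 by rewrite fmorph_eq0 lt0r_neq0 // addr_gt0.
rewrite -[X in X * nr _](ger0_norm h0) -nr_rc -nrZ; apply: cs_le_nr.
  by rewrite fip_gram; exact: hm_inner_ge0.
have := cs_ge0D (cs_ge0Z h0 (nd_geM k m)) (cs_ge0Z (ltW e0) (mf_ge0 mfM q)).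
rewrite /cs_le; congr cs_ge0.
have e3 : fip cip m (nsc e aM (nq e aM k q)) = fip cip q (nsc e aM q).
  by rewrite (nsc_nq e aMl) -nq_symM.
rewrite /nd (mfDr mfM) (mfNr mfM) e3 /nsc (mfZr mfM) (mfDr mfM) (mfZr mfM) -/aM.
by rewrite rmorphD rmorph1 in n0; lmod_coefs (Defs.C R); rc_push; field.
Qed.

Let RG_nq_le k g : nr (RG [ffun i => y i] (nq e aG k g)) ^+ 2 <= (1 + e) * sqn dG g.
Proof.
have h0 : 0 <= 1 + e by rewrite addr_ge0 // ltW.
rewrite -nqG; have := @cc_row n (nq e aE k [ffun i => y i]) (Num.sqrt (1 + e)) (sqrtr_ge0 _) _ g.
rewrite sqr_sqrtr // => H.
have -> : sqn dG g = \sum_j nr (g j) ^+ 2.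
  by rewrite /sqn /dG /fform raddf_sum; apply: eq_bigr => i _; rewrite -dot_sqn.
apply: H => m; exact: nqE_le.
Qed.

(** At the start |d| <= t = 1/(1 + e), because 1 - A is a contraction on G^n. If |d| <= b with b <=
    t, the next error is at most (3 b^2 + b^3)/4 <= b t. *)
Let nd_leG k g : sqn dG (nd e aG k g) <= (((1 + e)^-1) ^+ k.+1) ^+ 2 * sqn dG g.
Proof.
have h0 : 0 <= 1 + e by rewrite addr_ge0 // ltW.
have t0 : 0 <= (1 + e)^-1 by rewrite invr_ge0.
have t1 : (1 + e)^-1 <= 1 by rewrite invf_le1 ?lerDl ?ltW // addr_gt0.
elim: k g => [|k ih] g.
  have -> : nd e aG 0 g = rc (1 + e)^-1 *: (g - aG g).
    rewrite /nd /= /nsc.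
    have n0 : rc (1 + e) != 0 by rewrite fmorph_eq0 lt0r_neq0 // addr_gt0.
    rewrite rmorphD rmorph1 in n0.
    by lmod_coefs (Defs.C R); rc_push; field.
  rewrite (sqnZ dGp) nr_rc ger0_norm // expr1 ler_wpM2l ?sqr_ge0 //.
  exact: (gram_rep_defect y_le1 dd s0_rep).
set t := (1 + e)^-1 in ih t0 t1 *; set b := t ^+ k.+1 in ih *.
have b0 : 0 <= b by exact: exprn_ge0.
have b1 : b <= t by rewrite /b exprS ler_piMr // exprn_ile1.
have sq0 := sqn_ge0 dGp g; set N := Num.sqrt (sqn dG g).
have NE : N ^+ 2 = sqn dG g by rewrite sqr_sqrtr.
have N0 : 0 <= N by exact: sqrtr_ge0.
have h2 : sqn dG (nd e aG k (nd e aG k g)) <= (b ^+ 2 * N) ^+ 2.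
  apply: le_trans (ih _) _.
  have -> : (b ^+ 2 * N) ^+ 2 = b ^+ 2 * (b ^+ 2 * sqn dG g) by rewrite -NE; ring.
  by rewrite ler_wpM2l ?sqr_ge0.
have h3 : sqn dG (nd e aG k (nd e aG k (nd e aG k g))) <= (b ^+ 3 * N) ^+ 2.
  apply: le_trans (ih _) _.
  have -> : (b ^+ 3 * N) ^+ 2 = b ^+ 2 * (b ^+ 2 * N) ^+ 2 by ring.
  by rewrite ler_wpM2l ?sqr_ge0.
rewrite (ndS e aGl).
apply: le_trans (sqn_add_le dGp (a := 3 / 4 * (b ^+ 2 * N)) (b := 4^-1 * (b ^+ 3 * N)) _ _ _ _) _.
- by rewrite !mulr_ge0 ?sqr_ge0 // divr_ge0.
- by rewrite !mulr_ge0 ?exprn_ge0 // invr_ge0.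
- by rewrite (sqnZ dGp) nr_rc [`|_|]ger0_norm ?divr_ge0 // [X in _ <= X]exprMn ler_wpM2l ?sqr_ge0.
- by rewrite (sqnZ dGp) nr_rc [`|_|]ger0_norm ?invr_ge0 // [X in _ <= X]exprMn ler_wpM2l ?sqr_ge0.
rewrite -NE -exprMn ler_pXn2r ?nnegrE ?addr_ge0 ?mulr_ge0 ?exprn_ge0 ?divr_ge0 ?invr_ge0 //.
have -> : 3 / 4 * (b ^+ 2 * N) + 4^-1 * (b ^+ 3 * N) = (3 / 4 * b + 4^-1 * b ^+ 2) * (b * N) by field.
rewrite [t ^+ k.+2]exprS -/b -[X in _ <= X]mulrA ler_wpM2r ?mulr_ge0 //.
have bb : b * b <= b by rewrite ler_piMl // (le_trans b1).
by rewrite expr2; exact: newton_arith.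
Qed.

(** Decompose w = q^2 s w + d w. The row y q applied to q s w is bounded by (1 + e) <q s w, q s w> =
    (1 + e) <s w, w - d w>, and d w tends to 0 with k. What remains, (1 + e) <s w, w>, is <A w, w> +
    e <w, w>. *)
Lemma gram_contraction_eps g :
  nr (\sum_j s (y j) (g j)) ^+ 2 <=
  cre (\sum_i \sum_j dot (g i) (s0 (hm_inner (y i) (y j)) (g j))) + e * \sum_j nr (g j) ^+ 2.
Proof.
have h0 : 0 < 1 + e by rewrite addr_gt0.
set t := (1 + e)^-1.
have t0 : 0 < t by rewrite invr_gt0.
have t1 : t < 1 by rewrite invf_lt1 // ltrDl.
pose w : {ffun 'I_n -> G} := [ffun i => g i].
pose Y : {ffun 'I_n -> E} := [ffun i => y i].
have -> : \sum_j s (y j) (g j) = RG Y w.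
  by apply: eq_bigr => j _; rewrite !ffunE.
have -> : \sum_j nr (g j) ^+ 2 = sqn dG w.
  by rewrite /sqn /dG /fform raddf_sum; apply: eq_bigr => i _; rewrite ffunE -dot_sqn.
have -> : cre (\sum_i \sum_j dot (g i) (s0 (hm_inner (y i) (y j)) (g j))) + e * sqn dG w =
   (1 + e) * cre (dG (nsc e aG w) w).
  rewrite /nsc (psfZl dGp) conj_rc cre_rcM mulrA divff ?lt0r_neq0 // mul1r.
  rewrite (psfDl dGp) (psfZl dGp) conj_rc raddfD /= cre_rcM; congr (_ + _).
  rewrite -[in RHS](psf_conj dGp) cre_conj; congr cre; apply: eq_bigr => i _.
  by rewrite !ffunE (psf_sumr dd); apply: eq_bigr => j _; rewrite ffunE.
set r := nr (RG Y w).
have r0 : 0 <= r by exact: nr_ge0.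
pose K := \sum_j nr (y j).
have K0 : 0 <= K by apply: sumr_ge0 => j _; exact: nr_ge0.
have RGb v (b : R) : 0 <= b -> sqn dG v <= b ^+ 2 -> nr (RG Y v) <= K * b.
  move=> b0 hb; apply: le_trans (nr_sum _ _ _) _; rewrite mulr_suml.
  apply: ler_sum => j _; rewrite ffunE; apply: le_trans (cc_contractive _ _) _.
  rewrite ler_wpM2l ?nr_ge0 // -(@ler_pXn2r _ 2) ?nnegrE ?nr_ge0 //.
  apply: le_trans hb; rewrite /sqn /dG /fform raddf_sum /= (bigD1 j) //= -dot_sqn lerDl.
  by apply: sumr_ge0 => i _; exact: (sqn_ge0 dd).
have RGD u v : RG Y (u + v) = RG Y u + RG Y v.
  by rewrite /RG -big_split; apply: eq_bigr => i _; rewrite [X in s _ X]ffunE linearD.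
set N := Num.sqrt (sqn dG w).
have NE : N ^+ 2 = sqn dG w by rewrite sqr_sqrtr // (sqn_ge0 dGp).
have N0 : 0 <= N by exact: sqrtr_ge0.
set N' := Num.sqrt (sqn dG (nsc e aG w)).
have NE' : N' ^+ 2 = sqn dG (nsc e aG w) by rewrite sqr_sqrtr // (sqn_ge0 dGp).
have N0' : 0 <= N' by exact: sqrtr_ge0.
apply: (@geo_lim t _ _ ((1 + e) * (N' * N) + 2 * (r + K * N) * (K * N) + (K * N) ^+ 2)) => [|k].
  by rewrite (ltW t0).
set d := nd e aG k w; set b := t ^+ k.
have b0 : 0 <= b by rewrite exprn_ge0 // ltW.
have b1 : b <= 1 by rewrite exprn_ile1 // ltW.
have hd : sqn dG d <= (b * N) ^+ 2.
  apply: le_trans (nd_leG _ _) _; rewrite exprMn NE ler_wpM2r ?(sqn_ge0 dGp) //.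
  rewrite ler_pXn2r ?nnegrE ?exprn_ge0 ?(ltW t0) // exprS /b ler_piMl ?exprn_ge0 // ltW //.
have hRd : nr (RG Y d) <= K * (b * N) by apply: RGb => //; rewrite mulr_ge0.
have hRw : nr (RG Y (w - d)) <= r + K * (b * N).
  have := nrB (RG Y w) (RG Y d).
  have -> : RG Y w - RG Y d = RG Y (w - d).
    have := RGD (w - d) d; rewrite subrK => ->; by rewrite addrK.
  move=> h; apply: le_trans h _; rewrite lerD2l; exact: hRd.
have hq : nr (RG Y (w - d)) ^+ 2 <= (1 + e) * (cre (dG (nsc e aG w) w) + N' * (b * N)).
  have -> : w - d = nq e aG k (nq e aG k (nsc e aG w)).
    by rewrite /d /nd subKr !(nsc_nq e aGl).
  apply: le_trans (RG_nq_le _ _) _; rewrite ler_wpM2l ?(ltW h0) //.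
  rewrite /sqn nq_symG.
  have -> : nq e aG k (nq e aG k (nsc e aG w)) = w - d.
    by rewrite /d /nd subKr !(nsc_nq e aGl).
  rewrite (psfDr dGp) (psfNr dGp) raddfD lerD2l.
  apply: le_trans (cre_le_nr _) _; rewrite nrN.
  rewrite -(@ler_pXn2r _ 2) ?nnegrE ?mulr_ge0 ?nr_ge0 //.
  apply: le_trans (psf_CS dGp _ _) _; rewrite [X in _ <= X]exprMn -NE' ler_wpM2l ?sqr_ge0 //.
have hr : r <= nr (RG Y (w - d)) + nr (RG Y d).
  by rewrite /r; have := nrD (RG Y (w - d)) (RG Y d); rewrite -RGD subrK.
move: hq hr hRw hRd; set x := nr (RG Y (w - d)); set z := nr (RG Y d).
have x0 : 0 <= x by exact: nr_ge0.
have z0 : 0 <= z by exact: nr_ge0.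
set X := cre (dG (nsc e aG w) w).
move=> hq hr hx hz.
have hr2 : r ^+ 2 <= (x + z) ^+ 2 by rewrite ler_pXn2r ?nnegrE ?addr_ge0.
have KN0 : 0 <= K * N by rewrite mulr_ge0.
have hz' : z <= b * (K * N) by rewrite mulrCA.
have hx' : x <= r + K * N.
  apply: le_trans hx _; rewrite lerD2l mulrCA ler_piMl //.
have hxz : x * z <= (r + K * N) * (b * (K * N)) by apply: ler_pM.
have hzz : z ^+ 2 <= b * (K * N) ^+ 2.
  have : z * z <= (K * N) * (b * (K * N)).
    by apply: ler_pM => //; apply: le_trans hz' _; rewrite ler_piMl.
  by rewrite expr2 (expr2 (K * N)) => h; apply: le_trans h _; rewrite mulrCA.
have -> : (1 + e) * X + ((1 + e) * (N' * N) + 2 * (r + K * N) * (K * N) + (K * N) ^+ 2) * b =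
  (1 + e) * (X + N' * (b * N)) + 2 * ((r + K * N) * (b * (K * N))) + b * (K * N) ^+ 2 by ring.
apply: le_trans hr2 _.
have -> : (x + z) ^+ 2 = x ^+ 2 + 2 * (x * z) + z ^+ 2 by ring.
lra.
Qed.

End Scaled.

(* The contraction [E (.) G -> G] induced by a completely contractive
   covariant map. *)
Lemma gram_contraction n (y : 'I_n -> E) (g : 'I_n -> G) :
  nr (\sum_j s (y j) (g j)) ^+ 2 <=
  cre (\sum_i \sum_j dot (g i) (s0 (hm_inner (y i) (y j)) (g j))).
Proof.
have [r r0 hr] := row_scale y.
rewrite -(@ler_pM2l _ (r ^+ 2)) ?exprn_gt0 //.
have -> : r ^+ 2 * nr (\sum_j s (y j) (g j)) ^+ 2 = nr (\sum_j s (rc r *: y j) (g j)) ^+ 2.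
  under [in RHS]eq_bigr => j _ do rewrite (linZ (s_lin _)).
  by rewrite -scaler_sumr nrZ nr_rc exprMn gtr0_norm.
have -> : r ^+ 2 * cre (\sum_i \sum_j dot (g i) (s0 (hm_inner (y i) (y j)) (g j))) =
   cre (\sum_i \sum_j dot (g i) (s0 (hm_inner (rc r *: y i) (rc r *: y j)) (g j))).
  rewrite -cre_rcM mulr_sumr; congr cre; apply: eq_bigr => i _.
  rewrite mulr_sumr; apply: eq_bigr => j _.
  rewrite (mfZl (hm_mform E)) (mfZr (hm_mform E)) scalerA conj_rc -rmorphM -expr2.
  by rewrite (linZ (fr_linl s0_rep _)) (psfZr dd).
apply/ler_addgt0Pr => e e0.
have n0 : 0 <= \sum_j nr (g j) ^+ 2 by apply: sumr_ge0 => j _; exact: sqr_ge0.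
set N := \sum_j nr (g j) ^+ 2 in n0.
have N1 : 0 < N + 1 by lra.
have e0' : 0 < e / (N + 1) by rewrite divr_gt0.
apply: le_trans (gram_contraction_eps hr e0' g) _.
rewrite lerD2l -/N mulrAC ler_pdivrMr // ler_pM2l //; lra.
Qed.

End GramContraction.

(** * Kolmogorov decomposition of a positive kernel *)

Section ComplexComplete.
Variable R : realType.
Local Notation C := (C R).

Lemma cvg_ge (u : nat -> R) (l a : R) :
  u n @[n --> \oo] --> l -> (forall n, a <= u n) -> a <= l.
Proof. by move=> ul h; apply: (closed_cvg [set x | a <= x]) ul => //; exact: nearW. Qed.

Lemma invn_small (e : R) : 0 < e -> exists N, forall n, (N <= n)%N -> n.+1%:R^-1 < e.
Proof.
move=> e0; exists (Num.truncn e^-1) => n Nn.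
rewrite invf_plt ?posrE ?ltr0n //; apply: lt_le_trans (truncnS_gt _) _.
by rewrite ler_nat ltnS.
Qed.

Lemma lt_half_sum (e k a b : R) : k <= a + b -> a < e / 2 -> b < e / 2 -> k < e.
Proof. lra. Qed.

Lemma lt_third_sum (e k x a b c : R) :
  k <= x + c -> x <= a + b -> a < e / 3 -> b < e / 3 -> c < e / 3 -> k < e.
Proof. lra. Qed.

Lemma cvg_nr_eps (V : normedModType C) (v : nat -> V) (l : V) :
  v n @[n --> \oo] --> l <->
  (forall e : R, 0 < e -> exists N, forall n, (N <= n)%N -> nr (v n - l) < e).
Proof.
rewrite cvg_nrP; split=> [/cvgrPdist_lt h e e0|h].
  have [N _ hN] := h e e0; exists N => n Nn.
  by have := hN n Nn; rewrite /= sub0r normrN ger0_norm ?nr_ge0.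
apply/cvgrPdist_lt => e e0; have [N hN] := h e e0; exists N => // n Nn /=.
by rewrite sub0r normrN ger0_norm ?nr_ge0 // hN.
Qed.

Lemma normr_cre_le (a : C) : `|cre a| <= nr a.
Proof.
rewrite -(@ler_pXn2r _ 2) ?nnegrE ?nr_ge0 // real_normK ?num_real //.
by rewrite nr_sqrE lerDl sqr_ge0.
Qed.
Lemma normr_cim_le (a : C) : `|complex.Im a| <= nr a.
Proof.
rewrite -(@ler_pXn2r _ 2) ?nnegrE ?nr_ge0 // real_normK ?num_real //.
by rewrite nr_sqrE lerDr sqr_ge0.
Qed.
Lemma nr_le_re_im (a : C) : nr a <= `|cre a| + `|complex.Im a|.
Proof.
rewrite -(@ler_pXn2r _ 2) ?nnegrE ?nr_ge0 ?addr_ge0 // nr_sqrE sqrrD.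
rewrite !real_normK ?num_real // -addrA lerD2l lerDr.
by rewrite mulrn_wge0 // mulr_ge0.
Qed.

Lemma complex_complete (z : nat -> C) :
  (forall e : R, 0 < e -> exists N, forall m n,
     (N <= m)%N -> (N <= n)%N -> nr (z m - z n) < e) ->
  exists l : C, z n @[n --> \oo] --> l.
Proof.
move=> h.
have hc (p : C -> R) : (forall a b, p a - p b = p (a - b)) -> (forall a, `|p a| <= nr a) ->
    cvg (p (z n) @[n --> \oo]).
  move=> pB ple; apply: cauchy_cvg; apply: cauchy_exP => e e0.
  have [N hN] := h e e0; exists (p (z N)); exists N => // n Nn /=.
  rewrite -ball_normE /ball_ /= pB; apply: le_lt_trans (ple _) _; exact: hN.
have /cvg_ex[a /cvgrPdist_lt ha] := hc (@cre R) (fun a b => esym (raddfB (@cre R) a b)) normr_cre_le.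
have /cvg_ex[b /cvgrPdist_lt hb] := hc (@complex.Im R) (fun a b => esym (raddfB (@complex.Im R) a b)) normr_cim_le.
exists (Complex a b); apply/cvg_nr_eps => e e0.
have e2 : 0 < e / 2 by rewrite divr_gt0.
have [N1 _ h1] := ha _ e2; have [N2 _ h2] := hb _ e2.
exists (maxn N1 N2) => n; rewrite geq_max => /andP[n1 n2].
apply: le_lt_trans (nr_le_re_im _) _.
have := h1 n n1; have := h2 n n2; rewrite /= => h3 h4.
have -> : cre (z n - Complex a b) = - (a - cre (z n)).
  by rewrite raddfB /= opprB.
have -> : complex.Im (z n - Complex a b) = - (b - complex.Im (z n)).
  by rewrite (raddfB (@complex.Im R)) /= opprB.
rewrite !normrN; lra.
Qed.

Section SemiNorm.
Variables (V : lmodType C) (f : V -> V -> C).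
Hypothesis ff : psd_form f.
Definition fnorm v := Num.sqrt (sqn f v).
Lemma fnorm_ge0 v : 0 <= fnorm v. Proof. exact: sqrtr_ge0. Qed.
Lemma fnorm_sqr v : fnorm v ^+ 2 = sqn f v.
Proof. by rewrite sqr_sqrtr // (sqn_ge0 ff). Qed.
Lemma fnorm_CS u v : nr (f u v) <= fnorm u * fnorm v.
Proof.
rewrite -(@ler_pXn2r _ 2) ?nnegrE ?mulr_ge0 ?nr_ge0 ?fnorm_ge0 //.
by rewrite exprMn !fnorm_sqr psf_CS.
Qed.
Lemma fnormD u v : fnorm (u + v) <= fnorm u + fnorm v.
Proof.
rewrite -(@ler_pXn2r _ 2) ?nnegrE ?addr_ge0 ?fnorm_ge0 // fnorm_sqr.
by apply: sqn_add_le => //; rewrite ?fnorm_ge0 ?fnorm_sqr.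
Qed.
Lemma fnormZ a v : fnorm (a *: v) = nr a * fnorm v.
Proof. by rewrite /fnorm (sqnZ ff) sqrtrM ?sqr_ge0 // sqrtr_sqr ger0_norm ?nr_ge0. Qed.
Lemma fnormN v : fnorm (- v) = fnorm v.
Proof. by rewrite /fnorm (sqnN ff). Qed.
Lemma fnormB u v : fnorm (u - v) <= fnorm u + fnorm v.
Proof. by rewrite -(fnormN v); exact: fnormD. Qed.
Lemma fnormBC u v : fnorm (u - v) = fnorm (v - u).
Proof. by rewrite -fnormN opprB. Qed.
End SemiNorm.
End ComplexComplete.

(** * Completion of a semi-inner product space *)

Section Completion.
Variable R : realType.
Local Notation C := (C R).

Record psd_space := PsdSpace {
  psd_sort :> lmodType C ;
  psd_dot : psd_sort -> psd_sort -> C ;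
  psd_dotP : psd_form psd_dot }.

Variable S : psd_space.
Local Notation f := (@psd_dot S).
Local Notation fn := (fnorm f).
Let ff := psd_dotP S.

Definition cauchyf (u : nat -> S) := forall e : R, 0 < e ->
  exists N, forall m n, (N <= m)%N -> (N <= n)%N -> fn (u m - u n) < e.

(* The completion is realized as a space of antilinear functionals: [v |->
   lim_n f v (u n)] for Cauchy sequences [u]. *)
Definition repr_by (phi : S -> C) (u : nat -> S) :=
  cauchyf u /\ forall v, (f v (u n) : C) @[n --> \oo] --> phi v.

Definition in_completion : {pred (S -> C)} := fun phi => `[< exists u, repr_by phi u >].

Lemma repr_lin a phi psi u w : repr_by phi u -> repr_by psi w ->
  repr_by (a *: phi + psi) (fun n => a *: u n + w n).
Proof.
move=> [cu hu] [cw hw]; split=> [e e0|v].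
  have n1 : 0 < nr a + 1 by have := nr_ge0 a; lra.
  have e1 : 0 < e / 2 / (nr a + 1) by rewrite !divr_gt0.
  have e2 : 0 < e / 2 by rewrite divr_gt0.
  have [N1 h1] := cu _ e1; have [N2 h2] := cw _ e2.
  exists (maxn N1 N2) => m n; rewrite !geq_max => /andP[m1 m2] /andP[n1' n2].
  have -> : a *: u m + w m - (a *: u n + w n) = a *: (u m - u n) + (w m - w n) by lmod R.
  apply: le_lt_trans (fnormD ff _ _) _; rewrite (fnormZ ff).
  have h4 := h1 m n m1 n1'; have h3 := h2 m n m2 n2; rewrite ltr_pdivlMr // in h4.
  have := nr_ge0 a; have := fnorm_ge0 f (u m - u n); nra.
have -> : (fun n => f v (a *: u n + w n) : C) = (fun n => a *: (f v (u n) : C) + f v (w n)).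
  by apply/funext => n; rewrite (psfDr ff) (psfZr ff).
by apply: cvgD => //; apply: cvgZ => //; exact: cvg_cst.
Qed.

Lemma repr_cst v : repr_by (fun w => f w v) (fun=> v).
Proof.
split=> [e e0|w]; last exact: cvg_cst.
by exists 0%N => m n _ _; rewrite subrr /fnorm /sqn (psf0r ff) raddf0 sqrtr0.
Qed.

Fact in_completion_submod : submod_closed in_completion.
Proof.
split=> [|a phi psi /asboolP[u hu] /asboolP[w hw]]; apply/asboolP.
  have e : (0 : S -> C) = fun w => f w 0.
    by apply/funext => v; rewrite (psf0r ff).
  by exists (fun=> 0); rewrite e; exact: repr_cst.
by exists (fun n => a *: u n + w n); exact: repr_lin.
Qed.
HB.instance Definition _ := GRing.isSubmodClosed.Build C (S -> C) in_completion
  in_completion_submod.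

Record completion := Completed { cval :> S -> C ; cvalP : cval \in in_completion }.
HB.instance Definition _ := [isSub for cval].
HB.instance Definition _ := [Choice of completion by <:].
HB.instance Definition _ := [SubChoice_isSubLmodule of completion by <:].

Definition crep (phi : completion) : nat -> S := projT1 (cid (asboolW (cvalP phi))).
Lemma crepP (phi : completion) : repr_by phi (crep phi).
Proof. by rewrite /crep; case: cid. Qed.

Lemma cauchyf_bounded u : cauchyf u -> exists B : R, forall n, fn (u n) <= B.
Proof.
move=> cu; have [N hN] := cu 1 ltr01.
exists (\sum_(i < N.+1) fn (u i) + 1) => n.
have h0 k : 0 <= \sum_(i < k) fn (u i) by apply: sumr_ge0 => i _; exact: fnorm_ge0.
have hle k : (k < N.+1)%N -> fn (u k) <= \sum_(i < N.+1) fn (u i).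
  move=> kN; rewrite (bigD1 (Ordinal kN)) //= lerDl.
  by apply: sumr_ge0 => i _; exact: fnorm_ge0.
case: (ltnP n N.+1) => nN; first by have := hle n nN; lra.
have := hN n N (ltnW nN) (leqnn _) => h1.
have := fnormD ff (u n - u N) (u N); rewrite subrK => h2.
have := hle N (leqnn _); lra.
Qed.

(** The convergence of [f v (w n)] to [psi v] is uniform for v in bounded sets, and [u] is bounded.
    This permits passing to diagonal limits in [cdot]. *)
Lemma repr_diag (psi : S -> C) u w : cauchyf u -> repr_by psi w ->
  nr (f (u n) (w n) - psi (u n)) @[n --> \oo] --> (0 : R).
Proof.
move=> /cauchyf_bounded[B hB] [cw hw].
have B0 : 0 <= B by apply: le_trans (hB 0%N); exact: fnorm_ge0.
apply/cvgrPdist_lt => e e0.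
have e1 : 0 < e / 2 / (B + 1) by rewrite !divr_gt0 //; lra.
have [N hN] := cw _ e1; exists N => // n /= Nn.
rewrite sub0r normrN ger0_norm ?nr_ge0 //.
suff : nr (f (u n) (w n) - psi (u n)) <= e / 2 by lra.
have h1 : (f (u n) (w n) - f (u n) (w (m + N)%N) : C) @[m --> \oo] --> (f (u n) (w n) - psi (u n) : C).
  apply: cvgB; first exact: cvg_cst.
  by have := hw (u n); rewrite -(cvg_shiftn N).
apply: (cvg_nr_le h1) => m; rewrite -(psfNr ff) -(psfDr ff).
apply: le_trans (fnorm_CS ff _ _) _.
have := hN n (m + N)%N Nn (leq_addl _ _); have := hB n.
have := fnorm_ge0 f (u n); have := fnorm_ge0 f (w n - w (m + N)%N).
rewrite ltr_pdivlMr; last by lra.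
nra.
Qed.

Lemma repr_form_cauchy phi u w : repr_by phi u -> cauchyf w -> forall e : R, 0 < e ->
  exists N, forall m n, (N <= m)%N -> (N <= n)%N -> nr (phi (w m) - phi (w n)) < e.
Proof.
move=> [cu hu] cw e e0; have [B hB] := cauchyf_bounded cu.
have B0 : 0 <= B by apply: le_trans (hB 0%N); exact: fnorm_ge0.
have e1 : 0 < e / 2 / (B + 1) by rewrite !divr_gt0 //; lra.
have [N hN] := cw _ e1; exists N => m n Nm Nn.
have h1 : (f (w m) (u k) - f (w n) (u k) : C) @[k --> \oo] --> (phi (w m) - phi (w n) : C).
  by apply: cvgB; exact: hu.
suff : nr (phi (w m) - phi (w n)) <= e / 2 by lra.
apply: (cvg_nr_le h1) => k; rewrite -(psfNl ff) -(psfDl ff).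
apply: le_trans (fnorm_CS ff _ _) _.
have := hN m n Nm Nn; have := hB k.
have := fnorm_ge0 f (u k); have := fnorm_ge0 f (w m - w n).
rewrite ltr_pdivlMr; last by lra.
nra.
Qed.

Lemma cdot_ex (phi psi : completion) :
  exists l : C, (psi (crep phi n) : C) @[n --> \oo] --> l.
Proof.
by apply: complex_complete; apply: repr_form_cauchy (crepP psi) _; case: (crepP phi).
Qed.

Definition cdot (phi psi : completion) : C := projT1 (cid (cdot_ex phi psi)).
Lemma cdotP (phi psi : completion) : (psi (crep phi n) : C) @[n --> \oo] --> (cdot phi psi : C).
Proof. by rewrite /cdot; case: cid. Qed.

Arguments cdotP : clear implicits.

Lemma cdot_diag (phi psi : completion) w : repr_by psi w ->
  (f (crep phi n) (w n) : C) @[n --> \oo] --> (cdot phi psi : C).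
Proof.
move=> hw; have [cu _] := crepP phi.
have h1 := cdotP phi psi; have h2 := repr_diag cu hw.
have : (f (crep phi n) (w n) - psi (crep phi n) : C) @[n --> \oo] --> (0 : C).
  by apply/cvg_nrP; under eq_fun do rewrite subr0.
move=> h3.
have -> : (fun n => f (crep phi n) (w n)) =
    (fun n => (f (crep phi n) (w n) - psi (crep phi n)) + psi (crep phi n)).
  by apply/funext => n; rewrite subrK.
rewrite -[cdot phi psi]add0r; exact: cvgD h3 h1.
Qed.

Arguments cdot_diag phi {psi w} _.

Lemma conj_cvg (z : nat -> C) (l : C) : z n @[n --> \oo] --> l ->
  (Num.conj (z n) : C) @[n --> \oo] --> (Num.conj l : C).
Proof.
move=> /cvg_nrP h; apply/cvg_nrP.
by under eq_fun do rewrite -rmorphB nr_conj.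
Qed.

Lemma cdot_conj phi psi : Num.conj (cdot phi psi) = cdot psi phi.
Proof.
have h1 := conj_cvg (cdot_diag phi (crepP psi)).
have h2 := cdot_diag psi (crepP phi).
apply: (cvg_unique_nr (V := C) h1); move: h2.
by under eq_fun do rewrite -(psf_conj ff).
Qed.

Lemma cdot_repr (phi psi : completion) u w : repr_by phi u -> repr_by psi w ->
  (f (u n) (w n) : C) @[n --> \oo] --> (cdot phi psi : C).
Proof.
move=> hu hw.
have h1 := cdot_diag psi hu.
have h2 := conj_cvg h1; rewrite cdot_conj in h2.
have h3 : (f (u n) (crep psi n) : C) @[n --> \oo] --> (cdot phi psi : C).
  by move: h2; under eq_fun do rewrite (psf_conj ff).
have [cu _] := hu.
have h4 := repr_diag cu hw; have h5 := repr_diag cu (crepP psi).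
have h6 : (f (u n) (w n) - psi (u n) : C) @[n --> \oo] --> (0 : C).
  by apply/cvg_nrP; under eq_fun do rewrite subr0.
have h7 : (f (u n) (crep psi n) - psi (u n) : C) @[n --> \oo] --> (0 : C).
  by apply/cvg_nrP; under eq_fun do rewrite subr0.
have -> : (fun n => f (u n) (w n)) = (fun n => ((f (u n) (w n) - psi (u n)) -
    (f (u n) (crep psi n) - psi (u n))) + f (u n) (crep psi n)).
  by apply/funext => n; rewrite opprB addrA subrK subrK.
rewrite -[cdot phi psi]add0r -[X in X + _](subrr 0); exact: cvgD (cvgB h6 h7) h3.
Qed.

Lemma cdot_linr phi (a : C) psi chi : cdot phi (a *: psi + chi) = a * cdot phi psi + cdot phi chi.
Proof.
have h1 := cdotP phi (a *: psi + chi).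
apply: (cvg_unique_nr (V := C) h1).
have e : (fun n => (a *: psi + chi) (crep phi n) : C) =
         (fun n => a *: (psi (crep phi n) : C) + chi (crep phi n)) by [].
rewrite e; apply: cvgD; last exact: cdotP.
by apply: cvgZ; [exact: cvg_cst|exact: cdotP].
Qed.

Lemma cre_cvg (z : nat -> C) (l : C) : z n @[n --> \oo] --> l ->
  cre (z n) @[n --> \oo] --> cre l.
Proof.
move=> /cvg_nr_eps h; apply/cvgrPdist_lt => e e0.
have [N hN] := h e e0; exists N => // n Nn /=.
rewrite distrC -raddfB; apply: le_lt_trans (normr_cre_le _) _; exact: hN.
Qed.

Lemma cdot_psd : psd_form cdot.
Proof.
split; [exact: cdot_linr|exact: cdot_conj|] => phi.
have h := cre_cvg (cdot_repr (crepP phi) (crepP phi)).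
have e : cdot phi phi = rc (cre (cdot phi phi)).
  have := cdot_conj phi phi; rewrite conjcE.
  case: (cdot phi phi) => x y /= [] /eqP; rewrite eq_sym -subr_eq0 opprK.
  by rewrite -mulr2n mulrn_eq0 /= => /eqP ->.
rewrite e -(rmorph0 (@rc R)) ler_rc.
by apply: (cvg_ge h) => n; exact: (sqn_ge0 ff).
Qed.

Definition cinj (v : S) : completion :=
  Completed (introT (asboolP _) (ex_intro _ _ (repr_cst v))).

Lemma cdot_cinj u v : cdot (cinj u) (cinj v) = f u v.
Proof.
have h := @cdot_repr (cinj u) (cinj v) _ _ (repr_cst u) (repr_cst v).
by apply: (cvg_unique_nr (V := C) h); exact: cvg_cst.
Qed.

Lemma cinj_linear : is_linear cinj.
Proof.
by move=> a u v; apply: val_inj; apply/funext => w /=; rewrite (psf_linr ff).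
Qed.

Lemma cdot_eq0 phi : cdot phi phi = 0 -> phi = 0.
Proof.
move=> h; apply: val_inj; apply/funext => v.
have [cu hu] := crepP phi.
have hh := cre_cvg (cdot_repr (crepP phi) (crepP phi)); rewrite h in hh.
suff H : (f v (crep phi n) : C) @[n --> \oo] --> (0 : C).
  by apply: (cvg_unique_nr (V := C) (hu v) H).
apply/cvg_nr_eps => e e0.
have s0 := sqn_ge0 ff v.
have e1 : 0 < e ^+ 2 / (sqn f v + 1) by rewrite divr_gt0 ?exprn_gt0 //; lra.
have /cvgrPdist_lt/(_ _ e1)[N _ hN] := hh.
exists N => n Nn; rewrite subr0 -(@ltr_pXn2r _ 2) ?nnegrE ?nr_ge0 ?(ltW e0) //.
apply: le_lt_trans (psf_CS ff _ _) _.
have := hN n Nn; have -> : cre (0 : C) = 0 by [].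
rewrite sub0r normrN -/(sqn f (crep phi n)).
rewrite ger0_norm ?(sqn_ge0 ff) // ltr_pdivlMr; last by lra.
have := sqn_ge0 ff (crep phi n); nra.
Qed.

Let cnorm (phi : completion) : C := rc (fnorm cdot phi).
Let cnormD x y : cnorm (x + y) <= cnorm x + cnorm y.
Proof. by rewrite /cnorm -rmorphD ler_rc; exact: fnormD cdot_psd _ _. Qed.
Let cnormZ a x : cnorm (a *: x) = `|a| * cnorm x.
Proof. by rewrite /cnorm (fnormZ cdot_psd) rmorphM normE. Qed.
Let cnorm0_eq0 x : cnorm x = 0 -> x = 0.
Proof.
move=> /(congr1 (@cre R)); rewrite raddf0 /cnorm rcK => h.
by apply: cdot_eq0; rewrite (sqnE cdot_psd) -(fnorm_sqr cdot_psd) h expr0n rmorph0.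
Qed.

HB.instance Definition _ := Lmodule_isNormed.Build C completion cnormD cnormZ cnorm0_eq0.

Lemma nr_completion (x : completion) : nr x = fnorm cdot x. Proof. by []. Qed.

Lemma cinj_dense (phi : completion) (e : R) : 0 < e -> exists v, nr (phi - cinj v) < e.
Proof.
move=> e0; have e2 : 0 < e / 2 by rewrite divr_gt0.
have [cu hu] := crepP phi; have [N hN] := cu _ e2.
exists (crep phi N); apply: le_lt_trans (_ : e / 2 < e); last by lra.
rewrite nr_completion -(@ler_pXn2r _ 2) ?nnegrE ?fnorm_ge0 ?(ltW e2) // (fnorm_sqr cdot_psd).
have hr : repr_by (phi - cinj (crep phi N)) (fun n => crep phi n - crep phi N).
  have := repr_lin (-1) (repr_cst (crep phi N)) (conj cu hu).
  have -> : (fun n => -1 *: crep phi N + crep phi n) = (fun n => crep phi n - crep phi N).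
    by apply/funext => n; rewrite scaleN1r addrC.
  suff -> : (-1 *: (fun w => f w (crep phi N)) + phi : S -> C) = cval (phi - cinj (crep phi N)) by [].
  by apply/funext => w; rewrite scaleN1r addrC.
have h := cre_cvg (cdot_repr hr hr).
have h' : cre (f (crep phi (n + N)%N - crep phi N) (crep phi (n + N)%N - crep phi N))
  @[n --> \oo] --> cre (cdot (phi - cinj (crep phi N)) (phi - cinj (crep phi N))).
  by rewrite (cvg_shiftn N (fun n => cre (f (crep phi n - crep phi N) (crep phi n - crep phi N)))).
apply: (cvg_le h') => n.
rewrite -/(sqn f _) -(fnorm_sqr ff) ler_pXn2r ?nnegrE ?fnorm_ge0 ?(ltW e2) //.
by apply: ltW; apply: hN; rewrite ?leq_addl.
Qed.

Lemma completion_seq_complete (x : nat -> completion) :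
  (forall e : R, 0 < e -> exists N, forall m n,
     (N <= m)%N -> (N <= n)%N -> nr (x m - x n) < e) ->
  exists l, forall e : R, 0 < e -> exists N, forall n, (N <= n)%N -> nr (x n - l) < e.
Proof.
move=> cx.
have inv_gt0 k : 0 < k.+1%:R^-1 :> R by rewrite invr_gt0 ltr0n.
pose v k := projT1 (cid (cinj_dense (x k) (inv_gt0 k))).
have hv k : nr (x k - cinj (v k)) < k.+1%:R^-1 by rewrite /v; case: cid.
have fv m n : fn (v m - v n) = nr (cinj (v m) - cinj (v n)).
  by rewrite -(linB cinj_linear) nr_completion /fnorm /sqn cdot_cinj.
have cv : cauchyf v.
  move=> e e0; have e3 : 0 < e / 3 by rewrite divr_gt0.
  have [N1 h1] := cx _ e3; have [N2 h2] := invn_small e3.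
  exists (maxn N1 N2) => m n; rewrite !geq_max => /andP[m1 m2] /andP[n1 n2].
  rewrite fv.
  have -> : cinj (v m) - cinj (v n) = (x m - x n) - (x m - cinj (v m)) + (x n - cinj (v n)).
    by lmod R.
  apply: lt_third_sum (nrD _ _) (nrB _ _) (h1 m n m1 n1) _ _.
  - exact: lt_trans (hv m) (h2 m m2).
  - exact: lt_trans (hv n) (h2 n n2).
have hphi w : exists l : C, (f w (v n) : C) @[n --> \oo] --> l.
  apply: complex_complete => e e0.
  have e1 : 0 < e / (fn w + 1) by rewrite divr_gt0 //; have := fnorm_ge0 f w; lra.
  have [N hN] := cv _ e1; exists N => m n Nm Nn.
  rewrite -(psfNr ff) -(psfDr ff); apply: le_lt_trans (fnorm_CS ff _ _) _.
  have := hN m n Nm Nn; rewrite ltr_pdivlMr; last by have := fnorm_ge0 f w; lra.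
  have := fnorm_ge0 f (v m - v n); nra.
pose phi w : C := projT1 (cid (hphi w)).
have hr : repr_by phi v by split=> // w; rewrite /phi; case: cid.
pose l := Completed (introT (asboolP _) (ex_intro _ v hr)).
exists l => e e0; have e4 : 0 < e / 4 by rewrite divr_gt0.
have [N1 h1] := cv _ e4; have [N2 h2] := invn_small e4.
exists (maxn N1 N2) => n; rewrite geq_max => /andP[n1 n2].
suff h : nr (l - cinj (v n)) <= e / 2.
  have -> : x n - l = x n - cinj (v n) - (l - cinj (v n)) by lmod R.
  apply: le_lt_trans (nrB _ _) _.
  have -> : e = e / 2 + e / 2 by field.
  apply: ltr_leD h; apply: lt_le_trans (lt_trans (hv n) (h2 n n2)) _.
  by rewrite ler_pM2l // lef_pV2 ?posrE // ler_nat.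
rewrite nr_completion -(@ler_pXn2r _ 2) ?nnegrE ?fnorm_ge0 ?divr_ge0 ?(ltW e0) // (fnorm_sqr cdot_psd).
have hr' : repr_by (l - cinj (v n)) (fun k => v k - v n).
  have := repr_lin (-1) (repr_cst (v n)) hr.
  have -> : (fun k => -1 *: v n + v k) = (fun k => v k - v n).
    by apply/funext => k; rewrite scaleN1r addrC.
  suff -> : (-1 *: (fun w => f w (v n)) + phi : S -> C) = cval (l - cinj (v n)) by [].
  by apply/funext => w; rewrite scaleN1r addrC.
have h := cre_cvg (cdot_repr hr' hr').
have h' : cre (f (v (k + N1)%N - v n) (v (k + N1)%N - v n))
  @[k --> \oo] --> cre (cdot (l - cinj (v n)) (l - cinj (v n))).
  by rewrite (cvg_shiftn N1 (fun k => cre (f (v k - v n) (v k - v n)))).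
apply: (cvg_le h') => k.
rewrite -/(sqn f _) -(fnorm_sqr ff) ler_pXn2r ?nnegrE ?fnorm_ge0 ?divr_ge0 ?(ltW e0) //.
have := h1 (k + N1)%N n (leq_addl _ _) n1 => h3; apply: le_trans (ltW h3) _.
by rewrite ler_pM2l // lef_pV2 ?posrE // ler_nat.
Qed.

Lemma completion_complete (F : set_system completion) :
  ProperFilter F -> cauchy F -> cvg F.
Proof.
move=> FF /cauchyP cF.
have inv_gt0 k : 0 < k.+1%:R^-1 :> R by rewrite invr_gt0 ltr0n.
have rinv_gt0 k : 0 < rc (k.+1%:R^-1) :> C by rewrite -(rmorph0 (@rc R)) ltr_rc.
pose x k := projT1 (cid (cF _ (rinv_gt0 k))).
have hx k : F (ball (x k) (rc k.+1%:R^-1)) by rewrite /x; case: cid.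
have ballE y (r : R) z : ball y (rc r) z <-> nr (y - z) < r.
  by rewrite -ball_normE /ball_ /= normE ltr_rc.
have [|l hl] := @completion_seq_complete x.
  move=> e e0; have e2 : 0 < e / 2 by rewrite divr_gt0.
  have [N hN] := invn_small e2; exists N => m n Nm Nn.
  have [z [/ballE zm /ballE zn]] := filter_ex (filterI (hx m) (hx n)).
  have -> : x m - x n = x m - z - (x n - z) by lmod R.
  apply: lt_half_sum (nrB _ _) _ _.
  - exact: lt_trans zm (hN m Nm).
  - exact: lt_trans zn (hN n Nn).
apply/cvg_ex; exists l; apply/cvgrPdist_lt => e e0.
have he : e = rc (cre e) by apply: ge0_rc; exact: ltW.
have e0' : 0 < cre e by move: e0; rewrite {1}he -(rmorph0 (@rc R)) ltr_rc.
have e2 : 0 < cre e / 2 by rewrite divr_gt0.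
have [N1 h1] := hl _ e2; have [N2 h2] := invn_small e2.
set n := maxn N1 N2.
apply: filterS (hx n) => z /ballE hz; rewrite he normE ltr_rc.
have -> : l - z = x n - z - (x n - l) by lmod R.
apply: lt_half_sum (nrB _ _) _ (h1 n (leq_maxl _ _)).
exact: lt_trans hz (h2 n (leq_maxr _ _)).
Qed.

HB.instance Definition _ := Uniform_isComplete.Build completion completion_complete.

Lemma cdot_norm (x : completion) : `|x| ^+ 2 = cdot x x.
Proof.
by rewrite normE nr_completion -rmorphXn (fnorm_sqr cdot_psd) (sqnE cdot_psd).
Qed.

Definition hilbert_completion : hilbert R :=
  @Hilbert R completion cdot cdot_linr cdot_conj cdot_norm.

End Completion.

Lemma psd_completion (R : realType) (V : lmodType (C R)) (f : V -> V -> C R) :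
  psd_form f -> exists (H : hilbert R) (i : V -> H),
  [/\ is_linear i, forall u v, dot (i u) (i v) = f u v &
      forall (h : H) (e : R), 0 < e -> exists v, nr (h - i v) < e].
Proof.
move=> ff; exists (hilbert_completion (PsdSpace ff)), (@cinj R (PsdSpace ff)).
split.
- exact: (@cinj_linear R (PsdSpace ff)).
- exact: (@cdot_cinj R (PsdSpace ff)).
- exact: (@cinj_dense R (PsdSpace ff)).
Qed.

(** * The space of a positive kernel *)

Section KernelSpace.
Variables (R : realType) (X : Type).
Local Notation C := (C R).
Variable ker : X -> X -> C.
Hypothesis ker_conj : forall a b, Num.conj (ker a b) = ker b a.
Hypothesis ker_ge0 : forall s : seq (C * X),
  0 <= cre (\sum_(p <- s) \sum_(q <- s) Num.conj p.1 * q.1 * ker p.2 q.2).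
Implicit Types s : seq (C * X).

(** A combination v of generators is represented by the function x -> <e_x, v>. Vectors orthogonal
    to all generators are then 0 outright, without forming a quotient. *)
Definition kcomb s : X -> C := fun x => \sum_(p <- s) p.1 * ker x p.2.

Definition in_kspace : {pred (X -> C)} := fun phi => `[< exists s, phi = kcomb s >].

Fact in_kspace_submod : submod_closed in_kspace.
Proof.
split=> [|a phi psi /asboolP[s ->] /asboolP[t ->]]; apply/asboolP.
  by exists [::]; apply/funext => x; rewrite /kcomb big_nil.
exists ([seq (a * p.1, p.2) | p <- s] ++ t); apply/funext => x.
rewrite /kcomb big_cat big_map /=; congr (_ + _).
by rewrite [LHS](scaler_sumr a); apply: eq_bigr => p _; rewrite -mulrA.
Qed.
HB.instance Definition _ := GRing.isSubmodClosed.Build C (X -> C) in_kspace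
  in_kspace_submod.

Record kspace := KSpace { kval :> X -> C ; kvalP : kval \in in_kspace }.
HB.instance Definition _ := [isSub for kval].
HB.instance Definition _ := [Choice of kspace by <:].
HB.instance Definition _ := [SubChoice_isSubLmodule of kspace by <:].

Definition krep (phi : kspace) : seq (C * X) := projT1 (cid (asboolW (kvalP phi))).
Lemma krepP (phi : kspace) : phi = kcomb (krep phi) :> (X -> C).
Proof. by rewrite /krep; case: cid. Qed.

Definition kdot (phi psi : kspace) : C := \sum_(p <- krep phi) Num.conj p.1 * psi p.2.

Lemma kpair_swap s t : \sum_(p <- s) Num.conj p.1 * kcomb t p.2 =
  Num.conj (\sum_(q <- t) Num.conj q.1 * kcomb s q.2).
Proof.
rewrite /kcomb rmorph_sum; under eq_bigr do rewrite mulr_sumr.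
rewrite exchange_big; apply: eq_bigr => q _ /=; rewrite rmorphM /= conjCK rmorph_sum mulr_sumr.
apply: eq_bigr => p _ /=; rewrite rmorphM /= ker_conj.
by rewrite mulrCA.
Qed.

(** [kdot] is defined from a chosen combination for [phi]; after swapping the arguments only the
    values of [phi] enter, so the choice does not matter. *)
Lemma kdotE (phi psi : kspace) s : phi = kcomb s :> (X -> C) ->
  kdot phi psi = \sum_(p <- s) Num.conj p.1 * psi p.2.
Proof.
have sw t : \sum_(p <- t) Num.conj p.1 * psi p.2 =
    Num.conj (\sum_(q <- krep psi) Num.conj q.1 * kcomb t q.2).
  by have e := krepP psi; rewrite -kpair_swap -e.
by move=> h; rewrite /kdot !sw -h -krepP.
Qed.

Lemma kdot_conj (phi psi : kspace) : Num.conj (kdot phi psi) = kdot psi phi.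
Proof.
rewrite /kdot; have e1 := krepP phi; have e2 := krepP psi.
by rewrite [in LHS]e2 [in RHS]e1 kpair_swap conjCK.
Qed.

Lemma kdot_psd : psd_form kdot.
Proof.
split=> [u a v w|u v|u].
- rewrite /kdot mulr_sumr -big_split; apply: eq_bigr => p _ /=.
  by rewrite [a * _]mulrCA -mulrDr.
- exact: kdot_conj.
have h : kdot u u = \sum_(p <- krep u) \sum_(q <- krep u)
    Num.conj p.1 * q.1 * ker p.2 q.2.
  rewrite /kdot; apply: eq_bigr => p _; have e := krepP u; rewrite [in LHS]e /kcomb mulr_sumr.
  by apply: eq_bigr => q _; rewrite mulrA.
have e : Num.conj (kdot u u) = kdot u u.
  exact: kdot_conj.
have := ker_ge0 (krep u); rewrite -h => h0.
suff -> : kdot u u = rc (cre (kdot u u)) by rewrite -(rmorph0 (@rc R)) ler_rc.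
move: e; rewrite conjcE; case: (kdot u u) => x y /= [] /eqP.
by rewrite eq_sym -subr_eq0 opprK -mulr2n mulrn_eq0 /= => /eqP ->.
Qed.

Fact ke_subproof a : kcomb [:: (1, a)] \in in_kspace.
Proof. by apply/asboolP; exists [:: (1, a)]. Qed.
Definition ke a := KSpace (ke_subproof a).

Lemma kdot_ke a v : kdot (ke a) v = v a.
Proof.
by rewrite (@kdotE (ke a) v [:: (1, a)]) // big_seq1 conjC1 mul1r.
Qed.

Lemma ke_span (v : kspace) : v = \sum_(p <- krep v) p.1 *: ke p.2.
Proof.
apply: val_inj; apply/funext => x; rewrite /= {1}krepP /kcomb.
elim: (krep v) => [|p s ih]; rewrite ?big_nil // !big_cons ih.
rewrite -[kval (_ + _) x]/(p.1 * kval (ke p.2) x + kval (\sum_(j <- s) j.1 *: ke j.2) x).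
by rewrite /= /kcomb big_seq1 mul1r.
Qed.

Lemma kernel_space : exists (V : lmodType C) (f : V -> V -> C) (e : X -> V),
  [/\ psd_form f, forall a b, f (e a) (e b) = ker a b,
      forall v, exists s : seq (C * X), v = \sum_(p <- s) p.1 *: e p.2 &
      forall v, (forall a, f (e a) v = 0) -> v = 0].
Proof.
exists kspace, kdot, ke; split.
- exact: kdot_psd.
- by move=> a b; rewrite kdot_ke /= /kcomb big_seq1 mul1r.
- by move=> v; exists (krep v); exact: ke_span.
- by move=> v h; apply: val_inj; apply/funext => a; rewrite -[LHS]kdot_ke h.
Qed.
End KernelSpace.

(** * Extension of linear maps from spanning and dense subspaces *)

Section Extension.
Variable R : realType.
Local Notation C := (C R).

Lemma span_extend (V W : lmodType C) (X : Type) (e : X -> V) (h : X -> W) :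
  (forall v, exists s : seq (C * X), v = \sum_(p <- s) p.1 *: e p.2) ->
  (forall s : seq (C * X), \sum_(p <- s) p.1 *: e p.2 = 0 ->
     \sum_(p <- s) p.1 *: h p.2 = 0) ->
  exists T : V -> W, is_linear T /\ forall a, T (e a) = h a.
Proof.
move=> sp h0; have rep v := cid (sp v).
pose T v := \sum_(p <- projT1 (rep v)) p.1 *: h p.2.
have TE s v : v = \sum_(p <- s) p.1 *: e p.2 -> T v = \sum_(p <- s) p.1 *: h p.2.
  move=> hs; have hr : v = \sum_(p <- projT1 (rep v)) p.1 *: e p.2.
    by case: (rep v).
  have := h0 (projT1 (rep v) ++ [seq (- p.1, p.2) | p <- s]).
  have neg (U : lmodType C) (k : X -> U) : \sum_(p <- [seq (- p.1, p.2) | p <- s]) p.1 *: k p.2 =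
      - \sum_(p <- s) p.1 *: k p.2.
    by rewrite big_map -sumrN; apply: eq_bigr => p _; rewrite scaleNr.
  by rewrite !big_cat !neg /= -hr -hs subrr => /(_ erefl) /eqP; rewrite subr_eq0 => /eqP.
exists T; split=> [a u v|a].
  have [s hs] := sp u; have [t ht] := sp v.
  rewrite (TE _ _ hs) (TE _ _ ht) (TE ([seq (a * p.1, p.2) | p <- s] ++ t)).
    rewrite big_cat big_map scaler_sumr; congr (_ + _).
    by apply: eq_bigr => p _; rewrite scalerA.
  rewrite big_cat big_map {1}hs {1}ht scaler_sumr; congr (_ + _).
  by apply: eq_bigr => p _; rewrite scalerA.
by rewrite (TE [:: (1, a)]) ?big_seq1 ?scale1r.
Qed.

Lemma half_bound (K x e : R) : 0 <= K -> 0 <= x -> x < e / (2 * (K + 1)) -> K * x < e / 2.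
Proof.
move=> K0 x0; rewrite ltr_pdivlMr; last by lra.
nra.
Qed.

(** The value at h is chosen with |l - T v| <= K |h - j v| for all v at once. This inequality
    determines it, and the extension property, the bound and linearity follow from it with no
    further reference to approximating sequences. *)
Lemma dense_extend (H : normedModType C) (W : completeNormedModType C) (V : lmodType C)
    (j : V -> H) (T : V -> W) (K : R) : 0 <= K ->
  is_linear j -> is_linear T ->
  (forall h (e : R), 0 < e -> exists v, nr (h - j v) < e) ->
  (forall v, nr (T v) <= K * nr (j v)) ->
  exists T' : H -> W, [/\ is_linear T', forall v, T' (j v) = T v &
    forall h, nr (T' h) <= K * nr h].
Proof.
move=> K0 lj lT dense bT.
have ex h : exists l : W, forall v, nr (l - T v) <= K * nr (h - j v).
  have inv_gt0 n : 0 < n.+1%:R^-1 :> R by rewrite invr_gt0 ltr0n.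
  pose v n := projT1 (cid (dense h _ (inv_gt0 n))).
  have hv n : nr (h - j (v n)) < n.+1%:R^-1 by rewrite /v; case: cid.
  have /cvg_ex[l hl] : cvg ((T (v n)) @[n --> \oo]).
    apply: seq_complete => e e0.
    have e2 : 0 < e / (2 * (K + 1)) by rewrite divr_gt0 //; lra.
    have [N hN] := invn_small e2; exists N => m n Nm Nn.
    rewrite -(linB lT); apply: le_lt_trans (bT _) _; rewrite (linB lj).
    have -> : j (v m) - j (v n) = (h - j (v n)) - (h - j (v m)) by lmod R.
    apply: lt_half_sum (_ : _ <= K * nr (h - j (v n)) + K * nr (h - j (v m))) _ _.
    - by rewrite -mulrDr ler_wpM2l // nrB.
    - by apply: half_bound => //; [exact: nr_ge0|exact: lt_trans (hv n) (hN n Nn)].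
    - by apply: half_bound => //; [exact: nr_ge0|exact: lt_trans (hv m) (hN m Nm)].
  exists l => w.
  have h1 : (T (v n) - T w) @[n --> \oo] --> l - T w by apply: cvgB => //; exact: cvg_cst.
  apply/ler_addgt0Pr => e e0.
  have e2 : 0 < e / (2 * (K + 1)) by rewrite divr_gt0 //; lra.
  have [N hN] := invn_small e2.
  have h2 : (T (v (n + N)%N) - T w) @[n --> \oo] --> l - T w.
    by rewrite (cvg_shiftn N (fun n => T (v n) - T w)).
  apply: (cvg_nr_le h2) => n; rewrite -(linB lT); apply: le_trans (bT _) _.
  rewrite (linB lj); set m := (n + N)%N.
  have -> : j (v m) - j w = (h - j w) - (h - j (v m)) by lmod R.
  apply: le_trans (_ : K * nr (h - j w) + K * nr (h - j (v m)) <= _).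
    by rewrite -mulrDr ler_wpM2l // nrB.
  rewrite lerD2l; have := lt_trans (hv m) (hN m (leq_addl _ _)) => h3.
  have := half_bound K0 (nr_ge0 _) h3; lra.
pose T' h := projT1 (cid (ex h)).
have T'P h v : nr (T' h - T v) <= K * nr (h - j v) by rewrite /T'; case: cid.
have T'E v : T' (j v) = T v.
  apply/eqP; rewrite -subr_eq0; apply/eqP/nr_eq0/eqP; rewrite eq_le nr_ge0 andbT.
  by apply: le_trans (T'P _ v) _; rewrite subrr nr0 mulr0.
exists T'; split=> // [a x y|h]; last first.
  by have := T'P h 0; rewrite (lin0 lT) (lin0 lj) !subr0.
apply/eqP; rewrite -subr_eq0; apply/eqP/nr_eq0/eqP; rewrite eq_le nr_ge0 andbT.
apply/ler_addgt0Pr => e e0; rewrite add0r.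
have a0 := nr_ge0 a.
(* Approximating x and y within e/(2c) makes the total error at most e/2. *)
set c := 2 * (nr a + 1) * (K + 1).
have c0 : 0 < c by rewrite !mulr_gt0 //; lra.
have e1 : 0 < e / c / 2 by rewrite !divr_gt0.
have [u hu] := dense x _ e1; have [v hv] := dense y _ e1.
have -> : T' (a *: x + y) - (a *: T' x + T' y) =
   (T' (a *: x + y) - T (a *: u + v)) - (a *: (T' x - T u) + (T' y - T v)).
  by rewrite lT; lmod R.
apply: le_trans (nrB _ _) _.
have h1 := T'P (a *: x + y) (a *: u + v); rewrite lj in h1.
have h2 : nr (a *: x + y - (a *: j u + j v)) <= nr a * nr (x - j u) + nr (y - j v).
  have -> : a *: x + y - (a *: j u + j v) = a *: (x - j u) + (y - j v) by lmod R.
  by rewrite -nrZ nrD.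
have h3 : nr (a *: (T' x - T u) + (T' y - T v)) <= nr a * (K * nr (x - j u)) + K * nr (y - j v).
  apply: le_trans (nrD _ _) _; rewrite nrZ; apply: lerD; last exact: T'P.
  by apply: ler_wpM2l => //; exact: T'P.
apply: (@le_trans _ _ (2 * (K * (nr a * nr (x - j u) + nr (y - j v))))).
  have -> : 2 * (K * (nr a * nr (x - j u) + nr (y - j v))) =
     K * (nr a * nr (x - j u) + nr (y - j v)) + (nr a * (K * nr (x - j u)) + K * nr (y - j v)) by ring.
  by apply: lerD h3; apply: le_trans h1 _; exact: ler_wpM2l.
have h4 : nr a * nr (x - j u) + nr (y - j v) <= (nr a + 1) * (e / c / 2).
  by rewrite mulrDl mul1r; apply: lerD (ltW hv); apply: ler_wpM2l => //; exact: ltW.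
apply: (@le_trans _ _ (2 * ((K + 1) * ((nr a + 1) * (e / c / 2))))).
  rewrite ler_pM2l //; apply: ler_pM => //; first by rewrite addr_ge0 ?mulr_ge0 ?nr_ge0.
  by lra.
have -> : 2 * ((K + 1) * ((nr a + 1) * (e / c / 2))) = e / 2 by rewrite /c; field; apply/andP; split; lra.
lra.
Qed.

Lemma exists_bop (H : hilbert R) (T : H -> H) (K : R) : is_linear T ->
  (forall h, nr (T h) <= K * nr h) -> exists a : bounded_op H, forall h, a h = T h.
Proof.
move=> lT bT.
pose L : {linear H -> H} := HB.pack T (GRing.isLinear.Build C H H *:%R T lT).
have cL : continuous L.
  by move=> x; apply: (@cvg_lip R H H L K) => // u v; rewrite -linearB; exact: bT.
by exists (BoundedOp cL).
Qed.

End Extension.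

(** * The kernel of the dilation *)

Section TotalSpace.
Variables (R : realType) (S : nmodType) (M : cstar_algebra R).
Variable gen : forall T : correspondence M, set T -> Prop.
Variable F : product_system S gen.
Local Notation C := (C R).

Lemma ps_mul_linl s t (y : F t) : is_linear (fun x : F s => ps_mul x y).
Proof.
by case: (ps_u_unitary F s t) => hl _ _ _ _ a x x'; rewrite /ps_mul tens_linl hl.
Qed.

Lemma ps_mul_linr s t (x : F s) : is_linear (fun y : F t => ps_mul x y).
Proof.
by case: (ps_u_unitary F s t) => hl _ _ _ _ a y y'; rewrite /ps_mul tens_linr hl.
Qed.

Lemma ps_mul_inner s t (x x' : F s) (y y' : F t) :
  hm_inner (ps_mul x y) (ps_mul x' y') = hm_inner y (co_lact (hm_inner x x') y').
Proof. by case: (ps_u_unitary F s t) => _ _ _ hi _; rewrite /ps_mul hi tens_inner. Qed.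

Lemma ps_mul_lact s t m (x : F s) (y : F t) :
  co_lact m (ps_mul x y) = ps_mul (co_lact m x) y.
Proof. by case: (ps_u_unitary F s t) => _ hl _ _ _; rewrite /ps_mul -hl tens_lact. Qed.

Lemma ps_mul_ract s t m (x : F s) (y : F t) :
  hm_ract (ps_mul x y) m = ps_mul x (hm_ract y m).
Proof. by case: (ps_u_unitary F s t) => _ _ hr _ _; rewrite /ps_mul -hr tens_ract. Qed.

Lemma ps_mul_balanced s t m (x : F s) (y : F t) :
  ps_mul (hm_ract x m) y = ps_mul x (co_lact m y).
Proof. by rewrite /ps_mul tens_balanced. Qed.

Lemma nr_ps_mul s t (x : F s) (y : F t) : nr (ps_mul x y) <= nr x * nr y.
Proof.
rewrite -(@ler_pXn2r _ 2) ?nnegrE ?mulr_ge0 ?nr_ge0 // -nr_hm ps_mul_inner.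
apply: le_trans (hm_CS _ _) _; apply: le_trans (ler_wpM2l (nr_ge0 _) (nr_lact _ _)) _.
by rewrite nr_hm exprMn mulrCA expr2.
Qed.

Lemma nr_ps_unit m : nr (ps_unit F m) = nr m.
Proof.
by apply/eqP; rewrite -(@eqrXn2 _ 2) ?nr_ge0 // -nr_hm ps_unit_inner nr_cstar.
Qed.

(** All fibers in one type, where associativity and the unit laws are plain equalities and no
    element has to be transported between fibers. *)
Definition ps_total := {t : S & (F t : Type)}.
Definition mk t (x : F t) : ps_total := existT (fun t => F t : Type) t x.

(** The value 0 at different times is a default; the lemmas about it either assume equal times or
    hold trivially there. *)
Definition hin (p q : ps_total) : M :=
  if tag p == tag q then hm_inner (tagged p) (tagged_as p q) else 0.
Definition hmul (p q : ps_total) : ps_total := mk (ps_mul (tagged p) (tagged q)).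
Definition hlact m (p : ps_total) : ps_total := mk (co_lact m (tagged p)).

Lemma hinE t (x y : F t) : hin (mk x) (mk y) = hm_inner x y.
Proof.
by rewrite /hin eqxx -[mk y]/(Tagged (fun t => F t : Type) (y : F (tag (mk x)))) tagged_asE.
Qed.

Lemma ex_mk p t : tag p = t -> exists x : F t, p = mk x.
Proof. by case: p => s x /= <-; exists x. Qed.

Lemma hmulA p q r : hmul (hmul p q) r = hmul p (hmul q r).
Proof. by case: p q r => ? ? [? ?] [? ?]; exact: ps_mulA. Qed.

Lemma hmul_unit m p : hmul (mk (ps_unit F m)) p = hlact m p.
Proof. by case: p => t x; exact: ps_mul_unitl. Qed.

Lemma hmul_unitr m t (x : F t) : hmul (mk x) (mk (ps_unit F m)) = mk (hm_ract x m).
Proof. exact: ps_mul_unitr. Qed.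

Lemma hlact_mul m p q : hlact m (hmul p q) = hmul (hlact m p) q.
Proof. by rewrite /hlact /hmul /= ps_mul_lact. Qed.

Lemma hlactM m n p : hlact (m ** n) p = hlact m (hlact n p).
Proof. by rewrite /hlact /= co_lactM. Qed.

Lemma hin_mul p p' q q' : tag p = tag p' -> tag q = tag q' ->
  hin (hmul p q) (hmul p' q') = hin q (hlact (hin p p') q').
Proof.
case: p p' q q' => s x [s' x'] [t y] [t' y'] /= es et.
subst s' t'; rewrite /hmul /hlact /=.
by rewrite !hinE ps_mul_inner.
Qed.

Lemma hin_lact m p q : hin (hlact m p) q = hin p (hlact (cs_star m) q).
Proof.
case: p q => s x [t y]; have [e|ne] := eqVneq s t; last by rewrite /hin /= (negPf ne).
by subst t; rewrite /hlact /= !hinE co_lact_adj.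
Qed.

Lemma hin_star p q : cs_star (hin p q) = hin q p.
Proof.
case: p q => s x [t y]; have [e|ne] := eqVneq s t; last first.
  by rewrite /hin /= (negPf ne) eq_sym (negPf ne) cs_star0.
by subst t; rewrite !hinE hm_inner_star.
Qed.

Lemma hin_eq p q : tag p = tag q -> (forall y, tag y = tag p -> hin p y = hin q y) -> p = q.
Proof.
case: p q => s x [t y] /= e; subst t => h; congr (existT _ _ _).
apply/eqP; rewrite -subr_eq0; apply/eqP; apply: hm_inner_eq0 => z.
have mf := hm_mform (F s).
have := h (mk z) erefl; rewrite !hinE => hz.
by rewrite (mfDl mf) (mfNl mf) hz subrr.
Qed.

(* [w = L_p^* q], where [L_p y = p (.) y]. *)
Definition quot (p q w : ps_total) : Prop := tag q = tag p + tag w /\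
  forall y, tag y = tag w -> hin w y = hin q (hmul p y).

(** The order structure of the time set in additive terms: s precedes t when t = s + r. Totality
    makes one of two vectors divisible by the other, and conicality limits divisibility in both
    directions to equal times. *)
Record time_like : Prop := TimeLike {
  tl_cancel : forall s r r' : S, s + r = s + r' -> r = r' ;
  tl_total : forall s t : S, (exists r, t = s + r) \/ (exists r, s = t + r) ;
  tl_conical : forall r r' : S, r + r' = 0 -> r = 0 }.

Hypothesis tl : time_like.

Lemma quot_inj p q w w' : quot p q w -> quot p q w' -> w = w'.
Proof.
move=> [e h] [e' h']; have et : tag w = tag w' by apply: (tl_cancel tl (s := tag p)); rewrite -e.
by apply: hin_eq => // y hy; rewrite h // h' // -et.
Qed.

Lemma quot_same p q : tag p = tag q -> quot p q (mk (ps_unit F (hin p q))).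
Proof.
move=> e; split; first by rewrite /= addr0.
move=> y /(@ex_mk _ 0)[z ->]; have [m <-] := ps_unit_surj z.
rewrite hinE ps_unit_inner hin_star.
case: p q e => s x [t y'] /= e; subst t.
rewrite hmul_unitr !hinE.
by rewrite hm_inner_ract.
Qed.

(** The adjoint of L_(p q) is L_q^* L_p^*, and L_p^* L_p' is left multiplication by <p, p'>. *)
Lemma quot_mul p p' q q' w : tag p = tag p' ->
  quot q (hlact (hin p p') q') w -> quot (hmul p q) (hmul p' q') w.
Proof.
move=> e [et h]; split; first by rewrite /= in et *; rewrite -e et addrA.
move=> y hy; rewrite h // hmulA.
rewrite -[LHS]hin_star -[RHS]hin_star; congr cs_star.
by rewrite hin_mul //= hy -et.
Qed.

Lemma quot_lact m p q w : quot p (hlact (cs_star m) q) w -> quot (hlact m p) q w.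
Proof.
move=> [e h]; split=> // y hy; rewrite h // -hlact_mul.
by rewrite -[LHS]hin_star -[RHS]hin_star hin_lact.
Qed.

(** Existence of L_x^* is isolated as a hypothesis because its sources differ: norm density of
    products and completeness in the C*-case, self-duality in the W*-case. *)
Definition adjointable_mul := forall s r (x : F s) (z : F (s + r)),
  exists w : F r, forall y, hm_inner w y = hm_inner z (ps_mul x y).

Hypothesis adj : adjointable_mul.

Lemma quot_ex p q r : tag q = tag p + r -> exists w, quot p q w.
Proof.
case: p => s x /= /ex_mk[z ->]; have [w hw] := adj x z.
exists (mk w); split=> // y /ex_mk[y' ->]; rewrite hinE hw.
by rewrite /hmul /= hinE.
Qed.

Lemma nr_quot p q w : quot p q w ->
  nr (tagged w) <= nr (tagged p) * nr (tagged q).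
Proof.
case: p q w => s x [t z] [r w] [/= e h]; subst t.
have := h (mk w) erefl; rewrite /hmul !hinE => /= hw.
have [w0|wn0] := eqVneq (nr w) 0; first by rewrite w0 mulr_ge0 ?nr_ge0.
have wp : 0 < nr w by rewrite lt_neqAle eq_sym wn0 nr_ge0.
rewrite -(ler_pM2r wp) -expr2 -nr_hm hw.
apply: le_trans (hm_CS _ _) _; rewrite mulrAC mulrC.
by rewrite ler_wpM2r ?nr_ge0 ?nr_ps_mul.
Qed.

End TotalSpace.
Arguments ex_mk {R S M gen F p t} _.

(** * The kernel on atoms *)

Section AtomKernel.
Variables (R : realType) (S : nmodType) (M : cstar_algebra R).
Variable gen : forall T : correspondence M, set T -> Prop.
Variables (F : product_system S gen) (G : hilbert R) (sigma : rep_family F G).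
Local Notation C := (C R).
Hypotheses (tl : time_like S) (adj : adjointable_mul F) (cov : covariant_rep sigma).
Local Notation total := (ps_total F).
Local Notation s0 := (rep0 sigma).

Definition sg (p : total) : bounded_op G := sigma (tagged p).

Lemma sg_mul p q g : sg (hmul p q) g = sg p (sg q g).
Proof. exact: (cov_mul cov). Qed.

Lemma sg_unit m : sg (mk (ps_unit F m)) = s0 m. Proof. by []. Qed.

Lemma sg_lact m p g : sg (hlact m p) g = s0 m (sg p g).
Proof. by rewrite -hmul_unit sg_mul. Qed.

Lemma sigma_linear t g : is_linear (fun x : F t => sigma x g).
Proof. by move=> a x y; exact: (cov_linear cov). Qed.

Lemma sigma_ract t (x : F t) m g : sigma (hm_ract x m) g = sigma x (s0 m g).
Proof. by have := sg_mul (mk x) (mk (ps_unit F m)) g; rewrite hmul_unitr. Qed.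

Lemma nr_sigma t (x : F t) g : nr (sigma x g) <= nr x * nr g.
Proof.
apply: (cc_contractive (s := @sigma t)); last exact: (cov_cc cov).
exact: sigma_linear.
Qed.

Lemma s0_rep : form_rep (@dot R G) (fun m g => s0 m g).
Proof.
have [h1 h2 h3] := cov_star_rep cov.
split=> //.
- by move=> m; exact: bop_linear.
- by move=> g a m n; exact: h1.
move=> u v; exists (nr u * nr v) => m.
apply: le_trans (dot_CS _ _) _; rewrite -mulrA ler_wpM2l ?nr_ge0 // mulrC.
by rewrite -(nr_ps_unit F); exact: nr_sigma.
Qed.

Lemma sigma_gram t n (y : 'I_n -> F t) (g : 'I_n -> G) :
  nr (\sum_j sigma (y j) (g j)) ^+ 2 <=
  cre (\sum_i \sum_j dot (g i) (s0 (hm_inner (y i) (y j)) (g j))).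
Proof.
exact: (gram_contraction s0_rep (@sigma_linear t) (@sigma_ract t) (cov_cc cov (t := t))).
Qed.

(* [(None, g)] stands for [V g] and [(Some x, g)] for [tau x (V g)]. *)
Definition atom : Type := (option total * G)%type.
Implicit Types (u v w : option total) (a b : atom) (p q : total).

Definition sgo u g : G := if u is Some p then sg p g else g.
Definition proj_atom a : G := sgo a.1 a.2.
Definition pmul p u : option total := Some (if u is Some q then hmul p q else p).
Definition act m a : atom :=
  if a.1 is Some q then (Some (hlact m q), a.2) else (None, s0 m a.2).
(** [None] acts as a formal unit that precedes time 0. It is kept apart from the elements of F_0
    because M may lack a unit and sigma_0 may be degenerate. Accordingly [None] divides everything,
    and nothing of the form [Some p] divides [None]. *)
Definition oquot u v w : Prop :=
  match u, v, w with
  | None, _, _ => w = v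
  | Some p, Some q, Some r => quot p q r
  | _, _, _ => False
  end.

Lemma oquot_inj u v w w' : oquot u v w -> oquot u v w' -> w = w'.
Proof.
case: u v w w' => [p|] [q|] [r|] [r'|] //= h h'; try by rewrite h h'.
by rewrite (quot_inj tl h h').
Qed.

Lemma oquot_total u v : (exists w, oquot u v w) \/ (exists w, oquot v u w).
Proof.
case: u v => [p|] [q|]; try (by left; eexists); try (by right; eexists).
case: (tl_total tl (tag p) (tag q)) => -[r e].
  by have [w hw] := quot_ex adj e; left; exists (Some w).
by have [w hw] := quot_ex adj e; right; exists (Some w).
Qed.

Lemma sgo_linear u : is_linear (sgo u).
Proof. by case: u => [p|] a g h //=; rewrite linearP. Qed.

(** If each divides the other, then both are [None] or the times agree. In the second case the two
    quotients are <p, q> and its adjoint in F_0, and sigma_0 is a *-representation. *)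
Lemma oquot_both u v w w' g h : oquot u v w -> oquot v u w' ->
  dot g (sgo w h) = Num.conj (dot h (sgo w' g)).
Proof.
have dconj (x y : G) : Num.conj (dot x y) = dot y x := dot_conj x y.
case: u v w w' => [p|] [q|] [r|] [r'|] //= h1 h2; try by rewrite dconj.
have [e1 _] := h1; have [e2 _] := h2.
have e0 : tag r + tag r' = 0.
  by apply: (tl_cancel tl (s := tag p)); rewrite addr0 addrA -e1.
have r0 := tl_conical tl e0.
have e : tag p = tag q by rewrite e1 r0 addr0.
rewrite (quot_inj tl h1 (quot_same e)) (quot_inj tl h2 (quot_same (esym e))) !sg_unit.
by rewrite dconj -(hin_star p q) (fr_adj s0_rep).
Qed.

Definition osel u v : option total :=
  if pselect (exists w, oquot u v w) is left h then projT1 (cid h) else None.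

Lemma oselP u v w : oquot u v w -> osel u v = w.
Proof.
move=> h; rewrite /osel; case: pselect => [h'|]; last by case; exists w.
by case: (cid h') => w' /= hw'; exact: oquot_inj hw' h.
Qed.

(** By totality one of the two quotients exists; when both do, [oquot_both] shows that the
    preference given to the first is immaterial. The default value of [osel] is thus never met. *)
Definition kap a b : C :=
  if `[< exists w, oquot a.1 b.1 w >] then dot a.2 (sgo (osel a.1 b.1) b.2)
  else Num.conj (dot b.2 (sgo (osel b.1 a.1) a.2)).

Lemma kapE u v w g h : oquot u v w -> kap (u, g) (v, h) = dot g (sgo w h).
Proof.
move=> hw; rewrite /kap /= ifT; last by apply/asboolP; exists w.
by rewrite (oselP hw).
Qed.

Lemma kapE' u v w g h : oquot v u w -> kap (u, g) (v, h) = Num.conj (dot h (sgo w g)).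
Proof.
move=> hw; rewrite /kap /=; case: asboolP => [[w' hw']|_]; last by rewrite (oselP hw).
by rewrite (oselP hw'); exact: oquot_both hw' hw.
Qed.

Lemma kap_conj a b : Num.conj (kap a b) = kap b a.
Proof.
case: a b => u g [v h]; case: (oquot_total u v) => -[w hw].
  by rewrite (kapE _ _ hw) (kapE' _ _ hw).
by rewrite (kapE _ _ hw) (kapE' _ _ hw) conjCK.
Qed.

Lemma kap_none g v h : kap (None, g) (v, h) = dot g (sgo v h).
Proof. exact: kapE. Qed.

Lemma kap_act m a b : kap (act m a) b = kap a (act (cs_star m) b).
Proof.
have H n u v w g h : oquot u v w ->
    kap (act n (u, g)) (v, h) = kap (u, g) (act (cs_star n) (v, h)).
  case: u v w => [p|] [q|] [r|] //= hw; rewrite /act /=.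
  - have [|w' hw'] := quot_ex adj (p := p) (q := hlact (cs_star n) q) (r := tag r).
      by have [e _] := hw.
    by rewrite (@kapE _ _ (Some w')) ?(@kapE _ _ (Some w')) //=; exact: quot_lact.
  - by rewrite !kap_none /= sg_lact -(fr_adj s0_rep) cs_starK.
  - by rewrite !kap_none /= -(fr_adj s0_rep) cs_starK.
case: a b => u g [v h]; case: (oquot_total u v) => -[w hw]; first exact: H hw.
by rewrite -[LHS]kap_conj -[RHS]kap_conj -{1}[m]cs_starK; congr Num.conj; rewrite -(H _ _ _ _ _ _ hw).
Qed.

Lemma quot_pmul p p' q : tag p = tag p' -> quot p (hmul p' q) (hlact (hin p p') q).
Proof.
move=> e; split; first by rewrite /= e.
by move=> y hy; rewrite -[LHS]hin_star -[RHS]hin_star hin_mul.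
Qed.

(** The kernel version of L_p^* L_p' = <p, p'>. It is the source both of the isometry of the
    dilation and of the amplification in the positivity proof. *)
Lemma kap_pmul p p' u v g h : tag p = tag p' ->
  kap (pmul p u, g) (pmul p' v, h) = kap (u, g) (act (hin p p') (v, h)).
Proof.
have H q q' x y w k l : tag q = tag q' -> oquot x y w ->
    kap (pmul q x, k) (pmul q' y, l) = kap (x, k) (act (hin q q') (y, l)).
  case: x y w => [r|] [t|] [w|] //= e hw; rewrite /act /=.
  - have [|w' hw'] := quot_ex adj (p := r) (q := hlact (hin q q') t) (r := tag w).
      by have [e' _] := hw.
    by rewrite (@kapE _ _ (Some w')) ?(@kapE _ _ (Some w')) //=; exact: quot_mul.
  - by rewrite kap_none (@kapE _ _ (Some (hlact (hin q q') t))) //; exact: quot_pmul.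
  - rewrite kap_none (@kapE _ _ (Some (mk (ps_unit F (hin q q'))))) //.
    exact: quot_same.
move=> e; case: (oquot_total u v) => -[w hw]; first exact: H hw.
rewrite -kap_conj (H _ _ _ _ _ _ _ (esym e) hw) kap_conj kap_act hin_star.
by [].
Qed.

Lemma kap_linr a v : is_linear (fun h => kap a (v, h)).
Proof.
case: a => u g c h k; case: (oquot_total u v) => -[w hw].
  by rewrite !(kapE _ _ hw) sgo_linear dot_linr.
by rewrite !(kapE' _ _ hw) !dot_conj dot_linr.
Qed.

Lemma kap_linx a t h : is_linear (fun x : F t => kap a (Some (mk x), h)).
Proof.
case: a => -[p|] g c x y; last by rewrite !kap_none /= sigma_linear dot_linr.
have mf r := hm_mform (F r).
case: (tl_total tl (tag p) t) => -[r e].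
- subst t; have [w hw] := quot_ex adj (erefl : tag (mk x) = tag p + r).
  have [w' hw'] := quot_ex adj (erefl : tag (mk y) = tag p + r).
  have [/(tl_cancel tl)/= e _] := hw; have [/(tl_cancel tl)/= e' _] := hw'.
  case: (ex_mk (esym e)) => z ez; case: (ex_mk (esym e')) => z' ez'; subst w w'.
  have hq : quot p (mk (c *: x + y)) (mk (c *: z + z')).
    split=> // q /ex_mk[b ->]; case: hw => _ /(_ (mk b) erefl) H1.
    case: hw' => _ /(_ (mk b) erefl); move: H1; rewrite /hmul !hinE => H1 H2.
    by rewrite !(mfDl (mf _)) !(mfZl (mf _)) H1 H2.
  rewrite (@kapE (Some p) (Some _) (Some _) _ _ hq) (@kapE (Some p) (Some _) (Some _) _ _ hw) (@kapE (Some p) (Some _) (Some _) _ _ hw').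
  by rewrite /= /sg /= sigma_linear dot_linr.
have [w hw] := quot_ex adj (e : tag p = tag (mk x) + r).
have [w' hw'] := quot_ex adj (e : tag p = tag (mk y) + r).
have er : tag w = r by have [e1 _] := hw; apply: (tl_cancel tl (s := t)); rewrite -e e1.
have er' : tag w' = r by have [e1 _] := hw'; apply: (tl_cancel tl (s := t)); rewrite -e e1.
case: (ex_mk er) => z ez; case: (ex_mk er') => z' ez'; subst w w'.
(* Now x is the divisor, and L_x^* depends antilinearly on x; the conjugate in the second branch of
   [kap] restores linearity. *)
have hq : quot (mk (c *: x + y)) p (mk (Num.conj c *: z + z')).
  split=> // q /ex_mk[b ->]; case: hw => _ /(_ (mk b) erefl) H1.
  case: hw' => _ /(_ (mk b) erefl); move: H1.
  case: (ex_mk e) => P ->; rewrite /hmul !hinE => H1 H2.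
  by rewrite /= ps_mul_linl !(mfDl (mf _), mfDr (mf _)) (mfZl (mf _)) (mfZr (mf _)) H1 H2 conjCK.
rewrite (@kapE' (Some p) (Some _) (Some _) _ _ hq) (@kapE' (Some p) (Some _) (Some _) _ _ hw) (@kapE' (Some p) (Some _) (Some _) _ _ hw').
by rewrite /= /sg /= sigma_linear dot_linr rmorphD rmorphM /= conjCK.
Qed.

Definition onorm u : R := if u is Some p then nr (tagged p) else 1.

Lemma onorm_ge0 u : 0 <= onorm u.
Proof. by case: u => [p|] //=; exact: nr_ge0. Qed.

Lemma nr_sgo u g : nr (sgo u g) <= onorm u * nr g.
Proof. by case: u => [p|] /=; rewrite ?mul1r //; exact: nr_sigma. Qed.

Lemma onorm_quot u v w : oquot u v w -> onorm w <= onorm u * onorm v.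
Proof.
case: u v w => [p|] [q|] [r|] //=; rewrite ?mulr1 ?mul1r //; try by move=> [->].
exact: nr_quot.
Qed.

Lemma nr_kap u v g h : nr (kap (u, g) (v, h)) <= onorm u * onorm v * (nr g * nr h).
Proof.
have H x y w k l : oquot x y w -> nr (dot k (sgo w l)) <= onorm x * onorm y * (nr k * nr l).
  move=> hw; apply: le_trans (dot_CS _ _) _.
  apply: le_trans (ler_wpM2l (nr_ge0 _) (nr_sgo _ _)) _.
  by rewrite mulrCA ler_wpM2r ?mulr_ge0 ?nr_ge0 // onorm_quot.
case: (oquot_total u v) => -[w hw]; first by rewrite (kapE _ _ hw); exact: H hw.
rewrite (kapE' _ _ hw) nr_conj; apply: le_trans (H _ _ _ _ _ hw) _.
by rewrite [onorm v * _]mulrC [nr h * _]mulrC.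
Qed.

Lemma nr_kap_act a b : exists K : R, forall m, nr (kap a (act m b)) <= K * nr m.
Proof.
case: a b => u g [v h]; exists (onorm u * onorm v * (nr g * nr h)) => m.
have h0 : 0 <= onorm u * (nr g * nr h) by rewrite !mulr_ge0 ?nr_ge0 ?onorm_ge0.
case: v => [q|]; rewrite /act /=; apply: le_trans (nr_kap _ _ _ _) _ => /=.
  rewrite [leLHS]mulrAC [X in X * nr m]mulrAC -[leRHS]mulrA ler_wpM2l //.
  by rewrite [leRHS]mulrC nr_lact.
rewrite !mulr1 -!mulrA ler_wpM2l ?onorm_ge0 // ler_wpM2l ?nr_ge0 // mulrC.
by rewrite -(nr_ps_unit F) mulrC [leRHS]mulrC; exact: nr_sigma.
Qed.

Lemma proj_act m a : proj_atom (act m a) = s0 m (proj_atom a).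
Proof. by case: a => -[p|] g //=; rewrite /proj_atom /= sg_lact. Qed.

Lemma proj_pmul p u g : proj_atom (pmul p u, g) = sg p (proj_atom (u, g)).
Proof. by case: u => [q|] //; rewrite /proj_atom /= sg_mul. Qed.

(* The kernel of the component orthogonal to [G]. *)
Definition kap' a b : C := kap a b - dot (proj_atom a) (proj_atom b).

Lemma kap'_none g b : kap' (None, g) b = 0.
Proof. by case: b => v h; rewrite /kap' kap_none subrr. Qed.

End AtomKernel.
Arguments kapE {R S M gen F G sigma} tl {u v w} g h _.
Arguments kap'_none {R S M gen F G sigma} tl g b.

Section SpanTools.
Variable R : realType.
Local Notation C := (C R).

Lemma span_eq (V W : lmodType C) (X : Type) (e : X -> V) (T T' : V -> W) :
  (forall v, exists s : seq (C * X), v = \sum_(p <- s) p.1 *: e p.2) ->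
  is_linear T -> is_linear T' -> (forall a, T (e a) = T' (e a)) -> forall v, T v = T' v.
Proof.
move=> sp l l' h v; have [s ->] := sp v.
rewrite (lin_sum l) (lin_sum l'); apply: eq_bigr => p _.
by rewrite (linZ l) (linZ l') h.
Qed.

End SpanTools.

(** * Representations on spaces spanned by atoms *)

Section KernelRep.
Variables (R : realType) (S : nmodType) (M : cstar_algebra R).
Variable gen : forall T : correspondence M, set T -> Prop.
Variables (F : product_system S gen) (G : hilbert R) (sigma : rep_family F G).
Local Notation C := (C R).
Hypotheses (cov : covariant_rep sigma).
Local Notation atom := (atom F G).
Local Notation s0 := (rep0 sigma).
Local Notation ac := (act sigma).
Variables (A : option (ps_total F) -> Prop) (K : atom -> atom -> C).
Hypothesis K_conj : forall a b, Num.conj (K a b) = K b a.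
Hypothesis K_linr : forall a v, is_linear (fun h => K a (v, h)).
Local Notation X := {a : atom | A a.1}.
Hypothesis K_pd : forall s : seq X, 0 <= cre (\sum_(a <- s) \sum_(b <- s) K (sval a) (sval b)).

Let K_linl b a c h k : K (a, c *: h + k) b = Num.conj c * K (a, h) b + K (a, k) b.
Proof. by rewrite -[LHS]K_conj K_linr rmorphD rmorphM /= !K_conj. Qed.

(** Scalars are absorbed into the component in G, so that positivity of sums without coefficients
    implies positivity of the kernel. *)
Definition xscal c (a : X) : X :=
  exist (fun a : atom => A a.1) ((sval a).1, c *: (sval a).2) (svalP a).

Lemma K_xscal c d a b :
  K (sval (xscal c a)) (sval (xscal d b)) = Num.conj c * d * K (sval a) (sval b).
Proof.
case: a b => -[u g] ha [[v h] hb] /=.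
have eg : c *: g = c *: g + 0 by rewrite addr0.
have e0 : K (u, 0) (v, d *: h) = 0.
  by have := K_linl (v, d *: h) u 1 0 0; rewrite scale1r addr0 conjC1 mul1r => /eqP;
     rewrite addrC -subr_eq subrr eq_sym => /eqP.
by rewrite eg K_linl e0 addr0 (linZ (K_linr _ _)) mulrA.
Qed.

Lemma kernel_atoms : exists (V : lmodType C) (f : V -> V -> C) (e : X -> V),
  [/\ psd_form f, forall a b, f (e a) (e b) = K (sval a) (sval b),
      forall v, exists s : seq (C * X), v = \sum_(p <- s) p.1 *: e p.2 &
      forall v, (forall a, f (e a) v = 0) -> v = 0].
Proof.
apply: (@kernel_space R X (fun a b => K (sval a) (sval b))) => [a b|s]; first exact: K_conj.
have := K_pd [seq xscal p.1 p.2 | p <- s].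
rewrite big_map; under eq_bigr do rewrite big_map.
by under eq_bigr => p _ do under eq_bigr => q _ do rewrite K_xscal.
Qed.

Section Action.
Hypothesis A_lact : forall m p, A (Some p) -> A (Some (hlact m p)).
Hypothesis K_act : forall m a b, K (ac m a) b = K a (ac (cs_star m) b).
Hypothesis K_linx : forall a t h, is_linear (fun x : F t => K a (Some (mk x), h)).
Hypothesis K_bnd : forall a b, exists k : R, forall m, nr (K a (ac m b)) <= k * nr m.

Fact xact_subproof m (a : X) : A (ac m (sval a)).1.
Proof. by case: a => -[[p|] g] //= h; exact: A_lact. Qed.
Definition xact m (a : X) : X := exist _ (ac m (sval a)) (xact_subproof m a).

Lemma act_linl_K b a c m n :
  K b (ac (c *: m + n) a) = c * K b (ac m a) + K b (ac n a).
Proof.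
case: a => -[[t x]|] g; rewrite /act /=.
  by rewrite /hlact /= co_lact_linl (@K_linx b t g).
by rewrite (fr_linl (s0_rep cov)) K_linr.
Qed.

(** The action of M on atoms descends to the span: it has an adjoint for the kernel, so the image of
    a vanishing combination is orthogonal to all atoms and hence 0 by nondegeneracy. *)
Lemma kernel_rep : exists (V : lmodType C) (f : V -> V -> C) (e : X -> V) (rho : M -> V -> V),
  [/\ psd_form f, form_rep f rho,
      forall a b, f (e a) (e b) = K (sval a) (sval b),
      forall v, exists s : seq (C * X), v = \sum_(p <- s) p.1 *: e p.2 &
      (forall v, (forall a, f (e a) v = 0) -> v = 0) /\
      forall m a, rho m (e a) = e (xact m a)].
Proof.
have [V [f [e [ff fe sp nd]]]] := kernel_atoms.
have nde v w : (forall a, f (e a) v = f (e a) w) -> v = w.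
  move=> h; apply/eqP; rewrite -subr_eq0; apply/eqP/nd => a.
  by rewrite (psfDr ff) (psfNr ff) h subrr.
have fact m a b : f (e a) (e (xact m b)) = f (e (xact (cs_star m) a)) (e b).
  by rewrite !fe /= K_act cs_starK.
have ex m : exists T : V -> V, is_linear T /\ forall a, T (e a) = e (xact m a).
  apply: span_extend => // s hs; apply: nd => a; rewrite (psf_sumr ff).
  under eq_bigr => p _ do rewrite (psfZr ff) fact -(psfZr ff).
  by rewrite -(psf_sumr ff) hs (psf0r ff).
pose rho m := projT1 (cid (ex m)).
have rl m : is_linear (rho m) by rewrite /rho; case: cid => T [].
have rE m a : rho m (e a) = e (xact m a) by rewrite /rho; case: cid => T [].
exists V, f, e, rho; split=> //; split=> //.
- move=> v c m n; move: v; apply: (span_eq sp) => [|d u v|a].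
  + exact: rl.
  + by rewrite !rl; lmod R.
  rewrite !rE; apply: nde => b; rewrite (psfDr ff) (psfZr ff) !fe /=.
  exact: act_linl_K.
- move=> m n; apply: (span_eq sp) => [|c u v|a]; rewrite ?rl //.
  rewrite !rE; congr e; apply: eq_exist => /=.
  case: a => -[[p|] g] ha; rewrite /act /= ?hlactM //.
  by rewrite (fr_mul (s0_rep cov)).
- move=> m u v; have [s ->] := sp u; have [t ->] := sp v.
  rewrite !(lin_sum (rl _)) !(psf_suml ff); apply: eq_bigr => p _.
  rewrite !(psf_sumr ff); apply: eq_bigr => q _.
  rewrite !(linZ (rl _)) !(psfZl ff) !(psfZr ff) !rE; congr (_ * (_ * _)).
  by rewrite fact.
move=> u v; have [s ->] := sp u; have [t ->] := sp v.
pose k (p q : C * X) := projT1 (cid (K_bnd (sval p.2) (sval q.2))).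
exists (\sum_(p <- s) \sum_(q <- t) nr p.1 * nr q.1 * k p q) => m.
rewrite (lin_sum (rl _)) (psf_suml ff); apply: le_trans (nr_sum _ _ _) _.
rewrite mulr_suml; apply: ler_sum => p _.
rewrite (psf_sumr ff); apply: le_trans (nr_sum _ _ _) _.
rewrite mulr_suml; apply: ler_sum => q _.
rewrite (linZ (rl _)) (psfZl ff) (psfZr ff) !nrM nr_conj rE fe -!mulrA.
rewrite ler_wpM2l ?nr_ge0 // ler_wpM2l ?nr_ge0 //.
by rewrite /k; case: cid => k0 /=; exact.
Qed.

End Action.
End KernelRep.

(** * Positivity on products with a fixed first factor *)

Section Positivity.
Variables (R : realType) (S : nmodType) (M : cstar_algebra R).
Variable gen : forall T : correspondence M, set T -> Prop.
Variables (F : product_system S gen) (G : hilbert R) (sigma : rep_family F G).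
Local Notation C := (C R).
Hypotheses (tl : time_like S) (adj : adjointable_mul F) (cov : covariant_rep sigma).
Local Notation total := (ps_total F).
Local Notation atom := (atom F G).
Local Notation s0 := (rep0 sigma).
Local Notation ac := (act sigma).
Local Notation k := (kap sigma).
Local Notation k' := (kap' sigma).
Local Notation P := (proj_atom sigma).
Let kc := kap_conj tl adj cov.
Let fr0 := s0_rep cov.

Lemma kap'_conj a b : Num.conj (k' a b) = k' b a.
Proof.
have d (x y : G) : Num.conj (dot x y) = dot y x := dot_conj x y.
by rewrite /kap' rmorphB /= kc d.
Qed.

Lemma kap'_act m a b : k' (ac m a) b = k' a (ac (cs_star m) b).
Proof.
by rewrite /kap' (kap_act tl adj cov) !(proj_act cov) -(fr_adj fr0) cs_starK.
Qed.

Lemma kap'_linr a v : is_linear (fun h => k' a (v, h)).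
Proof.
move=> c h l; rewrite /kap' (kap_linr tl adj cov) /proj_atom /= sgo_linear dot_linr.
by rewrite opprD addrACA scalerBr.
Qed.

Lemma kap'_linx a t h : is_linear (fun x : F t => k' a (Some (mk x), h)).
Proof.
move=> c x y; rewrite /kap' (kap_linx tl adj cov).
have e z : P (Some (mk z), h) = sigma z h by [].
by rewrite !e (sigma_linear cov) dot_linr opprD addrACA scalerBr.
Qed.

Lemma kap'_bnd a b : exists K : R, forall m, nr (k' a (ac m b)) <= K * nr m.
Proof.
have [K1 h1] := nr_kap_act tl adj cov a b; have [K2 h2] := fr_bnd fr0 (P a) (P b).
exists (K1 + K2) => m; rewrite /kap' (proj_act cov) mulrDl.
by apply: le_trans (nrB _ _) _; apply: lerD.
Qed.

Definition pd (K : atom -> atom -> C) (A : option total -> Prop) : Prop :=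
  forall s : seq {a : atom | A a.1},
    0 <= cre (\sum_(a <- s) \sum_(b <- s) K (sval a) (sval b)).

Lemma pd_sub K (A B : option total -> Prop) : (forall u, B u -> A u) -> pd K A -> pd K B.
Proof.
move=> h hA s.
have := hA [seq exist (fun a : atom => A a.1) (sval a) (h _ (svalP a)) | a <- s].
by rewrite big_map; under eq_bigr do rewrite big_map.
Qed.

Lemma pd_none A : pd k' A -> pd k' (fun u => u = None \/ A u).
Proof.
move=> hA s.
pose f (a : {a : atom | a.1 = None \/ A a.1}) :=
  if pselect (A (sval a).1) is left h then Some (exist (fun a : atom => A a.1) (sval a) h)
  else None.
have H (L : atom -> C) : (forall g, L (None, g) = 0) ->
    \sum_(a <- s) L (sval a) = \sum_(a <- pmap f s) L (sval a).
  move=> L0; elim: s => [|a s ih]; rewrite ?big_nil //= big_cons ih /f.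
  case: pselect => h; first by rewrite /= big_cons.
  by case: a h => -[u g] [/= ->|//] _; rewrite L0 add0r.
rewrite (H (fun a => \sum_(b <- s) k' a (sval b))); last first.
  by move=> g; rewrite big1 // => b _; exact: kap'_none.
have e (a : atom) : \sum_(b <- s) k' a (sval b) = \sum_(b <- pmap f s) k' a (sval b).
  by apply: H => g; rewrite -[LHS]kap'_conj kap'_none ?conjC0.
under eq_bigr do rewrite e.
exact: hA.
Qed.

(** The last two terms form the kernel of 1 - T^* T for T : x (.) g |-> sigma(x) g, evaluated at the
    projections to G. *)
Lemma kap'_pmul p p' u v g h : tag p = tag p' ->
  k' (pmul p u, g) (pmul p' v, h) =
  k' (u, g) (ac (hin p p') (v, h)) + dot (P (u, g)) (s0 (hin p p') (P (v, h)))
    - dot (sg sigma p (P (u, g))) (sg sigma p' (P (v, h))).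
Proof.
move=> e; rewrite /kap' (kap_pmul tl adj cov) // (proj_act cov) !(proj_pmul cov).
by rewrite subrK.
Qed.

(** Allowing [u = None] includes the elements of F_r themselves. *)
Definition prods r (A : option total -> Prop) (w : option total) : Prop :=
  exists p u, [/\ tag p = r, w = pmul p u & u = None \/ A u].

(* Left multiplication by [F r] turns the kernel into the amplification of the
   left action of [M], and the projection onto [G] is a contraction there. *)
Lemma pd_prods r A : (forall m p, A (Some p) -> A (Some (hlact m p))) ->
  pd k' A -> pd k' (prods r A).
Proof.
move=> Al /pd_none hA s.
have Al' m p : Some p = None \/ A (Some p) -> Some (hlact m p) = None \/ A (Some (hlact m p)).
  by case=> // /Al; right.
have [V [f [e [rho [ff fr fe _ [_ rhoE]]]]]] :=
  kernel_rep cov kap'_conj kap'_linr hA Al' kap'_act kap'_linx kap'_bnd.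
have ex (a : {a : atom | prods r A a.1}) : exists xu : F r * {a : atom | a.1 = None \/ A a.1},
    sval a = (pmul (mk xu.1) (sval xu.2).1, (sval xu.2).2).
  case: a => -[w g] /= [p [u [/ex_mk[x ->] -> hu]]].
  by exists (x, exist (fun a : atom => a.1 = None \/ A a.1) (u, g) hu).
pose n := size s; pose a i := tnth (in_tuple s) i.
pose x i := (projT1 (cid (ex (a i)))).1; pose u i := (projT1 (cid (ex (a i)))).2.
have aE i : sval (a i) = (pmul (mk (x i)) (sval (u i)).1, (sval (u i)).2).
  by rewrite /x /u; case: cid.
rewrite big_tnth; under eq_bigr do rewrite big_tnth.
under eq_bigr => i _ do under eq_bigr => j _ do rewrite !aE kap'_pmul // -!surjective_pairing hinE.
under eq_bigr => i _ do rewrite sumrB big_split /=.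
rewrite sumrB big_split /= raddfB raddfD /=.
have h1 := gram_rep_ge0 x (fun i => e (u i)) ff fr.
have h2 := sigma_gram cov x (fun i => P (sval (u i))).
have h3 : cre (\sum_i \sum_j dot (sg sigma (mk (x i)) (P (sval (u i))))
    (sg sigma (mk (x j)) (P (sval (u j))))) = nr (\sum_j sigma (x j) (P (sval (u j)))) ^+ 2.
  rewrite -dot_sqn /sqn (psf_suml (dot_psd G)); congr cre.
  by apply: eq_bigr => i _; rewrite (psf_sumr (dot_psd G)).
have h4 : \sum_i \sum_j f (e (u i)) (rho (hm_inner (x i) (x j)) (e (u j))) =
    \sum_i \sum_j k' (sval (u i)) (ac (hm_inner (x i) (x j)) (sval (u j))).
  by apply: eq_bigr => i _; apply: eq_bigr => j _; rewrite rhoE fe.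
by rewrite h3 -addrA addr_ge0 ?subr_ge0 // -h4.
Qed.

Definition timed (T : S -> Prop) (u : option total) : Prop :=
  exists2 p, u = Some p & T (tag p).

Lemma timed_lact T m p : timed T (Some p) -> timed T (Some (hlact m p)).
Proof. by move=> [q [<-] h]; exists (hlact m p). Qed.

(** The semi-inner product of z (.) h and z' (.) h. Approximation is measured in its seminorm, which
    covers the norm and the sigma-weak setting uniformly. *)
Definition hform t (h : G) (z z' : F t) : C := dot h (s0 (hm_inner z z') h).

Lemma s0_ge0 m h : cs_ge0 m -> 0 <= cre (dot h (s0 m h)).
Proof.
move=> [n ->]; rewrite (fr_mul fr0) -(fr_adj fr0) cs_starK.
by have := sqn_ge0 (dot_psd G) (s0 n h).
Qed.

Lemma s0_ge0_ge0 m h : cs_ge0 m -> 0 <= dot h (s0 m h).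
Proof.
by move=> [n ->]; rewrite (fr_mul fr0) -(fr_adj fr0) cs_starK; exact: psf_ge0 (dot_psd G) _.
Qed.

Lemma hform_psd t h : psd_form (@hform t h).
Proof.
split=> [z c x y|x y|x]; rewrite /hform.
- by rewrite hm_inner_linr (fr_linl fr0) dot_linr.
- have d (x' y' : G) : Num.conj (dot x' y') = dot y' x' := dot_conj x' y'.
  by rewrite d -(hm_inner_star y x) (fr_adj fr0).
- exact/s0_ge0_ge0/hm_inner_ge0.
Qed.

End Positivity.

(** * Cauchy-Schwarz bound for the kernel *)

Section KernelBound.
Variables (R : realType) (S : nmodType) (M : cstar_algebra R).
Variable gen : forall T : correspondence M, set T -> Prop.
Variables (F : product_system S gen) (G : hilbert R) (sigma : rep_family F G).
Local Notation C := (C R).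
Hypotheses (tl : time_like S) (adj : adjointable_mul F) (cov : covariant_rep sigma).
Local Notation total := (ps_total F).
Local Notation atom := (atom F G).
Local Notation s0 := (rep0 sigma).
Local Notation ac := (act sigma).
Local Notation k := (kap sigma).
Local Notation k' := (kap' sigma).
Local Notation P := (proj_atom sigma).
Let kc := kap_conj tl adj cov.
Let fr0 := s0_rep cov.

Lemma cs_ge0_scale c (m : M) : 0 < c -> cs_ge0 (rc c *: m) -> cs_ge0 m.
Proof.
move=> c0 /(cs_ge0Z (ltW (_ : 0 < c^-1))) h.
have := h (_ : 0 < c^-1); rewrite invr_gt0 => /(_ c0).
by rewrite scalerA -rmorphM mulVf ?gt_eqF // rmorph1 scale1r.
Qed.

(** As <z, x w> = <w, w>, the square of c z - x w plus c <w, w> - <x w, x w> equals c times the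
    asserted positive element. *)
Lemma adjoint_le s r (x : F s) (z : F (s + r)) (w : F r) (c : R) : 0 < c -> nr x ^+ 2 <= c ->
  (forall y, hm_inner w y = hm_inner z (ps_mul x y)) ->
  cs_ge0 (rc c *: hm_inner z z - hm_inner w w).
Proof.
move=> c0 xc hw.
have [n hn] := hm_inner_ge0 x.
have nc : nr n ^+ 2 <= c by rewrite -nr_cstar -hn nr_hm.
have h1 : cs_ge0 (rc c *: hm_inner w w - hm_inner (ps_mul x w) (ps_mul x w)).
  have -> : hm_inner (ps_mul x w) (ps_mul x w) = hm_inner (co_lact n w) (co_lact n w).
    by rewrite ps_mul_inner hn co_lactM co_lact_adj.
  have -> : rc c *: hm_inner w w - hm_inner (co_lact n w) (co_lact n w) =
     (rc (nr n ^+ 2) *: hm_inner w w - hm_inner (co_lact n w) (co_lact n w))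
       + rc (c - nr n ^+ 2) *: hm_inner w w.
    by rewrite rmorphB scalerBl; lmod R.
  apply: cs_ge0D; first exact: lact_le.
  by apply: cs_ge0Z; [rewrite subr_ge0|exact: hm_inner_ge0].
have h2 := hm_inner_ge0 (rc c *: z - ps_mul x w).
have mf := hm_mform (F (s + r)).
have zw : hm_inner z (ps_mul x w) = hm_inner w w by rewrite -hw.
have wz : hm_inner (ps_mul x w) z = hm_inner w w by rewrite -hm_inner_star zw hm_inner_star.
apply: (cs_ge0_scale c0).
move: (cs_ge0D h1 h2); congr cs_ge0.
rewrite (mfDl mf) !(mfDr mf) !(mfNl mf) !(mfZl mf) !(mfNr mf) !(mfZr mf) zw wz conj_rc.
by rewrite !scalerBr !scalerN; lmod R.
Qed.

Local Notation hn h := (fnorm (@hform R S M gen F G sigma _ h)).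

Lemma hn_le t (z : F t) h : hn h z <= nr h * nr z.
Proof.
rewrite -(@ler_pXn2r _ 2) ?nnegrE ?mulr_ge0 ?fnorm_ge0 ?nr_ge0 //.
rewrite (fnorm_sqr (hform_psd cov _ h)) /sqn /hform.
apply: le_trans (cre_le_nr _) _; apply: le_trans (dot_CS _ _) _.
rewrite exprMn expr2 -mulrA ler_wpM2l ?nr_ge0 //.
apply: le_trans (nr_sigma cov _ _) _.
by rewrite nr_ps_unit nr_hm mulrC.
Qed.

Lemma kap_self t (z z' : F t) h : k (Some (mk z), h) (Some (mk z'), h) = hform sigma h z z'.
Proof.
by rewrite (kapE tl (u := Some _) (v := Some _) (w := Some _) _ _ (quot_same (erefl : tag (mk z) = tag (mk z')))) /= hinE.
Qed.

Lemma nr_sigma_hn t (z : F t) h : nr (sigma z h) <= hn h z.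
Proof.
rewrite -(@ler_pXn2r _ 2) ?nnegrE ?nr_ge0 ?fnorm_ge0 // (fnorm_sqr (hform_psd cov _ h)).
by have := sigma_gram cov (fun=> z : F t) (fun=> h : G) (n := 1); rewrite !big_ord1.
Qed.

(** A crude bound with |x| in place of the seminorm of x. It uses no positivity and serves to make
    the error z - d small. The 1 keeps the constant positive when x = 0. *)
Lemma nr_kap_direct (p : total) r (z : F (tag p + r)) g h :
  nr (k (Some p, g) (Some (mk z), h)) <= nr g * ((nr (tagged p) + 1) * hn h z).
Proof.
case: p z => s x /= z; have [w hw] := adj x z.
have hq : quot (mk x) (mk z) (mk w).
  by split=> // y /ex_mk[y' ->]; rewrite /hmul !hinE hw.
rewrite (kapE tl (u := Some _) (v := Some _) (w := Some _) _ _ hq).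
apply: le_trans (dot_CS _ _) _; rewrite ler_wpM2l ?nr_ge0 //.
apply: le_trans (nr_sigma_hn _ _) _.
have x0 := nr_ge0 x.
have c0 : 0 < (nr x + 1) ^+ 2 by rewrite exprn_gt0; lra.
have xc : nr x ^+ 2 <= (nr x + 1) ^+ 2 by rewrite ler_pXn2r ?nnegrE ?addr_ge0 // lerDl.
have := s0_ge0 cov h (adjoint_le c0 xc hw).
rewrite (linB (fr_linl fr0 h)) (linZ (fr_linl fr0 h)).
rewrite (psfDr (dot_psd G)) (psfNr (dot_psd G)) (psfZr (dot_psd G)) raddfB /= cre_rcM.
rewrite subr_ge0 => h1.
rewrite -(@ler_pXn2r _ 2) ?nnegrE ?mulr_ge0 ?fnorm_ge0 ?addr_ge0 //.
by rewrite exprMn !(fnorm_sqr (hform_psd cov _ h)).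
Qed.

Lemma pd_single r : pd k' (timed (eq^~ r) : option total -> Prop).
Proof.
have h : pd k' (prods r (fun _ : option total => False)).
  by apply: (pd_prods tl adj cov) => // -[|[[]]] //; rewrite big_nil.
apply: pd_sub h => u [p -> hp]; exists p, None; split=> //.
by left.
Qed.

Lemma pd_kap A : pd k' A -> pd k A.
Proof.
move=> hA s; have := hA s; rewrite /kap'.
under eq_bigr do rewrite sumrB.
rewrite sumrB raddfB /= subr_ge0; apply: le_trans.
have -> : \sum_(i <- s) \sum_(j <- s) dot (P (sval i)) (P (sval j)) =
   dot (\sum_(i <- s) P (sval i)) (\sum_(i <- s) P (sval i)).
  rewrite (psf_suml (dot_psd G)); apply: eq_bigr => i _.
  by rewrite (psf_sumr (dot_psd G)).
exact: (sqn_ge0 (dot_psd G)).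
Qed.

Lemma kap_linx_sum a t h n (x : 'I_n -> F t) :
  k a (Some (mk (\sum_i x i)), h) = \sum_i k a (Some (mk (x i)), h).
Proof. exact: (lin_sum (kap_linx tl adj cov a h (t := t))). Qed.

(** Both arguments have a first factor in F_s, so [pd_prods] over the single time r makes the kernel
    positive on them, and the Cauchy-Schwarz inequality applies. *)
Lemma nr_kap_prods s r (x : F s) n (y : 'I_n -> F s) (z : 'I_n -> F r) g h
    (d := \sum_i ps_mul (y i) (z i)) :
  nr (k (Some (mk x), g) (Some (mk d), h)) <= hn g x * hn h d.
Proof.
set A := prods s (timed (eq^~ r)) : option total -> Prop.
have hA : pd k A.
  by apply/pd_kap/(pd_prods tl adj cov); [move=> m p; exact: timed_lact|exact: pd_single].
have [V [f [e [ff fe _ _]]]] := kernel_atoms kc (kap_linr tl adj cov) hA.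
have Ax : A (Some (mk x)) by exists (mk x), None; split=> //; left.
have Ayz i : A (Some (mk (ps_mul (y i) (z i)))).
  by exists (mk (y i)), (Some (mk (z i))); split=> //; right; exists (mk (z i)).
pose a : {a : atom | A a.1} := exist (fun a : atom => A a.1) (Some (mk x), g) Ax.
pose b i : {a : atom | A a.1} := exist (fun a : atom => A a.1) (Some (mk (ps_mul (y i) (z i))), h) (Ayz i).
have e1 : k (Some (mk x), g) (Some (mk d), h) = f (e a) (\sum_i e (b i)).
  by rewrite kap_linx_sum (psf_sumr ff); apply: eq_bigr => i _; rewrite fe.
have e2 : sqn f (e a) = sqn (hform sigma g (t := s)) x by rewrite /sqn fe -kap_self.
have e3 : sqn f (\sum_i e (b i)) = sqn (hform sigma h (t := s + r)) d.
  rewrite /sqn -kap_self kap_linx_sum (psf_sumr ff); congr cre; apply: eq_bigr => i _.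
  rewrite -[RHS]kc kap_linx_sum rmorph_sum (psf_suml ff); apply: eq_bigr => j _ /=.
  by rewrite kc fe.
by rewrite e1; apply: le_trans (fnorm_CS ff _ _) _; rewrite /fnorm e2 e3.
Qed.

(** Density of products in the seminorms of [hform] only. It follows from norm density in the
    C*-case and from normality of sigma in the W*-case. *)
Definition dense_mul := forall s r (z : F (s + r)) (h : G) (e : R), 0 < e ->
  exists n (x : 'I_n -> F s) (y : 'I_n -> F r), hn h (z - \sum_i ps_mul (x i) (y i)) < e.

Hypothesis dm : dense_mul.

(** The sharp bound holds for sums of products d close to z, the crude bound controls z - d, and the
    error disappears in the limit. *)
Lemma nr_kap_hn s t (x : F s) (z : F t) g h :
  nr (k (Some (mk x), g) (Some (mk z), h)) <= hn g x * hn h z.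
Proof.
have H u r (x' : F u) (z' : F (u + r)) g' h' :
    nr (k (Some (mk x'), g') (Some (mk z'), h')) <= hn g' x' * hn h' z'.
  set K := hn g' x' + nr g' * (nr x' + 1).
  have K0 : 0 <= K by rewrite addr_ge0 ?fnorm_ge0 ?mulr_ge0 ?addr_ge0 ?nr_ge0.
  apply/ler_addgt0Pr => e e0.
  have e1 : 0 < e / (K + 1) by rewrite divr_gt0 //; lra.
  have [n [y [w hd]]] := dm z' h' e1; set d := \sum_i _ in hd.
  have ez : z' = (z' - d) + d by rewrite subrK.
  have pz := hform_psd cov (u + r) h'.
  rewrite {1}ez (linD (kap_linx tl adj cov _ h')).
  apply: le_trans (nrD _ _) _.
  have h1 := nr_kap_direct (p := mk x') (z' - d) g' h'.
  have h2 := nr_kap_prods x' y w g' h'; rewrite /= -/d in h2.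
  have h3 : hn h' d <= hn h' z' + hn h' (z' - d).
    by rewrite (fnormBC pz) [leRHS]addrC; have := fnormD pz (d - z') z'; rewrite subrK.
  apply: le_trans (lerD h1 h2) _ => /=.
  have h4 := ler_wpM2l (fnorm_ge0 (hform sigma g' (t := u)) x') h3.
  apply: (@le_trans _ _ (hn g' x' * hn h' z' + K * hn h' (z' - d))).
    have -> : hn g' x' * hn h' z' + K * hn h' (z' - d) =
      nr g' * ((nr x' + 1) * hn h' (z' - d)) + hn g' x' * (hn h' z' + hn h' (z' - d)).
      by rewrite /K; ring.
    by rewrite lerD2l.
  rewrite lerD2l; apply: (@le_trans _ _ ((K + 1) * hn h' (z' - d))).
    by rewrite ler_wpM2r ?fnorm_ge0 // lerDl.
  by rewrite mulrC -ler_pdivlMr ?ltW //; lra.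
case: (tl_total tl s t) => -[r e]; first by subst t; exact: H.
by subst s; rewrite -kc nr_conj mulrC; exact: H.
Qed.

(** The factor 2 in each argument absorbs the two terms of [kap'], each bounded by the product of
    the seminorms. *)
Definition anorm (a : atom) : R := if a.1 is Some p then 2 * hn a.2 (tagged p) else 0.

Lemma nr_kap' a b : nr (k' a b) <= anorm a * anorm b.
Proof.
have k0 c g : k' c (None, g) = 0 by rewrite -(kap'_conj tl adj cov) (kap'_none tl) conjC0.
case: a b => -[[s x]|] g [[[t z]|] h]; rewrite ?(kap'_none tl) ?k0 ?nr0 /anorm /= ?mulr0 ?mul0r //.
rewrite /kap'; apply: le_trans (nrB _ _) _.
apply: le_trans (lerD (nr_kap_hn x z g h) (dot_CS _ _)) _.
have h1 : nr (P (Some (mk x), g)) <= hn g x := nr_sigma_hn x g.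
have h2 : nr (P (Some (mk z), h)) <= hn h z := nr_sigma_hn z h.
have := ler_pM (nr_ge0 _) (nr_ge0 _) h1 h2.
have : 0 <= hn g x * hn h z by rewrite mulr_ge0 ?fnorm_ge0.
have -> : 2 * hn g x * (2 * hn h z) = 4 * (hn g x * hn h z) by ring.
lra.
Qed.

End KernelBound.

(** * Positivity at all times *)

Section AllTimes.
Variables (R : realType) (S : nmodType) (M : cstar_algebra R).
Variable gen : forall T : correspondence M, set T -> Prop.
Variables (F : product_system S gen) (G : hilbert R) (sigma : rep_family F G).
Local Notation C := (C R).
Hypotheses (tl : time_like S) (adj : adjointable_mul F) (cov : covariant_rep sigma).
Hypothesis dm : dense_mul sigma.
Local Notation total := (ps_total F).
Local Notation atom := (atom F G).
Local Notation k' := (kap' sigma).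
Local Notation N := (anorm sigma).
Let kc' := kap'_conj tl adj cov.

Definition shift r (T : S -> Prop) (t : S) : Prop := t = r \/ exists2 t', T t' & t = r + t'.

Lemma anorm_ge0 a : 0 <= N a.
Proof. by rewrite /anorm; case: a.1 => [p|] //; rewrite mulr_ge0 ?fnorm_ge0. Qed.

(** The approximant [a'] carries a sum of products, so it need not itself be an atom over [prods];
    what matters is that the kernel sees it as a sum of such atoms. *)
Lemma approx_atom r (T : S -> Prop) (a : atom) (e : R) :
  0 < e -> timed (shift r T) a.1 ->
  exists a' m (b : 'I_m -> {a : atom | prods r (timed T) a.1}),
  [/\ forall c, k' c a' = \sum_i k' c (sval (b i)),
      forall c, nr (k' c a - k' c a') <= N c * e & N a' <= N a + e].
Proof.
move=> e0; case: a => u h [[t z] /= -> [tr|[t' Tt' te]]].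
  have hb : prods r (timed T) (Some (mk z)) by exists (mk z), None; split=> //; left.
  exists (Some (mk z), h), 1%N, (fun=> exist (fun a : atom => prods r (timed T) a.1) (Some (mk z), h) hb).
  split=> [c|c|]; first by rewrite big_ord1.
    by rewrite subrr nr0 mulr_ge0 ?anorm_ge0 ?ltW.
  by rewrite lerDl ltW.
subst t; have e2 : 0 < e / 2 by rewrite divr_gt0.
have [n [x [y hd]]] := dm z h e2; set d := \sum_i _ in hd.
have hb i : prods r (timed T) (Some (mk (ps_mul (x i) (y i)))).
  by exists (mk (x i)), (Some (mk (y i))); split=> //; right; exists (mk (y i)).
exists (Some (mk d), h), n,
  (fun i => exist (fun a : atom => prods r (timed T) a.1) (Some (mk (ps_mul (x i) (y i))), h) (hb i)).
have hd2 : N (Some (mk (z - d)), h) <= e by rewrite /anorm /=; lra.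
split=> [c|c|].
- exact: (lin_sum (kap'_linx tl adj cov c h)).
- rewrite -(linB (kap'_linx tl adj cov c h)).
  apply: le_trans (nr_kap' tl adj cov dm _ _) _.
  by rewrite ler_wpM2l ?anorm_ge0.
have pz := hform_psd cov (r + t') h.
have := fnormD pz (d - z) z; rewrite subrK (fnormBC pz).
by move: hd; rewrite /anorm /=; lra.
Qed.

(** A finite Gram matrix is perturbed: replacing each atom by its approximant changes the sum by at
    most [d * K], and the perturbed sum is the square of a vector in the space over products. *)
Lemma pd_shift r (T : S -> Prop) :
  pd k' (prods r (timed T) : option total -> Prop) ->
  pd k' (timed (shift r T) : option total -> Prop).
Proof.
move=> hB s.
have [V [f [e [ff fe _ _]]]] := kernel_atoms kc' (kap'_linr tl adj cov) hB.
pose n := size s; pose a i : atom := sval (tnth (in_tuple s) i).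
have aT i : timed (shift r T) (a i).1 by rewrite /a; case: (tnth _ _).
rewrite big_tnth; under eq_bigr do rewrite big_tnth.
change (0 <= cre (\sum_(i < n) \sum_(j < n) k' (a i) (a j))).
(* The 1 accounts for [N (a' j) <= N (a j) + d] with d at most 1. *)
pose K := \sum_(i < n) \sum_(j < n) (N (a i) + N (a j) + 1).
have K0 : 0 <= K.
  by apply: sumr_ge0 => i _; apply: sumr_ge0 => j _; rewrite !addr_ge0 ?anorm_ge0.
apply/ler_addgt0Pr => eps eps0.
pose d := Num.min 1 (eps / (K + 1)).
have d1 : d <= 1 by rewrite ge_min lexx.
have dK : d * K <= eps.
  apply: (@le_trans _ _ (d * (K + 1))).
    by rewrite ler_wpM2l ?lerDl // le_min ler01 divr_ge0 ?ltW //; lra.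
  rewrite -ler_pdivlMr; last by lra.
  by rewrite /d ge_min lexx orbT.
have d0 : 0 < d by rewrite lt_min ltr01 divr_gt0 //; lra.
pose A i := cid (approx_atom d0 (aT i)).
pose a' i := projT1 (A i).
have ex i : exists w : V,
  [/\ forall c, nr (k' c (a i) - k' c (a' i)) <= N c * d, N (a' i) <= N (a i) + d &
      exists m (b : 'I_m -> {a : atom | prods r (timed T) a.1}),
        (forall c, k' c (a' i) = \sum_i k' c (sval (b i))) /\ w = \sum_i e (b i)].
  rewrite /a'; case: (A i) => c [m [b [h1 h2 h3]]] /=.
  by exists (\sum_i e (b i)); split=> //; exists m, b.
pose w i := projT1 (cid (ex i)).
have h2 i c : nr (k' c (a i) - k' c (a' i)) <= N c * d by case: (projT2 (cid (ex i))).
have h3 i : N (a' i) <= N (a i) + d by case: (projT2 (cid (ex i))).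
have h1 i j : k' (a' i) (a' j) = f (w i) (w j).
  rewrite /w; case: (projT2 (cid (ex i))) => _ _ [m [b [hb ->]]].
  case: (projT2 (cid (ex j))) => _ _ [m' [b' [hb' ->]]].
  rewrite hb' (psf_sumr ff); apply: eq_bigr => l _.
  rewrite -kc' hb rmorph_sum (psf_suml ff); apply: eq_bigr => l' _ /=.
  by rewrite kc' fe.
have pos : 0 <= cre (\sum_i \sum_j k' (a' i) (a' j)).
  suff -> : \sum_i \sum_j k' (a' i) (a' j) = f (\sum_i w i) (\sum_i w i) by exact: (sqn_ge0 ff).
  rewrite (psf_suml ff); apply: eq_bigr => i _.
  by rewrite (psf_sumr ff); apply: eq_bigr => j _.
have diff : nr (\sum_i \sum_j k' (a' i) (a' j) - \sum_i \sum_j k' (a i) (a j)) <= d * K.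
  rewrite -sumrB /K mulr_sumr; apply: le_trans (nr_sum _ _ _) _; apply: ler_sum => i _.
  rewrite -sumrB mulr_sumr; apply: le_trans (nr_sum _ _ _) _; apply: ler_sum => j _.
  have -> : k' (a' i) (a' j) - k' (a i) (a j) =
      - (k' (a i) (a' j) - k' (a' i) (a' j)) - (k' (a i) (a j) - k' (a i) (a' j)) by ring.
  apply: le_trans (nrB _ _) _; rewrite nrN.
  have e1 : nr (k' (a i) (a' j) - k' (a' i) (a' j)) <= N (a' j) * d.
    by rewrite -kc' -[X in _ - X]kc' -rmorphB nr_conj; exact: h2.
  apply: le_trans (lerD e1 (h2 j (a i))) _.
  rewrite -mulrDl mulrC ler_wpM2l ?(ltW d0) //.
  have := h3 j; lra.
have := le_trans (cre_le_nr _) (le_trans diff dK); rewrite raddfB /=; lra.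
Qed.

Lemma exists_min (l : seq S) : l != [::] ->
  exists2 m, m \in l & forall t, t \in l -> exists d, t = m + d.
Proof.
elim: l => // x l ih _; have [->|/ih[m ml hm]] := eqVneq l [::].
  by exists x; rewrite ?mem_head // => t; rewrite inE => /eqP ->; exists 0; rewrite addr0.
case: (tl_total tl x m) => -[r e].
  exists x; rewrite ?mem_head // => t; rewrite inE => /predU1P[->|/hm[d ->]].
    by exists 0; rewrite addr0.
  by exists (r + d); rewrite e addrA.
exists m; rewrite ?inE ?ml ?orbT // => t /predU1P[->|/hm //].
by exists r.
Qed.

Lemma pd_times (l : seq S) : pd k' (timed (fun t => t \in l) : option total -> Prop).
Proof.
move: {2}(size l) (leqnn (size l)) => n; elim: n l => [|n ih] l.
  rewrite leqn0 size_eq0 => /eqP -> [|a s]; first by rewrite big_nil.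
  by case: a => a [].
move=> sl; have [l0|/exists_min[m ml hm]] := eqVneq l [::].
  by apply: ih; rewrite l0.
pose d t := if pselect (exists d, t = m + d) is left h then projT1 (cid h) else 0.
have dE t : t \in l -> t = m + d t.
  by move=> /hm h; rewrite /d; case: pselect => // h'; case: cid.
have hd : (size [seq d t | t <- rem m l] <= n)%N.
  by rewrite size_map size_rem //; move: sl; case: (size l).
have h := pd_shift (pd_prods tl adj cov (r := m) (@timed_lact _ _ _ _ F _) (ih _ hd)).
apply: pd_sub h => u [p -> pl]; exists p => //.
move: (pl); rewrite (perm_mem (perm_to_rem ml)) inE => /predU1P[->|pr]; first by left.
by right; exists (d (tag p)); [exact: map_f|exact: dE].
Qed.

Lemma pd_all : pd (kap sigma) (fun _ : option total => True).
Proof.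
apply: pd_kap.
have h : pd k' (timed (fun=> True) : option total -> Prop).
  move=> s'; pose l := [seq (if (sval a).1 is Some p then tag p else 0) | a <- s'].
  have hl a : List.In a s' -> timed (fun t => t \in l) (sval a).1.
    rewrite /l {l}; elim: s' => //= a' s' ih [->|/ih].
      by case: (svalP a) => p e _; exists p; rewrite // e mem_head.
    by case=> p hp hpl; exists p; rewrite // in_cons hpl orbT.
  move: l hl => l hl.
  suff [t e] : exists t : seq {a : atom | timed (fun t => t \in l) a.1},
      map sval s' = map sval t.
    have := pd_times t.
    rewrite -(big_map sval xpredT (fun a => \sum_(b <- t) k' a (sval b))) -e big_map.
    under eq_bigr => a _ do
      rewrite -(big_map sval xpredT (fun b => k' (sval a) b)) -e big_map.
    exact.
  elim: s' hl => [|a s' ih] hl /=; first by exists [::].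
  have [|t ->] := ih; first by move=> b hb; apply: hl; right.
  by exists (exist (fun a : atom => timed (fun t => t \in l) a.1) (sval a) (hl a (or_introl erefl)) :: t).
have := pd_none tl adj cov h; apply: pd_sub => -[p|] _; last by left.
by right; exists p.
Qed.

End AllTimes.

(** * Continuity arguments on dense subspaces *)

Section DenseMaps.
Variable R : realType.
Local Notation C := (C R).

Lemma cvg_nsum (V : normedModType C) (I : Type) (r : seq I) (f : I -> nat -> V) (l : I -> V) :
  (forall i, f i n @[n --> \oo] --> l i) ->
  (\sum_(i <- r) f i n) @[n --> \oo] --> \sum_(i <- r) l i.
Proof.
move=> h; elim: r => [|i r ih].
  by rewrite big_nil; under eq_fun do rewrite big_nil; exact: cvg_cst.
by rewrite big_cons; under eq_fun do rewrite big_cons; exact: cvgD.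
Qed.

Lemma cvg_rsum (I : Type) (r : seq I) (f : I -> nat -> R) (l : I -> R) :
  (forall i, f i n @[n --> \oo] --> l i) ->
  (\sum_(i <- r) f i n) @[n --> \oo] --> \sum_(i <- r) l i.
Proof.
move=> h; elim: r => [|i r ih].
  by rewrite big_nil; under eq_fun do rewrite big_nil; exact: cvg_cst.
by rewrite big_cons; under eq_fun do rewrite big_cons; exact: cvgD.
Qed.

Lemma cvg_nr (V : normedModType C) (v : nat -> V) (l : V) :
  v n @[n --> \oo] --> l -> nr (v n) @[n --> \oo] --> nr l.
Proof.
move=> /cvg_nr_eps h; apply/cvgrPdist_lt => e e0; have [N hN] := h e e0.
exists N => // n Nn /=; apply: le_lt_trans (hN n Nn).
rewrite ler_norml; have := nrD (v n) (l - v n); have := nrD l (v n - l).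
by rewrite ![_ + (_ - _)]addrC !subrK (nrBC l); lra.
Qed.

Variables (V : lmodType C) (H : normedModType C) (j : V -> H).
Hypothesis dense : forall h (e : R), 0 < e -> exists v, nr (h - j v) < e.

Lemma dense_seq (h : H) : exists v : nat -> V, (j (v n) : H) @[n --> \oo] --> h.
Proof.
have inv_gt0 n : 0 < n.+1%:R^-1 :> R by rewrite invr_gt0 ltr0n.
pose v n := projT1 (cid (dense h (inv_gt0 n))).
have hv n : nr (h - j (v n)) < n.+1%:R^-1 by rewrite /v; case: cid.
exists v; apply/cvg_nr_eps => e e0; have [N hN] := invn_small e0.
by exists N => n Nn; rewrite nrBC; exact: lt_trans (hv n) (hN n Nn).
Qed.

Lemma dense_eq (W : normedModType C) (f g : H -> W) : continuous f -> continuous g ->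
  (forall v, f (j v) = g (j v)) -> forall h, f h = g h.
Proof.
move=> cf cg e h; have [v hv] := dense_seq h.
have h1 : f (j (v n)) @[n --> \oo] --> f h by apply: continuous_cvg hv; exact: cf.
have h2 : g (j (v n)) @[n --> \oo] --> g h by apply: continuous_cvg hv; exact: cg.
apply: (cvg_unique_nr h1); move: h2.
by under eq_fun do rewrite -e.
Qed.

End DenseMaps.

Section DotContinuity.
Variables (R : realType) (H : hilbert R).
Local Notation C := (C R).

Lemma dot_contr (g : H) : continuous (fun h : H => dot g h : C).
Proof.
move=> x; apply: (@cvg_lip R H C (fun h => dot g h) (nr g)) => // u v.
by rewrite -(psfNr (dot_psd H)) -(psfDr (dot_psd H)); exact: dot_CS.
Qed.

Lemma dot_contl (h : H) : continuous (fun g : H => dot g h : C).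
Proof.
move=> x; apply: (@cvg_lip R H C (fun g => dot g h) (nr h)) => // u v.
by rewrite -(psfNl (dot_psd H)) -(psfDl (dot_psd H)) mulrC; exact: dot_CS.
Qed.

Lemma bop_bounded (a : bounded_op H) : exists2 K : R, 0 <= K & forall h, nr (a h) <= K * nr h.
Proof.
have [r r0 small] : exists2 r : R, 0 < r & forall h, nr h < r -> nr (a h) < 1.
  have /cvgrPdist_lt/(_ 1 ltr01) := @bop_continuous _ _ a (0 : H).
  rewrite linear0 => /nbhs_ballP[e /= e0 he].
  have ee : e = rc (cre e) by apply: ge0_rc; exact: ltW.
  exists (cre e) => [|h hh]; first by move: e0; rewrite {1}ee -(rmorph0 (@rc R)) ltr_rc.
  have := he h; rewrite -ball_normE /ball_ /= sub0r normrN => H1.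
  have : `|0 - a h| < 1 by apply: H1; rewrite ee normE ltr_rc.
  by rewrite sub0r normrN normE -(rmorph1 (@rc R)) ltr_rc.
exists (2 / r) => [|h]; first by rewrite divr_ge0 ?ltW.
have [h0|hn0] := eqVneq (nr h) 0.
  by rewrite (nr_eq0 h0) linear0 !nr0 mulr0.
have hp : 0 < nr h by rewrite lt_neqAle eq_sym hn0 nr_ge0.
have := small (rc (r / (2 * nr h)) *: h); rewrite linearZ /= !nrZ nr_rc.
rewrite gtr0_norm ?divr_gt0 ?mulr_gt0 // => /(_ _)/ltW; rewrite -ler_pdivlMl ?divr_gt0 ?mulr_gt0 //.
have -> : (r / (2 * nr h))^-1 * 1 = 2 / r * nr h by field; apply/andP; split; lra.
apply; have -> : r / (2 * nr h) * nr h = r / 2 by field; lra.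
lra.
Qed.

Lemma bop_cvg (a : bounded_op H) (v : nat -> H) (l : H) :
  v n @[n --> \oo] --> l -> a (v n) @[n --> \oo] --> a l.
Proof.
have [K _ hK] := bop_bounded a; apply: (cvg_lip (K := K)) => x y.
by rewrite -linearB.
Qed.

Lemma bop_cont_lin (a b : bounded_op H) (c : C) : continuous (fun h : H => c *: a h + b h : H).
Proof.
have [K _ hK] := bop_bounded a; have [K' _ hK'] := bop_bounded b.
move=> x; apply: (@cvg_lip R H H (fun h => c *: a h + b h) (nr c * K + K')) => // u v.
have -> : c *: a u + b u - (c *: a v + b v) = c *: a (u - v) + b (u - v).
  by rewrite !linearB opprD addrACA.
by apply: le_trans (nrD _ _) _; rewrite nrZ mulrDl -mulrA lerD // ler_wpM2l ?nr_ge0.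
Qed.

Lemma bop_comp_cont (a b : bounded_op H) : continuous (fun h => a (b h)).
Proof. by move=> x; apply: continuous_comp; [exact: bop_continuous|exact: bop_continuous]. Qed.

Lemma dot_bop_contr (g : H) (a : bounded_op H) : continuous (fun h : H => dot g (a h) : C).
Proof. by move=> x; apply: continuous_comp; [exact: bop_continuous|exact: dot_contr]. Qed.

Lemma dot_bop_contl (h : H) (a : bounded_op H) : continuous (fun g : H => dot (a g) h : C).
Proof.
move=> x; apply: (@continuous_comp _ _ _ a (fun g : H => dot g h : C)); first exact: bop_continuous.
exact: dot_contl.
Qed.

End DotContinuity.

(** * The dilation *)

Section Dilation.
Variables (R : realType) (S : nmodType) (M : cstar_algebra R).
Variable gen : forall T : correspondence M, set T -> Prop.
Variables (F : product_system S gen) (G : hilbert R) (sigma : rep_family F G).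
Local Notation C := (C R).
Hypotheses (tl : time_like S) (adj : adjointable_mul F) (cov : covariant_rep sigma).
Hypothesis dm : dense_mul sigma.
Local Notation total := (ps_total F).
Local Notation atom := (atom F G).
Local Notation s0 := (rep0 sigma).
Local Notation k := (kap sigma).
Let kc := kap_conj tl adj cov.
Let fr0 := s0_rep cov.

Section Algebraic.
Variables (V : lmodType C) (f : V -> V -> C) (e : atom -> V) (rho : M -> V -> V).
Hypotheses (ff : psd_form f) (fr : form_rep f rho).
Hypothesis fe : forall a b, f (e a) (e b) = k a b.
Hypothesis sp : forall v, exists s : seq (C * atom), v = \sum_(p <- s) p.1 *: e p.2.
Hypothesis nd : forall v, (forall a, f (e a) v = 0) -> v = 0.
Hypothesis rhoE : forall m a, rho m (e a) = e (act sigma m a).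

(** The hypotheses make <e a - e b, e a - e b> vanish. This is how the relations between the formal
    atoms are recovered in the space. *)
Lemma atom_eq a b : k a a = k a b -> k b b = k a b -> e a = e b.
Proof.
move=> h1 h2; apply/eqP; rewrite -subr_eq0; apply/eqP/nd => c.
apply: (psf_CS_eq0 ff); rewrite /sqn (psfDr ff) !(psfDl ff) !(psfNl ff) !(psfNr ff) !fe.
by rewrite -(kc a b) h2 -!h1 kc opprK subrr add0r addNr.
Qed.

Lemma kap_dot t (y z : F t) g h :
  k (Some (mk y), g) (Some (mk z), h) = dot g (s0 (hm_inner y z) h).
Proof.
by rewrite (kapE tl (u := Some _) (v := Some _) (w := Some _) _ _
  (quot_same (erefl : tag (mk y) = tag (mk z)))) hinE.
Qed.

(** Here the formal unit [None] is tied to F_0: tau_0(m) V g = V sigma_0(m) g. *)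
Lemma atom_unit m g : e (Some (mk (ps_unit F m)), g) = e (None, s0 m g).
Proof.
have e1 : k (Some (mk (ps_unit F m)), g) (Some (mk (ps_unit F m)), g) = dot g (s0 (cs_star m ** m) g).
  by rewrite kap_dot ps_unit_inner.
have e2 : k (None, s0 m g) (None, s0 m g) = dot g (s0 (cs_star m ** m) g).
  by rewrite (kapE tl (w := None)) //= (fr_mul fr0) -[in RHS](fr_adj fr0) cs_starK.
have e3 : k (Some (mk (ps_unit F m)), g) (None, s0 m g) = dot g (s0 (cs_star m ** m) g).
  by rewrite -kc (kapE tl (w := Some (mk (ps_unit F m)))) //= (dot_conj _ _) (fr_mul fr0) -[in RHS](fr_adj fr0) cs_starK.
by apply: atom_eq; rewrite ?e1 ?e2 e3.
Qed.

Lemma atom_ract t (x : F t) m g : e (Some (mk (hm_ract x m)), g) = e (Some (mk x), s0 m g).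
Proof.
have mf := hm_mform (F t).
have e1 : k (Some (mk (hm_ract x m)), g) (Some (mk (hm_ract x m)), g) =
    dot g (s0 (cs_star m ** (hm_inner x x ** m)) g).
  by rewrite kap_dot (mf_ractl mf) hm_inner_ract.
have e2 : k (Some (mk x), s0 m g) (Some (mk x), s0 m g) =
    dot g (s0 (cs_star m ** (hm_inner x x ** m)) g).
  by rewrite kap_dot !(fr_mul fr0) -[in RHS](fr_adj fr0) cs_starK.
have e3 : k (Some (mk (hm_ract x m)), g) (Some (mk x), s0 m g) =
    dot g (s0 (cs_star m ** (hm_inner x x ** m)) g).
  by rewrite kap_dot (mf_ractl mf) !(fr_mul fr0).
by apply: atom_eq; rewrite ?e1 ?e2 e3.
Qed.

Definition latom t (x : F t) (a : atom) : atom := (pmul (mk x) a.1, a.2).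

Lemma latom_form t (x y : F t) a b :
  f (e (latom x a)) (e (latom y b)) = f (e a) (rho (hm_inner x y) (e b)).
Proof.
by case: a b => u g [v h]; rewrite rhoE !fe /latom (kap_pmul tl adj cov) // hinE.
Qed.

Lemma latom_form_sum t (x y : F t) (s s' : seq (C * atom)) :
  f (\sum_(p <- s) p.1 *: e (latom x p.2)) (\sum_(q <- s') q.1 *: e (latom y q.2)) =
  f (\sum_(p <- s) p.1 *: e p.2) (rho (hm_inner x y) (\sum_(q <- s') q.1 *: e q.2)).
Proof.
rewrite (lin_sum (fr_linr fr _)) !(psf_suml ff); apply: eq_bigr => p _.
rewrite !(psf_sumr ff); apply: eq_bigr => q _.
by rewrite (linZ (fr_linr fr _)) !(psfZl ff) !(psfZr ff) latom_form.
Qed.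

(** Well defined because the square of the image is a value of the form at the original combination,
    with <x, x> acting. *)
Lemma lmul_ex t (x : F t) : exists T : V -> V, is_linear T /\ forall a, T (e a) = e (latom x a).
Proof.
apply: (span_extend sp) => s hs; apply: nd => a; apply: (psf_CS_eq0 ff).
by rewrite /sqn latom_form_sum hs (lin0 (fr_linr fr _)) (psf0r ff).
Qed.

Definition lmul t (x : F t) : V -> V := projT1 (cid (lmul_ex x)).

Lemma lmul_linear t (x : F t) : is_linear (lmul x).
Proof. by rewrite /lmul; case: cid => T []. Qed.

Lemma lmulE t (x : F t) a : lmul x (e a) = e (latom x a).
Proof. by rewrite /lmul; case: cid => T []. Qed.

Lemma lmul_form t (x y : F t) u v : f (lmul x u) (lmul y v) = f u (rho (hm_inner x y) v).
Proof.
have [s ->] := sp u; have [s' ->] := sp v; rewrite -latom_form_sum.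
rewrite !(lin_sum (lmul_linear _)); congr f; apply: eq_bigr => p _;
  by rewrite (linZ (lmul_linear _)) lmulE.
Qed.

Lemma sqn_lmul_mx t p n (X : 'I_p -> 'I_n -> F t) (v : 'I_n -> V) (K : R) : 0 <= K ->
  (forall m : 'I_n -> M, let Xm i := \sum_j hm_ract (X i j) (m j) in
     nr (\sum_i hm_inner (Xm i) (Xm i)) <= K ^+ 2 * nr (\sum_j cs_star (m j) ** m j)) ->
  \sum_i sqn f (\sum_j lmul (X i j) (v j)) <= K ^+ 2 * \sum_j sqn f (v j).
Proof.
move=> K0 hX; have := mx_rep_le v ff fr K0 hX; congr (_ <= _).
rewrite /sqn -raddf_sum; congr cre.
under [RHS]eq_bigr => i _.
  rewrite (psf_suml ff).
  under eq_bigr => j _.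
    rewrite (psf_sumr ff).
    under eq_bigr => l _ do rewrite lmul_form.
    over.
  over.
rewrite [RHS]exchange_big; apply: eq_bigr => j _ /=.
rewrite [RHS]exchange_big; apply: eq_bigr => l _ /=.
by rewrite (lin_sum (fr_linl fr _)) (psf_sumr ff).
Qed.

Lemma sqn_lmul t (x : F t) v : sqn f (lmul x v) <= nr x ^+ 2 * sqn f v.
Proof.
have := @sqn_lmul_mx t 1 1 (fun _ _ => x) (fun=> v) (nr x) (nr_ge0 x).
rewrite !big_ord1; apply => m /=; rewrite !big_ord1 nr_hm nr_cstar -exprMn.
by rewrite ler_pXn2r ?nnegrE ?mulr_ge0 ?nr_ge0 // nr_ract.
Qed.

Lemma lmul_linl t a (x y : F t) v : lmul (a *: x + y) v = a *: lmul x v + lmul y v.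
Proof.
move: v; apply: (span_eq sp) => [|c u v|b]; first exact: lmul_linear.
  by rewrite !lmul_linear; lmod R.
rewrite !lmulE; apply/eqP; rewrite -subr_eq0; apply/eqP/nd => c.
rewrite (psfDr ff) (psfNr ff) (psfDr ff) (psfZr ff) !fe /latom.
case: b => -[[t' z]|] h; rewrite /pmul /hmul /=.
  by rewrite ps_mul_linl (kap_linx tl adj cov c h) subrr.
by rewrite (kap_linx tl adj cov c h) subrr.
Qed.

Lemma lmul_unit m v : lmul (ps_unit F m) v = rho m v.
Proof.
move: v; apply: (span_eq sp); [exact: lmul_linear|exact: (fr_linr fr)|].
move=> [[p|] g]; rewrite lmulE rhoE /latom /act /pmul /=; first by rewrite hmul_unit.
exact: atom_unit.
Qed.

Lemma lmul_bimodule t m1 (x : F t) m2 v :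
  lmul (hm_ract (co_lact m1 x) m2) v = rho m1 (lmul x (rho m2 v)).
Proof.
move: v; apply: (span_eq sp) => [|a u v|[[[t' y]|] g]].
- exact: lmul_linear.
- by rewrite (fr_linr fr) lmul_linear (fr_linr fr).
- rewrite rhoE !lmulE rhoE /latom /act /pmul /= /hlact /hmul /=.
  by rewrite ps_mul_balanced ps_mul_lact.
by rewrite rhoE !lmulE rhoE /latom /act /= atom_ract.
Qed.

Lemma lmul_mul s t (x : F s) (y : F t) v : lmul (ps_mul x y) v = lmul x (lmul y v).
Proof.
move: v; apply: (span_eq sp) => [|a u v|[[p|] g]].
- exact: lmul_linear.
- by rewrite !lmul_linear.
- by rewrite !lmulE /latom /pmul /= -hmulA.
by rewrite !lmulE.
Qed.

Lemma base_linear : is_linear (fun g => e (None, g)).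
Proof.
move=> c g h; apply/eqP; rewrite -subr_eq0; apply/eqP/nd => a.
rewrite (psfDr ff) (psfNr ff) (psfDr ff) (psfZr ff) !fe.
by rewrite (kap_linr tl adj cov) subrr.
Qed.

(** This is the adjoint of V on the span of atoms: <V z, e a> = <z, proj a>, so a vanishing
    combination is sent to a vector z with <z, z> = 0. *)
Lemma coproj_ex : exists T : V -> G, is_linear T /\ forall a, T (e a) = proj_atom sigma a.
Proof.
apply: (span_extend sp) => s hs.
set z := \sum_(p <- s) _; apply: nr_eq0; apply/eqP.
rewrite -sqrf_eq0 -dot_sqn /sqn.
suff -> : dot z z = f (e (None, z)) (\sum_(p <- s) p.1 *: e p.2).
  by rewrite hs (psf0r ff).
rewrite {2}/z (psf_sumr ff) (psf_sumr (dot_psd G)); apply: eq_bigr => p _.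
by rewrite (psfZr (dot_psd G)) (psfZr ff) fe; case: p => c [u g]; rewrite (kapE tl (w := u)).
Qed.

Lemma coproj_form (T : V -> G) g v : is_linear T ->
  (forall a, T (e a) = proj_atom sigma a) -> dot g (T v) = f (e (None, g)) v.
Proof.
move=> lT hT; have [s ->] := sp v; rewrite (lin_sum lT) (psf_sumr (dot_psd G)) (psf_sumr ff).
apply: eq_bigr => p _; rewrite (linZ lT) (psfZr (dot_psd G)) (psfZr ff) fe hT.
by case: p => c [u h]; rewrite (kapE tl (w := u)).
Qed.

End Algebraic.

(** The atoms, their inner products and their totality are part of the conclusion, since normality
    of the dilation is tested on them. *)
Theorem dilation_exists : exists (H : hilbert R) (V : G -> H) (tau : rep_family F H) (e : atom -> H),
  [/\ isometric_dilation sigma V tau,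
      forall a b, dot (e a) (e b) = k a b,
      forall t (x : F t) a, tau t x (e a) = e (latom x a) &
      forall h (eps : R), 0 < eps ->
        exists s : seq (C * atom), nr (h - \sum_(p <- s) p.1 *: e p.2) < eps].
Proof.
have [V [f [e0 [rho [ff fr fe0 sp0 [nd0 rhoE0]]]]]] :=
  kernel_rep cov kc (kap_linr tl adj cov) (pd_all tl adj cov dm) (fun _ _ _ => I)
    (kap_act tl adj cov) (kap_linx tl adj cov) (nr_kap_act tl adj cov).
pose e a := e0 (exist (fun a : atom => True) a I).
have eE a : e0 a = e (sval a) by case: a => a [].
have fe a b : f (e a) (e b) = k a b by rewrite fe0.
have sp v : exists s : seq (C * atom), v = \sum_(p <- s) p.1 *: e p.2.
  have [s ->] := sp0 v; exists [seq (p.1, sval p.2) | p <- s].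
  by rewrite big_map; apply: eq_bigr => p _ /=; rewrite eE.
have nd v : (forall a, f (e a) v = 0) -> v = 0.
  by move=> h; apply: nd0 => a; rewrite eE.
have rhoE m a : rho m (e a) = e (act sigma m a) by rewrite rhoE0 eE.
have [H [j [jl jd jn]]] := psd_completion ff.
pose L t (x : F t) := lmul ff fr fe sp nd rhoE x.
have nrj v : nr (j v) = fnorm f v.
  by rewrite /fnorm /sqn -jd -/(sqn _ _) dot_sqn sqrtr_sqr ger0_norm ?nr_ge0.
have ex t (x : F t) : exists a : bounded_op H, forall v, a (j v) = j (L t x v).
  have jL : is_linear (fun v => j (L t x v)).
    by move=> c u v; rewrite /L lmul_linear jl.
  have [v|T [lT hT bT]] := dense_extend (nr_ge0 x) jl jL jn.
    rewrite !nrj -(@ler_pXn2r _ 2) ?nnegrE ?mulr_ge0 ?fnorm_ge0 ?nr_ge0 //.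
    by rewrite exprMn !(fnorm_sqr ff) sqn_lmul.
  by have [a ha] := exists_bop lT bT; exists a => v; rewrite ha hT.
pose tau : rep_family F H := fun t x => projT1 (cid (ex t x)).
have tauE t (x : F t) v : tau t x (j v) = j (L t x v) by rewrite /tau; case: cid.
have tau0 m v : rep0 tau m (j v) = j (rho m v) by rewrite /rep0 tauE /L lmul_unit.
pose Vi g : H := j (e (None, g)).
have Vl : is_linear Vi.
  by move=> c g h; rewrite /Vi (base_linear ff fe nd) jl.
have Vd g h : dot (Vi g) (Vi h) = dot g h.
  by rewrite /Vi jd fe (kapE tl (w := None)).
have [P [lP hP]] := coproj_ex ff fe sp.
(* [P] is contractive because |P v|^2 = <V (P v), v>. Its extension Q is the adjoint of V, and V Q
   the projection. *)
have [|v|Q [lQ hQ bQ]] := @dense_extend R H G V j P 1 _ jl lP jn; first exact: ler01.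
  rewrite mul1r nrj; have [P0|Pn0] := eqVneq (nr (P v)) 0; first by rewrite P0 fnorm_ge0.
  have Pp : 0 < nr (P v) by rewrite lt_neqAle eq_sym Pn0 nr_ge0.
  rewrite -(ler_pM2l Pp) -expr2 -dot_sqn; apply: le_trans (cre_le_nr _) _.
  rewrite (coproj_form ff fe sp _ _ lP hP); apply: le_trans (fnorm_CS ff _ _) _.
  by rewrite -nrj -[j _]/(Vi _) ler_wpM2r ?fnorm_ge0 // -(@ler_pXn2r _ 2) ?nnegrE ?nr_ge0 //
     -!dot_sqn /sqn Vd.
have cQ : continuous Q.
  by move=> x; apply: (@cvg_lip R H G Q 1) => // u v; rewrite -(linB lQ).
have adjQ g : forall h, dot (Vi g) h = dot g (Q h).
  apply: (dense_eq jn (W := C)) => [||v]; first exact: dot_contr.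
    by move=> x; apply: continuous_comp; [exact: cQ|exact: dot_contr].
  by rewrite hQ /Vi jd (coproj_form ff fe sp _ _ lP hP).
have nrV g : nr (Vi g) = nr g.
  by apply/eqP; rewrite -(@eqrXn2 _ 2) ?nr_ge0 // -!dot_sqn /sqn Vd.
have lVQ : is_linear (fun h => Vi (Q h)) by move=> c u v; rewrite lQ Vl.
have [|p hp] := @exists_bop R H _ 1 lVQ; first by move=> h; rewrite nrV.
have Pe g : Q (Vi g) = g by rewrite /Vi hQ hP.
exists H, Vi, tau, (fun a => j (e a)); split; last first.
- move=> h eps eps0; have [v hv] := jn h eps eps0; have [s hs] := sp v.
  exists s; move: hv; rewrite hs (lin_sum jl).
  by under eq_bigr do rewrite (linZ jl).
- by move=> t x a; rewrite tauE /L lmulE.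
- by move=> a b; rewrite jd.
split.
- split.
  + move=> t c x y; apply: (dense_eq jn); first exact: bop_continuous.
      exact: bop_cont_lin.
    by move=> v; rewrite !tauE /L lmul_linl jl.
  (* Both sides of the matrix inequality are continuous in g, so it suffices to take vectors from
     the dense subspace, where it is [sqn_lmul_mx]. *)
  + move=> t n X K K0 hX g.
    have eK : K = rc (cre K) by apply: ge0_rc.
    have K0' : 0 <= cre K by exact: cre_ge0.
    have [w hw] : exists w : 'I_n -> nat -> V, forall i, j (w i m) @[m --> \oo] --> g i.
      exists (fun i => projT1 (cid (dense_seq jn (g i)))) => i.
      by case: cid.
    suff h : \sum_i nr (\sum_l tau t (X i l) (g l)) ^+ 2 <= cre K ^+ 2 * \sum_l nr (g l) ^+ 2.
      rewrite eK; under eq_bigr do rewrite normE -rmorphXn.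
      under [X in _ <= _ * X]eq_bigr do rewrite normE -rmorphXn.
      rewrite -!rmorph_sum -rmorphXn -rmorphM ler_rc.
      by under eq_bigr do under eq_bigr do rewrite mxE.
    have sq (z : nat -> R) (l : R) : z m @[m --> \oo] --> l -> z m ^+ 2 @[m --> \oo] --> l ^+ 2.
      by move=> hz; rewrite expr2; under eq_fun do rewrite expr2; exact: cvgM.
    have h1 : (\sum_i nr (\sum_l tau t (X i l) (j (w l m))) ^+ 2) @[m --> \oo] -->
        \sum_i nr (\sum_l tau t (X i l) (g l)) ^+ 2.
      apply: cvg_rsum => i; apply/sq/cvg_nr/cvg_nsum => l; apply: bop_cvg; exact: hw.
    have h2 : (cre K ^+ 2 * \sum_l nr (j (w l m)) ^+ 2) @[m --> \oo] -->
        cre K ^+ 2 * \sum_l nr (g l) ^+ 2.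
      apply: cvgM; first exact: cvg_cst.
      by apply: cvg_rsum => i; apply/sq/cvg_nr; exact: hw.
    have h3 : (cre K ^+ 2 * \sum_l nr (j (w l m)) ^+ 2 -
        \sum_i nr (\sum_l tau t (X i l) (j (w l m))) ^+ 2) @[m --> \oo] -->
        cre K ^+ 2 * \sum_l nr (g l) ^+ 2 - \sum_i nr (\sum_l tau t (X i l) (g l)) ^+ 2.
      exact: cvgB.
    rewrite -subr_ge0; apply: (cvg_ge h3) => m; rewrite subr_ge0.
    under eq_bigr => i _ do under eq_bigr => l _ do rewrite tauE.
    under eq_bigr => i _ do rewrite -(lin_sum jl) nrj (fnorm_sqr ff).
    under [X in _ <= _ * X]eq_bigr => i _ do rewrite nrj (fnorm_sqr ff).
    apply: (sqn_lmul_mx ff fr fe sp nd rhoE) => // m' /=.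
    have := hX m'; rewrite /= eK -rmorphXn !normE -rmorphM ler_rc; exact.
  + split.
    * move=> c m n; apply: (dense_eq jn); first exact: bop_continuous.
        exact: bop_cont_lin.
      by move=> v; rewrite !tau0 (fr_linl fr) jl.
    * move=> m n; apply: (dense_eq jn); first exact: bop_continuous.
        exact: bop_comp_cont.
      by move=> v; rewrite !tau0 (fr_mul fr).
    move=> m g h; move: g; apply: (dense_eq jn (W := C)).
    - exact: dot_bop_contl.
    - exact: dot_contl.
    move=> u; move: h; apply: (dense_eq jn (W := C)).
    - exact: dot_contr.
    - exact: dot_bop_contr.
    by move=> v; rewrite !tau0 !jd (fr_adj fr).
  + move=> t m1 x m2; apply: (dense_eq jn); first exact: bop_continuous.
      move=> z; apply: (@continuous_comp _ _ _ (fun h => tau t x (rep0 tau m2 h)) (rep0 tau m1)).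
        exact: bop_comp_cont.
      exact: bop_continuous.
    by move=> v; rewrite (tauE t (hm_ract _ _)) tau0 (tauE t x) tau0 /L lmul_bimodule.
  move=> s t x y; apply: (dense_eq jn); first exact: bop_continuous.
    exact: bop_comp_cont.
  by move=> v; rewrite !tauE /L lmul_mul.
- move=> t x y g h; move: g; apply: (dense_eq jn (W := C)).
  + exact: dot_bop_contl.
  + exact: dot_contl.
  move=> u; move: h; apply: (dense_eq jn (W := C)).
  + exact: dot_bop_contr.
  + exact: dot_bop_contr.
  by move=> v; rewrite tau0 !tauE !jd /L lmul_form.
- by split.
exists p.
  move=> h; split; first by exists (Q h).
  by move=> g; rewrite (psfDr (dot_psd H)) (psfNr (dot_psd H)) hp Vd adjQ subrr.
by move=> t x g; rewrite !hp Pe /Vi tauE /L lmulE hQ hP.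
Qed.

End Dilation.

Section TimeLike.
Variable R : realType.

Lemma time_like_time (k : time_kind) : time_like (time R k).
Proof.
case: k; split => /=.
- by move=> s r r' /addnI.
- move=> s t; case: (leqP s t) => [st|/ltnW ts].
    by left; exists (t - s)%N; rewrite -[RHS]/(s + (t - s))%N subnKC.
  by right; exists (s - t)%N; rewrite -[RHS]/(t + (s - t))%N subnKC.
- by move=> r r' /eqP; rewrite -[X in X == _]/(r + r')%N addn_eq0 => /andP[/eqP ->].
- by move=> s r r' /(congr1 (@nnval R)) /addrI /val_inj.
- move=> s t; case: (leP (nnval s) (nnval t)) => [st|/ltW ts].
    have h : 0 <= nnval t - nnval s by rewrite subr_ge0.
    by left; exists (NNReal h); apply: val_inj; rewrite /= addrC subrK.
  have h : 0 <= nnval s - nnval t by rewrite subr_ge0.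
  by right; exists (NNReal h); apply: val_inj; rewrite /= addrC subrK.
move=> [r r0] [r' r0'] /(congr1 (@nnval R)) /= /eqP; rewrite paddr_eq0 // => /andP[/eqP h _].
exact: val_inj.
Qed.

End TimeLike.

(** * The C*-case *)

Section NormDense.
Variables (R : realType) (S : nmodType) (M : cstar_algebra R).
Variable F : cstar_product_system S M.
Local Notation C := (C R).

Lemma ps_mul_dense s r (z : F (s + r)) (e : R) : 0 < e ->
  exists n (x : 'I_n -> F s) (y : 'I_n -> F r), nr (z - \sum_i ps_mul (x i) (y i)) < e.
Proof.
move=> e0; have [lu _ _ iu /(_ z)[w wz]] := ps_u_unitary F s r.
have nru (v : ps_tensor F s r) : nr (ps_u v) = nr v.
  by apply/eqP; rewrite -(@eqrXn2 _ 2) ?nr_ge0 // -!nr_hm iu.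
have : closure (lin_span [set tens (ps_tensor F s r) xy.1 xy.2 | xy in [set: F s * F r]]) w.
  by rewrite (tens_gen (ps_tensor F s r)).
move=> /(_ (ball w (rc e))) [|v [[n [a [b [hb ->]]]]]].
  by apply: nbhsx_ballx; rewrite -(rmorph0 (@rc R)) ltr_rc.
rewrite -ball_normE /ball_ /= normE ltr_rc => hv.
have hb' i : exists xy : F s * F r, tens (ps_tensor F s r) xy.1 xy.2 = b i.
  by case: (hb i) => xy _ e'; exists xy.
pose x i : F s := a i *: (projT1 (cid (hb' i))).1; pose y i := (projT1 (cid (hb' i))).2.
exists n, x, y; have -> : \sum_i ps_mul (x i) (y i) = ps_u (\sum_i a i *: b i).
  rewrite (lin_sum lu); apply: eq_bigr => i _; rewrite (linZ lu).
  rewrite /x (linZ (ps_mul_linl _)); congr (_ *: _).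
  by rewrite /y; case: cid => -[x' y'] /= <-.
by rewrite -wz -(linB lu) nru.
Qed.

(** On products L_x^* (u (.) v) = <x, u> v is explicit. The bound |L_x^* z| <= |x| |z| makes the
    adjoints of an approximating sequence Cauchy. *)
Lemma cstar_adjointable_mul : adjointable_mul F.
Proof.
move=> s r x z; pose P (z : F (s + r)) (w : F r) := forall y, hm_inner w y = hm_inner z (ps_mul x y).
have mf t := hm_mform (F t).
have PB a b v w : P a v -> P b w -> P (a - b) (v - w).
  by move=> h1 h2 y; rewrite !(mfDl (mf _)) !(mfNl (mf _)) h1 h2.
have Pn a v : P a v -> nr v <= nr x * nr a.
  move=> h; have hq : quot (mk x) (mk a) (mk v).
    by split=> // y /ex_mk[y' ->]; rewrite /hmul !hinE.
  exact: nr_quot hq.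
have Pp n (u : 'I_n -> F s) (v : 'I_n -> F r) :
    P (\sum_i ps_mul (u i) (v i)) (\sum_i co_lact (hm_inner x (u i)) (v i)).
  move=> y; rewrite !(mf_suml (mf _)); apply: eq_bigr => i _.
  by rewrite ps_mul_inner co_lact_adj hm_inner_star.
have inv_gt0 n : 0 < n.+1%:R^-1 :> R by rewrite invr_gt0 ltr0n.
have ex n : exists a w, P a w /\ nr (z - a) < n.+1%:R^-1.
  by have [m [u [v h]]] := ps_mul_dense z (inv_gt0 n); exists (\sum_i ps_mul (u i) (v i)); eexists; split; [exact: Pp|exact: h].
pose a n := projT1 (cid (ex n)); pose w n := projT1 (cid (projT2 (cid (ex n)))).
have aw n : P (a n) (w n) /\ nr (z - a n) < n.+1%:R^-1.
  by rewrite /w /a; case: (cid (ex n)) => a' h' /=; case: cid.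
have az : a n @[n --> \oo] --> z.
  apply/cvg_nr_eps => e e0; have [N hN] := invn_small e0.
  by exists N => n Nn; rewrite nrBC; exact: lt_trans (aw n).2 (hN n Nn).
have /cvg_ex[l hl] : cvg (w n @[n --> \oo]).
  apply: seq_complete => e e0.
  have e2 : 0 < e / (2 * (nr x + 1)) by rewrite divr_gt0 // mulr_gt0 //; have := nr_ge0 x; lra.
  have [N hN] := invn_small e2; exists N => m n Nm Nn.
  apply: le_lt_trans (Pn _ _ (PB _ _ _ _ (aw m).1 (aw n).1)) _.
  have -> : a m - a n = (z - a n) - (z - a m) by lmod R.
  apply: lt_half_sum (_ : _ <= nr x * nr (z - a n) + nr x * nr (z - a m)) _ _.
  - by rewrite -mulrDr ler_wpM2l ?nr_ge0 // nrB.
  - by apply: half_bound; rewrite ?nr_ge0 //; exact: lt_trans (aw n).2 (hN n Nn).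
  - by apply: half_bound; rewrite ?nr_ge0 //; exact: lt_trans (aw m).2 (hN m Nm).
exists l => y.
have cl t (v : nat -> F t) (l' u : F t) : v n @[n --> \oo] --> l' ->
    (hm_inner (v n) u : M) @[n --> \oo] --> hm_inner l' u.
  apply: (@cvg_lip R (F t) M (fun b => hm_inner b u) (nr u)) => b c.
  by rewrite -(mfNl (mf _)) -(mfDl (mf _)) mulrC hm_CS.
apply: (cvg_unique_nr (cl _ _ _ y hl)).
under eq_fun do rewrite (aw _).1.
exact: cl az.
Qed.

Lemma cstar_dense_mul (G : hilbert R) (sigma : rep_family F G) :
  covariant_rep sigma -> dense_mul sigma.
Proof.
move=> cov s r z h e e0.
have e1 : 0 < e / (nr h + 1) by rewrite divr_gt0 //; have := nr_ge0 h; lra.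
have [n [x [y hd]]] := ps_mul_dense z e1; exists n, x, y.
set d := z - _ in hd *.
apply: le_lt_trans (hn_le cov d h) _; move: hd; rewrite ltr_pdivlMr; last by have := nr_ge0 h; lra.
have := nr_ge0 h; have := nr_ge0 d; nra.
Qed.

Theorem cstar_dilation (G : hilbert R) (sigma : rep_family F G) :
  time_like S -> covariant_rep sigma ->
  exists (H : hilbert R) (V : G -> H) (tau : rep_family F H), isometric_dilation sigma V tau.
Proof.
move=> tl cov.
have [H [V [tau [_ [h _ _ _]]]]] :=
  dilation_exists tl cstar_adjointable_mul cov (cstar_dense_mul cov).
by exists H, V, tau.
Qed.

End NormDense.

(** * Sigma-weakly continuous functionals *)

Section FunctionalTopology.
Variables (R : realType) (I : Type).
Local Notation C := (C R).

Section Choice.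
Variables (V : choiceType) (p : I -> V -> C).
Local Notation FT := (functional_topology p).

Lemma ft_cvg (F : set_system V) (v : V) : Filter F ->
  (forall i, (p i w : C) @[w --> F] --> (p i v : C)) -> F `=>` nbhs (v : FT).
Proof.
move=> FF h A [_ [[B oB <-] Bv] BA].
have hc : (fun w i => p i w) @ F --> ((fun i => p i v) : {ptws I -> C}).
  apply/cvg_sup => i U [_ [[W oW <-] Wv] WU].
  apply: filterS WU _; have := h i W; apply.
  exact: open_nbhs_nbhs.
have : nbhs ((fun i => p i v) : {ptws I -> C}) B by exact: open_nbhs_nbhs.
move=> /hc hB; exact: (@filterS _ F FF _ _ BA).
Qed.

Lemma ft_continuous i : continuous (p i : FT -> C).
Proof.
move=> v A Av; apply: (@initial_continuous V {ptws I -> C} (fun w i => p i w) v (fun g => A (g i))).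
have hid : nbhs ((fun i => p i v) : {ptws I -> C}) --> ((fun i => p i v) : {ptws I -> C}).
  exact: cvg_id.
have /cvg_sup/(_ i) := hid; apply.
exact: (@initial_continuous (I -> C) C (fun g => g i) (fun i => p i v)).
Qed.

Lemma ft_near_sum (s : seq I) (v : V) (e : R) : 0 < e ->
  nbhs (v : FT) [set w | \sum_(i <- s) nr (p i w - p i v) < e].
Proof.
elim: s e => [|i s ih] e e0.
  by apply: filterS filterT => w _ /=; rewrite big_nil.
have e2 : 0 < e / 2 by rewrite divr_gt0.
have h1 : nbhs (v : FT) [set w | nr (p i w - p i v) < e / 2].
  have /cvgrPdist_lt/(_ (rc (e / 2))) := @ft_continuous i v.
  rewrite -(rmorph0 (@rc R)) ltr_rc => /(_ e2); apply: filterS => w /=.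
  by rewrite normE ltr_rc nrBC.
apply: filterS (filterI h1 (ih _ e2)) => w /= [a b].
by rewrite big_cons; lra.
Qed.

Lemma ft_nbhs (v : V) (A : set V) : nbhs (v : FT) A ->
  exists (s : seq I) (e : R), 0 < e /\
    forall w, \sum_(i <- s) nr (p i w - p i v) < e -> A w.
Proof.
pose F : set_system V := fun A => exists (s : seq I) (e : R), 0 < e /\
    forall w, \sum_(i <- s) nr (p i w - p i v) < e -> A w.
have FF : Filter F.
  split=> [|A1 A2 [s1 [e1 [e10 h1]]] [s2 [e2 [e20 h2]]]|A1 A2 h12 [s [e [e0 h]]]].
  - by exists [::], 1.
  - exists (s1 ++ s2), (Num.min e1 e2); split; first by rewrite lt_min e10.
    have sge0 s w : 0 <= \sum_(i <- s) nr (p i w - p i v).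
      by apply: sumr_ge0 => i _; exact: nr_ge0.
    move=> w; rewrite big_cat /= lt_min => /andP[b1 b2].
    split; [apply: h1|apply: h2].
      by apply: le_lt_trans b1; rewrite lerDl.
    by apply: le_lt_trans b2; rewrite lerDr.
  - by exists s, e; split=> // w /h /h12.
apply: (@ft_cvg F v FF) => i; apply/cvgrPdist_lt => e e0.
have ee : e = rc (cre e) by apply: ge0_rc; exact: ltW.
exists [:: i], (cre e); split; first by move: e0; rewrite {1}ee -(rmorph0 (@rc R)) ltr_rc.
by move=> w; rewrite big_seq1 => h; rewrite ee normE ltr_rc nrBC.
Qed.

Lemma ft_comp_continuous (X : topologicalType) (g : X -> V) :
  (forall i, continuous ((fun x => p i (g x)) : X -> C)) -> continuous (g : X -> FT).
Proof.
move=> h x; apply: (@ft_cvg (g @ x) (g x)) => i; exact: h.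
Qed.

End Choice.

Variables (V : lmodType C) (p : I -> V -> C).
Local Notation FT := (functional_topology p).

(** For linear functionals this is continuity in the functional topology, in a form that is
    convenient for estimates. *)
Definition dominated (f : V -> C) : Prop :=
  exists (s : seq I) (K : R), forall v, nr (f v) <= K * \sum_(i <- s) nr (p i v).

Hypothesis p_lin : forall i, is_linear (p i).

Lemma continuous_dominated (f : V -> C) : is_linear f ->
  continuous (f : FT -> C) -> dominated f.
Proof.
move=> lf /(_ (0 : V)) /cvgrPdist_lt/(_ 1 ltr01) /ft_nbhs[s [e [e0 he]]].
have he' w : \sum_(i <- s) nr (p i w) < e -> nr (f w) < 1.
  move=> h; have := he w; rewrite (lin0 lf) sub0r normrN normE -(rmorph1 (@rc R)) ltr_rc.
  apply; apply: le_lt_trans h; apply: ler_sum => i _.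
  by rewrite (lin0 (p_lin i)) subr0.
have hs (t : R) v : 0 <= t -> t * (\sum_(i <- s) nr (p i v)) < e -> t * nr (f v) < 1.
  move=> t0 h; have := he' (rc t *: v); rewrite (linZ lf) nrZ nr_rc ger0_norm //; apply.
  apply: le_lt_trans h; rewrite mulr_sumr; apply: ler_sum => i _.
  by rewrite (linZ (p_lin i)) nrZ nr_rc ger0_norm.
exists s, (2 / e) => v.
set X := \sum_(i <- s) _; have X0 : 0 <= X by apply: sumr_ge0 => i _; exact: nr_ge0.
have [XE|Xn0] := eqVneq X 0.
  rewrite XE mulr0; have [->//|fn0] := eqVneq (nr (f v)) 0.
  have f0 : 0 < nr (f v) by rewrite lt_neqAle eq_sym fn0 nr_ge0.
  have := hs (nr (f v))^-1 v; rewrite -/X XE mulr0 invr_ge0 nr_ge0 => /(_ isT e0).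
  by rewrite mulVf // ltxx.
have Xp : 0 < X by rewrite lt_neqAle eq_sym Xn0.
have t0 : 0 < e / (2 * X) by rewrite divr_gt0 // mulr_gt0.
have := hs (e / (2 * X)) v (ltW t0); rewrite -/X.
have -> : e / (2 * X) * X = e / 2 by field; lra.
have e2 : e / 2 < e by lra.
move=> /(_ e2)/ltW; rewrite -ler_pdivlMl // mulr1; congr (_ <= _).
by field; apply/andP; split; lra.
Qed.

Lemma dominated_continuous (f : V -> C) : is_linear f -> dominated f ->
  continuous (f : FT -> C).
Proof.
move=> lf [s [K hK]] v; apply/(@cvgrPdist_lt _ _ _ (nbhs (v : FT))) => e e0.
have ee : e = rc (cre e) by apply: ge0_rc; exact: ltW.
have e1 : 0 < cre e by move: e0; rewrite {1}ee -(rmorph0 (@rc R)) ltr_rc.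
have e2 : 0 < cre e / (`|K| + 1) by rewrite divr_gt0 //; have := normr_ge0 K; lra.
apply: filterS (ft_near_sum p s v e2) => w /= h.
rewrite ee normE ltr_rc nrBC -(linB lf).
apply: le_lt_trans (hK _) _.
under eq_bigr do rewrite (linB (p_lin _)).
have X0 : 0 <= \sum_(i <- s) nr (p i w - p i v) by apply: sumr_ge0 => i _; exact: nr_ge0.
move: h; rewrite ltr_pdivlMr; last by have := normr_ge0 K; lra.
apply: le_lt_trans; rewrite mulrC ler_wpM2l //.
by apply: le_trans (ler_norm K) _; rewrite lerDl.
Qed.

Lemma dominated_le (f g : V -> C) (K : R) :
  (forall v, nr (f v) <= K * nr (g v)) -> dominated g -> dominated f.
Proof.
move=> h [s [K' hK]]; exists s, (`|K| * K') => v.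
apply: le_trans (h v) _; rewrite -mulrA.
apply: (@le_trans _ _ (`|K| * nr (g v))); first by rewrite ler_wpM2r ?nr_ge0 ?ler_norm.
by rewrite ler_wpM2l.
Qed.

Lemma dominatedD (f g : V -> C) : dominated f -> dominated g -> dominated (fun v => f v + g v).
Proof.
move=> [s [K hK]] [s' [K' hK']]; exists (s ++ s'), (`|K| + `|K'|) => v.
apply: le_trans (nrD _ _) _; rewrite big_cat /=.
have X0 u : 0 <= \sum_(i <- u) nr (p i v) by apply: sumr_ge0 => i _; exact: nr_ge0.
have k0 := normr_ge0 K; have k0' := normr_ge0 K'.
have h1 : nr (f v) <= `|K| * \sum_(i <- s) nr (p i v).
  by apply: le_trans (hK v) _; rewrite ler_wpM2r ?ler_norm.
have h2 : nr (g v) <= `|K'| * \sum_(i <- s') nr (p i v).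
  by apply: le_trans (hK' v) _; rewrite ler_wpM2r ?ler_norm.
apply: le_trans (lerD h1 h2) _; rewrite mulrDl lerD // ler_wpM2l //.
  by rewrite lerDl.
by rewrite lerDr.
Qed.

Lemma dominated0 : dominated (fun=> 0).
Proof. by exists [::], 0 => v; rewrite nr0 mul0r. Qed.

Lemma dominated_sum (J : Type) (r : seq J) (f : J -> V -> C) :
  (forall j, dominated (f j)) -> dominated (fun v => \sum_(j <- r) f j v).
Proof.
move=> h; elim: r => [|j r ih].
  by under eq_fun do rewrite big_nil; exact: dominated0.
by under eq_fun do rewrite big_cons; exact: dominatedD.
Qed.

(** A functional vanishing on the common kernel of finitely many functionals is a combination of
    them. The predicate [Q] stands for any property stable under combinations, which avoids carrying
    coefficients. The induction subtracts the multiple of [p i] that agrees with f at a vector [v0]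
    separating [p i] from the remaining ones. *)
Lemma kernel_span (Q : (V -> C) -> Prop) (s : seq I) (f : V -> C) : is_linear f ->
  Q (fun=> 0) -> (forall a g h, Q g -> Q h -> Q (fun v => a * g v + h v)) ->
  (forall i, List.In i s -> Q (p i)) ->
  (forall v, (forall i, List.In i s -> p i v = 0) -> f v = 0) -> Q f.
Proof.
move=> lf Q0 QD; elim: s f lf => [|i s ih] f lf Qp hf.
  have -> : f = fun=> 0 by apply/funext => v; exact: hf.
  exact: Q0.
have Qs j : List.In j s -> Q (p j) by move=> js; apply: Qp; right.
have [h|] := pselect (forall v, (forall j, List.In j s -> p j v = 0) -> p i v = 0).
  by apply: ih => // v hv; apply: hf => j [<-|js]; [exact: h|exact: hv].
move=> /existsNP[v0 /not_implyP[hv0 /eqP pv0]].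
set c := f v0 / p i v0.
have lf' : is_linear (fun v => f v - c * p i v).
  by move=> a u v; rewrite lf p_lin mulrDr [c * (_ *: _)]mulrCA opprD addrACA scalerBr.
have -> : f = fun v => c * p i v + (f v - c * p i v).
  by apply/funext => v; rewrite addrC subrK.
apply: QD; first by apply: Qp; left.
apply: ih => // v hv.
have : f (v - (p i v / p i v0) *: v0) = 0.
  apply: hf => j [<-|js].
    by rewrite (linB (p_lin _)) (linZ (p_lin _)) [_ *: _]divfK ?subrr.
  by rewrite (linB (p_lin _)) (linZ (p_lin _)) (hv j js) (hv0 j js) [_ *: _]mulr0 subrr.
rewrite (linB lf) (linZ lf) => <-; congr (_ - _); rewrite /c.
by rewrite mulrAC -mulrA [RHS]mulrC.
Qed.

Lemma dominated_span (Q : (V -> C) -> Prop) (f : V -> C) : is_linear f ->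
  Q (fun=> 0) -> (forall a g h, Q g -> Q h -> Q (fun v => a * g v + h v)) ->
  (forall i, Q (p i)) -> dominated f -> Q f.
Proof.
move=> lf Q0 QD Qp [s [K hK]]; apply: (kernel_span (s := s)) => // v hv.
apply: nr_eq0; apply/eqP; rewrite eq_le nr_ge0 andbT; apply: le_trans (hK v) _.
suff -> : \sum_(i <- s) nr (p i v) = 0 by rewrite mulr0.
elim: s hv {hK} => [|i s ih] hv; first by rewrite big_nil.
by rewrite big_cons hv ?nr0 ?add0r; [apply: ih => j hj; apply: hv; right|left].
Qed.

End FunctionalTopology.

(** * The Hahn-Banach theorem *)

Section HahnBanach.
Variables (R : realType) (V : lmodType (C R)).
Local Notation C := (C R).
Local Notation "t *r x" := (rc t *: x) (at level 40).

Definition sublinear (q : V -> R) : Prop :=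
  (forall x y, q (x + y) <= q x + q y) /\ forall t x, 0 <= t -> q (t *r x) <= t * q x.

Lemma sublinear0 q : sublinear q -> q 0 = 0.
Proof.
move=> [hD hZ]; apply/eqP; rewrite eq_le; apply/andP; split.
  by have := hZ 0 0 (lexx 0); rewrite mul0r scaler0.
by have := hD 0 0; rewrite addr0; lra.
Qed.

Lemma sublinearN q x : sublinear q -> - q (- x) <= q x.
Proof.
by move=> hq; have := hq.1 x (- x); rewrite subrr (sublinear0 hq); lra.
Qed.

Lemma sublinearZ q t x : sublinear q -> 0 <= t -> q (t *r x) = t * q x.
Proof.
move=> hq; rewrite le_eqVlt => /predU1P[<-|t0].
  by rewrite rmorph0 scale0r mul0r (sublinear0 hq).
apply/eqP; rewrite eq_le (hq.2 _ _ (ltW t0)) /=.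
have := hq.2 t^-1 (t *r x); rewrite invr_ge0 (ltW t0) => /(_ isT).
by rewrite scalerA -rmorphM mulVf ?lt0r_neq0 // rmorph1 scale1r ler_pdivlMl.
Qed.

(** A sublinear functional below q whose value at -x0 is at most - q x0. If q is minimal it
    coincides with q for every x0, and this is what forces q to be additive. *)
Definition relax (q : V -> R) (x0 x : V) : R :=
  inf [set q (x + t *r x0) - t * q x0 | t in [set t : R | 0 <= t]].

Lemma relax_lb q x0 x : sublinear q ->
  has_inf [set q (x + t *r x0) - t * q x0 | t in [set t : R | 0 <= t]].
Proof.
move=> hq; split; first by exists (q (x + 0 *r x0) - 0 * q x0); exists 0 => //=.
exists (- q (- x)) => _ [t /= t0 <-].
have := hq.1 (x + t *r x0) (- x); rewrite addrAC subrr add0r (sublinearZ _ hq t0); lra.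
Qed.

Lemma relax_le q x0 x t : sublinear q -> 0 <= t ->
  relax q x0 x <= q (x + t *r x0) - t * q x0.
Proof. by move=> hq t0; apply: ge_inf; [case: (relax_lb x0 x hq)|exists t]. Qed.

Lemma relax_sublinear q x0 : sublinear q -> sublinear (relax q x0).
Proof.
move=> hq; split=> [x y|t x t0].
  apply/ler_addgt0Pr => e e0; have e2 : 0 < e / 2 by rewrite divr_gt0.
  have [_ [s /= s0 <-] hs] := inf_adherent e2 (relax_lb x0 x hq).
  have [_ [t /= t0 <-] ht] := inf_adherent e2 (relax_lb x0 y hq).
  have := relax_le x0 (x + y) hq (addr_ge0 s0 t0).
  rewrite rmorphD scalerDl addrACA => h1.
  have h2 := hq.1 (x + s *r x0) (y + t *r x0).
  by move: hs ht h1; rewrite -/(relax q x0 x) -/(relax q x0 y) mulrDl; lra.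
move: t0; rewrite le_eqVlt => /predU1P[<-|t0].
  rewrite mul0r rmorph0 scale0r; have := relax_le x0 0 hq (lexx 0).
  by rewrite rmorph0 scale0r addr0 mul0r subr0 (sublinear0 hq).
rewrite -ler_pdivrMl //; apply/ler_addgt0Pr => e e0.
have [_ [s /= s0 <-] hs] := inf_adherent e0 (relax_lb x0 x hq).
rewrite -/(relax q x0 x) in hs; apply: le_trans (ltW hs).
rewrite ler_pdivrMl //.
apply: le_trans (relax_le x0 _ hq (mulr_ge0 (ltW t0) s0)) _.
rewrite rmorphM -scalerA -scalerDr mulrBr mulrA lerD2r.
exact/hq.2/ltW.
Qed.

(** Zorn's lemma for the reversed pointwise order. The infimum of a chain is finite because q x >= -
    q (- x) >= - N (- x), and it is subadditive because two members of a chain are comparable. *)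
Lemma minimal_sublinear (N : V -> R) : sublinear N ->
  exists q, [/\ sublinear q, forall x, q x <= N x &
    forall q', sublinear q' -> (forall x, q' x <= q x) -> forall x, q' x = q x].
Proof.
move=> hN.
pose T := {q : V -> R | sublinear q /\ forall x, q x <= N x}.
pose le_op (a b : T) := `[< forall x, sval b x <= sval a x >].
have [||||[q [hq qN]] qmin] := @Zorn T le_op.
- by move=> a; apply/asboolP.
- by move=> a b c /asboolP ab /asboolP bc; apply/asboolP => x; exact: le_trans (bc x) (ab x).
- move=> [a ha] [b hb] /asboolP /= ab /asboolP /= ba; apply: eq_exist => /=.
  by apply/funext => x; apply/eqP; rewrite eq_le ab ba.
- move=> A totA; have [->|/set0P[a0 Aa0]] := eqVneq A set0.
    by exists (exist _ N (conj hN (fun x => lexx (N x)))).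
  pose Ax x := [set sval a x | a in A].
  have lbA x : has_inf (Ax x).
    split; first by exists (sval a0 x); exists a0.
    exists (- N (- x)) => _ [a Aa <-]; case: a {Aa} => a [ha aN] /=.
    by apply: le_trans (sublinearN x ha); rewrite lerN2.
  pose q x := inf (Ax x).
  have q_le a x : A a -> q x <= sval a x.
    by move=> Aa; apply: ge_inf; [case: (lbA x)|exists a].
  have hq : sublinear q.
    split=> [x y|t x t0].
      apply/ler_addgt0Pr => e e0; have e2 : 0 < e / 2 by rewrite divr_gt0.
      have [_ [a Aa <-] ha] := inf_adherent e2 (lbA x).
      have [_ [b Ab <-] hb] := inf_adherent e2 (lbA y).
      rewrite -/(q x) in ha; rewrite -/(q y) in hb.
      have key c : A c -> sval c x <= sval a x -> sval c y <= sval b y ->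
          q (x + y) <= q x + q y + e.
        move=> Ac h1 h2; have := q_le c (x + y) Ac.
        have := (svalP c).1.1 x y; move: ha hb h1 h2.
        move: (sval c (x + y)) (sval c x) (sval c y) (sval a x) (sval b y) => ? ? ? ? ?; lra.
      case: (totA a b Aa Ab) => /asboolP ab; first exact: (key b).
      exact: (key a).
    move: t0; rewrite le_eqVlt => /predU1P[<-|t0].
      rewrite mul0r rmorph0 scale0r; apply: le_trans (q_le a0 0 Aa0) _.
      by rewrite (sublinear0 (svalP a0).1).
    rewrite -ler_pdivrMl //; apply/ler_addgt0Pr => e e0.
    have [_ [a Aa <-] ha] := inf_adherent e0 (lbA x).
    rewrite -/(q x) in ha; apply: le_trans (ltW ha).
    rewrite ler_pdivrMl //; apply: le_trans (q_le a _ Aa) _.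
    exact: (svalP a).1.2 _ _ (ltW t0).
  have qN x : q x <= N x by apply: le_trans (q_le a0 x Aa0) _; exact: (svalP a0).2.
  exists (exist (fun q => sublinear q /\ forall x, q x <= N x) q (conj hq qN)).
  by move=> a Aa; apply/asboolP => x; exact: q_le.
exists q; split=> // q' hq' q'q x.
have hN' : sublinear q' /\ forall x, q' x <= N x.
  by split=> // y; exact: le_trans (q'q y) (qN y).
have := qmin (exist _ q' hN').
have -> : le_op (exist _ q (conj hq qN)) (exist _ q' hN') by apply/asboolP.
by move=> /(_ isT) /(congr1 sval) /= ->.
Qed.

Lemma hahn_banach_real (N : V -> R) (p : V) : sublinear N ->
  exists q : V -> R, [/\ forall x y, q (x + y) = q x + q y,
    forall t x, q (t *r x) = t * q x, forall x, q x <= N x & N p <= q p].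
Proof.
(* Starting from [relax N p] instead of [N] secures q (- p) <= - N p, that is, the norm of p is
   attained. *)
move=> hN; have [q [hq qN qmin]] := minimal_sublinear (relax_sublinear p hN).
have qD x y : q (x + y) = q x + q y.
  apply/eqP; rewrite eq_le hq.1 /=.
  have h := qmin _ (relax_sublinear y hq) _ x.
  rewrite -h => [|z]; last first.
    by have := relax_le y z hq (lexx 0); rewrite rmorph0 scale0r addr0 mul0r subr0.
  have := relax_le y x hq ler01; rewrite rmorph1 scale1r mul1r; lra.
have qNeg x : q (- x) = - q x.
  by apply/eqP; rewrite -addr_eq0 -qD addNr (sublinear0 hq).
exists q; split=> // [t x|x|].
- case: (lerP 0 t) => [t0|/ltW t0]; first exact: sublinearZ.
  have -> : t *r x = - ((- t) *r x) by rewrite rmorphN scaleNr opprK.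
  by rewrite qNeg sublinearZ ?oppr_ge0 // mulNr opprK.
- apply: le_trans (qN x) _; have := relax_le p x hN (lexx 0).
  by rewrite rmorph0 scale0r addr0 mul0r subr0.
have := qN (- p); have := relax_le p (- p) hN ler01.
by rewrite rmorph1 scale1r mul1r addNr (sublinear0 hN) qNeg; lra.
Qed.

End HahnBanach.

(** * Norm of the predual and normal functionals *)

Section Predual.
Variables (R : realType) (M : wstar_algebra R).
Local Notation C := (C R).
Local Notation P := (ws_predual M).

Lemma ws_lin_l p : is_linear (fun m : M => ws_pair m p : C).
Proof. by move=> a x y; exact: ws_pair_linl. Qed.

Lemma ws_lin_r (m : M) : is_linear (fun p : P => ws_pair m p : C).
Proof. by move=> a x y; exact: ws_pair_linr. Qed.

Lemma nr_ws_pair (m : M) (p : P) : nr (ws_pair m p) <= nr m * nr p.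
Proof. by have := ws_pair_le m p; rewrite !normE -rmorphM ler_rc. Qed.

Lemma ws_norm_le (m : M) (K : R) : 0 <= K ->
  (forall p : P, nr (ws_pair m p) <= K * nr p) -> nr m <= K.
Proof.
move=> K0 h; have K0' : 0 <= rc K by rewrite -(rmorph0 (@rc R)) ler_rc.
have := ws_pair_norm (x := m) K0'; rewrite normE ler_rc; apply => p.
by rewrite !normE -rmorphM ler_rc.
Qed.

Lemma ws_sep (m n : M) : (forall p : P, ws_pair m p = ws_pair n p) -> m = n.
Proof.
move=> h; apply/eqP; rewrite -subr_eq0; apply/eqP/nr_eq0/eqP.
rewrite eq_le nr_ge0 andbT; apply: ws_norm_le => // p.
by rewrite mul0r (linB (ws_lin_l p)) h subrr nr0.
Qed.

(** The real functional q obtained from Hahn-Banach is complexified to q(x) - i q(i x). The duality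
    between the predual and M represents the result by an element of M. *)
Lemma predual_norming (p : P) : exists x : M, nr x <= 1 /\ nr p <= nr (ws_pair x p).
Proof.
have [|q [qD qZ qN qp]] := @hahn_banach_real R P (@nr R P) p.
  split=> [x y|t x t0]; first exact: nrD.
  by rewrite nrZ nr_rc ger0_norm.
pose f (x : P) : C := rc (q x) - 'i%C * rc (q ('i%C *: x)).
have i2 : ('i%C : C) * 'i%C = -1 by rewrite -expr2 sqr_i.
have qNeg x : q (- x) = - q x.
  by have := qZ (-1) x; rewrite rmorphN1 scaleN1r mulN1r.
have fD x y : f (x + y) = f x + f y.
  by rewrite /f scalerDr !qD !rmorphD; ring.
have fZ t x : f (rc t *: x) = rc t * f x.
  have e : 'i%C *: (rc t *: x) = rc t *: ('i%C *: x) by rewrite !scalerA mulrC.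
  by rewrite /f e !qZ !rmorphM; ring.
have fi x : f ('i%C *: x) = 'i%C * f x.
  by rewrite /f scalerA i2 scaleN1r qNeg rmorphN mulrBr mulrA i2; ring.
have fl : forall (a : C) x y, f (a *: x + y) = a * f x + f y.
  move=> a x y; have -> : a = rc (cre a) + 'i%C * rc (complex.Im a).
    by case: a => u v; rewrite /rc /cre /=; simpc.
  by rewrite fD scalerDl fD -scalerA fi !fZ mulrDl mulrA.
have cf x : cre (f x) = q x.
  have e : cre ('i%C * rc (q ('i%C *: x))) = 0 by rewrite creMi /= oppr0.
  by rewrite /f raddfB [X in _ - X]e subr0.
have fn x : nr (f x) <= nr x.
  have [b nb hb] := exists_phase (f x).
  have : f (b *: x) = rc (nr (f x)).
    by have := fl b x 0; rewrite addr0 hb => ->; have := fl 0 0 0; rewrite scale0r add0r mul0r add0r => _; have := fZ 0 0; rewrite rmorph0 scale0r mul0r => ->; rewrite addr0.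
  move=> /(congr1 (@cre R)); rewrite cf rcK => <-.
  by apply: le_trans (qN _) _; rewrite nrZ nb mul1r.
have [||x hx] := @ws_pair_surj R M f.
- exact: fl.
- by exists 1 => y; rewrite mul1r !normE ler_rc.
exists x; split; first by apply: ws_norm_le => // y; rewrite mul1r hx.
by rewrite hx; apply: le_trans qp _; rewrite -cf; exact: cre_le_nr.
Qed.

Definition normal_form (f : M -> C) : Prop := exists p : P, forall m, f m = ws_pair m p.

(** Since the unit ball of M norms the predual, approximants of f that converge uniformly on the
    ball form a Cauchy sequence in the predual. *)
Lemma normal_form_closed (f : M -> C) :
  (forall e : R, 0 < e -> exists p : P, forall m, nr (f m - ws_pair m p) <= e * nr m) ->
  normal_form f.
Proof.
move=> h; have inv_gt0 n : 0 < n.+1%:R^-1 :> R by rewrite invr_gt0 ltr0n.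
pose p n := projT1 (cid (h _ (inv_gt0 n))).
have hp n m : nr (f m - ws_pair m (p n)) <= n.+1%:R^-1 * nr m by rewrite /p; case: cid.
have small (e : R) : 0 < e -> exists N, forall n, (N <= n)%N -> forall m, nr m <= 1 ->
    nr (f m - ws_pair m (p n)) < e.
  move=> e0; have [N hN] := invn_small e0; exists N => n Nn m m1.
  apply: le_lt_trans (hp n m) _; apply: le_lt_trans (hN n Nn).
  by rewrite -[leRHS]mulr1 ler_wpM2l // ltW.
have /cvg_ex[l hl] : cvg (p n @[n --> \oo]).
  apply: seq_complete => e e0; have e2 : 0 < e / 2 by rewrite divr_gt0.
  have [N hN] := small _ e2; exists N => m n Nm Nn.
  have [x [x1 hx]] := predual_norming (p m - p n).
  apply: le_lt_trans hx _; rewrite (linB (ws_lin_r x)).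
  have -> : ws_pair x (p m) - ws_pair x (p n) =
    (f x - ws_pair x (p n)) - (f x - ws_pair x (p m)) by ring.
  exact: lt_half_sum (nrB _ _) (hN n Nn x x1) (hN m Nm x x1).
exists l => m; have h1 : (ws_pair m (p n) : C) @[n --> \oo] --> (ws_pair m l : C).
  apply: (@cvg_lip R P C (fun q => ws_pair m q) (nr m)) hl => x y.
  by rewrite -(linB (ws_lin_r m)) nr_ws_pair.
apply: (cvg_unique_nr (V := C) _ h1).
apply/cvg_nr_eps => e e0.
have e1 : 0 < e / (nr m + 1) by rewrite divr_gt0 //; have := nr_ge0 m; lra.
have [N hN] := invn_small e1; exists N => n Nn; rewrite nrBC.
apply: le_lt_trans (hp n m) _; have := hN n Nn.
rewrite ltr_pdivlMr; last by have := nr_ge0 m; lra.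
apply: le_lt_trans; rewrite ler_wpM2l ?(ltW (inv_gt0 n)) //; lra.
Qed.

End Predual.

(** * Limits along ultrafilters *)

Section UltraLimit.
Variables (R : realType) (U : set_system nat).
Hypothesis UU : UltraFilter U.
Local Notation C := (C R).

Lemma ultra_real_limit (u : nat -> R) (B : R) : (forall n, `|u n| <= B) ->
  exists l : R, u @ U --> l.
Proof.
move=> hB; have UP : ProperFilter U by exact: ultra_proper.
have : (u @ U) `[- B, B]%classic.
  by apply: (@filterE _ U) => n /=; rewrite in_itv /= -ler_norml.
move=> /(segment_compact (fmap_proper_filter u UP))[l [_ cl]].
exists l => A Al; have [//|nA] := in_ultra_setVsetC (u @^-1` A) UU.
by have [x [/= nx ax]] := cl _ _ (nA : (u @ U) (~` A)) Al.
Qed.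

Lemma ultra_limit (z : nat -> C) (B : R) : (forall n, nr (z n) <= B) ->
  exists l : C, (z n : C) @[n --> U] --> l.
Proof.
move=> hB; have UP : ProperFilter U by exact: ultra_proper.
have [a ha] := @ultra_real_limit (fun n => cre (z n)) B (fun n => le_trans (normr_cre_le _) (hB n)).
have [b hb] := @ultra_real_limit (fun n => complex.Im (z n)) B (fun n => le_trans (normr_cim_le _) (hB n)).
exists (Complex a b : C); apply/cvgrPdist_lt => e e0.
have ee : e = rc (cre e) by apply: ge0_rc; exact: ltW.
have e1 : 0 < cre e by move: e0; rewrite {1}ee -(rmorph0 (@rc R)) ltr_rc.
have e2 : 0 < cre e / 2 by rewrite divr_gt0.
move/cvgrPdist_lt: ha => /(_ _ e2) ha; move/cvgrPdist_lt: hb => /(_ _ e2) hb.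
apply: filterS (filterI ha hb) => n /= [h1 h2].
rewrite ee normE ltr_rc; apply: le_lt_trans (nr_le_re_im _) _.
by move: h1 h2; case: (z n) => x y /=; move: (cre e) => r h1 h2; lra.
Qed.

End UltraLimit.

(** * Normal functionals on self-dual modules *)

Section SelfDual.
Variables (R : realType) (M : wstar_algebra R) (E : hilbert_module M).
Local Notation C := (C R).
Local Notation P := (ws_predual M).
Variable one : M.
Hypotheses (one_mul : forall m, one ** m = m) (mul_one : forall m, m ** one = m).
Hypothesis one_star : cs_star one = one.
Hypothesis mul_normal : forall (a : M) p, exists p', forall m, ws_pair (a ** m) p = ws_pair m p'.
Hypothesis sd : self_dual E.

Definition pairE (py : P * E) (x : E) : C := ws_pair (hm_inner py.2 x) py.1.

Lemma pairE_linear py : is_linear (pairE py).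
Proof. by move=> a x y; rewrite /pairE hm_inner_linr ws_pair_linl. Qed.

Let mf := hm_mform E.

Lemma nr_one : nr one <= 1.
Proof.
have := nr_cstar one; rewrite one_star one_mul => h.
have := nr_ge0 one; nra.
Qed.

Lemma ract_one (x : E) : hm_ract x one = x.
Proof.
apply/eqP; rewrite -subr_eq0; apply/eqP/hm_inner_eq0 => z.
by rewrite (mfDl mf) (mfNl mf) (mf_ractl mf) one_star one_mul subrr.
Qed.

(** Weak compactness of the unit ball. For each y the limit of <y, x_n> is bounded on the predual
    and so defines an element g(y) of M. The map y |-> g(y)^* is a bounded module map, represented
    by u through self-duality. *)
Lemma self_dual_limit (U : set_system nat) (x : nat -> E) : UltraFilter U ->
  (forall n, nr (x n) <= 1) ->
  exists u : E, nr u <= 1 /\ forall py, (pairE py (x n) : C) @[n --> U] --> (pairE py u : C).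
Proof.
move=> UU x1; have UP : ProperFilter U by exact: ultra_proper.
have bnd y (p : P) n : nr (ws_pair (hm_inner y (x n)) p) <= nr y * nr p.
  apply: le_trans (nr_ws_pair _ _) _; rewrite ler_wpM2r ?nr_ge0 //.
  by apply: le_trans (hm_CS _ _) _; rewrite -[leRHS]mulr1 ler_wpM2l ?nr_ge0.
have exl y p := ultra_limit UU (bnd y p).
pose l y p : C := projT1 (cid (exl y p)).
have hl y p : (ws_pair (hm_inner y (x n)) p : C) @[n --> U] --> (l y p : C).
  by rewrite /l; case: cid.
have uniq (z : nat -> C) (a b : C) : z n @[n --> U] --> a -> z n @[n --> U] --> b -> a = b.
  by move=> ha hb; exact: (cvg_unique _ ha hb).
have lp y (a : C) p q : l y (a *: p + q) = a * l y p + l y q.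
  apply: uniq (hl _ _) _.
  have -> : (fun n => ws_pair (hm_inner y (x n)) (a *: p + q) : C) =
     fun n => a *: (ws_pair (hm_inner y (x n)) p : C) + ws_pair (hm_inner y (x n)) q.
    by apply/funext => n; rewrite ws_pair_linr.
  by apply: cvgD; [apply: cvgZ; [exact: cvg_cst|]|]; exact: hl.
have lb y p : nr (l y p) <= nr y * nr p.
  have h := hl y p; apply/ler_addgt0Pr => e e0.
  move/cvgrPdist_lt: h => /(_ (rc e)); rewrite -(rmorph0 (@rc R)) ltr_rc => /(_ e0) h.
  have [n /=] := filter_ex h; rewrite normE ltr_rc => hn.
  have := nrD (l y p - ws_pair (hm_inner y (x n)) p) (ws_pair (hm_inner y (x n)) p).
  rewrite subrK => h1; apply: le_trans h1 _; rewrite addrC lerD ?bnd //; exact: ltW.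
have exg y : exists m : M, forall p, ws_pair m p = l y p.
  apply: ws_pair_surj; first exact: lp.
  by exists (rc (nr y)) => p; rewrite !normE -rmorphM ler_rc.
pose g y := projT1 (cid (exg y)).
have hg y p : ws_pair (g y) p = l y p by rewrite /g; case: cid.
have gl (a : C) y z : g (a *: y + z) = Num.conj a *: g y + g z.
  apply: ws_sep => p; rewrite ws_pair_linl !hg; apply: uniq (hl _ _) _.
  have -> : (fun n => ws_pair (hm_inner (a *: y + z) (x n)) p : C) =
     fun n => Num.conj a *: (ws_pair (hm_inner y (x n)) p : C) + ws_pair (hm_inner z (x n)) p.
    by apply/funext => n; rewrite (mfDl mf) (mfZl mf) ws_pair_linl.
  by apply: cvgD; [apply: cvgZ; [exact: cvg_cst|]|]; exact: hl.
have gm y m : g (hm_ract y m) = cs_star m ** g y.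
  (* Normality of left multiplication moves m^* into the predual, where the limit can be taken. *)
  apply: ws_sep => p; have [p' hp'] := mul_normal (cs_star m) p.
  rewrite hp' !hg; apply: uniq (hl _ _) _.
  have -> : (fun n => ws_pair (hm_inner (hm_ract y m) (x n)) p : C) =
      fun n => ws_pair (hm_inner y (x n)) p'.
    by apply/funext => n; rewrite (mf_ractl mf) hp'.
  exact: hl.
have gb y : nr (g y) <= nr y.
  by apply: ws_norm_le => [|p]; rewrite ?nr_ge0 // hg.
have [|||u hu] := sd (f := fun y => cs_star (g y)).
- by move=> a y z; rewrite gl cs_starD cs_starZ conjCK.
- by move=> y m; rewrite gm cs_starM cs_starK.
- by exists 1 => y; rewrite mul1r !normE ler_rc nr_star.
have ug y : hm_inner y u = g y by rewrite -hm_inner_star -hu cs_starK.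
exists u; split=> [|[p y]].
  have := nr_hm u; rewrite ug => h; have := gb u; rewrite h => h1.
  have := nr_ge0 u; nra.
by rewrite /pairE ug hg; exact: hl.
Qed.

(** With b = <u, x> and c = 1 - b the vector is u c + x, and its square plus the positive terms c^*
    (1 - <u, u>) c and b^* b equals 1 + <x, x>. *)
Lemma attained_bound (u x : E) : nr u <= 1 ->
  nr (u + (x - hm_ract u (hm_inner u x))) ^+ 2 <= 1 + nr x ^+ 2.
Proof.
move=> u1; set b := hm_inner u x; pose c := one - b.
have -> : u + (x - hm_ract u b) = hm_ract u c + x.
  by rewrite (linB (hm_ract_linr u)) ract_one addrAC addrA.
have a1 : cs_ge0 (one - hm_inner u u).
  have := @ge0_le_nr_conj R M (hm_inner u u) one 1 (hm_inner_ge0 u).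
  rewrite nr_hm rmorph1 scale1r one_star one_mul !mul_one; apply.
  by rewrite expr_le1 // nr_ge0.
have key : hm_inner (hm_ract u c + x) (hm_ract u c + x) +
    (cs_star c ** (one - hm_inner u u) ** c + cs_star b ** b) = one + hm_inner x x.
  have cb : cs_star c + cs_star b = one by rewrite -cs_starD subrK.
  have cb' : c + b = one by rewrite subrK.
  rewrite !(mfDl mf) !(mfDr mf) !(mf_ractl mf) !(mf_ract mf) -/b.
  have -> : hm_inner x u = cs_star b by rewrite hm_inner_star.
  rewrite cmBr mul_one cmBl -cs_mulA.
  have e : cs_star c ** c + cs_star c ** b + cs_star b ** c + cs_star b ** b = one.
    by rewrite -cmDr cb' mul_one -addrA -cmDr cb' mul_one cb.
  rewrite -[in RHS]e; lmod R.
rewrite -nr_hm.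
have h : nr (hm_inner (hm_ract u c + x) (hm_ract u c + x)) <= nr (one + hm_inner x x).
  rewrite -key; apply: nr_ge0_mono; first exact: hm_inner_ge0.
  by apply: cs_ge0D; [exact: cs_ge0_conj|exists b].
apply: le_trans h _; apply: le_trans (nrD _ _) _; rewrite nr_hm.
by rewrite lerD2r nr_one.
Qed.

Lemma first_order (al c X : R) : 0 <= al -> 0 <= c -> 0 <= X ->
  (forall t, 0 < t -> (c + t * al) ^+ 2 <= c ^+ 2 * (1 + t ^+ 2 * X)) -> al = 0.
Proof.
move=> al0 c0 X0 h; apply/eqP/negPn/negP => aln0.
have alp : 0 < al by rewrite lt_neqAle eq_sym aln0.
have cX := mulr_ge0 c0 X0.
have cX1 : 0 < c * X + 1 by lra.
have [t [t0 e]] : exists t, 0 < t /\ t * (c * X + 1) = al.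
  by exists (al / (c * X + 1)); rewrite divr_gt0 // divfK // gt_eqF.
have ht := h _ t0.
have h1 : 2 * c * al + t * al ^+ 2 <= c ^+ 2 * (t * X).
  rewrite -(ler_pM2l t0) -subr_ge0; move: ht; rewrite -subr_ge0; congr (0 <= _).
  by ring.
have h2 : c ^+ 2 * (t * X) <= c * al.
  rewrite expr2 -mulrA ler_wpM2l // -e; nra.
have h3 : 0 < t * al ^+ 2 by rewrite mulr_gt0 // exprn_gt0.
have := mulr_ge0 c0 al0; lra.
Qed.

(** Moving from u along x' = x - u <u, x> changes the norm only to second order, by
    [attained_bound]. If f x' were nonzero, f would grow to first order and exceed c times the
    norm. *)
Lemma attained_factor (f : E -> C) (c : R) (u : E) : is_linear f -> 0 <= c ->
  (forall x, nr (f x) <= c * nr x) -> nr u <= 1 -> f u = rc c ->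
  forall x, f x = f (hm_ract u (hm_inner u x)).
Proof.
move=> lf c0 hf u1 fu x; set x' := x - hm_ract u (hm_inner u x).
suff h : f x' = 0 by apply/eqP; rewrite -subr_eq0 -(linB lf) h.
apply: nr_eq0; apply: (@first_order _ c (nr x ^+ 2)); rewrite ?nr_ge0 ?sqr_ge0 //.
move=> t t0; have [b nb hb] := exists_phase (f x').
have tx : (rc t * b) *: x - hm_ract u (hm_inner u ((rc t * b) *: x)) = (rc t * b) *: x'.
  by rewrite (mfZr mf) (linZ (hm_ract_linr u)) scalerBr.
have := attained_bound ((rc t * b) *: x) u1; rewrite tx nrZ nrM nr_rc nb mulr1.
rewrite exprMn (gtr0_norm t0) => h1.
have h2 := hf (u + (rc t * b) *: x').
have e2 : f (u + (rc t * b) *: x') = rc (c + t * nr (f x')).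
  have -> : rc (c + t * nr (f x')) = rc c + rc t * (b * f x') by rewrite hb -rmorphM -rmorphD.
  by rewrite mulrA -fu -[(rc t * b) * f x'](linZ lf) -(linD lf).
rewrite e2 nr_rc in h2.
rewrite ger0_norm in h2; last by rewrite addr_ge0 // mulr_ge0 ?nr_ge0 ?ltW.
apply: le_trans (_ : (c * nr (u + (rc t * b) *: x')) ^+ 2 <= _).
  by rewrite ler_pXn2r ?nnegrE ?addr_ge0 ?mulr_ge0 ?nr_ge0 ?(ltW t0).
by rewrite exprMn ler_wpM2l ?sqr_ge0.
Qed.

Lemma dominated_bound (f : E -> C) : dominated pairE f ->
  exists2 B : R, 0 <= B & forall x, nr (f x) <= B * nr x.
Proof.
move=> [s [K hK]]; exists (`|K| * \sum_(py <- s) nr py.2 * nr py.1).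
  by rewrite mulr_ge0 // sumr_ge0 // => i _; rewrite mulr_ge0 ?nr_ge0.
move=> x; apply: le_trans (hK x) _; rewrite -mulrA mulr_suml.
have h : \sum_(i <- s) nr (pairE i x) <= \sum_(i <- s) nr i.2 * nr i.1 * nr x.
  apply: ler_sum => i _; apply: le_trans (nr_ws_pair _ _) _.
  by rewrite mulrAC ler_wpM2r ?nr_ge0 // hm_CS.
apply: le_trans (_ : `|K| * \sum_(i <- s) nr (pairE i x) <= _).
  by rewrite ler_wpM2r ?ler_norm // sumr_ge0 // => i _; exact: nr_ge0.
by rewrite ler_wpM2l.
Qed.

(* A bounded functional that is a norm limit of sigma-weakly continuous ones
   attains its norm at some [u] in the unit ball, and [f x = f (u <u, x>)]. *)
Lemma dominated_closed (f : E -> C) : is_linear f ->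
  (forall e : R, 0 < e -> exists f' : E -> C,
     [/\ is_linear f', dominated pairE f' & forall x, nr (f x - f' x) <= e * nr x]) ->
  dominated pairE f.
Proof.
move=> lf approx.
have [B B0 hB] : exists2 B : R, 0 <= B & forall x, nr (f x) <= B * nr x.
  have [f' [_ /dominated_bound[B B0 hB] h]] := approx 1 ltr01.
  exists (B + 1) => [|x]; first by rewrite addr_ge0.
  have := nrD (f x - f' x) (f' x); rewrite subrK => h1.
  by apply: le_trans h1 _; rewrite mulrDl addrC lerD.
pose A := [set nr (f x) | x in [set x | nr x <= 1]].
have supA : has_sup A.
  split; first by exists (nr (f 0)); exists 0 => //=; rewrite nr0.
  exists B => _ [x /= x1 <-]; apply: le_trans (hB x) _.
  by rewrite -[leRHS]mulr1 ler_wpM2l.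
pose c := sup A.
have cA x : nr x <= 1 -> nr (f x) <= c.
  by move=> x1; apply: ub_le_sup; [case: supA|exists x].
have c0 : 0 <= c by apply: le_trans (cA 0 _); rewrite ?nr_ge0 // nr0.
have hf x : nr (f x) <= c * nr x.
  have [x0|xn0] := eqVneq (nr x) 0; first by rewrite (nr_eq0 x0) (lin0 lf) !nr0 mulr0.
  have xp : 0 < nr x by rewrite lt_neqAle eq_sym xn0 nr_ge0.
  have := cA (rc (nr x)^-1 *: x); rewrite (linZ lf) !nrZ nr_rc gtr0_norm ?invr_gt0 //.
  by rewrite mulVf // lexx => /(_ isT); rewrite mulrC ler_pdivrMr.
have inv_gt0 n : 0 < n.+1%:R^-1 :> R by rewrite invr_gt0 ltr0n.
have ex n : exists x : E, nr x <= 1 /\ exists2 r : R, f x = rc r & c - n.+1%:R^-1 < r <= c.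
  have [_ [x /= x1 <-] hx] := sup_adherent (inv_gt0 n) supA.
  have [b nb hb] := exists_phase (f x); exists (b *: x).
  rewrite nrZ nb mul1r; split=> //; exists (nr (f x)); first by rewrite (linZ lf).
  by rewrite hx cA.
pose x n := projT1 (cid (ex n)).
have hx n : nr (x n) <= 1 /\ exists2 r : R, f (x n) = rc r & c - n.+1%:R^-1 < r <= c.
  by rewrite /x; case: cid.
(* The predual may be nonseparable, so a subsequence of the maximizing sequence need not converge; a
   limit along an ultrafilter exists. *)
have [U [UU sU]] := ultraFilterLemma (_ : ProperFilter (\oo : set_system nat)).
have UP : ProperFilter U by exact: ultra_proper.
have [u [u1 hu]] := self_dual_limit UU (fun n => (hx n).1).
have fc : (f (x n) : C) @[n --> U] --> (rc c : C).
  apply: (cvg_trans (cvg_app (fun n => f (x n) : C) sU)); apply/cvg_nr_eps => e e0.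
  have [N hN] := invn_small e0; exists N => n Nn.
  have [_ [r -> /andP[r1 r2]]] := hx n; rewrite -rmorphB nr_rc ler0_norm ?subr_le0 //.
  by move: (n.+1%:R^-1) (hN n Nn) r1 => w hw r1; lra.
(* On the unit ball f is a uniform limit of sigma-weakly continuous functionals, hence continuous
   along the sequence. *)
have fu : (f (x n) : C) @[n --> U] --> (f u : C).
  apply/cvgrPdist_lt => e e0.
  have ee : e = rc (cre e) by apply: ge0_rc; exact: ltW.
  have e1 : 0 < cre e by move: e0; rewrite {1}ee -(rmorph0 (@rc R)) ltr_rc.
  have e3 : 0 < cre e / 3 by rewrite divr_gt0.
  have [f' [lf' df' hf']] := approx _ e3.
  have : (f' (x n) : C) @[n --> U] --> (f' u : C).
    have xu : x @ U `=>` nbhs (u : functional_topology pairE) by apply: ft_cvg.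
    exact: cvg_comp xu (dominated_continuous pairE_linear lf' df' (x := u)).
  move=> /cvgrPdist_lt/(_ (rc (cre e / 3))); rewrite -(rmorph0 (@rc R)) ltr_rc => /(_ e3).
  apply: filterS => n /=; rewrite ee !normE !ltr_rc => h1.
  have b1 y : nr y <= 1 -> nr (f y - f' y) <= cre e / 3.
    by move=> y1; apply: le_trans (hf' y) _; rewrite -[leRHS]mulr1 ler_wpM2l // ltW.
  have h2 := b1 u u1; have h3 := b1 _ (hx n).1.
  have -> : f u - f (x n) = (f u - f' u) + (f' u - f' (x n)) - (f (x n) - f' (x n)) by ring.
  have := nrB ((f u - f' u) + (f' u - f' (x n))) (f (x n) - f' (x n)).
  have := nrD (f u - f' u) (f' u - f' (x n)).
  move: (nr _) (nr _) (nr _) (nr _) (nr _) h1 h2 h3 => ? ? ? ? ?; lra.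
have fuc : f u = rc c by apply: (cvg_unique _ fu fc).
have fact := attained_factor lf c0 hf u1 fuc.
have [p hp] : normal_form (fun m => f (hm_ract u m)).
  apply: normal_form_closed => e e0; have [f' [lf' df' hf']] := approx _ e0.
  have lg : is_linear (fun m => f' (hm_ract u m)).
    by move=> a m n; rewrite hm_ract_linr lf'.
  suff [p hp] : normal_form (fun m => f' (hm_ract u m)).
    exists p => m; rewrite -hp; apply: le_trans (hf' _) _; rewrite ler_wpM2l ?(ltW e0) //.
    by apply: le_trans (nr_ract _ _) _; rewrite -[leRHS]mul1r ler_wpM2r ?nr_ge0.
  apply: (@dominated_span R _ M (fun py m => ws_pair (hm_inner py.2 u ** m) py.1)) lg _ _ _ _.
  - by move=> py a m n; rewrite cmDr cmZr ws_pair_linl.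
  - by exists 0 => m; rewrite (lin0 (ws_lin_r m)).
  - move=> a g h [p hp] [q hq]; exists (a *: p + q) => m.
    by rewrite ws_pair_linr hp hq.
  - by move=> [p y]; have [p' hp'] := mul_normal (hm_inner y u) p; exists p' => m; rewrite /= hp'.
  have [s [K hK]] := df'; exists s, K => m; apply: le_trans (hK _) _.
  by under eq_bigr => i _ do rewrite /pairE hm_inner_ract.
exists [:: (p, u)], 1 => y; rewrite big_seq1 mul1r fact.
by rewrite (hp (hm_inner u y)).
Qed.

End SelfDual.

(** * The W*-case *)

Section WstarSystem.
Variables (R : realType) (S : nmodType) (M : wstar_algebra R).
Variable F : wstar_product_system S M.
Local Notation C := (C R).
Local Notation P := (ws_predual M).

Lemma ws_dominated_normal (f : M -> C) : is_linear f ->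
  dominated (fun (p : P) (m : M) => ws_pair m p) f -> normal_form f.
Proof.
move=> lf; apply: dominated_span => //.
- by move=> p; exact: ws_lin_l.
- by exists 0 => m; rewrite (lin0 (ws_lin_r m)).
- move=> a g h [p hp] [q hq]; exists (a *: p + q) => m.
  by rewrite ws_pair_linr hp hq.
by move=> p; exists p.
Qed.

Lemma lact_normal t (z y : F t) p : exists p', forall m,
  ws_pair (hm_inner y (co_lact m z)) p = ws_pair m p'.
Proof.
have [_ /(_ z) ct] := wps_fiber F t.
apply: (@ws_dominated_normal (fun m => ws_pair (hm_inner y (co_lact m z)) p)).
  by move=> a m n; rewrite co_lact_linl hm_inner_linr ws_pair_linl.
apply: continuous_dominated.
- by move=> q; exact: ws_lin_l.
- by move=> a m n; rewrite co_lact_linl hm_inner_linr ws_pair_linl.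
move=> m; apply: (@continuous_comp (ws_sigma_weak M) (hm_sigma_weak (F t)) C
  (fun m => co_lact m z) (fun x => ws_pair (hm_inner y x) p)).
  exact: ct.
exact: (@ft_continuous R _ (F t) (fun (py : P * F t) x => ws_pair (hm_inner py.2 x) py.1) (p, y)).
Qed.

(** F_0 is M as a right module and is self-dual. The identity map, being a bounded module map, is of
    the form m |-> y^* m, which exhibits a left unit. *)
Lemma wstar_unit : exists one : M, [/\ forall m, one ** m = m,
  forall m, m ** one = m & cs_star one = one].
Proof.
have [sd _] := wps_fiber F 0.
pose f (x : F 0) := projT1 (cid (ps_unit_surj x)).
have hf x : ps_unit F (f x) = x by rewrite /f; case: cid.
have uI m n : ps_unit F m = ps_unit F n -> m = n.
  move=> e; apply/eqP; rewrite -subr_eq0; apply/eqP/nr_eq0.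
  by rewrite -(nr_ps_unit F) (linB (ps_unit_linear _)) e subrr nr0.
have [|||y hy] := sd f.
- by move=> a x z; apply: uI; rewrite (ps_unit_linear F) !hf.
- by move=> x m; apply: uI; rewrite ps_unit_ract !hf.
- by exists 1 => x; rewrite mul1r !normE ler_rc -(nr_ps_unit F) hf.
pose one := cs_star (f y).
have h1 m : one ** m = m.
  by rewrite /one -(ps_unit_inner F) hf -hy; apply: uI; rewrite hf.
have h2 m : m ** cs_star one = m.
  by rewrite -[m]cs_starK -cs_starM h1.
have e : cs_star one = one by rewrite -[LHS]h1 h2.
by exists one; split=> // m; rewrite -{1}e h2.
Qed.

(** This is normality of the left action on F_0 = M, tested between the unit and a^*. *)
Lemma mul_normal (a : M) p : exists p', forall m, ws_pair (a ** m) p = ws_pair m p'.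
Proof.
have [one [_ mul1 _]] := wstar_unit.
have [p' hp'] := lact_normal (ps_unit F one) (ps_unit F (cs_star a)) p.
by exists p' => m; rewrite -hp' -ps_unit_lact ps_unit_inner cs_starK mul1.
Qed.

Lemma wstar_adjointable_mul : adjointable_mul F.
Proof.
move=> s r x z; have [sd _] := wps_fiber F r.
have [|||w hw] := sd (fun y => hm_inner z (ps_mul x y)).
- by move=> a y y'; rewrite (ps_mul_linr x) hm_inner_linr.
- by move=> y m; rewrite -ps_mul_ract hm_inner_ract.
- exists (rc (nr z * nr x)) => y; rewrite !normE -rmorphM ler_rc.
  apply: le_trans (hm_CS _ _) _; rewrite -mulrA ler_wpM2l ?nr_ge0 //.
  exact: nr_ps_mul.
by exists w => y; rewrite -hw.
Qed.

Lemma fiber_closed t (f : F t -> C) : is_linear f ->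
  (forall e : R, 0 < e -> exists f' : F t -> C,
     [/\ is_linear f', dominated (@pairE R M (F t)) f' & forall x, nr (f x - f' x) <= e * nr x]) ->
  dominated (@pairE R M (F t)) f.
Proof.
have [one [h1 h2 h3]] := wstar_unit; have [sd _] := wps_fiber F t.
exact: (dominated_closed h1 h2 h3 mul_normal sd).
Qed.

(** Pulled back along the unitary, f is sigma-weakly continuous on the tensor product, where the
    elementary tensors span a sigma-weakly dense subspace. *)
Lemma ps_mul_sigma_dense s r (f : F (s + r) -> C) : is_linear f ->
  dominated (@pairE R M (F (s + r))) f ->
  (forall x y, f (ps_mul x y) = 0) -> forall z, f z = 0.
Proof.
move=> lf [l [K hK]] f0 z; have [lu _ _ iu su] := ps_u_unitary F s r.
have [w wz] := su z.
pose g (v : ps_tensor F s r) := f (ps_u v).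
have lg : is_linear g by move=> a u v; rewrite /g lu lf.
have cg : continuous (g : hm_sigma_weak (ps_tensor F s r) -> C).
  apply: dominated_continuous => // [i|]; first exact: pairE_linear.
  pose pull (y : F (s + r)) := projT1 (cid (su y)).
  exists [seq (py.1, pull py.2) | py <- l], K => v; rewrite big_map.
  apply: le_trans (hK _) _; rewrite le_eqVlt; apply/orP; left; apply/eqP.
  congr (_ * _); apply: eq_bigr => py _; rewrite /pairE /= -iu /pull.
  by case: cid => y' /= ->.
have [_ ct] := tens_gen (ps_tensor F s r).
rewrite -wz -/(g w); apply: nr_eq0; apply/eqP; rewrite eq_le nr_ge0 andbT.
apply/ler_addgt0Pr => e e0; rewrite add0r.
have : closure (lin_span [set tens (ps_tensor F s r) xy.1 xy.2 | xy in [set: F s * F r]]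
    : set (hm_sigma_weak (ps_tensor F s r))) w by rewrite ct.
move=> /(_ [set v | nr (g w - g v) < e]) [|v [[n [a [b [hb ->]]]]] /=].
  have /cvgrPdist_lt/(_ (rc e)) := cg w.
  rewrite -(rmorph0 (@rc R)) ltr_rc => /(_ e0); apply: filterS => v /=.
  by rewrite normE ltr_rc.
rewrite (lin_sum lg) big1 ?subr0 => [/ltW //|i _].
rewrite (linZ lg) /g; case: (hb i) => -[x y] _ <- /=.
by rewrite -[ps_u _]/(ps_mul x y) f0 [_ *: _]mulr0.
Qed.

(** * Normal representations and density of products *)

Section Normal.
Variables (G : hilbert R) (sigma : rep_family F G).
Hypotheses (cov : covariant_rep sigma) (nor : normal_rep sigma).
Local Notation s0 := (rep0 sigma).

Lemma series_single (u : nat -> C) : (forall n, u n.+1 = 0) -> series u @ \oo --> u 0%N.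
Proof.
move=> h; apply/cvg_nr_eps => e e0; exists 1%N => -[//|n] _.
rewrite /series /= big_nat_recl // big1 ?addr0 ?subrr ?nr0 //.
Qed.

(** A single matrix coefficient is one of the functionals defining the topology of [bop_sigma_weak],
    for sequences that vanish after their first term. *)
Lemma sigma_normal t g h : dominated (@pairE R M (F t)) (fun x => dot g (sigma x h)).
Proof.
apply: continuous_dominated; first by move=> i; exact: pairE_linear.
  by move=> a x y; rewrite (sigma_linear cov) dot_linr.
pose ext (k : G) (n : nat) : G := if n is 0 then k else 0.
have sq k : square_summable (ext k).
  have := @series_single (fun n => `|ext k n| ^+ 2 : C) _.
  by move=> H; apply/cvg_ex; eexists; apply: H => n /=; rewrite normr0 expr0n.
pose i : {gh : (nat -> G) * (nat -> G) | square_summable gh.1 /\ square_summable gh.2} :=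
  exist (fun gh : (nat -> G) * (nat -> G) => square_summable gh.1 /\ square_summable gh.2)
    (ext g, ext h) (conj (sq g) (sq h)).
have e (a : bounded_op G) :
    limn (series (fun n => dot ((sval i).1 n) (a ((sval i).2 n)))) = dot g (a h).
  apply: cvg_lim; first exact: norm_hausdorff.
  apply: (@series_single (fun n => dot (ext g n) (a (ext h n)))) => n /=.
  by rewrite linear0 (psf0r (dot_psd G)).
move=> x.
have -> : (fun x : F t => dot g (sigma x h)) = (fun x : F t =>
    limn (series (fun n => dot ((sval i).1 n) ((sigma x : bounded_op G) ((sval i).2 n))))).
  by apply/funext => y; rewrite e.
apply: (@continuous_comp (hm_sigma_weak (F t)) (bop_sigma_weak G) C (@sigma t)
  (fun a => limn (series (fun n => dot ((sval i).1 n) (a ((sval i).2 n)))))).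
  exact: nor.
exact: (@ft_continuous R _ (bounded_op G) _ i).
Qed.

Lemma s0_normal g h : normal_form (fun m => dot g (s0 m h)).
Proof.
have l : is_linear (fun m => dot g (s0 m h)).
  by move=> a m n; rewrite (fr_linl (s0_rep cov)) dot_linr.
have [s [K hK]] := sigma_normal 0 g h.
apply: (@dominated_span R _ M (fun (py : P * F 0) m => ws_pair (hm_inner py.2 (ps_unit F m)) py.1)) l _ _ _ _.
- by move=> py a m n; rewrite (ps_unit_linear F) hm_inner_linr ws_pair_linl.
- by exists 0 => m; rewrite (lin0 (ws_lin_r m)).
- move=> a f k [p hp] [q hq]; exists (a *: p + q) => m.
  by rewrite ws_pair_linr hp hq.
- move=> [p y]; have [n <-] := ps_unit_surj y.
  have [p' hp'] := mul_normal (cs_star n) p; exists p' => m.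
  by rewrite /= ps_unit_inner hp'.
by exists s, K => m; exact: hK.
Qed.

Lemma hform_dominated t h (z : F t) : dominated (@pairE R M (F t)) (hform sigma h z).
Proof.
have [p hp] := s0_normal h h.
by exists [:: (p, z)], 1 => y; rewrite big_seq1 mul1r /hform hp.
Qed.

(** Take sums of products d_n nearly minimizing the distance to z in the seminorm of h. The errors
    b_n = z - d_n are almost orthogonal to products and Cauchy in the seminorm, so the functionals
    <b_n, .> have a normal limit [psi] that vanishes on products and hence everywhere. Then |b_n|^2
    = <b_n, z> - <b_n, d_n> tends to 0. *)
Lemma wstar_dense_mul : dense_mul sigma.
Proof.
move=> s r z h eps eps0.
pose f := hform sigma h (t := s + r); have ff : psd_form f := hform_psd cov _ h.
pose D (d : F (s + r)) := exists n (x : 'I_n -> F s) (y : 'I_n -> F r), d = \sum_i ps_mul (x i) (y i).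
have DD a d d' : D d -> D d' -> D (a *: d + d').
  move=> [n [x [y ->]]] [n' [x' [y' ->]]].
  exists (n + n')%N.
  exists (fun i : 'I_(n + n') => match fintype.split i with inl j => a *: x j | inr j => x' j end).
  exists (fun i : 'I_(n + n') => match fintype.split i with inl j => y j | inr j => y' j end).
  rewrite big_split_ord /= scaler_sumr; congr (_ + _); apply: eq_bigr => i _.
    by rewrite (unsplitK (inl i)) (linZ (ps_mul_linl _)).
  by rewrite (unsplitK (inr i)).
have D0 : D 0 by exists 0%N, (fun=> 0), (fun=> 0); rewrite big_ord0.
pose A := [set sqn f (z - d) | d in D].
have infA : has_inf A.
  split; first by exists (sqn f (z - 0)); exists 0.
  by exists 0 => _ [d _ <-]; exact: sqn_ge0.
pose dl := inf A; have dlA d : D d -> dl <= sqn f (z - d).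
  by move=> Dd; apply: ge_inf; [case: infA|exists d].
have inv_gt0 n : 0 < n.+1%:R^-1 :> R by rewrite invr_gt0 ltr0n.
(* The excess is a square because the defect from orthogonality is of the order of its root. *)
have ex n : exists d, D d /\ sqn f (z - d) < dl + n.+1%:R^-1 ^+ 2.
  have [_ [d Dd <-] hd] := inf_adherent (exprn_gt0 2 (inv_gt0 n)) infA.
  by exists d.
pose d n := projT1 (cid (ex n)).
have hd n : D (d n) /\ sqn f (z - d n) < dl + n.+1%:R^-1 ^+ 2 by rewrite /d; case: cid.
pose b n := z - d n.
have sqD u v : sqn f (u + v) = sqn f u + 2 * cre (f u v) + sqn f v.
  have e : cre (f v u) = cre (f u v) by rewrite -(psf_conj ff) cre_conj.
  by rewrite /sqn (psfDr ff) !(psfDl ff) !raddfD /= e; ring.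
have orth n y : D y -> nr (f (b n) y) <= n.+1%:R^-1 * fnorm f y.
  move=> Dy; have [c nc hc] := exists_phase (f (b n) y).
  have h1 : nr (f (b n) y) ^+ 2 <= (n.+1%:R^-1 ^+ 2) * sqn f y.
    apply: quadratic_ge0 => t.
    have Dt : D (d n - (rc t * c) *: y).
      have -> : d n - (rc t * c) *: y = (- (rc t * c)) *: y + d n by rewrite scaleNr [RHS]addrC.
      by apply: DD => //; exact: (hd n).1.
    have := dlA _ Dt.
    have -> : z - (d n - (rc t * c) *: y) = b n + (rc t * c) *: y by rewrite opprD opprK addrA.
    have e1 : f (b n) ((rc t * c) *: y) = rc (t * nr (f (b n) y)).
      by rewrite (psfZr ff) -mulrA hc -rmorphM.
    have e3 : sqn f ((rc t * c) *: y) = t ^+ 2 * sqn f y.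
      by rewrite (sqnZ ff) nrM nr_rc nc mulr1 real_normK ?num_real.
    have -> : sqn f (b n + (rc t * c) *: y) = sqn f (b n) + 2 * (t * nr (f (b n) y)) + t ^+ 2 * sqn f y.
      by rewrite sqD e1 rcK e3.
    move: (n.+1%:R^-1 ^+ 2) (hd n).2 => w; rewrite -/(b n) -[2 * t * _]mulrA.
    by move: (t * nr _) (t ^+ 2 * _) (sqn f (b n)) => ? ? ?; lra.
  rewrite -(@ler_pXn2r _ 2) ?nnegrE ?nr_ge0 ?mulr_ge0 ?fnorm_ge0 ?(ltW (inv_gt0 n)) //.
  by rewrite exprMn (fnorm_sqr ff).
have cau m n : fnorm f (b m - b n) <= m.+1%:R^-1 + n.+1%:R^-1.
  set e := b m - b n.
  have De : D e.
    have -> : e = -1 *: d m + d n by rewrite /e /b; lmod R.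
    by apply: DD; [exact: (hd m).1|exact: (hd n).1].
  have [e0|en0] := eqVneq (fnorm f e) 0; first by rewrite e0 addr_ge0 // ltW.
  have ep : 0 < fnorm f e by rewrite lt_neqAle eq_sym en0 fnorm_ge0.
  rewrite -(ler_pM2r ep) -expr2 (fnorm_sqr ff) /sqn {1}/e (psfDl ff) (psfNl ff).
  apply: le_trans (cre_le_nr _) _; apply: le_trans (nrB _ _) _.
  by rewrite mulrDl lerD // orth.
have exl y : exists l : C, (f (b n) y : C) @[n --> \oo] --> l.
  apply: complex_complete => e e0; have fy := fnorm_ge0 f y.
  have e2 : 0 < e / (2 * (fnorm f y + 1)) by rewrite divr_gt0 //; lra.
  have [N hN] := invn_small e2; exists N => m n Nm Nn.
  rewrite -(psfNl ff) -(psfDl ff); apply: le_lt_trans (fnorm_CS ff _ _) _.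
  apply: le_lt_trans (ler_wpM2r fy (cau m n)) _.
  apply: lt_half_sum (_ : _ <= fnorm f y * m.+1%:R^-1 + fnorm f y * n.+1%:R^-1) _ _.
  - by rewrite mulrDl mulrC [X in _ + X]mulrC.
  - by apply: half_bound => //; exact: hN.
  - by apply: half_bound => //; exact: hN.
pose psi y : C := projT1 (cid (exl y)).
have hpsi y : (f (b n) y : C) @[n --> \oo] --> (psi y : C) by rewrite /psi; case: cid.
have lpsi : is_linear psi.
  move=> a x y; apply: (cvg_unique_nr (V := C) (hpsi _)).
  have -> : (fun n => f (b n) (a *: x + y)) = fun n => a *: (f (b n) x : C) + f (b n) y.
    by apply/funext => n; rewrite (psf_linr ff).
  by apply: cvgD; [apply: cvgZ; [exact: cvg_cst|]|]; exact: hpsi.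
have near n y : nr (psi y - f (b n) y) <= n.+1%:R^-1 * fnorm f y.
  have h1 : (f (b m) y - f (b n) y : C) @[m --> \oo] --> (psi y - f (b n) y : C).
    by apply: cvgB; [exact: hpsi|exact: cvg_cst].
  apply/ler_addgt0Pr => e e0; have fy := fnorm_ge0 f y.
  have e2 : 0 < e / (2 * (fnorm f y + 1)) by rewrite divr_gt0 //; lra.
  have [N hN] := invn_small e2.
  have h2 : (f (b (m + N)%N) y - f (b n) y : C) @[m --> \oo] --> (psi y - f (b n) y : C).
    by rewrite (cvg_shiftn N (fun m => f (b m) y - f (b n) y : C)).
  apply: (cvg_nr_le h2) => m; rewrite -(psfNl ff) -(psfDl ff).
  apply: le_trans (fnorm_CS ff _ _) _; apply: le_trans (ler_wpM2r fy (cau _ n)) _.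
  rewrite mulrDl [leLHS]addrC lerD2l mulrC.
  have := half_bound fy (ltW (inv_gt0 (m + N)%N)) (hN _ (leq_addl m N)).
  by move=> /ltW h3; apply: le_trans h3 _; lra.
have psi_dom : dominated (@pairE R M (F (s + r))) psi.
  apply: fiber_closed => // e e0.
  have e2 : 0 < e / (nr h + 1) by rewrite divr_gt0 //; have := nr_ge0 h; lra.
  have [N hN] := invn_small e2; exists (f (b N)); split.
  - exact: (psf_linr ff).
  - exact: hform_dominated.
  move=> x; apply: le_trans (near N x) _.
  apply: le_trans (ler_wpM2l (ltW (inv_gt0 N)) (hn_le cov x h)) _.
  rewrite mulrA ler_wpM2r ?nr_ge0 //.
  have := hN N (leqnn N); rewrite ltr_pdivlMr; last by have := nr_ge0 h; lra.
  by have := inv_gt0 N; move: (N.+1%:R^-1) => w w0 hw; nra.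
have psi0 : psi z = 0.
  apply: (ps_mul_sigma_dense lpsi psi_dom) => x y.
  have Dxy : D (ps_mul x y) by exists 1%N, (fun=> x), (fun=> y); rewrite big_ord1.
  apply: (cvg_unique_nr (V := C) (hpsi _)); apply/cvg_nr_eps => e e0.
  have fy := fnorm_ge0 f (ps_mul x y).
  have e2 : 0 < e / (fnorm f (ps_mul x y) + 1) by rewrite divr_gt0 //; lra.
  have [N hN] := invn_small e2; exists N => n Nn; rewrite subr0.
  apply: le_lt_trans (orth n _ Dxy) _.
  have := hN n Nn; rewrite ltr_pdivlMr; last by lra.
  by have := inv_gt0 n; move: (n.+1%:R^-1) => w w0; nra.
have bn n : fnorm f (b n) ^+ 2 <= n.+1%:R^-1 * (2 * fnorm f z + fnorm f (b n)).
  rewrite (fnorm_sqr ff).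
  have -> : sqn f (b n) = cre (f (b n) z - f (b n) (d n)).
    by rewrite /sqn {2}/b (psfDr ff) (psfNr ff).
  apply: le_trans (cre_le_nr _) _; apply: le_trans (nrB _ _) _.
  have h1 := near n z; rewrite psi0 sub0r nrN in h1.
  have h2 := orth n _ (hd n).1.
  have h3 : fnorm f (d n) <= fnorm f z + fnorm f (b n).
    have e : d n = z - b n by rewrite /b opprB [RHS]addrC subrK.
    by rewrite {1}e; exact: fnormB.
  have h4 := ler_wpM2l (ltW (inv_gt0 n)) h3.
  by move: (n.+1%:R^-1) h1 h2 h4 => w h1 h2 h4; rewrite mulrDr mulrDr in h4 *; lra.
have Z0 := fnorm_ge0 f z.
have k0 : 0 < 2 * fnorm f z / eps + 1 by rewrite ltr_wpDl // divr_ge0 ?mulr_ge0 // ltW.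
(* With w = 1/(N+1), X = |b_N| and Z = |z|, the bound reads X^2 <= w (2 Z + X). If X >= eps, then X
   <= w (2 Z / eps + 1), so w below this threshold contradicts X >= eps. *)
have e2 : 0 < eps / (2 * fnorm f z / eps + 1) by rewrite divr_gt0.
have [N hN] := invn_small e2.
have [n [x [y e]]] := (hd N).1; exists n, x, y; rewrite -e -/(b N) -/f.
rewrite ltNge; apply/negP => hX.
have := bn N; have := hN N (leqnn N); rewrite ltr_pdivlMr //.
have w0 := inv_gt0 N; move: (N.+1%:R^-1) w0 => w w0.
move: (fnorm f (b N)) (fnorm f z) Z0 hX {k0 e2 hN} => X Z Z0 hX h1 h2.
have X0 : 0 < X by lra.
have h3 : X <= w * (2 * Z / X + 1).
  by rewrite -(ler_pM2r X0) -expr2; apply: le_trans h2 _; rewrite -[leRHS]mulrA [(_ + 1) * X]mulrDl mul1r divfK // gt_eqF.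
have h4 : 2 * Z / X <= 2 * Z / eps.
  by rewrite ler_wpM2l ?mulr_ge0 // lef_pV2 ?posrE.
have : X < eps; last by lra.
by apply: le_lt_trans h3 _; apply: le_lt_trans h1; rewrite ler_pM2l // lerD2r.
Qed.

End Normal.
End WstarSystem.

(** * Normality of the dilation *)

Section Normality.
Variables (R : realType) (S : nmodType) (M : wstar_algebra R).
Variable F : wstar_product_system S M.
Local Notation C := (C R).
Local Notation P := (ws_predual M).
Variables (G : hilbert R) (sigma : rep_family F G).
Hypotheses (tl : time_like S) (cov : covariant_rep sigma) (nor : normal_rep sigma).
Local Notation s0 := (rep0 sigma).
Local Notation atom := (atom F G).
Local Notation k := (kap sigma).
Let adj : adjointable_mul F := wstar_adjointable_mul (F := F).
Let dm : dense_mul sigma := wstar_dense_mul cov nor.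
Let kc := kap_conj tl adj cov.

Lemma normal_form_sum (J : Type) (r : seq J) (f : J -> M -> C) :
  (forall j, normal_form (f j)) -> normal_form (fun m => \sum_(j <- r) f j m).
Proof.
move=> h; elim: r => [|j r [q hq]].
  by exists 0 => m; rewrite big_nil (lin0 (ws_lin_r m)).
have [p hp] := h j; exists (p + q) => m.
by rewrite big_cons hp hq (linD (ws_lin_r m)).
Qed.

Lemma kap_none_proj g b : k (None, g) b = dot g (proj_atom sigma b).
Proof. by case: b => v h; rewrite (kapE tl (w := v)). Qed.

Lemma kap_none_r a m h : k a (None, s0 m h) = dot (proj_atom sigma a) (s0 m h).
Proof. by rewrite -kc kap_none_proj (dot_conj _ _). Qed.

Lemma act_none m h : act sigma m (None, h) = (None, s0 m h).
Proof. by []. Qed.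

Lemma kap_suml t n (x : 'I_n -> F t) g b :
  k (Some (mk (\sum_i x i)), g) b = \sum_i k (Some (mk (x i)), g) b.
Proof.
rewrite -kc (kap_linx_sum tl adj cov) rmorph_sum; apply: eq_bigr => i _; exact: kc.
Qed.

Lemma kap_Bl t (x y : F t) g b :
  k (Some (mk (x - y)), g) b = k (Some (mk x), g) b - k (Some (mk y), g) b.
Proof.
by rewrite -kc (linB (kap_linx tl adj cov b g (t := t))) rmorphB /= !kc.
Qed.

Lemma small_mul (e c : R) : 0 < e -> 0 <= c -> exists2 d : R, 0 < d & d * c <= e.
Proof.
move=> e0 c0; exists (e / (c + 1)); first by rewrite divr_gt0 //; lra.
by rewrite mulrAC ler_pdivrMr ?ler_wpM2l ?ltW //; lra.
Qed.

(** If the time of a comes first, L_x^* turns the kernel into a coefficient of sigma along m |->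
    L_x^* (m y). If it comes later, x is approximated by sums of products whose first factor cancels
    against m y and leaves coefficients of sigma_0; norm limits of normal functionals are normal. *)
Lemma act_normal a b : normal_form (fun m => k a (act sigma m b)).
Proof.
case: a b => [[[s x]|] g] [[[t y]|] h]; last 1 first.
- have [p hp] := s0_normal cov nor g (proj_atom sigma (None, h)).
  by exists p => m; rewrite kap_none_proj (proj_act cov) hp.
- case: (tl_total tl s t) => -[r e].
  + subst t; pose w m := projT1 (cid (adj x (co_lact m y))).
    have hw m z : hm_inner (w m) z = hm_inner (co_lact m y) (ps_mul x z).
      by rewrite /w; case: cid => w' /= ->.
    have kw m : k (Some (existT _ s x), g) (act sigma m (Some (existT _ (s + r) y), h)) =
        dot g (sigma (w m) h).
      have hq : quot (mk x) (mk (co_lact m y)) (mk (w m)).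
        by split=> // z /ex_mk[z' ->]; rewrite /hmul !hinE hw.
      exact: (kapE tl (u := Some _) (v := Some _) (w := Some _) g h hq).
    have [l [K hK]] := sigma_normal cov nor r g h.
    have lin : is_linear (fun m => k (Some (existT _ s x), g) (act sigma m (Some (existT _ (s + r) y), h))).
      move=> c m n; apply: (act_linl_K cov) => [a' v|a' t' h'].
        exact: (kap_linr tl adj cov).
      exact: (kap_linx tl adj cov).
    apply: (@dominated_span R _ M
      (fun (py : P * F r) m => ws_pair (hm_inner (ps_mul x py.2) (co_lact m y)) py.1)) lin _ _ _ _.
    * by move=> py c m n; rewrite co_lact_linl hm_inner_linr ws_pair_linl.
    * by exists 0 => m; rewrite (lin0 (ws_lin_r m)).
    * move=> c f f' [p hp] [q hq]; exists (c *: p + q) => m.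
      by rewrite ws_pair_linr hp hq.
    * by move=> [p z]; have [p' hp'] := lact_normal y (ps_mul x z) p; exists p'.
    exists l, K => m; rewrite kw; apply: le_trans (hK _) _.
    rewrite le_eqVlt; apply/orP; left; apply/eqP; congr (_ * _).
    apply: eq_bigr => -[p z] _; rewrite /pairE /=.
    by rewrite -hm_inner_star hw hm_inner_star.
  subst s; apply: normal_form_closed => e e0.
  have [d d0 hd] := small_mul e0 (mulr_ge0 (nr_ge0 h) (nr_ge0 y)).
  have [n [u [z hz]]] := dm x g d0.
  set D := \sum_i _ in hz.
  have kD m : k (Some (mk D), g) (act sigma m (Some (mk y), h)) =
      \sum_i dot (sigma (z i) g) (s0 (hm_inner (u i) (co_lact m y)) h).
    rewrite kap_suml; apply: eq_bigr => i _.
    have := kap_pmul tl adj cov (Some (mk (z i))) None g h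
      (erefl : tag (mk (u i)) = tag (mk (co_lact m y))).
    by rewrite hinE act_none kap_none_r => <-.
  have [p hp] : normal_form (fun m => \sum_i dot (sigma (z i) g) (s0 (hm_inner (u i) (co_lact m y)) h)).
    apply: normal_form_sum => i; have [p hp] := s0_normal cov nor (sigma (z i) g) h.
    by have [p' hp'] := lact_normal y (u i) p; exists p' => m; rewrite hp hp'.
  exists p => m; rewrite -hp -kD -(kap_Bl x D).
  apply: le_trans (nr_kap_hn tl adj cov dm _ _ _ _) _.
  have h1 := hn_le cov (co_lact m y) h.
  have h2 := nr_lact m y.
  apply: (@le_trans _ _ (d * (nr h * nr y * nr m))); last first.
    by rewrite mulrA ler_wpM2r ?nr_ge0.
  apply: ler_pM; rewrite ?fnorm_ge0 ?(ltW hz) //.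
  by apply: le_trans h1 _; rewrite -mulrA ler_wpM2l ?nr_ge0 // mulrC.
- have [p hp] := s0_normal cov nor (proj_atom sigma (Some (existT _ s x), g)) h.
  by exists p => m; rewrite act_none kap_none_r hp.
have [p hp] := s0_normal cov nor g (proj_atom sigma (Some (existT _ t y), h)).
by exists p => m; rewrite kap_none_proj (proj_act cov) hp.
Qed.

(** L_x^* (z (.) q) = (L_x^* z) (.) q. The defining identity can be checked directly only against
    products, and [ps_mul_sigma_dense] extends it to the whole fiber. *)
Lemma quot_hmulr s r t (x : F s) (z : F (s + r)) (w : F r) (q : F t) :
  (forall y, hm_inner w y = hm_inner z (ps_mul x y)) ->
  quot (mk x) (hmul (mk z) (mk q)) (mk (ps_mul w q)).
Proof.
move=> hw.
have [W hW] := quot_ex adj (p := mk x) (q := hmul (mk z) (mk q)) (r := r + t) (esym (addrA s r t)).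
have et : tag W = r + t.
  have [e1 _] := hW; apply: (tl_cancel tl (s := s)); rewrite addrA; exact: esym e1.
case: (ex_mk et) => W' eW; subst W.
suff -> : ps_mul w q = W' by [].
have mf := hm_mform (F (r + t)).
apply/eqP; rewrite -subr_eq0; apply/eqP/hm_inner_eq0 => y0.
apply: ws_sep => p; rewrite (lin0 (ws_lin_l p)).
pose f y := ws_pair (hm_inner (ps_mul w q - W') y) p.
apply: (@ps_mul_sigma_dense R S M F r t f) => [a y y'||y1 y2].
- by rewrite /f hm_inner_linr ws_pair_linl.
- by exists [:: (p, ps_mul w q - W')], 1 => y; rewrite big_seq1 mul1r.
rewrite /f (mfDl mf) (mfNl mf).
have -> : hm_inner W' (ps_mul y1 y2) = hm_inner (ps_mul w q) (ps_mul y1 y2).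
  have [_ /(_ (mk (ps_mul y1 y2)) erefl)] := hW.
  rewrite hinE -[mk (ps_mul y1 y2)]/(hmul (mk y1) (mk y2)) -hmulA => ->.
  rewrite hin_mul // [hmul (mk x) (mk y1)]/hmul /= hinE -hw.
  by rewrite [hlact _ _]/(mk (co_lact (hm_inner w y1) y2)) hinE ps_mul_inner.
by rewrite subrr (lin0 (ws_lin_l p)).
Qed.

Lemma latom_linear t a b : is_linear (fun x : F t => k a (latom x b)).
Proof.
case: b => -[[t' q]|] h c x y; rewrite /latom /pmul /hmul /=.
  by rewrite ps_mul_linl (kap_linx tl adj cov).
by rewrite (kap_linx tl adj cov).
Qed.

(** Two cases as in [act_normal]. When the time of a is the later one, cancelling the first factor
    leaves <u_i, y> acting on b, and [act_normal] makes this normal in y. *)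
Lemma latom_normal t a b : dominated (@pairE R M (F t)) (fun x => k a (latom x b)).
Proof.
case: a b => [[[s x]|] g] [v h]; last first.
  apply: (dominated_le (K := 1) _ (sigma_normal cov nor t g (proj_atom sigma (v, h)))) => y.
  by rewrite mul1r kap_none_proj /latom (proj_pmul cov).
case: (tl_total tl s t) => -[r e].
  subst t.
  pose w (y : F (s + r)) := projT1 (cid (adj x y)).
  have hw y z : hm_inner (w y) z = hm_inner y (ps_mul x z).
    by rewrite /w; case: cid => w' /= ->.
  have kw y : k (Some (existT _ s x), g) (latom y (v, h)) =
      dot g (sigma (w y) (proj_atom sigma (v, h))).
    case: v => [[t' q]|].
      rewrite -[RHS]/(dot g (sg sigma (mk (w y)) (sg sigma (mk q) h))) -(sg_mul cov).
      exact: (kapE tl (u := Some _) (v := Some _) (w := Some _) g h (quot_hmulr q (hw y))).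
    have hq : quot (mk x) (mk y) (mk (w y)).
      by split=> // z /ex_mk[z' ->]; rewrite /hmul !hinE hw.
    exact: (kapE tl (u := Some _) (v := Some _) (w := Some _) g h hq).
  have [l [K hK]] := sigma_normal cov nor r g (proj_atom sigma (v, h)).
  exists [seq (py.1, ps_mul x py.2) | py <- l], K => y; rewrite kw big_map.
  apply: le_trans (hK _) _; rewrite le_eqVlt; apply/orP; left; apply/eqP.
  congr (_ * _); apply: eq_bigr => -[p z] _; rewrite /pairE /=.
  by rewrite -hm_inner_star hw hm_inner_star.
subst s; apply: fiber_closed; first exact: latom_linear.
move=> e e0.
have [d d0 hd] := small_mul e0 (mulr_ge0 (nr_ge0 h) (onorm_ge0 v)).
have [n [u [z hz]]] := dm x g d0; set D := \sum_i _ in hz.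
exists (fun y => k (Some (mk D), g) (latom y (v, h))); split.
- exact: latom_linear.
- have e1 y : k (Some (mk D), g) (latom y (v, h)) =
      \sum_i k (Some (mk (z i)), g) (act sigma (hm_inner (u i) y) (v, h)).
    rewrite kap_suml; apply: eq_bigr => i _.
    have := kap_pmul tl adj cov (Some (mk (z i))) v g h
      (erefl : tag (mk (u i)) = tag (mk y)).
    by rewrite hinE => <-.
  have -> : (fun y => k (Some (mk D), g) (latom y (v, h))) = (fun y =>
      \sum_i k (Some (mk (z i)), g) (act sigma (hm_inner (u i) y) (v, h))).
    by apply/funext.
  apply: dominated_sum => i; have [p hp] := act_normal (Some (mk (z i)), g) (v, h).
  by exists [:: (p, u i)], 1 => y; rewrite big_seq1 mul1r hp.
move=> y; rewrite -(kap_Bl x D).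
have h3 : nr (k (Some (mk (x - D)), g) (latom y (v, h))) <= d * (nr h * (onorm v * nr y)).
  have H t' (y' : F t') : nr y' <= onorm v * nr y ->
      nr (k (Some (mk (x - D)), g) (Some (mk y'), h)) <= d * (nr h * (onorm v * nr y)).
    move=> hy; apply: le_trans (nr_kap_hn tl adj cov dm _ _ _ _) _.
    apply: ler_pM; rewrite ?fnorm_ge0 ?(ltW hz) //.
    by apply: le_trans (hn_le cov y' h) _; rewrite ler_wpM2l ?nr_ge0.
  case: v {hd} H => [[t' q]|] H; apply: H => /=; last by rewrite mul1r.
  by rewrite mulrC; exact: nr_ps_mul.
by apply: le_trans h3 _; rewrite !mulrA ler_wpM2r ?nr_ge0 // -mulrA.
Qed.

Section Dilated.
Variables (H : hilbert R) (tau : rep_family F H) (e : atom -> H).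
Hypotheses (covt : covariant_rep tau) (fe : forall a b, dot (e a) (e b) = k a b).
Hypothesis taue : forall t (x : F t) a, tau x (e a) = e (latom x a).
Hypothesis tot : forall h (eps : R), 0 < eps ->
  exists s : seq (C * atom), nr (h - \sum_(p <- s) p.1 *: e p.2) < eps.

Lemma tau_vec_linear t g h : is_linear (fun x : F t => dot g (tau x h)).
Proof. by move=> a x y; rewrite (sigma_linear covt) dot_linr. Qed.

Lemma tau_vec_normal t g h : dominated (@pairE R M (F t)) (fun x => dot g (tau x h)).
Proof.
apply: fiber_closed; first exact: tau_vec_linear.
move=> eps eps0; have ee2 : 0 < eps / 2 by rewrite divr_gt0.
have [d1 d10 hd1] := small_mul ee2 (nr_ge0 g).
have [s hs] := tot h d10; set h' := \sum_(p <- s) _ in hs.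
have [d2 d20 hd2] := small_mul ee2 (nr_ge0 h').
have [s' hs'] := tot g d20; set g' := \sum_(p <- s') _ in hs'.
have dp := dot_psd H.
exists (fun x => dot g' (tau x h')); split; first exact: tau_vec_linear.
  have -> : (fun x : F t => dot g' (tau x h')) = (fun x =>
      \sum_(p <- s') \sum_(q <- s) Num.conj p.1 * q.1 * k p.2 (latom x q.2)).
    apply/funext => x; rewrite /g' (psf_suml dp); apply: eq_bigr => p _.
    rewrite (lin_sum (bop_linear _)) (psf_sumr dp); apply: eq_bigr => q _.
    by rewrite (linZ (bop_linear _)) taue (psfZl dp) (psfZr dp) fe mulrA.
  apply: dominated_sum => p; apply: dominated_sum => q.
  apply: (dominated_le (K := nr (Num.conj p.1 * q.1)) _ (latom_normal t p.2 q.2)) => x.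
  by rewrite nrM.
move=> x.
have -> : dot g (tau x h) - dot g' (tau x h') =
    dot g (tau x (h - h')) + dot (g - g') (tau x h').
  rewrite (linB (bop_linear _)) (psfDr dp) (psfNr dp) (psfDl dp) (psfNl dp).
  by rewrite addrA subrK.
apply: le_trans (nrD _ _) _.
have -> : eps * nr x = eps / 2 * nr x + eps / 2 * nr x by rewrite -mulrDl; congr (_ * _); field.
apply: lerD; apply: le_trans (dot_CS _ _) _.
  apply: le_trans (ler_wpM2l (nr_ge0 _) (nr_sigma covt _ _)) _.
  apply: le_trans (_ : d1 * nr g * nr x <= _); last by rewrite ler_wpM2r ?nr_ge0.
  by rewrite mulrCA mulrC ler_wpM2r ?nr_ge0 // mulrC ler_wpM2r ?nr_ge0 // ltW.
apply: le_trans (ler_wpM2l (nr_ge0 _) (nr_sigma covt _ _)) _.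
apply: le_trans (_ : d2 * nr h' * nr x <= _); last by rewrite ler_wpM2r ?nr_ge0.
by rewrite mulrCA mulrC ler_wpM2r ?nr_ge0 // ler_wpM2r ?nr_ge0 // ltW.
Qed.

Lemma square_summable_bounded (g : nat -> H) : square_summable g ->
  exists B : R, forall n, \sum_(0 <= i < n) nr (g i) ^+ 2 <= B.
Proof.
move=> /cvg_ex[l hl].
have e1 : (fun n => cre (series (fun n => `|g n| ^+ 2 : C) n)) = (fun n => \sum_(0 <= i < n) nr (g i) ^+ 2).
  apply/funext => n; rewrite /series /= raddf_sum; apply: eq_bigr => i _.
  have -> : `|g i| ^+ 2 = rc (nr (g i) ^+ 2) :> C by rewrite rmorphXn /= -normE.
  by [].
have := cre_cvg hl; rewrite e1 => h; exists (cre l) => n.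
have nd : nondecreasing_seq (fun n => \sum_(0 <= i < n) nr (g i) ^+ 2).
  by apply/nondecreasing_seqP => m; rewrite big_nat_recr //= lerDl sqr_ge0.
have := nondecreasing_cvgn_le nd (cvgP _ h) n.
by rewrite (cvg_lim (@norm_hausdorff _ _) h).
Qed.

(** A sigma-weak functional on the operators is a series of coefficients. Its tail is at most |x|
    times the tail of the sum of |g_n|^2 + |h_n|^2, so it is a norm limit of finite sums, each of
    which is normal by [tau_vec_normal]. *)
Theorem dilation_normal : normal_rep tau.
Proof.
move=> t; apply: ft_comp_continuous => -[[g h] [/= sg sh]].
have [Bg hBg] := square_summable_bounded sg.
have [Bh hBh] := square_summable_bounded sh.
pose T n := \sum_(0 <= i < n) (nr (g i) ^+ 2 + nr (h i) ^+ 2).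
have TB n : T n <= Bg + Bh by rewrite /T big_split /=; apply: lerD.
have Tnd : nondecreasing_seq T.
  by apply/nondecreasing_seqP => m; rewrite /T big_nat_recr //= lerDl addr_ge0 ?sqr_ge0.
have cT : cvg (T n @[n --> \oo]).
  by apply: nondecreasing_is_cvgn => //; exists (Bg + Bh) => _ [n _ <-].
pose Tl := limn T; have hT : T n @[n --> \oo] --> Tl by [].
have Tle n : T n <= Tl := nondecreasing_cvgn_le Tnd cT n.
pose u (x : F t) n := dot (g n) (tau x (h n)).
have un x n : nr (u x n) <= nr x * (nr (g n) ^+ 2 + nr (h n) ^+ 2).
  apply: le_trans (dot_CS _ _) _; apply: le_trans (ler_wpM2l (nr_ge0 _) (nr_sigma covt _ _)) _.
  rewrite mulrCA ler_wpM2l ?nr_ge0 //.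
  have := nr_ge0 (g n); have := nr_ge0 (h n); nra.
have step x n : nr (series (u x) n.+1 - series (u x) n) <= nr x * T n.+1 - nr x * T n.
  rewrite /series /= /T !big_nat_recr //= addrAC subrr add0r.
  by apply: le_trans (un x n) _; rewrite -mulrBr addrAC subrr add0r.
have cu x : cvg (series (u x) n @[n --> \oo]).
  apply/cvg_ex; apply: complex_complete.
  apply: (telescope_cauchy (V := C) (b := fun n => nr x * T n) (B := nr x * Tl)).
    exact: step.
  by move=> n; rewrite ler_wpM2l ?nr_ge0.
pose f x := limn (series (u x)).
have hf x : (series (u x) n : C) @[n --> \oo] --> (f x : C) by exact: cu.
have lu n : is_linear (fun x : F t => series (u x) n).
  move=> a x y; rewrite /series /= scaler_sumr -big_split; apply: eq_bigr => i _.
  exact: tau_vec_linear.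
have lf : is_linear f.
  move=> a x y; apply: (cvg_unique_nr (V := C) (hf _)).
  have -> : series (u (a *: x + y)) = (fun n => a *: (series (u x) n : C) + series (u y) n).
    by apply/funext => n; rewrite (lu n).
  by apply: cvgD; [apply: cvgZ; [exact: cvg_cst|]|]; exact: hf.
have tail x N : nr (f x - series (u x) N) <= nr x * (Tl - T N).
  have h1 : (series (u x) (n + N)%N - series (u x) N : C) @[n --> \oo] --> (f x - series (u x) N : C).
    apply: cvgB; last exact: cvg_cst.
    by rewrite (cvg_shiftn N (fun n => series (u x) n : C)); exact: hf.
  apply: (cvg_nr_le h1) => n; rewrite addnC.
  apply: le_trans (telescope_le (V := C) (step x) N n) _.
  by rewrite -mulrBr ler_wpM2l ?nr_ge0 // lerD2r.
have df : dominated (@pairE R M (F t)) f.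
  apply: fiber_closed => // eps eps0.
  have /cvgrPdist_lt/(_ _ eps0)[N _ /(_ N (leqnn N))/= hN] := hT.
  exists (fun x => series (u x) N); split=> // [|x].
    apply: dominated_sum => n; exact: tau_vec_normal.
  apply: le_trans (tail x N) _; rewrite mulrC ler_wpM2r ?nr_ge0 //.
  by apply: ltW; apply: le_lt_trans hN; exact: ler_norm.
exact: (dominated_continuous (@pairE_linear R M (F t)) lf df).
Qed.

End Dilated.

Theorem wstar_dilation :
  exists (H : hilbert R) (V : G -> H) (tau : rep_family F H),
    isometric_dilation sigma V tau /\ normal_rep tau.
Proof.
have [H [V [tau [e [dil fe taue tot]]]]] := dilation_exists tl adj cov dm.
exists H, V, tau; split=> //.
by apply: (dilation_normal _ fe taue tot); case: dil.
Qed.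

End Normality.

Theorem theorem1p1 (R : realType) (k : time_kind) :
  (forall (M : cstar_algebra R) (F : cstar_product_system (time R k) M)
      (G : hilbert R) (sigma : rep_family F G),
    covariant_rep sigma ->
    exists (H : hilbert R) (V : G -> H) (tau : rep_family F H),
      isometric_dilation sigma V tau)
  /\
  (forall (M : wstar_algebra R) (F : wstar_product_system (time R k) M)
      (G : hilbert R) (sigma : rep_family F G),
    covariant_rep sigma -> normal_rep sigma ->
    exists (H : hilbert R) (V : G -> H) (tau : rep_family F H),
      isometric_dilation sigma V tau /\ normal_rep tau).
Proof.
have tl := time_like_time R k; split=> M F G sigma cov.
  exact: cstar_dilation tl cov.
by move=> nor; exact: wstar_dilation tl cov nor.
Qed.
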